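(* Assume the Riemann Hypothesis. For $T>0$ let \[ I(T)=\int_{-T}^{T}\frac{\log|\zeta(\tfrac12+it)|}{\tfrac14+t^2}\,dt . \] Then, as $T\to\infty$, \[ I(T)=O\!\left(\frac{1}{T^2}\,\frac{\log T}{(\log\log T)^2}\right) \qquad\text{and}\qquad I(T)=\Omega\!\left(\frac{1}{T^2}\,\frac{\sqrt{\log T}}{(\log\log T)^{3/2}}\right). \]
   Context: $\zeta(s)$ is the Riemann zeta-function; the Riemann Hypothesis (RH) asserts that all nontrivial zeros of $\zeta(s)$ have real part $1/2$. For positive $g$, $f(T)=\Omega(g(T))$ means that $f(T)=o(g(T))$ is false as $T\to\infty$, i.e. $\limsup_{T\to\infty}|f(T)|/g(T)>0$. *)

(* Defs.v *)
From HB Require Import structures.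
From mathcomp Require Import all_boot all_order all_algebra.
From mathcomp Require Export complex.
From mathcomp Require Import all_classical all_reals all_analysis.

Set Implicit Arguments.
Unset Strict Implicit.
Unset Printing Implicit Defensive.

Import Order.TTheory GRing.Theory Num.Theory.
Import numFieldNormedType.Exports.

Local Open Scope classical_set_scope.
Local Open Scope ring_scope.
Local Open Scope complex_scope.

Definition cexp (R : realType) (z : R[i]) : R[i] :=
  (expR (complex.Re z) * cos (complex.Im z)) +i*
  (expR (complex.Re z) * sin (complex.Im z)).

(* [(n + 1)^(- s)]; the shift makes [series] start at the integer 1. *)
Definition dirichlet_term (R : realType) (s : R[i]) (n : nat) : R[i] :=
  cexp (- s * (ln n.+1%:R)%:C).

(* [zeta] is the meromorphic continuation of the Dirichlet series. The
   continuation is unique on [C \ {1}]; the value at the pole 1 is left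
   unspecified. [^o] makes [derivable] refer to complex scalars, so that
   derivability in the direction 1 is complex differentiability. *)
Definition is_riemann_zeta (R : realType) (zeta : R[i] -> R[i]) : Prop :=
  (forall s : R[i], s != 1 ->
     derivable (zeta : (R[i])^o -> (R[i])^o) s 1) /\
  (forall s : R[i], 1 < complex.Re s ->
     series (dirichlet_term s : nat -> (R[i])^o) @ \oo --> (zeta s : (R[i])^o)).

(* The trivial zeros are the negative even integers. *)
Definition nontrivial_zero (R : realType) (zeta : R[i] -> R[i]) (s : R[i]) :
    Prop :=
  [/\ s != 1, zeta s = 0 & forall n : nat, s != - (n.+1.*2)%:R].

Definition riemann_hypothesis (R : realType) (zeta : R[i] -> R[i]) : Prop :=
  forall s : R[i], nontrivial_zero zeta s -> complex.Re s = 2^-1.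

(* [Normc.normc] is the real-valued modulus ([`|z|] has type [R[i]]). Since
   [ln 0 = 0] in the library, the integrand is 0 instead of [-oo] at the
   zeros of zeta on the critical line, a negligible set. *)
Definition log_zeta_integral (R : realType) (zeta : R[i] -> R[i]) (T : R) : R :=
  (\int[@lebesgue_measure R]_(t in `[- T, T])
     (ln (Normc.normc (zeta (2^-1 +i* t))) / (4^-1 + t ^+ 2)))%R.

(* The Landau notations take a bundled filter. *)
Definition pinfty_filter (R : realType) : filter_on R :=
  FilterType (pinfty_nbhs R) _.

Definition bigO_pinfty (R : realType) (f g : R -> R) : Prop :=
  let F := pinfty_filter R in (f : R -> R^o) =O_F (g : R -> R^o).

(* The negation of [f = o(g)] (Hardy and Littlewood). The library's
   [=Omega_F] is the different relation [g = O(f)]. *)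
Definition Omega_pinfty (R : realType) (f g : R -> R) : Prop :=
  let F := pinfty_filter R in ~ (f : R -> R^o) =o_F (g : R -> R^o).

(* Main.v *)
(* Under RH there is a holomorphic G on Re s > 1/2 with exp G(s) = zeta(s) (s - 1) / s, and
   |(s - 1) / s| = 1 on the critical line; so I(T) is the limit, as e -> 0, of the integrals J_e(T)
   of Re G(1/2 + e + i t) / (1/4 + t^2), and all estimates are made for J_e uniformly in e.

   Upper bound. The maximum principle and a nonnegative kernel reduce the values of Re G near the
   critical line to the line Re s = 3 and give Re G <= C log T / log log T =: M. Weight Re G by a
   majorant or minorant of the indicator of [-T, T] of exponential type d = c log log T: moving the
   contour to Re s = 3 shows that the weighted integral is negligible, and since Re G is bounded above
   by M the error of the weight costs O(M / (d T^2)).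

   Lower bound. Suppose I = o(g) for the second rate g. Integrate Re G against the real part of
   e^(p^2/2) cosh(l p), p = s - 1/2 - e -+ i T: integration by parts against J_e gives o(l T^2 g(T)).
   Moving the contour to Re s = 3 turns the same integral into a sum over primes q near y = e^l. By
   Dirichlet's theorem some T with log T << y / log y has cos(T log q) >= 1/2 for all primes
   q <= 2^20 y, and Chebyshev's estimates then bound the sum below by a multiple of y^(1/2) / l, which
   for such T is a contradiction. *)

Require Import Defs.
From mathcomp Require Import all_boot all_order all_algebra.
From mathcomp Require Import all_classical all_reals all_analysis.
From mathcomp Require Import ring lra zify measurable_realfun.
Set Implicit Arguments.
Unset Strict Implicit.
Unset Printing Implicit Defensive.
Import Order.TTheory GRing.Theory Num.Theory.
Import numFieldNormedType.Exports.
Local Open Scope classical_set_scope.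
Local Open Scope ring_scope.
Local Open Scope complex_scope.

(** On the critical line [1 / (1/4 + t^2)] is [1 / (s (1 - s))], which has a pole at 1. With the
    factor [(s - 1) / s] one has [G 1 = 0]; after the shift by e the small value [G (1 + e)] is
    subtracted to keep the integrand holomorphic, and continuity at 1 makes it negligible. Only
    upper bounds of [Re G] are uniform near the line, because zeros of zeta send it to minus
    infinity: hence the one-sided weights, and hence a kernel that is nonnegative on a vertical
    line. Two-sided bounds of [G] depend on e and serve only to discard horizontal sides of contours
    for fixed e. The type c is so small that a weight grows only to [(log T)^(1/4)] on [Re s = 3],
    below the main term. In the lower bound the hypothesis concerns symmetric intervals, whence an
    even test function with humps at T and -T. Higher prime powers are integrated on [Re s = 3/4],
    where their series is bounded, and cost only [y^(1/4)]. The third power [y^3 <= T] keeps what is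
    neither prime nor prime power bounded on [Re s = 3]. *)

Notation Nc := (@Normc.normc _).
Notation iC := (Complex 0 1).
Notation Re := complex.Re.
Notation Im := complex.Im.

(* The running time of [lra] grows steeply with the context: [ulra] keeps only the listed
   hypotheses, [rlra n] the last [n] inequalities and equations. The hypotheses of a section, on
   which constants may depend, are not cleared: [section_fact] recognizes them. *)
Ltac section_fact H := fail.
Ltac is_fact P := lazymatch P with
  | is_true (@Order.le _ _ _ _) => idtac
  | is_true (@Order.lt _ _ _ _) => idtac
  | is_true (andb _ _) => idtac
  | and _ _ => idtac
  | @eq ?T _ _ => lazymatch T with nat => fail | bool => fail | complex _ => fail | _ => idtac end
  end.
Ltac revert_fact := match goal with H : ?P |- _ => is_fact P; tryif section_fact H then fail else revert H end.
Ltac clear_facts := repeat match goal with H : ?P |- _ => is_fact P; tryif section_fact H then fail else clear H end.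
Tactic Notation "ulra" ne_hyp_list(l) := revert l; clear_facts; intros; lra.
Tactic Notation "rlra" integer(n) := do n (try revert_fact); clear_facts; intros; lra.

(** * Modulus, continuity and differentiability in one complex variable *)

Section ComplexBasics.
Variable R : realType.
Implicit Types (z w s h : R[i]) (x y t e : R) (f g : R[i] -> R[i]).

Lemma Nc_ge0 z : 0 <= Nc z.
Proof. by case: z => a b; rewrite /Normc.normc /= sqrtr_ge0. Qed.

Lemma Nc0 : Nc (0 : R[i]) = 0. Proof. exact: Normc.normc0. Qed.
Lemma Nc1 : Nc (1 : R[i]) = 1. Proof. exact: Normc.normc1. Qed.
Lemma NcM z w : Nc (z * w) = Nc z * Nc w. Proof. exact: Normc.normcM. Qed.
Lemma NcV z : Nc z^-1 = (Nc z)^-1. Proof. exact: Normc.normcV. Qed.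
Lemma NcN z : Nc (- z) = Nc z. Proof. exact: normcN. Qed.
Lemma NcD z w : Nc (z + w) <= Nc z + Nc w. Proof. exact: le_normcD. Qed.
Lemma NcB z w : Nc (z - w) <= Nc z + Nc w. Proof. by rewrite -(NcN w) NcD. Qed.
Lemma NcBC z w : Nc (z - w) = Nc (w - z). Proof. by rewrite -NcN opprB. Qed.

Lemma Nc_eq0 z : (Nc z == 0) = (z == 0).
Proof.
by apply/idP/idP => [/eqP /Normc.eq0_normc ->|/eqP ->]; rewrite ?Nc0.
Qed.

Lemma Nc_gt0 z : (0 < Nc z) = (z != 0).
Proof. by rewrite lt_def Nc_ge0 andbT Nc_eq0. Qed.

Lemma NcX z n : Nc (z ^+ n) = Nc z ^+ n.
Proof. by elim: n => [|n IH]; rewrite ?expr0 ?Nc1 // !exprS NcM IH. Qed.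

Lemma Nc_sqr z : Nc z ^+ 2 = Re z ^+ 2 + Im z ^+ 2.
Proof. by case: z => a b; rewrite /Normc.normc /= sqr_sqrtr // addr_ge0 ?sqr_ge0. Qed.

Lemma le_sqr_norm x e : 0 <= e -> (x ^+ 2 <= e ^+ 2) = (`|x| <= e).
Proof. by move=> e0; rewrite -(real_normK (num_real x)) ler_sqr // ?nnegrE. Qed.

Lemma Re_Nc z : `|Re z| <= Nc z.
Proof. by rewrite -le_sqr_norm ?Nc_ge0 // Nc_sqr lerDl sqr_ge0. Qed.
Lemma Im_Nc z : `|Im z| <= Nc z.
Proof. by rewrite -le_sqr_norm ?Nc_ge0 // Nc_sqr lerDr sqr_ge0. Qed.
Lemma Re_le_Nc z : Re z <= Nc z.
Proof. exact: le_trans (ler_norm _) (Re_Nc z). Qed.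

Lemma Nc_real x : Nc (x%:C) = `|x|.
Proof. by rewrite /Normc.normc /= expr0n /= addr0 sqrtr_sqr. Qed.

Lemma Nc_i : Nc (iC : R[i]) = 1.
Proof. by rewrite /Normc.normc /= expr0n /= expr1n add0r sqrtr1. Qed.

Lemma Nc_le z : Nc z <= `|Re z| + `|Im z|.
Proof.
have -> : z = (Re z)%:C + iC * (Im z)%:C.
  by case: z => a b /=; apply/eqP; rewrite eq_complex /=; apply/andP; split; apply/eqP; ring.
apply: le_trans (NcD _ _) _; rewrite NcM Nc_i mul1r !Nc_real.
rewrite /= !(mul0r, mulr0, addr0, add0r, subr0, mul1r) //.
Qed.

Lemma NcD_ge z w : Nc z - Nc w <= Nc (z + w).
Proof. by rewrite lerBlDr; apply: le_trans (NcB _ w); rewrite addrK. Qed.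

Lemma NcB_ge z w : Nc z - Nc w <= Nc (z - w).
Proof. by have := NcD_ge z (- w); rewrite NcN. Qed.

Lemma ReD z w : Re (z + w) = Re z + Re w.
Proof. by case: z; case: w. Qed.
Lemma ImD z w : Im (z + w) = Im z + Im w.
Proof. by case: z; case: w. Qed.
Lemma ReN z : Re (- z) = - Re z. Proof. by case: z. Qed.
Lemma ImN z : Im (- z) = - Im z. Proof. by case: z. Qed.
Lemma ReM z w : Re (z * w) =
  Re z * Re w - Im z * Im w.
Proof. by case: z; case: w. Qed.
Lemma ImM z w : Im (z * w) =
  Re z * Im w + Im z * Re w.
Proof. by case: z; case: w. Qed.
Lemma ReC x : Re x%:C = x. Proof. by []. Qed.
Lemma ImC x : Im x%:C = 0. Proof. by []. Qed.
Lemma Rei : Re (iC : R[i]) = 0. Proof. by []. Qed.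
Lemma Imi : Im (iC : R[i]) = 1. Proof. by []. Qed.
Lemma ReI x y : Re (x +i* y) = x. Proof. by []. Qed.
Lemma ImI x y : Im (x +i* y) = y. Proof. by []. Qed.
Definition ReImE := (ReD, ImD, ReN, ImN, ReM, ImM, Rei, Imi, ReI, ImI, ReC, ImC).

Lemma Ceq z w : Re z = Re w -> Im z = Im w -> z = w.
Proof. by case: z w => [a b] [c d] /= -> ->. Qed.

Lemma realC_D x y : (x + y)%:C = x%:C + y%:C :> R[i].
Proof. by rewrite rmorphD. Qed.
Lemma realC_M x y : (x * y)%:C = x%:C * y%:C :> R[i].
Proof. by rewrite rmorphM. Qed.
Lemma realC_N x : (- x)%:C = - x%:C :> R[i].
Proof. by rewrite rmorphN. Qed.
Lemma realC_B x y : (x - y)%:C = x%:C - y%:C :> R[i].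
Proof. by rewrite rmorphB. Qed.
Lemma realC_V x : (x^-1)%:C = (x%:C)^-1 :> R[i].
Proof. by rewrite fmorphV. Qed.
Lemma realC_eq0 x : (x%:C == 0 :> R[i]) = (x == 0).
Proof. by rewrite eq_complex /= eqxx andbT. Qed.
Lemma realC_nat n : (n%:R)%:C = n%:R :> R[i].
Proof. by rewrite rmorph_nat. Qed.
Lemma ii : iC * iC = -1 :> R[i].
Proof. by apply: Ceq; rewrite !ReImE; ring. Qed.
Lemma i_neq0 : iC != 0 :> R[i].
Proof. by rewrite -Nc_gt0 Nc_i. Qed.

(** * Complex differentiability *)

Definition ccont (f : R[i] -> R[i]) s :=
  forall e : R, 0 < e -> exists2 d : R, 0 < d & forall z, Nc (z - s) < d -> Nc (f z - f s) < e.

(** Caratheodory's form of differentiability: the difference quotient extends to a function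
    continuous at [s]. Sums, products, inverses and compositions then follow by algebra and
    continuity, without division by [z - s]. *)
Definition cder (f : R[i] -> R[i]) s (d : R[i]) :=
  exists phi, [/\ ccont phi s, phi s = d & forall z, f z = f s + phi z * (z - s)].

Lemma ccont_cst (c : R[i]) s : ccont (fun=> c) s.
Proof. by move=> e e0; exists 1 => // z _; rewrite subrr Nc0. Qed.

Lemma ccont_id s : ccont id s.
Proof. by move=> e e0; exists e. Qed.

Lemma ccontD f g s : ccont f s -> ccont g s -> ccont (fun z => f z + g z) s.
Proof.
move=> cf cg e e0.
have e2 : 0 < e / 2 by rewrite divr_gt0.
have [d1 d10 h1] := cf _ e2; have [d2 d20 h2] := cg _ e2.
exists (Num.min d1 d2); first by rewrite lt_min d10.
move=> z; rewrite lt_min => /andP[/h1 a /h2 b].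
have -> : f z + g z - (f s + g s) = (f z - f s) + (g z - g s) by ring.
by apply: le_lt_trans (NcD _ _) _; lra.
Qed.

Lemma ccontM f g s : ccont f s -> ccont g s -> ccont (fun z => f z * g z) s.
Proof.
move=> cf cg e e0.
pose A := Nc (f s) + Nc (g s) + 1.
have A0 : 1 <= A by rewrite /A; have := Nc_ge0 (f s); have := Nc_ge0 (g s); lra.
have e2 : 0 < Num.min 1 (e / (2 * A)) by rewrite lt_min ltr01 divr_gt0 //; lra.
have [d1 d10 h1] := cf _ e2; have [d2 d20 h2] := cg _ e2.
exists (Num.min d1 d2); first by rewrite lt_min d10.
move=> z; rewrite lt_min => /andP[/h1 + /h2]; rewrite !lt_min => /andP[a1 a2] /andP[b1 b2].
have -> : f z * g z - f s * g s = (f z - f s) * (g z - g s) + (f z - f s) * g s + f s * (g z - g s) by ring.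
apply: le_lt_trans (NcD _ _) _.
apply: le_lt_trans (lerD (NcD _ _) (lexx _)) _; rewrite !NcM.
set u := Nc (f z - f s) in a1 a2 *; set v := Nc (g z - g s) in b1 b2 *.
have u0 : 0 <= u := Nc_ge0 _.
have v0 : 0 <= v := Nc_ge0 _.
have uA : u * A < e / 2.
  have := a2; rewrite ltr_pdivlMr; last ulra A0.
  by move=> ?; rlra 1.
have vA : v * A < e / 2.
  have := b2; rewrite ltr_pdivlMr; last ulra A0.
  by move=> ?; rlra 1.
have fs0 := Nc_ge0 (f s); have gs0 := Nc_ge0 (g s).
have : u * v <= u by rewrite ler_piMr //; ulra b1.
have : u * (1 + Nc (g s)) <= u * A by apply: ler_wpM2l => //; rewrite /A; ulra fs0.
have : Nc (f s) * v <= v * A by rewrite mulrC; apply: ler_wpM2l => //; rewrite /A; ulra gs0.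
ulra vA uA.
Qed.

Lemma ccontN f s : ccont f s -> ccont (fun z => - f z) s.
Proof.
move=> cf e e0; have [d d0 h] := cf _ e0; exists d => // z /h.
by rewrite -opprD NcN.
Qed.

Lemma ccontV f s : f s != 0 -> ccont f s -> ccont (fun z => (f z)^-1) s.
Proof.
move=> fs cf e e0; have n0 : 0 < Nc (f s) by rewrite Nc_gt0.
pose m := Nc (f s).
have p : 0 < Num.min (m / 2) (e * m ^+ 2 / 2).
  by rewrite lt_min !divr_gt0 // ?mulr_gt0 ?exprn_gt0.
have [d d0 h] := cf _ p; exists d => // z /h; rewrite lt_min => /andP[a b].
have fz : m / 2 < Nc (f z).
  have := NcB_ge (f s) (f s - f z); rewrite subKr NcBC -/m.
  by move: a; rewrite NcBC; lra.
have fz0 : f z != 0 by rewrite -Nc_gt0; apply: lt_trans fz; rewrite divr_gt0.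
have -> : (f z)^-1 - (f s)^-1 = (f s - f z) * ((f z)^-1 * (f s)^-1).
  by field; rewrite fz0 fs.
rewrite !NcM !NcV -/m NcBC -invfM ltr_pdivrMr; last by rewrite mulr_gt0 // Nc_gt0.
apply: lt_le_trans b _.
have -> : e * m ^+ 2 / 2 = e * (m / 2 * m) by ring.
by rewrite ler_pM2l // ler_pM2r // ltW.
Qed.

Lemma ccont_comp f g s : ccont g s -> ccont f (g s) -> ccont (fun z => f (g z)) s.
Proof.
move=> cg cf e e0; have [d d0 h] := cf _ e0; have [d' d'0 h'] := cg _ d0.
by exists d' => // z /h' /h.
Qed.

Lemma ccont_loc f g s r : 0 < r -> (forall z, Nc (z - s) < r -> f z = g z) ->
  ccont f s -> ccont g s.
Proof.
move=> r0 fg cf e e0; have [d d0 h] := cf _ e0.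
exists (Num.min r d); first by rewrite lt_min r0.
move=> z; rewrite lt_min => /andP[a b].
by rewrite -!fg ?subrr ?Nc0 //; apply: h.
Qed.

Lemma cderP f s d : cder f s d <->
  (forall e : R, 0 < e -> exists2 r : R, 0 < r & forall z, Nc (z - s) < r ->
     Nc (f z - f s - d * (z - s)) <= e * Nc (z - s)).
Proof.
split=> [[phi [cphi <- fE]] e e0|H].
  have [r r0 h] := cphi _ e0; exists r => // z /h /ltW hz.
  have -> : f z - f s - phi s * (z - s) = (phi z - phi s) * (z - s).
    by rewrite {1}(fE z); ring.
  by rewrite NcM ler_wpM2r ?Nc_ge0.
exists (fun z => if z == s then d else (f z - f s) / (z - s)); split.
- move=> e e0; have e2 : 0 < e / 2 by rewrite divr_gt0.
  have [r r0 h] := H _ e2; exists r => // z /h hz; rewrite eqxx.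
  case: eqVneq => [_|zs]; first by rewrite subrr Nc0.
  have zs0 : z - s != 0 by rewrite subr_eq0.
  have -> : (f z - f s) / (z - s) - d = (f z - f s - d * (z - s)) / (z - s).
    by rewrite [RHS]mulrBl mulfK.
  rewrite NcM NcV ltr_pdivrMr ?Nc_gt0 //; apply: le_lt_trans hz _.
  by rewrite ltr_pM2r ?Nc_gt0 // ltr_pdivrMr // ltr_pMr // ltr1n.
- by rewrite eqxx.
- move=> z; case: eqVneq => [->|zs]; first by rewrite subrr mulr0 addr0.
  by rewrite divfK ?subr_eq0 // addrC subrK.
Qed.

Lemma cder_ccont f s d : cder f s d -> ccont f s.
Proof.
move=> [phi [cphi _ fE]].
have c : ccont (fun z => f s + phi z * (z - s)) s.
  apply: ccontD; first exact: ccont_cst.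
  apply: ccontM => //; apply: (@ccontD _ (fun=> - s)); [exact: ccont_id|exact: ccont_cst].
by apply: ccont_loc c; first exact: ltr01; move=> z _ /=; rewrite -fE.
Qed.

Lemma cder_loc f g s d r : 0 < r -> (forall z, Nc (z - s) < r -> f z = g z) ->
  cder f s d -> cder g s d.
Proof.
move=> r0 fg /cderP H; apply/cderP => e /H[r' r'0 h].
exists (Num.min r r'); first by rewrite lt_min r0.
move=> z; rewrite lt_min => /andP[a b].
by rewrite -!fg ?subrr ?Nc0 //; apply: h.
Qed.

Lemma cder_ext f g s d : f =1 g -> cder f s d -> cder g s d.
Proof. by move=> fg; apply: (@cder_loc _ _ _ _ 1). Qed.

Lemma cder_eq f s d d' : d = d' -> cder f s d -> cder f s d'. Proof. by move=> ->. Qed.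

Lemma cder_cst (c : R[i]) s : cder (fun=> c) s 0.
Proof.
exists (fun=> 0); split=> //; first exact: ccont_cst.
by move=> z; rewrite mul0r addr0.
Qed.

Lemma cder_id s : cder id s 1.
Proof.
exists (fun=> 1); split=> //; first exact: ccont_cst.
by move=> z; rewrite mul1r addrC subrK.
Qed.

Lemma cderD f g s a b : cder f s a -> cder g s b -> cder (fun z => f z + g z) s (a + b).
Proof.
move=> [p [cp <- fE]] [q [cq <- gE]]; exists (fun z => p z + q z); split=> //.
  exact: ccontD.
by move=> z; rewrite (fE z) (gE z); ring.
Qed.

Lemma cderM f g s a b : cder f s a -> cder g s b ->
  cder (fun z => f z * g z) s (a * g s + f s * b).
Proof.
move=> df [q [cq <- gE]]; have cf := cder_ccont df; case: df => [p [cp <- fE]].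
exists (fun z => p z * g s + f z * q z); split=> //.
  by apply: ccontD; apply: ccontM => //; exact: ccont_cst.
by move=> z; rewrite (gE z) (fE z); ring.
Qed.

Lemma cderN f s a : cder f s a -> cder (fun z => - f z) s (- a).
Proof.
move=> [p [cp <- fE]]; exists (fun z => - p z); split=> //; first exact: ccontN.
by move=> z; rewrite (fE z); ring.
Qed.

Lemma cderB f g s a b : cder f s a -> cder g s b -> cder (fun z => f z - g z) s (a - b).
Proof. by move=> df dg; apply: cderD => //; apply: cderN. Qed.

Lemma cderZ (c : R[i]) f s a : cder f s a -> cder (fun z => c * f z) s (c * a).
Proof.
by move=> df; have := cderM (cder_cst c s) df; rewrite mul0r add0r.
Qed.

Lemma cder_comp f g s a b : cder g s b -> cder f (g s) a ->
  cder (fun z => f (g z)) s (a * b).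
Proof.
move=> dg [p [cp <- fE]]; have cg := cder_ccont dg; case: dg => [q [cq <- gE]].
exists (fun z => p (g z) * q z); split=> //.
  by apply: ccontM => //; apply: ccont_comp.
by move=> z; rewrite (fE (g z)) {2}(gE z); ring.
Qed.

Lemma cderV f s a : f s != 0 -> cder f s a ->
  cder (fun z => (f z)^-1) s (- a / f s ^+ 2).
Proof.
move=> fs df; have cf := cder_ccont df; case: df => [p [cp <- fE]].
have [r r0 near0] : exists2 r, 0 < r & forall z, Nc (z - s) < r -> f z != 0.
  have [r r0 h] := cf _ (ltac:(by rewrite Nc_gt0) : 0 < Nc (f s)).
  exists r => // z /h; apply: contraTneq => ->.
  by rewrite sub0r NcN ltxx.
apply: (@cder_loc (fun z => (f s)^-1 - p z * (f z)^-1 / f s * (z - s)) _ _ _ r) => //.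
  by move=> z /near0 fz; have := fE z; move=> /eqP; rewrite -subr_eq0 => /eqP e; apply/eqP; rewrite -subr_eq0;
    have -> : (f s)^-1 - p z / f z / f s * (z - s) - (f z)^-1 = (f z - (f s + p z * (z - s))) / (f z * f s);
    [by field; rewrite fz fs | by rewrite e mul0r].
apply: (@cder_eq _ _ (0 - ((p s * (f s)^-1 / f s) * 1))).
  by field; rewrite fs.
apply: cderB; first exact: cder_cst.
exists (fun z => p z * (f z)^-1 / f s); split; rewrite ?mulr1 //.
  apply: ccontM; last exact: ccont_cst.
  by apply: ccontM => //; apply: ccontV.
by move=> z; rewrite subrr mulr0 add0r.
Qed.

Lemma cderX f s a n : cder f s a -> cder (fun z => f z ^+ n) s (a * (f s ^+ n.-1) *+ n).
Proof.
move=> df; elim: n => [|n IH]; first by rewrite mulr0n; apply: cder_cst.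
apply: (@cder_ext (fun z => f z * f z ^+ n)); first by move=> z; rewrite exprS.
apply: cder_eq (cderM df IH).
case: n {IH} => [|n] /=; first by rewrite !expr0 !mulr1n mulr0n mulr0 addr0.
by rewrite -mulr_natr -[RHS]mulr_natr exprS -natr1; ring.
Qed.

End ComplexBasics.

(** * Real derivatives, comparison of increments, primitives of continuous functions *)

Section RealCalculus.
Variable R : realType.
Implicit Types (x y t e a b d : R) (f g : R -> R).

Definition rder (f : R -> R) (x d : R) : Prop := is_derive (x : R) (1 : R) f d.

Lemma rder_eps f x d :
  (forall e : R, 0 < e -> exists2 r : R, 0 < r & forall h, `|h| < r ->
     `|f (x + h) - f x - d * h| <= e * `|h|) -> rder f x d.
Proof.
move=> H.
suff c : (fun h => h^-1 *: ((f \o shift x) (h *: 1) - f x)) @ 0^' --> d.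
  by apply: DeriveDef; [apply: cvgP c|apply: cvg_lim c].
apply/cvgrPdist_le => e e0; have [r r0 h] := H _ e0.
near=> k.
have k0 : k != 0 by near: k; exact: nbhs_dnbhs_neq.
have kr : `|k| < r by near: k; apply: dnbhs0_lt.
have := h _ kr; rewrite /= [k *: 1]mulr1 [k + x]addrC => hk.
have -> : d - k^-1 *: (f (x + k) - f x) = - (k^-1 * (f (x + k) - f x - d * k)).
  by rewrite /GRing.scale /=; field.
by rewrite normrN normrM normfV ler_pdivrMl ?normr_gt0 // [_ * e]mulrC.
Unshelve. all: by end_near.
Qed.

Lemma rder_epsE f x d : rder f x d ->
  forall e : R, 0 < e -> exists2 r : R, 0 < r & forall h, `|h| < r ->
     `|f (x + h) - f x - d * h| <= e * `|h|.
Proof.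
move=> [df dE] e e0.
have : (fun h => h^-1 *: ((f \o shift x) (h *: 1) - f x)) @ 0^' --> d.
  by rewrite -dE.
move=> /cvgrPdist_le /(_ _ e0); rewrite /dnbhs /within /= => /nbhs_ballP[r /= r0 H].
exists r => // h hr; have [->|h0] := eqVneq h 0.
  by rewrite addr0 subrr mulr0 subr0 normr0 mulr0.
have := H h; rewrite /ball /= sub0r normrN => /(_ hr h0).
rewrite [h *: 1]mulr1 [h + x]addrC => hk.
have -> : f (x + h) - f x - d * h = - (h * (d - h^-1 * (f (x + h) - f x))).
  by field.
by rewrite normrN normrM mulrC ler_wpM2r.
Qed.

Lemma rder_cont f x d : rder f x d -> {for x, continuous f}.
Proof. by move=> [df _]; apply/differentiable_continuous/derivable1_diffP. Qed.

Lemma rder_ext f g x d : f =1 g -> rder f x d -> rder g x d.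
Proof. by move=> /funext ->. Qed.

Lemma rder_eq f x d d' : d = d' -> rder f x d -> rder f x d'.
Proof. by move=> ->. Qed.

Lemma rder_cst c x : rder (fun=> c) x 0. Proof. exact: is_derive_cst. Qed.
Lemma rder_id x : rder id x 1. Proof. exact: is_derive_id. Qed.
Lemma rderD f g x a b : rder f x a -> rder g x b -> rder (fun t => f t + g t) x (a + b).
Proof. exact: is_deriveD. Qed.
Lemma rderN f x a : rder f x a -> rder (fun t => - f t) x (- a).
Proof. exact: is_deriveN. Qed.
Lemma rderB f g x a b : rder f x a -> rder g x b -> rder (fun t => f t - g t) x (a - b).
Proof. exact: is_deriveB. Qed.
Lemma rderM f g x a b : rder f x a -> rder g x b ->
  rder (fun t => f t * g t) x (a * g x + f x * b).
Proof.
move=> h1 h2; apply: rder_eq (is_deriveM h1 h2); rewrite /GRing.scale /=; ring.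
Qed.
Lemma rderZ c f x a : rder f x a -> rder (fun t => c * f t) x (c * a).
Proof. by move=> h; apply: rder_eq (rderM (rder_cst c x) h); ring. Qed.
Lemma rder_comp f g x a b : rder f (g x) a -> rder g x b -> rder (fun t => f (g t)) x (a * b).
Proof. exact: is_derive1_comp. Qed.
Lemma rderX f x a n : rder f x a -> rder (fun t => f t ^+ n) x (n%:R * f x ^+ n.-1 * a).
Proof.
move=> df; elim: n => [|n IH]; first by rewrite !mul0r; apply: rder_cst.
apply: (@rder_ext (fun z => f z * f z ^+ n)); first by move=> z; rewrite exprS.
apply: rder_eq (rderM df IH).
case: n {IH} => [|n] /=; first by rewrite !expr0; ring.
by rewrite exprS -[in RHS]natr1; ring.
Qed.
Lemma rder_aff c k x : rder (fun t => c + k * t) x k.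
Proof. by apply: rder_eq (rderD (rder_cst c x) (rderZ k (rder_id x))); ring. Qed.
Lemma rderV f x a : f x != 0 -> rder f x a -> rder (fun t => (f t)^-1) x (- a / f x ^+ 2).
Proof.
move=> fx h; apply: rder_eq (is_deriveV fx h).
by rewrite /GRing.scale /= mulrC mulNr mulrN.
Qed.

(** The mean value theorem for [g - f]. Comparison of derivatives takes the place of monotonicity of
    the integral in the estimates of real integrals. *)
Lemma rder_mono f df g dg a b : a <= b ->
  (forall t, a <= t <= b -> rder f t (df t)) ->
  (forall t, a <= t <= b -> rder g t (dg t)) ->
  (forall t, a <= t <= b -> df t <= dg t) -> f b - f a <= g b - g a.
Proof.
rewrite le_eqVlt => /predU1P[-> _ _ _|ab Df Dg H]; first by rewrite !subrr.
have D t : a <= t <= b -> rder (fun x => g x - f x) t (dg t - df t).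
  by move=> h; have := Df _ h; have := Dg _ h => ? ?; apply: rderB.
have [] := @MVT R (fun x => g x - f x) (fun t => dg t - df t) a b ab.
- by move=> t; rewrite in_itv /= => /andP[/ltW ? /ltW ?]; apply: D; apply/andP.
- apply: continuous_in_subspaceT => t; rewrite inE /= in_itv /= => /D; exact: rder_cont.
move=> c; rewrite in_itv /= => /andP[/ltW c1 /ltW c2].
have := H c; rewrite c1 c2 => /(_ isT) h.
have : 0 <= (dg c - df c) * (b - a) by rewrite mulr_ge0 // subr_ge0 // ltW.
by move=> ? ?; lra.
Qed.

(** The endpoints are unordered, so that a segment may be run through in either direction. *)
Definition inseg a b t := ((a <= t <= b) || (b <= t <= a)).

Lemma insegC a b t : inseg a b t = inseg b a t. Proof. by rewrite /inseg orbC. Qed.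
Lemma insegl a b : inseg a b a.
Proof. by rewrite /inseg lexx /= andbT le_total. Qed.
Lemma insegr a b : inseg a b b. Proof. by rewrite insegC insegl. Qed.
Lemma inseg_le a b t : a <= b -> inseg a b t = (a <= t <= b).
Proof.
move=> ab; apply/orP/idP => [[//|/andP[h1 h2]]|]; last by left.
by apply/andP; split; lra.
Qed.

Lemma prim_exists f a b : a <= b ->
  (forall t, a <= t <= b -> {for t, continuous f}) ->
  exists F : R -> R, forall t, a <= t <= b -> rder F t (f t).
Proof.
(* Clamping to [[a, b]] makes the integrand continuous on the whole line, so that the primitive is
   differentiable from both sides at [a] and [b]. *)
move=> ab cf; pose cl t := Num.max a (Num.min b t).
have clE t : a <= t <= b -> cl t = t.
  move=> /andP[h1 h2]; rewrite /cl; have /min_idPr -> := h2; exact/max_idPr.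
have cli t : a <= cl t <= b by rewrite /cl le_max lexx /= ge_max ab ge_min lexx.
have ccl : continuous cl.
  move=> t; apply: continuous_max; first exact: cvg_cst.
  by apply: continuous_min; [exact: cvg_cst|exact: cvg_id].
have cg : continuous (f \o cl).
  by move=> t; apply: continuous_comp; [exact: ccl|apply: cf; exact: cli].
(* Integration starts at [a - 1] to make [a] an interior point. *)
exists (fun x => \int[lebesgue_measure]_(t in `[a - 1, x]) ((f \o cl) t))%R => t tab.
have /andP[t1 t2] := tab.
have [] := @continuous_FTC1_closed R (f \o cl) (a - 1) t (b + 1).
- by lra.
- apply: continuous_compact_integrable; first exact: segment_compact.
  exact: continuous_subspaceT.
- by lra.
- exact: cg.
move=> D E; apply: DeriveDef => //.
by rewrite -derive1E E /= clE.
Qed.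

End RealCalculus.

(** * Complex-valued functions of a real variable and their integrals *)

Section ComplexPath.
Variable R : realType.
Local Notation C := R[i].
Implicit Types (f g F G : R -> C) (a b t x y e : R).

Definition rcder F t (d : C) :=
  rder (fun x => Re (F x)) t (Re d) /\
  rder (fun x => Im (F x)) t (Im d).

Definition rccont F t :=
  {for t, continuous (fun x => Re (F x))} /\
  {for t, continuous (fun x => Im (F x))}.

Lemma rcder_cont F t d : rcder F t d -> rccont F t.
Proof. by move=> [/rder_cont ? /rder_cont ?]. Qed.

Lemma rcder_ext F G t d : F =1 G -> rcder F t d -> rcder G t d.
Proof. by move=> /funext ->. Qed.

Lemma rcder_eq F t d d' : d = d' -> rcder F t d -> rcder F t d'.
Proof. by move=> ->. Qed.

Lemma rcder_cst (c : C) t : rcder (fun=> c) t 0.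
Proof. by split; exact: is_derive_cst. Qed.

Lemma rcderD F G t d d' : rcder F t d -> rcder G t d' ->
  rcder (fun x => F x + G x) t (d + d').
Proof.
move=> [f1 f2] [g1 g2]; split; rewrite !ReImE.
  by apply: rder_ext (is_deriveD f1 g1) => x; rewrite !ReImE.
by apply: rder_ext (is_deriveD f2 g2) => x; rewrite !ReImE.
Qed.

Lemma rcderM F G t d d' : rcder F t d -> rcder G t d' ->
  rcder (fun x => F x * G x) t (d * G t + F t * d').
Proof.
move=> [f1 f2] [g1 g2]; split; rewrite !ReImE.
  apply: rder_ext (rder_eq _ (rderB (rderM f1 g1) (rderM f2 g2))).
    by move=> x /=; rewrite !ReImE.
  by ring.
apply: rder_ext (rder_eq _ (rderD (rderM f1 g2) (rderM f2 g1))).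
  by move=> x /=; rewrite !ReImE.
by ring.
Qed.

Lemma rcderZ (c : C) F t d : rcder F t d -> rcder (fun x => c * F x) t (c * d).
Proof. by move=> h; apply: rcder_eq (rcderM (rcder_cst c t) h); rewrite mul0r add0r. Qed.

Lemma rcderN F t d : rcder F t d -> rcder (fun x => - F x) t (- d).
Proof.
move=> h; apply: rcder_eq (rcder_ext _ (rcderZ (-1) h)); first by rewrite mulN1r.
by move=> x; rewrite mulN1r.
Qed.

Lemma rcderB F G t d d' : rcder F t d -> rcder G t d' ->
  rcder (fun x => F x - G x) t (d - d').
Proof. by move=> ? ?; apply: rcderD => //; apply: rcderN. Qed.

Lemma rcder_real (g : R -> R) t d : rder g t d -> rcder (fun x => (g x)%:C) t d%:C.
Proof. by move=> h; split => //=; exact: rder_cst. Qed.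

Lemma rcder_comp F (k : R -> R) t d c : rcder F (k t) d -> rder k t c ->
  rcder (fun x => F (k x)) t (d * c%:C).
Proof.
move=> [h1 h2] h; split; rewrite !ReImE !mulr0 ?add0r ?addr0 ?subr0.
  exact: (is_derive1_comp h1 h).
exact: (is_derive1_comp h2 h).
Qed.

Lemma rcder_aff F t d c k : rcder F (c + k * t) d ->
  rcder (fun x => F (c + k * x)) t (d * k%:C).
Proof.
move=> h; apply: (@rcder_comp F (fun x => c + k * x)) => //.
exact: rder_aff.
Qed.

(** Both components are read off one complex error bound [key], which splits into the error of [f]
    at [F t] and [d] times the error of the path. *)
Lemma cder_path (f : C -> C) F t d w : rcder F t w -> cder f (F t) d ->
  rcder (fun x => f (F x)) t (d * w).
Proof.
move=> [F1 F2] /cderP df.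
have key e : 0 < e -> exists2 r : R, 0 < r & forall h, `|h| < r ->
  Nc (f (F (t + h)) - f (F t) - d * w * h%:C) <= e * `|h|.
  move=> e0.
  pose M := Nc w + 2; have M0 : 2 <= M by rewrite /M lerDr Nc_ge0.
  pose e1 := Num.min 1 (e / (2 * (2 * Nc d + 1))).
  have d0 := Nc_ge0 d.
  have e10 : 0 < e1 by rewrite lt_min ltr01 divr_gt0 //; lra.
  have [r1 r10 H1] := rder_epsE F1 e10; have [r2 r20 H2] := rder_epsE F2 e10.
  have [r3 r30 H3] := df _ (ltac:(apply: divr_gt0; ulra e0 M0) : 0 < e / (2 * M)).
  have r3M : 0 < r3 / M by apply: divr_gt0; ulra r30 M0.
  exists (Num.min r1 (Num.min r2 (r3 / M))); first by rewrite !lt_min r10 r20.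
  move=> h; rewrite !lt_min => /and3P[h1 h2 h3].
  have b1 := H1 _ h1; have b2 := H2 _ h2.
  have hb : Nc (F (t + h) - F t - w * h%:C) <= 2 * e1 * `|h|.
    apply: le_trans (Nc_le _) _.
    rewrite !ReImE !mulr0 subr0 add0r.
    have -> : 2 * e1 * `|h| = e1 * `|h| + e1 * `|h| by ring.
    by apply: lerD.
  have e11 : e1 <= 1 by rewrite ge_min lexx.
  have hM : Nc (F (t + h) - F t) <= M * `|h|.
    have -> : F (t + h) - F t = (F (t + h) - F t - w * h%:C) + w * h%:C by ring.
    apply: le_trans (NcD _ _) _; rewrite NcM Nc_real /M mulrDl addrC lerD2l.
    by apply: le_trans hb _; apply: ler_wpM2r => //; ulra e11.
  have hr : Nc (F (t + h) - F t) < r3.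
    apply: le_lt_trans hM _; move: h3; rewrite ltr_pdivlMr; last ulra M0.
    by rewrite mulrC.
  have -> : f (F (t + h)) - f (F t) - d * w * h%:C =
     (f (F (t + h)) - f (F t) - d * (F (t + h) - F t)) + d * (F (t + h) - F t - w * h%:C) by ring.
  apply: le_trans (NcD _ _) _; rewrite NcM.
  have a1 := H3 _ hr.
  have a2 : e / (2 * M) * Nc (F (t + h) - F t) <= e / 2 * `|h|.
    apply: (@le_trans _ _ (e / (2 * M) * (M * `|h|))).
      by apply: ler_wpM2l => //; apply/ltW/divr_gt0; rlra 23.
    rewrite le_eqVlt; apply/orP; left; apply/eqP; field; ulra M0.
  have a3 : Nc d * Nc (F (t + h) - F t - w * h%:C) <= e / 2 * `|h|.
    apply: (@le_trans _ _ (Nc d * (2 * e1 * `|h|))); first exact: ler_wpM2l.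
    have -> : Nc d * (2 * e1 * `|h|) = (Nc d * 2 * e1) * `|h| by ring.
    apply: ler_wpM2r => //.
    apply: (@le_trans _ _ ((2 * Nc d + 1) * (e / (2 * (2 * Nc d + 1))))).
      apply: ler_pM; [ulra d0|ulra e10|rlra 0|]; by rewrite /e1 ge_min lexx orbT.
    rewrite le_eqVlt; apply/orP; left; apply/eqP; field; ulra d0.
  have -> : e * `|h| = e / 2 * `|h| + e / 2 * `|h| by field.
  by apply: lerD => //; apply: le_trans a1 a2.
split; apply: rder_eps => e /key[r r0 H]; exists r => // h /H hh.
  apply: le_trans hh; apply: le_trans (Re_Nc _).
  by rewrite !ReImE !mulr0 !subr0.
apply: le_trans hh; apply: le_trans (Im_Nc _).
by rewrite !ReImE !mulr0 add0r.
Qed.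

Lemma rcder_line (s w : C) t : rcder (fun x => s + x%:C * w) t w.
Proof.
apply: rcder_eq (rcderD (rcder_cst s t) (rcderM (rcder_real (rder_id t)) (rcder_cst w t))).
by rewrite mulr0 addr0 add0r mul1r.
Qed.

Lemma cder_line (f : C -> C) s w t d : cder f (s + t%:C * w) d ->
  rcder (fun x => f (s + x%:C * w)) t (d * w).
Proof. by move=> h; apply: cder_path (rcder_line s w t) h. Qed.

Lemma cder_x (f : C -> C) x y d : cder f (x +i* y) d ->
  rcder (fun t => f (t +i* y)) x d.
Proof.
have E t : t +i* y = (0 +i* y) + t%:C * 1 by apply: Ceq; rewrite !ReImE; ring.
by rewrite E => /cder_line h; apply: rcder_eq (rcder_ext _ h); [rewrite mulr1|move=> t; rewrite -E].
Qed.

Lemma cder_y (f : C -> C) x y d : cder f (x +i* y) d ->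
  rcder (fun t => f (x +i* t)) y (d * iC).
Proof.
have E t : x +i* t = x%:C + t%:C * iC by apply: Ceq; rewrite !ReImE; ring.
by rewrite E => /cder_line h; apply: rcder_ext h => t; rewrite -E.
Qed.

(* Multiplying by the conjugate phase of [F b - F a] reduces to a real function. *)
Lemma mvt_ineq F f (G g : R -> R) a b : a <= b ->
  (forall t, a <= t <= b -> rcder F t (f t)) ->
  (forall t, a <= t <= b -> rder G t (g t)) ->
  (forall t, a <= t <= b -> Nc (f t) <= g t) ->
  Nc (F b - F a) <= G b - G a.
Proof.
move=> ab DF DG H; set D := F b - F a.
have [D0|D0] := eqVneq D 0.
  rewrite D0 Nc0 -(subrr (0:R)).
  apply: (@rder_mono _ (fun=> 0) (fun=> 0) G g a b) => //.
    by move=> t _; exact: rder_cst.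
  by move=> t /H; apply: le_trans; exact: Nc_ge0.
have nD : 0 < Nc D by rewrite Nc_gt0.
pose u := (Re D / Nc D) +i* (- Im D / Nc D).
have Nu : Nc u = 1.
  apply/eqP; rewrite -(eqrXn2 (n := 2)) ?Nc_ge0 // expr1n Nc_sqr /u /=.
  have := Nc_sqr D; move: nD; move: (Nc D) (Re D) (Im D) => n p q n0 E.
  have -> : (p / n) ^+ 2 + (- q / n) ^+ 2 = (p ^+ 2 + q ^+ 2) / n ^+ 2 by field; lra.
  by rewrite -E divff // expf_neq0 // gt_eqF.
have ReuD : Re (u * D) = Nc D.
  rewrite ReM /u ReI ImI; have := Nc_sqr D; move: nD; move: (Nc D) (Re D) (Im D) => n p q n0 E.
  have -> : p / n * p - - q / n * q = (p ^+ 2 + q ^+ 2) / n by field; lra.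
  by rewrite -E expr2 mulfK // gt_eqF.
have := @rder_mono _ (fun t => Re (u * F t)) (fun t => Re (u * f t)) G g a b ab.
have -> : Re (u * F b) - Re (u * F a) = Nc D.
  by rewrite -ReuD /D !ReImE; ring.
apply => //.
  by move=> t /DF h; have [] := rcderZ u h.
move=> t /H; apply: le_trans; apply: le_trans (Re_le_Nc _) _.
by rewrite NcM Nu mul1r.
Qed.

Lemma mvt_bound F f a b (K : R) : (forall t, inseg a b t -> rcder F t (f t)) ->
  (forall t, inseg a b t -> Nc (f t) <= K) -> Nc (F b - F a) <= K * `|b - a|.
Proof.
move=> DF H.
have main c d : c <= d -> (forall t, c <= t <= d -> rcder F t (f t)) ->
    (forall t, c <= t <= d -> Nc (f t) <= K) -> Nc (F d - F c) <= K * `|d - c|.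
  move=> cd D1 D2; rewrite ger0_norm ?subr_ge0 // mulrBr.
  apply: (@mvt_ineq F f (fun t => K * t) (fun=> K)) => // t _.
  by apply: rder_eq (rderZ K (rder_id t)); rewrite mulr1.
have [ab|/ltW ba] := leP a b.
  by apply: main => // t h; [apply: DF|apply: H]; rewrite inseg_le.
rewrite NcBC distrC; apply: main => // t h; [apply: DF|apply: H]; by rewrite insegC inseg_le.
Qed.

(** * Integrals over segments *)

Definition is_prim F f a b := forall t, inseg a b t -> rcder F t (f t).

(** The integral is the increment of an arbitrary primitive, with the default 0 when there is none.
    By the mean value inequality the choice does not matter; [prim_ex] gives existence for
    continuous integrands. *)
Definition cint f a b : C :=
  if pselect (exists F, is_prim F f a b) is left h then
    projT1 (cid h) b - projT1 (cid h) a else 0.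

Lemma is_prim_sub F f a b c d : is_prim F f a b ->
  inseg a b c -> inseg a b d -> is_prim F f c d.
Proof.
move=> h; rewrite /inseg => hc hd t ht; apply: h; move: hc hd ht; rewrite /inseg.
move=> /orP[]/andP[? ?] /orP[]/andP[? ?] /orP[]/andP[? ?]; apply/orP;
 (by left; apply/andP; split; lra) || (by right; apply/andP; split; rlra 6).
Qed.

Lemma cintE F f a b : is_prim F f a b -> cint f a b = F b - F a.
Proof.
move=> h; rewrite /cint; case: pselect => [e|[]]; last by exists F.
case: (cid e) => G hG /=.
have := @mvt_bound (fun t => G t - F t) (fun=> 0) a b 0.
rewrite mul0r => H; apply/eqP; rewrite -subr_eq0 -Nc_eq0 eq_le Nc_ge0 andbT.
have -> : G b - G a - (F b - F a) = G b - F b - (G a - F a) by ring.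
apply: H => t ht; last by rewrite Nc0.
by apply: rcder_eq (rcderB (hG _ ht) (h _ ht)); rewrite subrr.
Qed.

Definition segcont f a b := forall t, inseg a b t -> rccont f t.

Lemma prim_ex f a b : segcont f a b -> exists F, is_prim F f a b.
Proof.
wlog ab : a b / a <= b.
  move=> H cf; have [ab|/ltW ba] := leP a b; first exact: H.
  have [|F hF] := H b a ba; first by move=> t; rewrite insegC; apply: cf.
  by exists F => t; rewrite insegC; apply: hF.
move=> cf.
have [|F1 h1] := @prim_exists _ (fun t => Re (f t)) a b ab.
  by move=> t ht; have [] := cf t; rewrite ?inseg_le.
have [|F2 h2] := @prim_exists _ (fun t => Im (f t)) a b ab.
  by move=> t ht; have [] := cf t; rewrite ?inseg_le.
by exists (fun t => F1 t +i* F2 t) => t; rewrite inseg_le // => ht; split => /=; auto.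
Qed.

Lemma cintNn f a b : cint f b a = - cint f a b.
Proof.
rewrite /cint; case: pselect => [e|n]; case: pselect => [e'|n'].
- case: (cid e) => F hF; case: (cid e') => G hG /=.
  have E : cint f a b = G b - G a by apply: cintE.
  have E' : cint f a b = F b - F a by apply: cintE => t; rewrite insegC; apply: hF.
  by rewrite -E E' opprB.
- by case: n'; case: e => F hF; exists F => t; rewrite insegC; apply: hF.
- by case: n; case: e' => F hF; exists F => t; rewrite insegC; apply: hF.
- by rewrite oppr0.
Qed.

Lemma cint_ext f g a b : (forall t, inseg a b t -> f t = g t) -> cint f a b = cint g a b.
Proof.
move=> fg; rewrite /cint; case: pselect => [e|n]; case: pselect => [e'|n'] //.
- case: (cid e) => F hF; case: (cid e') => G hG /=.
  rewrite -(cintE hG) -(cintE (f := g) (F := F)) // => t ht.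
  by rewrite -fg //; apply: hF.
- by case: n'; case: e => F hF; exists F => t ht; rewrite -fg //; apply: hF.
- by case: n; case: e' => F hF; exists F => t ht; rewrite fg //; apply: hF.
Qed.

Lemma cintD f g a b : segcont f a b -> segcont g a b ->
  cint (fun t => f t + g t) a b = cint f a b + cint g a b.
Proof.
move=> /prim_ex[F hF] /prim_ex[G hG].
rewrite (cintE hF) (cintE hG) (cintE (F := fun t => F t + G t)); first ring.
by move=> t ht; apply: rcderD; [apply: hF|apply: hG].
Qed.

Lemma cintZ (c : C) f a b : segcont f a b ->
  cint (fun t => c * f t) a b = c * cint f a b.
Proof.
move=> /prim_ex[F hF].
rewrite (cintE hF) (cintE (F := fun t => c * F t)); first ring.
by move=> t ht; apply: rcderZ; apply: hF.
Qed.

Lemma cintN f a b : segcont f a b -> cint (fun t => - f t) a b = - cint f a b.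
Proof.
move=> h; rewrite -mulN1r -cintZ //; apply: cint_ext => t _; by rewrite mulN1r.
Qed.

Lemma segcontN f a b : segcont f a b -> segcont (fun t => - f t) a b.
Proof.
move=> h t /h[c1 c2]; split.
  rewrite (_ : (fun x => _) = (fun x => - Re (f x))); [exact: continuousN|by apply/funext => x; rewrite ReN].
rewrite (_ : (fun x => _) = (fun x => - Im (f x))); [exact: continuousN|by apply/funext => x; rewrite ImN].
Qed.

Lemma cintB f g a b : segcont f a b -> segcont g a b ->
  cint (fun t => f t - g t) a b = cint f a b - cint g a b.
Proof. by move=> hf hg; rewrite cintD ?cintN //; apply: segcontN. Qed.

Lemma cint_chasles f a b c d e : segcont f d e -> inseg d e a -> inseg d e b -> inseg d e c ->
  cint f a b + cint f b c = cint f a c.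
Proof.
move=> /prim_ex[F hF] ha hb hc.
rewrite (cintE (is_prim_sub hF ha hb)) (cintE (is_prim_sub hF hb hc)) (cintE (is_prim_sub hF ha hc)).
ring.
Qed.

Lemma cint_bound f a b (K : R) : segcont f a b ->
  (forall t, inseg a b t -> Nc (f t) <= K) -> Nc (cint f a b) <= K * `|b - a|.
Proof. by move=> /prim_ex[F hF] H; rewrite (cintE hF); apply: mvt_bound H. Qed.

Lemma cint_le f (G g : R -> R) a b : a <= b -> segcont f a b ->
  (forall t, a <= t <= b -> rder G t (g t)) ->
  (forall t, a <= t <= b -> Nc (f t) <= g t) -> Nc (cint f a b) <= G b - G a.
Proof.
move=> ab /prim_ex[F hF] DG H; rewrite (cintE hF); apply: mvt_ineq H => // t ht.
by apply: hF; rewrite inseg_le.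
Qed.

Lemma cint_aff f a b c k : segcont f (c + k * a) (c + k * b) ->
  cint (fun t => f (c + k * t) * k%:C) a b = cint f (c + k * a) (c + k * b).
Proof.
move=> /prim_ex[F hF]; rewrite (cintE hF) (cintE (F := fun t => F (c + k * t))) //.
move=> t ht; apply: rcder_aff; apply: hF; move: ht; rewrite /inseg !lerD2l.
have [k0|k0|->] := ltrgt0P k.
- by rewrite !ler_pM2l.
- by rewrite !ler_nM2l // orbC => /orP[]/andP[-> ->]; rewrite ?orbT.
- by rewrite !mul0r lexx.
Qed.

Definition rint (g : R -> R) a b : R := Re (cint (fun t => (g t)%:C) a b).

Lemma rcont_real (g : R -> R) t : {for t, continuous g} -> rccont (fun x => (g x)%:C) t.
Proof. by move=> h; split => //=; exact: cvg_cst. Qed.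

Lemma rintE (G g : R -> R) a b : (forall t, inseg a b t -> rder G t (g t)) ->
  rint g a b = G b - G a.
Proof.
move=> h; rewrite /rint (cintE (F := fun t => (G t)%:C)) ?ReImE //.
by move=> t /h; exact: rcder_real.
Qed.

Definition rsegcont (g : R -> R) a b := forall t, inseg a b t -> {for t, continuous g}.

Lemma rprim_ex (g : R -> R) a b : rsegcont g a b ->
  exists G : R -> R, forall t, inseg a b t -> rder G t (g t).
Proof.
move=> h; have [|F hF] := @prim_ex (fun t => (g t)%:C) a b.
  by move=> t /h /rcont_real.
by exists (fun t => Re (F t)) => t /hF[].
Qed.

Lemma Re_cint f a b : segcont f a b -> Re (cint f a b) = rint (fun t => Re (f t)) a b.
Proof.
move=> /prim_ex[F hF]; rewrite (cintE hF) (rintE (G := fun t => Re (F t))) ?ReImE //.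
by move=> t /hF[].
Qed.

End ComplexPath.

(** * The complex exponential *)

Section Cexp.
Variable R : realType.
Local Notation C := R[i].
Implicit Types (z w s : C) (x y t : R).

Lemma cexpD z w : cexp (z + w) = cexp z * cexp w.
Proof.
rewrite /cexp; apply: Ceq; rewrite !ReImE.
  by rewrite expRD cosD; ring.
by rewrite expRD sinD; ring.
Qed.

Lemma cexp0 : cexp 0 = 1 :> C.
Proof. by rewrite /cexp; apply: Ceq; rewrite /= expR0 ?cos0 ?sin0; ring. Qed.

Lemma Nc_cexp z : Nc (cexp z) = expR (Re z).
Proof.
apply/eqP; rewrite -(eqrXn2 (n := 2)) ?Nc_ge0 ?expR_ge0 // Nc_sqr /cexp ReI ImI.
by rewrite !exprMn -mulrDr cos2Dsin2 mulr1.
Qed.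

Lemma cexp_neq0 z : cexp z != 0.
Proof. by rewrite -Nc_gt0 Nc_cexp expR_gt0. Qed.

Lemma cexpN z : cexp (- z) = (cexp z)^-1.
Proof.
by apply: (mulfI (cexp_neq0 z)); rewrite -cexpD subrr cexp0 divff ?cexp_neq0.
Qed.

Lemma cexpB z w : cexp (z - w) = cexp z / cexp w.
Proof. by rewrite cexpD cexpN. Qed.

Lemma cexp_real x : cexp x%:C = (expR x)%:C.
Proof. by rewrite /cexp; apply: Ceq; rewrite /= ?cos0 ?sin0; ring. Qed.

Lemma cexp_der z : cder (@cexp R) z (cexp z).
(* Multiplicativity reduces the derivative at [z] to the one at 0. *)
Proof.
suff H0 : cder (@cexp R) 0 1.
  have Ht : cder (fun s => s - z) z 1.
    by apply: cder_eq (cderB (cder_id z) (cder_cst z z)); rewrite subr0.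
  have H1 : cder (fun s => cexp (s - z)) z 1.
    by apply: cder_eq (cder_comp Ht _); last (rewrite subrr; exact: H0); rewrite mulr1.
  apply: cder_eq (cder_ext _ (cderZ (cexp z) H1)); first by rewrite mulr1.
  by move=> s; rewrite -cexpD; congr cexp; ring.
apply/cderP => e e0.
have [e1 [e10 e11 e16]] : exists e1 : R, [/\ 0 < e1, e1 <= 1 & e1 <= e / 6].
  by exists (Num.min 1 (e / 6)); split; rewrite ?lt_min ?ge_min ?lexx ?ltr01 ?divr_gt0 ?orbT.
have [r1 r10 H1] := @rder_epsE _ _ _ _ (@is_derive_expR R 0) _ e10.
have [r2 r20 H2] := @rder_epsE _ _ _ _ (@is_derive_cos R 0) _ e10.
have [r3 r30 H3] := @rder_epsE _ _ _ _ (@is_derive_sin R 0) _ e10.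
exists (Num.min e1 (Num.min r1 (Num.min r2 r3))); first by rewrite !lt_min e10 r10 r20.
move=> h; rewrite subr0 !lt_min => /and4P[h0 h1 h2 h3].
have hx := Re_Nc h; have hy := Im_Nc h.
set n := Nc h in h0 h1 h2 h3 hx hy *.
have n0 : 0 <= n := Nc_ge0 h.
move: h1 h2 h3 hx hy; set x := Re h; set y := Im h => h1 h2 h3 hx hy.
have := H1 x (le_lt_trans hx h1); rewrite add0r expR0 mul1r => b1.
have := H2 y (le_lt_trans hy h2); rewrite add0r cos0 sin0 oppr0 mul0r subr0 => b2.
have := H3 y (le_lt_trans hy h3); rewrite add0r sin0 cos0 mul1r subr0 => b3.
(* Each summand is a first-order error of [expR], [cos] or [sin], or the product of [x] with a
   quantity of the size of [n]. *)
have -> : cexp h - cexp 0 - 1 * h =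
  (expR x - 1 - x)%:C * (cos y +i* sin y) + x%:C * ((cos y - 1)%:C + iC * (sin y)%:C)
  + ((cos y - 1)%:C + iC * (sin y - y)%:C).
  rewrite cexp0 mul1r /cexp -/x -/y; apply: Ceq; rewrite !ReImE; last by rewrite -/y; ring.
  by rewrite -/x; ring.
have Nu : Nc (cos y +i* sin y) = 1.
  apply/eqP; rewrite -(eqrXn2 (n := 2)) ?Nc_ge0 // Nc_sqr ReI ImI cos2Dsin2.
  by rewrite expr1n.
have bs : `|sin y| <= 2 * n.
  have -> : sin y = (sin y - y) + y by ring.
  apply: le_trans (ler_normD _ _) _.
  have : e1 * `|y| <= 1 * `|y| by apply: ler_wpM2r.
  ulra b3 hy.
have bc : `|cos y - 1| <= n.
  have : e1 * `|y| <= 1 * `|y| by apply: ler_wpM2r.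
  ulra b2 hy.
apply: le_trans (NcD _ _) _; apply: le_trans (lerD (NcD _ _) (lexx _)) _.
rewrite !NcM !Nc_real Nu mulr1.
have a1 : Nc ((cos y - 1)%:C + iC * (sin y)%:C) <= 3 * n.
  by apply: le_trans (NcD _ _) _; rewrite NcM Nc_i !Nc_real mul1r; ulra bc bs.
have ey : e1 * `|y| <= e1 * n by apply: ler_wpM2l hy; exact: ltW.
have a2 : Nc ((cos y - 1)%:C + iC * (sin y - y)%:C) <= 2 * e1 * n.
  apply: le_trans (NcD _ _) _; rewrite NcM Nc_i !Nc_real mul1r.
  by rewrite -mulrA [2 * _]mulr_natl mulr2n; exact: lerD (le_trans b2 ey) (le_trans b3 ey).
have a3 : `|expR x - 1 - x| <= e1 * n.
  by apply: le_trans b1 _; apply: ler_wpM2l hx; exact: ltW.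
have a4 : `|x| * Nc ((cos y - 1)%:C + iC * (sin y)%:C) <= e1 * (3 * n).
  apply: ler_pM => //; first exact: Nc_ge0.
  by apply: le_trans hx (ltW h0).
have : 6 * e1 * n <= e * n by apply: ler_wpM2r => //; ulra e16.
ulra a2 a3 a4.
Qed.

End Cexp.

(** * Cauchy's theorem *)

Section Rectangles.
Variable R : realType.
Local Notation C := R[i].
Implicit Types (f g : C -> C) (z w s : C) (a b c d x y t e r : R).

Definition holo f z := exists k : C, cder f z k.

Lemma holo_ccont f z : holo f z -> ccont f z.
Proof. by case=> d; exact: cder_ccont. Qed.

Lemma holo_cst (k : C) z : holo (fun=> k) z. Proof. exists 0; exact: cder_cst. Qed.
Lemma holo_id z : holo id z. Proof. exists 1; exact: cder_id. Qed.
Lemma holoD f g z : holo f z -> holo g z -> holo (fun s => f s + g s) z.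
Proof. by move=> [a ha] [b hb]; exists (a + b); exact: cderD. Qed.
Lemma holoN f z : holo f z -> holo (fun s => - f s) z.
Proof. by move=> [a ha]; exists (- a); exact: cderN. Qed.
Lemma holoB f g z : holo f z -> holo g z -> holo (fun s => f s - g s) z.
Proof. by move=> [a ha] [b hb]; exists (a - b); exact: cderB. Qed.
Lemma holoM f g z : holo f z -> holo g z -> holo (fun s => f s * g s) z.
Proof. by move=> [a ha] [b hb]; exists (a * g z + f z * b); exact: cderM. Qed.
Lemma holoV f z : f z != 0 -> holo f z -> holo (fun s => (f s)^-1) z.
Proof. by move=> h [a ha]; exists (- a / f z ^+ 2); exact: cderV. Qed.
Lemma holoX f n z : holo f z -> holo (fun s => f s ^+ n) z.
Proof. by move=> [a ha]; exists (a * (f z ^+ n.-1) *+ n); exact: cderX. Qed.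
Lemma holo_comp f g z : holo g z -> holo f (g z) -> holo (fun s => f (g s)) z.
Proof. by move=> [a ha] [b hb]; exists (b * a); exact: cder_comp. Qed.
Lemma holo_exp f z : holo f z -> holo (fun s => cexp (f s)) z.
Proof. by move=> h; apply: (@holo_comp (@cexp R)) => //; exists (cexp (f z)); exact: cexp_der. Qed.
Lemma holo_loc f g z r : 0 < r -> (forall s, Nc (s - z) < r -> f s = g s) ->
  holo f z -> holo g z.
Proof. by move=> r0 h [d hd]; exists d; apply: cder_loc h hd. Qed.

Lemma ccont_rccont f (F : R -> C) t : ccont f (F t) -> rccont F t ->
  rccont (fun x => f (F x)) t.
Proof.
move=> cf [c1 c2].
have key (p : C -> R) : (forall u v, `|p u - p v| <= Nc (u - v)) ->
  {for t, continuous (fun x => p (f (F x)))}.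
  move=> pl; apply/cvgrPdist_lt => e e0; have [d d0 h] := cf _ e0.
  have d2 : 0 < d / 2 by rewrite divr_gt0.
  move/cvgrPdist_lt : c1 => /(_ _ d2) n1; move/cvgrPdist_lt : c2 => /(_ _ d2) n2.
  near=> x.
  have h1 : `|Re (F t) - Re (F x)| < d / 2 by near: x.
  have h2 : `|Im (F t) - Im (F x)| < d / 2 by near: x.
  rewrite distrC; apply: le_lt_trans (pl _ _) _; apply: h.
  apply: le_lt_trans (Nc_le _) _; rewrite !ReImE distrC [`|Im _ - _|]distrC; ulra h2 h1.
split.
  by apply: (key (@Re R)) => u v; apply: le_trans (Re_Nc _); rewrite !ReImE.
by apply: (key (@Im R)) => u v; apply: le_trans (Im_Nc _); rewrite !ReImE.
Unshelve. all: by end_near.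
Qed.

Lemma cont_x f x y : ccont f (x +i* y) -> rccont (fun t => f (t +i* y)) x.
Proof.
by move=> h; apply: (@ccont_rccont f (fun t => t +i* y) x h); split; [exact: cvg_id|exact: cvg_cst].
Qed.

Lemma cont_y f x y : ccont f (x +i* y) -> rccont (fun t => f (x +i* t)) y.
Proof.
by move=> h; apply: (@ccont_rccont f (fun t => x +i* t) y h); split; [exact: cvg_cst|exact: cvg_id].
Qed.

Lemma segcont_x f a b y : a <= b -> (forall x, a <= x <= b -> ccont f (x +i* y)) -> segcont (fun x => f (x +i* y)) a b.
Proof. by move=> ab h x; rewrite (inseg_le _ ab) => /h; exact: (@cont_x f). Qed.

Lemma segcont_y f a b x : a <= b -> (forall y, a <= y <= b -> ccont f (x +i* y)) -> segcont (fun y => f (x +i* y)) a b.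
Proof. by move=> ab h y; rewrite (inseg_le _ ab) => /h; exact: (@cont_y f). Qed.

Lemma segcont_bounded (F : R -> C) a b : segcont F a b ->
  exists2 K : R, 0 < K & forall t, inseg a b t -> Nc (F t) <= K.
Proof.
wlog ab : a b / a <= b.
  move=> H cf; have [ab|/ltW ba] := leP a b; first exact: H.
  have [|K K0 hK] := H b a ba; first by move=> t; rewrite insegC; apply: cf.
  by exists K => // t; rewrite insegC; apply: hK.
move=> cf.
have bnd (p : R -> R) : (forall t, a <= t <= b -> {for t, continuous p}) ->
    exists K : R, forall t, a <= t <= b -> p t <= K.
  move=> cp; have [|c _ h] := @EVT_max R p a b ab.
    by apply: continuous_in_subspaceT => t; rewrite inE /= in_itv /=; apply: cp.
  by exists (p c) => t ht; apply: h; rewrite in_itv.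
have [K1 h1] := bnd (fun t => `|Re (F t)|) (fun t ht =>
   continuous_comp (cf t (ltac:(rewrite inseg_le //))).1 (@norm_continuous _ _ _)).
have [K2 h2] := bnd (fun t => `|Im (F t)|) (fun t ht =>
   continuous_comp (cf t (ltac:(rewrite inseg_le //))).2 (@norm_continuous _ _ _)).
exists (`|K1| + `|K2| + 1); first by rewrite ltr_pwDr // addr_ge0.
move=> t; rewrite inseg_le // => ht; apply: le_trans (Nc_le _) _.
have := h1 _ ht; have := h2 _ ht; have := ler_norm K1; have := ler_norm K2; lra.
Qed.

(** The counterclockwise contour integral over the boundary, with [dz = i dy] on the vertical
    sides. *)
Definition rect f a b c d : C :=
  cint (fun x => f (x +i* c)) a b - cint (fun x => f (x +i* d)) a b +
  iC * (cint (fun y => f (b +i* y)) c d - cint (fun y => f (a +i* y)) c d).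

Definition inrect a b c d z :=
  (a <= Re z <= b) && (c <= Im z <= d).
Definition onrect a b c d z := inrect a b c d z &&
  [|| Re z == a, Re z == b, Im z == c | Im z == d].

Definition bcont f a b c d := forall z, onrect a b c d z -> ccont f z.

Lemma bcont_sides f a b c d : a <= b -> c <= d -> bcont f a b c d ->
  [/\ segcont (fun x => f (x +i* c)) a b, segcont (fun x => f (x +i* d)) a b,
      segcont (fun y => f (b +i* y)) c d & segcont (fun y => f (a +i* y)) c d].
Proof.
move=> ab cd h; split; [apply: (@segcont_x f)|apply: (@segcont_x f)|apply: (@segcont_y f)|apply: (@segcont_y f)] => // t ht; apply: h;
 by rewrite /onrect /inrect ht ?lexx ?ab ?cd ?eqxx ?orbT.
Qed.

Lemma rect_bound f a b c d (K : R) : a <= b -> c <= d -> bcont f a b c d ->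
  (forall z, onrect a b c d z -> Nc (f z) <= K) ->
  Nc (rect f a b c d) <= K * (2 * ((b - a) + (d - c))).
Proof.
move=> ab cd cf H; have [c1 c2 c3 c4] := bcont_sides ab cd cf.
have B1 := cint_bound c1 (K := K); have B2 := cint_bound c2 (K := K).
have B3 := cint_bound c3 (K := K); have B4 := cint_bound c4 (K := K).
rewrite !(@ger0_norm _ (b - a)) ?subr_ge0 // in B1 B2.
rewrite !(@ger0_norm _ (d - c)) ?subr_ge0 // in B3 B4.
apply: le_trans (NcD _ _) _; rewrite NcM Nc_i mul1r.
apply: le_trans (lerD (NcB _ _) (NcB _ _)) _.
have E : K * (2 * (b - a + (d - c))) = (K * (b - a) + K * (b - a)) + (K * (d - c) + K * (d - c)) by ring.
rewrite E; apply: lerD; apply: lerD; [apply: B1|apply: B2|apply: B3|apply: B4];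
 move=> t; rewrite inseg_le // => ht; apply: H;
 by rewrite /onrect /inrect /= ?ht ?lexx ?ab ?cd ?eqxx ?orbT.
Qed.

Lemma rect_ext f g a b c d : a <= b -> c <= d ->
  (forall z, onrect a b c d z -> f z = g z) -> rect f a b c d = rect g a b c d.
Proof.
move=> ab cd H; rewrite /rect; congr (_ - _ + iC * (_ - _)); apply: cint_ext => t;
 rewrite inseg_le // => ht; apply: H;
 by rewrite /onrect /inrect /= ?ht ?lexx ?ab ?cd ?eqxx ?orbT.
Qed.

Lemma rectZ (k : C) f a b c d : a <= b -> c <= d -> bcont f a b c d ->
  rect (fun z => k * f z) a b c d = k * rect f a b c d.
Proof.
move=> ab cd cf; have [f1 f2 f3 f4] := bcont_sides ab cd cf.
by rewrite /rect !cintZ //; ring.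
Qed.

Lemma rectB f g a b c d : a <= b -> c <= d -> bcont f a b c d -> bcont g a b c d ->
  rect (fun z => f z - g z) a b c d = rect f a b c d - rect g a b c d.
Proof.
move=> ab cd cf cg; have [f1 f2 f3 f4] := bcont_sides ab cd cf.
have [g1 g2 g3 g4] := bcont_sides ab cd cg.
by rewrite /rect !cintB //; ring.
Qed.

Lemma rect_prim F f a b c d : a <= b -> c <= d ->
  (forall z, onrect a b c d z -> cder F z (f z)) -> rect f a b c d = 0.
Proof.
move=> ab cd H; rewrite /rect.
rewrite (cintE (F := fun x => F (x +i* c))); last first.
  move=> t; rewrite inseg_le // => ht; apply: cder_x; apply: H.
  by rewrite /onrect /inrect /= ?ht ?lexx ?ab ?cd ?eqxx ?orbT.
rewrite (cintE (F := fun x => F (x +i* d))); last first.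
  move=> t; rewrite inseg_le // => ht; apply: cder_x; apply: H.
  by rewrite /onrect /inrect /= ?ht ?lexx ?ab ?cd ?eqxx ?orbT.
rewrite (cintE (F := fun y => - iC * F (b +i* y))); last first.
  move=> t; rewrite inseg_le // => ht.
  apply: rcder_eq (rcderZ (- iC) (cder_y (d := f (b +i* t)) _)); last first.
    apply: H; by rewrite /onrect /inrect /= ?ht ?lexx ?ab ?cd ?eqxx ?orbT.
  by rewrite mulrC -mulrA mulrN ii; ring.
rewrite (cintE (F := fun y => - iC * F (a +i* y))); last first.
  move=> t; rewrite inseg_le // => ht.
  apply: rcder_eq (rcderZ (- iC) (cder_y (d := f (a +i* t)) _)); last first.
    apply: H; by rewrite /onrect /inrect /= ?ht ?lexx ?ab ?cd ?eqxx ?orbT.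
  by rewrite mulrC -mulrA mulrN ii; ring.
have E (p q u v : C) : p + iC * (- iC * q - - iC * u - (- iC * v - - iC * 0)) = p - (iC * iC) * (q - u - v).
  by ring.
transitivity (F (b +i* c) - F (a +i* c) - (F (b +i* d) - F (a +i* d)) - (iC * iC) *
  (F (b +i* d) - F (b +i* c) - (F (a +i* d) - F (a +i* c)))); first ring.
by rewrite ii; ring.
Qed.

Lemma rect_vsplit f a m b c d : a <= m <= b ->
  segcont (fun x => f (x +i* c)) a b -> segcont (fun x => f (x +i* d)) a b ->
  rect f a b c d = rect f a m c d + rect f m b c d.
Proof.
move=> hm h1 h2; rewrite /rect.
have im : inseg a b m by rewrite /inseg hm.
rewrite -(cint_chasles h1 (insegl a b) im (insegr a b)).
by rewrite -(cint_chasles h2 (insegl a b) im (insegr a b)); ring.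
Qed.

Lemma rect_hsplit f a b c m d : c <= m <= d ->
  segcont (fun y => f (b +i* y)) c d -> segcont (fun y => f (a +i* y)) c d ->
  rect f a b c d = rect f a b c m + rect f a b m d.
Proof.
move=> hm h1 h2; rewrite /rect.
have im : inseg c d m by rewrite /inseg hm.
rewrite -(cint_chasles h1 (insegl c d) im (insegr c d)).
by rewrite -(cint_chasles h2 (insegl c d) im (insegr c d)); ring.
Qed.

Lemma hol_bcont f a b c d : (forall z, inrect a b c d z -> holo f z) -> bcont f a b c d.
Proof. by move=> h z /andP[hz _]; apply: holo_ccont; apply: h. Qed.

Lemma nested_limit (x w : nat -> R) :
  (forall n, x n <= x n.+1) -> (forall n, x n.+1 + w n.+1 <= x n + w n) ->
  (forall n, 0 <= w n) -> exists p, forall n, x n <= p <= x n + w n.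
Proof.
move=> xi xd w0.
have mono n m : (n <= m)%N -> x n <= x m.
  move=> /subnKC <-; elim: (m - n)%N => [|k IH]; first by rewrite addn0.
  by rewrite addnS; apply: le_trans IH (xi _).
have anti n m : (n <= m)%N -> x m + w m <= x n + w n.
  move=> /subnKC <-; elim: (m - n)%N => [|k IH]; first by rewrite addn0.
  by rewrite addnS; apply: le_trans (xd _) IH.
have ub n m : x m <= x n + w n.
  apply: le_trans (mono _ _ (leq_maxl m n)) _.
  apply: le_trans (anti _ _ (leq_maxr m n)); rewrite lerDl; exact: w0.
exists (sup (range x)) => n; apply/andP; split.
  apply: sup_upper_bound; last by exists n.
  by split; [exists (x 0%N); exists 0%N|exists (x 0%N + w 0%N) => _ [m _ <-]].
apply: ge_sup; first by exists (x 0%N); exists 0%N.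
by move=> _ [m _ <-].
Qed.

Lemma exp2_big (x : R) : exists n, x < 2 ^+ n.
Proof. by exists (Num.bound x); apply: upper_nthrootP. Qed.

Lemma quarter_bound f x y (w h k : R) : 0 <= w -> 0 <= h ->
  (forall z, inrect x (x + w + w) y (y + h + h) z -> holo f z) ->
  4 * k <= Nc (rect f x (x + w + w) y (y + h + h)) -> Nc (rect f x (x + w) y (y + h)) < k ->
  Nc (rect f (x + w) (x + w + w) y (y + h)) < k -> Nc (rect f x (x + w) (y + h) (y + h + h)) < k ->
  k <= Nc (rect f (x + w) (x + w + w) (y + h) (y + h + h)).
Proof.
move=> w0 h0 hP.
have xw : x <= x + w <= x + w + w by rewrite !lerDl w0.
have yh : y <= y + h <= y + h + h by rewrite !lerDl h0.
have xww : x <= x + w + w by case/andP: xw; exact: le_trans.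
have yhh : y <= y + h + h by case/andP: yh; exact: le_trans.
have cx y' : y <= y' <= y + h + h -> segcont (fun t => f (t +i* y')) x (x + w + w).
  by move=> hy; apply: (@segcont_x f) => // t ht; apply/holo_ccont/hP; rewrite /inrect ht.
have cy x' : x <= x' <= x + w + w -> segcont (fun t => f (x' +i* t)) y (y + h + h).
  by move=> hx; apply: (@segcont_y f) => // t ht; apply/holo_ccont/hP; rewrite /inrect hx.
have [x2 y2] : (x + w <= x + w + w) /\ (y + h <= y + h + h) by rewrite !lerDl.
rewrite (@rect_vsplit f x (x + w) (x + w + w)); [|by []|by apply: cx; rewrite lexx|by apply: cx; rewrite lexx yhh].
rewrite (@rect_hsplit f x (x + w) y (y + h) (y + h + h)); [|by []|exact: cy|by apply: cy; rewrite lexx].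
rewrite (@rect_hsplit f (x + w) (x + w + w) y (y + h) (y + h + h)); [|by []|by apply: cy; rewrite lexx xww|exact: cy].
move: (rect f _ _ _ _) (rect f _ _ _ _) (rect f _ _ _ _) (rect f _ _ _ _) => r1 r2 r3 r4.
have := NcD (r4 + r3) (r2 + r1); have := NcD r4 r3; have := NcD r2 r1; clear; lra.
Qed.

(** The affine part of [f] at [s] has a primitive and integrates to 0; what is left is at most
    [e (w + h)] on the boundary. *)
Lemma rect_affine_bound f x y (w h : R) s k e r : 0 <= w -> 0 <= h -> 0 < e -> inrect x (x + w) y (y + h) s ->
  w + h < r -> (forall z, inrect x (x + w) y (y + h) z -> holo f z) ->
  (forall z, Nc (z - s) < r -> Nc (f z - f s - k * (z - s)) <= e * Nc (z - s)) ->
  Nc (rect f x (x + w) y (y + h)) <= 2 * e * (w + h) ^+ 2.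
Proof.
move=> w0 h0 e0 /andP[/andP[p1 p2] /andP[q1 q2]] wr hol hr.
have xw : x <= x + w by rewrite lerDl.
have yh : y <= y + h by rewrite lerDl.
have lin : rect (fun z => f s + k * (z - s)) x (x + w) y (y + h) = 0.
  apply: (@rect_prim (fun z => (f s - k * s) * z + k / 2 * (z * z))) => // z _.
  apply: cder_eq (cderD (cderZ _ (cder_id z)) (cderZ _ (cderM (cder_id z) (cder_id z)))).
  by field.
have cl : bcont (fun z => f s + k * (z - s)) x (x + w) y (y + h).
  move=> z _; apply: holo_ccont; apply: holoD; first exact: holo_cst.
  by apply: holoM; [exact: holo_cst|apply: holoB; [exact: holo_id|exact: holo_cst]].
have cfn := hol_bcont hol.
have := @rect_bound (fun z => f z - (f s + k * (z - s))) x (x + w) y (y + h) (e * (w + h)) xw yh.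
rewrite rectB // lin subr0 => B; apply: le_trans (B _ _) _.
- by move=> z hz; apply: ccontD; [exact: cfn|apply: ccontN; exact: cl].
- move=> z /andP[/andP[/andP[u1 u2] /andP[v1 v2]] _].
  have zs : Nc (z - s) <= w + h.
    apply: le_trans (Nc_le _) _; rewrite !ReImE; apply: lerD; rewrite ler_norml.
      by apply/andP; split; [move: u1 p2|move: u2 p1]; clear; lra.
    by apply/andP; split; [move: v1 q2|move: v2 q1]; clear; lra.
  rewrite opprD addrA; apply: le_trans (hr z (le_lt_trans zs wr)) _.
  by apply: ler_wpM2l; [exact: ltW|exact: zs].
by rewrite le_eqVlt; apply/orP; left; apply/eqP; ring.
Qed.

Lemma sqr_frac_lt (K D : R) : 0 < K -> 0 <= D -> 2 * (K / (4 * (D ^+ 2 + 1))) * D ^+ 2 < K.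
Proof.
move=> K0 D0; have D2 : 0 <= D ^+ 2 by rewrite sqr_ge0.
have D1 : D ^+ 2 + 1 != 0 by apply: lt0r_neq0; rewrite ltr_wpDl.
have -> : 2 * (K / (4 * (D ^+ 2 + 1))) * D ^+ 2 = K * (D ^+ 2 / (2 * (D ^+ 2 + 1))) by field.
by rewrite gtr_pMr // ltr_pdivrMr; lra.
Qed.

(* Bisection: a quarter carrying at least a fourth of the integral is selected at each step. *)
Theorem goursat f a b c d : a <= b -> c <= d ->
  (forall z, inrect a b c d z -> holo f z) -> rect f a b c d = 0.
Proof.
move=> ab cd hf; apply/eqP/negPn/negP => K0.
set K := Nc (rect f a b c d); have {K0}K0 : 0 < K by rewrite Nc_gt0.
pose W n := (b - a) / 2 ^+ n; pose H n := (d - c) / 2 ^+ n.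
have W0 n : 0 <= W n by rewrite divr_ge0 ?subr_ge0 ?exprn_ge0.
have H0 n : 0 <= H n by rewrite divr_ge0 ?subr_ge0 ?exprn_ge0.
have half (u : R) n : u / 2 ^+ n = u / 2 ^+ n.+1 + u / 2 ^+ n.+1 by rewrite exprS; field; rewrite expf_neq0.
have WS n : W n = W n.+1 + W n.+1 := half _ n.
have HS n : H n = H n.+1 + H n.+1 := half _ n.
pose I n (p : R * R) := Nc (rect f p.1 (p.1 + W n) p.2 (p.2 + H n)).
pose nxt n (p : R * R) : R * R :=
  if K / 4 ^+ n.+1 <= I n.+1 p then p
  else if K / 4 ^+ n.+1 <= I n.+1 (p.1 + W n.+1, p.2) then (p.1 + W n.+1, p.2)
  else if K / 4 ^+ n.+1 <= I n.+1 (p.1, p.2 + H n.+1) then (p.1, p.2 + H n.+1)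
  else (p.1 + W n.+1, p.2 + H n.+1).
pose P := fix P n : R * R := if n is m.+1 then nxt m (P m) else (a, c).
have PS n : P n.+1 = nxt n (P n) by [].
have P1 n : (P n).1 <= (P n.+1).1 <= (P n).1 + W n.+1.
  by have := W0 n.+1; rewrite PS /nxt; case: ifP => _; [|case: ifP => _; [|case: ifP => _]] => /= h; rewrite lexx lerDl h.
have P2 n : (P n).2 <= (P n.+1).2 <= (P n).2 + H n.+1.
  by have := H0 n.+1; rewrite PS /nxt; case: ifP => _; [|case: ifP => _; [|case: ifP => _]] => /= h; rewrite lexx lerDl h.
have nest (u v w w1 b' : R) : u + w <= b' -> w = w1 + w1 -> v <= u + w1 -> v + w1 <= b' by clear; lra.
have B1 n : a <= (P n).1 /\ (P n).1 + W n <= b.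
  elim: n => [|n [i1 i2]]; first by rewrite /= /W expr0 divr1 subrKC.
  by have /andP[h1 h2] := P1 n; split; [exact: le_trans h1|exact: nest i2 (WS n) h2].
have B2 n : c <= (P n).2 /\ (P n).2 + H n <= d.
  elim: n => [|n [i1 i2]]; first by rewrite /= /H expr0 divr1 subrKC.
  by have /andP[h1 h2] := P2 n; split; [exact: le_trans h1|exact: nest i2 (HS n) h2].
have hol n z : inrect (P n).1 ((P n).1 + W n) (P n).2 ((P n).2 + H n) z -> holo f z.
  move=> /andP[/andP[x1 x2] /andP[y1 y2]]; apply: hf.
  have [? x3] := B1 n; have [? y3] := B2 n.
  by rewrite /inrect (le_trans _ x1) // (le_trans x2) // (le_trans _ y1) // (le_trans y2).
have IK n : K / 4 ^+ n <= I n (P n).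
  elim: n => [|n IH]; first by rewrite /I /= /W /H expr0 !divr1 !subrKC /K.
  rewrite PS /nxt; case: ifP => // /negbT; rewrite -ltNge => q1.
  case: ifP => // /negbT; rewrite -ltNge => q2.
  case: ifP => // /negbT; rewrite -ltNge => q3.
  move: q1 q2 q3 IH (hol n); rewrite /I /= (WS n) (HS n) !addrA => q1 q2 q3 IH hP.
  apply: quarter_bound => //; apply: le_trans IH.
  by rewrite exprS invfM mulrCA mulVKf.
have nest' (u v w w1 : R) : w = w1 + w1 -> u <= v <= u + w1 -> u <= v /\ v + w1 <= u + w.
  by clear => h /andP[h1 h2]; split; lra.
have [p hp] := @nested_limit (fun n => (P n).1) W (fun n => (andP (P1 n)).1) (fun n => (nest' _ _ _ _ (WS n) (P1 n)).2) W0.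
have [q hq] := @nested_limit (fun n => (P n).2) H (fun n => (andP (P2 n)).1) (fun n => (nest' _ _ _ _ (HS n) (P2 n)).2) H0.
pose D := (b - a) + (d - c); have D0 : 0 <= D by rewrite addr_ge0 // subr_ge0.
have sn n : inrect (P n).1 ((P n).1 + W n) (P n).2 ((P n).2 + H n) (p +i* q) by rewrite /inrect hp hq.
have [k hk] : holo f (p +i* q) by exact: hol (sn 0%N).
(* With this [e] one has [2 e D^2 < K]. At stage [n] the semiperimeter is [D / 2^n], so both the
   lower and the upper bound of the integral carry the factor [4^-n] and contradict each other. *)
have e0 : 0 < K / (4 * (D ^+ 2 + 1)) by rewrite divr_gt0 // mulr_gt0 // ltr_wpDl // sqr_ge0.
move/cderP : hk => /(_ _ e0) [r r0 hr].
have [n hn] := exp2_big (D / r).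
have E : W n + H n = D / 2 ^+ n by rewrite /W /H -mulrDl.
have Dn : W n + H n < r by rewrite E ltr_pdivrMr ?exprn_gt0 // mulrC -ltr_pdivrMr.
have := le_trans (IK n) (rect_affine_bound (W0 n) (H0 n) e0 (sn n) Dn (hol n) hr).
apply/negP; rewrite -ltNge E exprMn exprVn -exprM mulnC exprM mulrA (_ : 2 ^+ 2 = 4) -?natrX //.
by rewrite ltr_pM2r ?invr_gt0 ?exprn_gt0 //; exact: sqr_frac_lt.
Qed.

End Rectangles.

(** * A simple residue and Cauchy's formula on rectangles *)

Section Residues.
Variable R : realType.
Local Notation C := R[i].
Implicit Types (f g : C -> C) (z w s A : C) (a b c d x y t e r p q : R).

Lemma on_in a b c d z : onrect a b c d z -> inrect a b c d z.
Proof. by case/andP. Qed.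

(** The four rectangles around the small square avoid the singular point, so Goursat's theorem
    removes them. *)
Lemma rect_shrink f a b c d p q r : 0 < r ->
  a <= p - r -> p + r <= b -> c <= q - r -> q + r <= d ->
  (forall z, inrect a b c d z -> z != p +i* q -> holo f z) ->
  rect f a b c d = rect f (p - r) (p + r) (q - r) (q + r).
Proof.
move=> r0 h1 h2 h3 h4 hf.
have cx y x1 x2 : a <= x1 -> x1 <= x2 -> x2 <= b -> c <= y <= d -> y != q ->
    segcont (fun t => f (t +i* y)) x1 x2.
  move=> ? ? ? hy yq t; rewrite inseg_le // => /andP[? ?].
  apply: cont_x; apply: holo_ccont; apply: hf.
    by rewrite /inrect /= hy andbT; apply/andP; split; lra.
  by apply: contra_neq yq => -[].
have cy x y1 y2 : c <= y1 -> y1 <= y2 -> y2 <= d -> a <= x <= b -> x != p ->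
    segcont (fun t => f (x +i* t)) y1 y2.
  move=> ? ? ? hy yq t; rewrite inseg_le // => /andP[? ?].
  apply: cont_y; apply: holo_ccont; apply: hf.
    by rewrite /inrect /= hy /=; apply/andP; split; rlra 6.
  by apply: contra_neq yq => -[].
have G x1 x2 y1 y2 : a <= x1 -> x1 <= x2 -> x2 <= b -> c <= y1 -> y1 <= y2 -> y2 <= d ->
   (x2 < p) || (p < x1) || (y2 < q) || (q < y1) -> rect f x1 x2 y1 y2 = 0.
  move=> ? ? ? ? ? ? H; apply: goursat => // z /andP[/andP[? ?] /andP[? ?]]; apply: hf.
    by rewrite /inrect; apply/andP; split; apply/andP; split; rlra 10.
  apply/negP => /eqP zE; have zr : Re z = p by rewrite zE.
  have zi : Im z = q by rewrite zE.
  by move: H; rewrite -!orbA => /or4P[]; lra.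
rewrite (@rect_vsplit _ f a (p - r) b); first last.
- by apply: cx; lra.
- by apply: cx; ulra h2 h1 r0 h4 h3.
- by apply/andP; split; lra.
rewrite (@rect_vsplit _ f (p - r) (p + r) b); first last.
- by apply: cx; ulra h1 h2 r0 h4 h3.
- by apply: cx; ulra h1 h2 r0 h4 h3.
- by apply/andP; split; lra.
rewrite (G a (p - r)); [|ulra h1 h2 r0 h4 h3..|]; last by apply/orP; left; apply/orP; left; apply/orP; left; ulra r0.
rewrite (G (p + r) b); [|ulra h1 r0 h2 h4 h3..|]; last by apply/orP; left; apply/orP; left; apply/orP; right; ulra r0.
rewrite (@rect_hsplit _ f (p - r) (p + r) c (q - r) d); first last.
- by apply: cy; ulra h4 h3 r0 h2 h1.
- by apply: cy; ulra h4 h3 r0 h2 h1.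
- by apply/andP; split; lra.
rewrite (@rect_hsplit _ f (p - r) (p + r) (q - r) (q + r) d); first last.
- by apply: cy; ulra h3 h4 r0 h2 h1.
- by apply: cy; ulra h3 h4 r0 h2 h1.
- by apply/andP; split; lra.
rewrite (G (p - r) (p + r) c (q - r)); [|ulra h1 r0 h2 h3 h4..|]; last by apply/orP; left; apply/orP; right; ulra r0.
rewrite (G (p - r) (p + r) (q + r) d); [|ulra h1 r0 h2 h3 h4..|]; last by apply/orP; right; ulra r0.
by rewrite add0r addr0 add0r addr0.
Qed.

Definition twoipi : C := iC * (2 * pi)%:C.

(** On opposite sides of the square the integrands combine into multiples of
    [2 r / ((t - p)^2 + r^2)], whose primitive is [2 atan ((t - p) / r)]; each pair of sides
    contributes [i pi]. *)
Lemma rect_inv p q r : 0 < r ->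
  rect (fun z => (z - (p +i* q))^-1) (p - r) (p + r) (q - r) (q + r) = twoipi.
Proof.
move=> r0; have pr : p - r <= p + r by lra.
have qr : q - r <= q + r by lra.
have nz z : onrect (p - r) (p + r) (q - r) (q + r) z -> z - (p +i* q) != 0.
  move=> /andP[_ H]; apply: contraTneq H => /eqP; rewrite subr_eq0 => /eqP -> /=.
  by rewrite !negb_or; repeat (apply/andP; split); apply/eqP; lra.
have bc : bcont (fun z => (z - (p +i* q))^-1) (p - r) (p + r) (q - r) (q + r).
  move=> z /nz hz; apply: holo_ccont; apply: holoV => //.
  by apply: holoB; [exact: holo_id|exact: holo_cst].
have [c1 c2 c3 c4] := bcont_sides pr qr bc.
rewrite /rect -!cintB //.
have at' x0 t : rder (fun x => 2 * atan (- (x0 / r) + r^-1 * x)) t (2 * ((1 + (- (x0 / r) + r^-1 * t) ^+ 2)^-1 * r^-1)).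
  apply: rderZ; apply: (@rder_comp _ (@atan R) (fun x => - (x0 / r) + r^-1 * x)).
    exact: is_derive1_atan.
  exact: rder_aff.
have dE x0 t : 2 * ((1 + (- (x0 / r) + r^-1 * t) ^+ 2)^-1 * r^-1) = 2 * r / ((t - x0) ^+ 2 + r ^+ 2).
  have r2 : 0 < r ^+ 2 by rewrite exprn_gt0.
  have P : 0 <= (t - x0) ^+ 2 by rewrite sqr_ge0.
  have -> : - (x0 / r) + r^-1 * t = (t - x0) / r by ring.
  by field; do ?(apply/andP; split); apply: lt0r_neq0; ulra P r2 r0.
have sq u : 0 < u ^+ 2 + r ^+ 2 by rewrite ltr_wpDl ?sqr_ge0 // exprn_gt0.
rewrite (cintE (F := fun x => iC * (2 * atan (- (p / r) + r^-1 * x))%:C)); last first.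
  move=> t _; apply: rcder_eq (rcderZ iC (rcder_real (at' p t))).
  rewrite dE realC_M realC_V.
  have -> : t +i* (q - r) - (p +i* q) = (t - p)%:C - iC * r%:C by apply: Ceq; rewrite !ReImE; ring.
  have -> : t +i* (q + r) - (p +i* q) = (t - p)%:C + iC * r%:C by apply: Ceq; rewrite !ReImE; ring.
  have E : ((t - p)%:C - iC * r%:C) * ((t - p)%:C + iC * r%:C) = ((t - p) ^+ 2 + r ^+ 2)%:C.
    rewrite (realC_D ((t - p) ^+ 2)) !expr2 !realC_M.
    transitivity ((t - p)%:C * (t - p)%:C - (iC * iC) * (r%:C * r%:C)); first ring.
    by rewrite ii; ring.
  have : ((t - p) ^+ 2 + r ^+ 2)%:C != 0 :> C by rewrite realC_eq0 gt_eqF.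
  rewrite -E mulf_eq0 negb_or => /andP[n1 n2].
  rewrite (_ : (2 * r)%:C = 2 * r%:C); last by rewrite realC_M realC_nat.
  move: (t - p)%:C (iC : C) r%:C n1 n2 => u j v n1 n2.
  by field; rewrite n1 n2.
rewrite (cintE (F := fun y => (2 * atan (- (q / r) + r^-1 * y))%:C)); last first.
  move=> t _; apply: rcder_eq (rcder_real (at' q t)).
  rewrite dE realC_M realC_V.
  have -> : (p + r) +i* t - (p +i* q) = r%:C + iC * (t - q)%:C by apply: Ceq; rewrite !ReImE; ring.
  have -> : (p - r) +i* t - (p +i* q) = - (r%:C - iC * (t - q)%:C) by apply: Ceq; rewrite !ReImE; ring.
  have E : (r%:C - iC * (t - q)%:C) * (r%:C + iC * (t - q)%:C) = ((t - q) ^+ 2 + r ^+ 2)%:C.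
    rewrite (realC_D ((t - q) ^+ 2)) !expr2 !realC_M.
    transitivity (r%:C * r%:C - (iC * iC) * ((t - q)%:C * (t - q)%:C)); first ring.
    by rewrite ii; ring.
  have : ((t - q) ^+ 2 + r ^+ 2)%:C != 0 :> C by rewrite realC_eq0 gt_eqF.
  rewrite -E mulf_eq0 negb_or => /andP[n1 n2].
  rewrite (_ : (2 * r)%:C = 2 * r%:C); last by rewrite realC_M realC_nat.
  rewrite invrN opprK; move: (t - q)%:C (iC : C) r%:C n1 n2 => u j v n1 n2.
  by field; rewrite ?oppr_eq0 n1 n2.
have e1 u : - (u / r) + r^-1 * (u + r) = 1 by field; lra.
have e2 u : - (u / r) + r^-1 * (u - r) = - 1 by field; lra.
rewrite !e1 !e2 atanN atan1 /twoipi.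
rewrite -mulrBr -mulrDr -!realC_B -realC_D; by congr (_ * _%:C); field.
Qed.

Lemma twoipi_neq0 : twoipi != 0.
Proof.
rewrite /twoipi mulf_neq0 ?i_neq0 // realC_eq0 mulf_neq0 //; exact/lt0r_neq0/pi_gt0.
Qed.

(** Subtracting [A / (z - w)] leaves an integrand of size [e / (8 r)] on a boundary of length [8 r],
    for arbitrarily small squares. Only the limit of [(z - w) f z] enters. *)
Lemma residue f a b c d p q A : a < p < b -> c < q < d ->
  (forall z, inrect a b c d z -> z != p +i* q -> holo f z) ->
  (forall e, 0 < e -> exists2 r : R, 0 < r & forall z, z != p +i* q -> Nc (z - (p +i* q)) < r ->
      Nc ((z - (p +i* q)) * f z - A) <= e) ->
  rect f a b c d = twoipi * A.
Proof.
move=> /andP[ap pb] /andP[cq qd] hf lim.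
apply/eqP; rewrite -subr_eq0 -Nc_eq0 eq_le Nc_ge0 andbT.
apply/ler_addgt0Pr => e e0; rewrite add0r.
have [r1 r10 H] := lim _ (ltac:(by rewrite divr_gt0) : 0 < e / 8).
have [r [r0 rr ra [rb rc rd]]] : exists r, [/\ 0 < r, r <= r1 / 4, r <= p - a & [/\ r <= b - p, r <= q - c & r <= d - q]].
  exists (Num.min (r1 / 4) (Num.min (Num.min (p - a) (b - p)) (Num.min (q - c) (d - q)))).
  by rewrite !lt_min !ge_min !lexx !subr_gt0 ap pb cq qd divr_gt0 //= !orbT.
rewrite (@rect_shrink f a b c d p q r) //; try lra.
have pr : p - r <= p + r by lra.
have qr : q - r <= q + r by lra.
rewrite -(rect_inv p q r0) mulrC.
set w := p +i* q in hf H *.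
have nz z : onrect (p - r) (p + r) (q - r) (q + r) z -> [/\ z != w, Nc (z - w) < r1 & r <= Nc (z - w)].
  move=> /andP[/andP[/andP[i1 i2] /andP[i3 i4]] H'].
  have rN : r <= Nc (z - w).
    have : (r <= `|Re (z - w)|) || (r <= `|Im (z - w)|).
      rewrite !ReImE; case/or4P: H' => /eqP ->.
      - by apply/orP; left; rewrite ler_normr; apply/orP; right; rlra 0.
      - by apply/orP; left; rewrite ler_normr; apply/orP; left; rlra 0.
      - by apply/orP; right; rewrite ler_normr; apply/orP; right; rlra 0.
      - by apply/orP; right; rewrite ler_normr; apply/orP; left; rlra 0.
    by case/orP => h; apply: le_trans h _; [exact: Re_Nc|exact: Im_Nc].
  split => //.
    by apply: contraTneq rN => ->; rewrite subrr Nc0 -ltNge.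
  apply: le_lt_trans (Nc_le _) _; rewrite !ReImE.
  have : `|Re z - p| <= r by rewrite ler_norml; apply/andP; split; ulra i1 i2.
  have : `|Im z - q| <= r by rewrite ler_norml; apply/andP; split; ulra i3 i4.
  ulra rr r0.
have b1 : bcont f (p - r) (p + r) (q - r) (q + r).
  move=> z hz; have [n1 _ _] := nz _ hz; apply: holo_ccont; apply: hf => //.
  by move: hz => /andP[/andP[/andP[? ?] /andP[? ?]] _]; rewrite /inrect; apply/andP; split; apply/andP; split; rlra 10.
have b2 : bcont (fun z => (z - w)^-1) (p - r) (p + r) (q - r) (q + r).
  move=> z /nz[h _ _]; apply: holo_ccont; apply: holoV; first by rewrite subr_eq0.
  by apply: holoB; [exact: holo_id|exact: holo_cst].
have b3 : bcont (fun z => A * (z - w)^-1) (p - r) (p + r) (q - r) (q + r).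
  by move=> z hz; apply: ccontM; [exact: ccont_cst|exact: b2].
rewrite -rectZ // -rectB //.
have B := @rect_bound R (fun z => f z - A * (z - w)^-1) (p - r) (p + r) (q - r) (q + r) (e / 8 / r) pr qr.
apply: le_trans (B _ _) _.
- by move=> z hz; apply: ccontD; [exact: b1|apply: ccontN; exact: b3].
- move=> z /nz[n1 n2 n3]; have n1' : z - w != 0 by rewrite subr_eq0.
  have -> : f z - A / (z - w) = ((z - w) * f z - A) / (z - w) by field.
  rewrite NcM NcV ler_pdivrMr ?Nc_gt0 //; apply: le_trans (H _ n1 n2) _.
  have := ler_wpM2l (ltW (divr_gt0 (divr_gt0 e0 (ltr0Sn _ 7)) r0)) n3.
  by rewrite divfK // gt_eqF.
- rewrite le_eqVlt; apply/orP; left; apply/eqP; field; ulra r0.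
Qed.

Lemma cauchy_formula f a b c d w : a < Re w < b -> c < Im w < d ->
  (forall z, inrect a b c d z -> holo f z) ->
  rect (fun z => f z / (z - w)) a b c d = twoipi * f w.
Proof.
move=> h1 h2 hf; have wE : w = Re w +i* Im w by case: (w).
apply: (@residue _ _ _ _ _ (Re w) (Im w)) => //.
  rewrite -wE => z hz zw; apply: holoM; first exact: hf.
  apply: holoV; first by rewrite subr_eq0.
  by apply: holoB; [exact: holo_id|exact: holo_cst].
rewrite -wE => e e0.
have /andP[/ltW a1 /ltW a2] := h1; have /andP[/ltW a3 /ltW a4] := h2.
have [r r0 H] := holo_ccont (hf w (ltac:(by rewrite /inrect a1 a2 a3 a4))) e0.
exists r => // z zw zr; have zw' : z - w != 0 by rewrite subr_eq0.
have -> : (z - w) * (f z / (z - w)) - f w = f z - f w by field.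
exact/ltW/H.
Qed.

Lemma cauchy_bound f a b c d w (M D : R) : a < Re w < b -> c < Im w < d ->
  (forall z, inrect a b c d z -> holo f z) -> 0 < D ->
  (forall z, onrect a b c d z -> Nc (f z) <= M) ->
  (forall z, onrect a b c d z -> D <= Nc (z - w)) ->
  Nc (f w) <= M / D * ((b - a) + (d - c)).
Proof.
move=> h1 h2 hf D0 HM HD.
have /andP[a1 a2] := h1; have /andP[a3 a4] := h2.
have ab : a <= b by lra. have cd : c <= d by lra.
have nz z : onrect a b c d z -> z - w != 0.
  by move=> /HD h; rewrite -Nc_gt0; apply: lt_le_trans h.
have B := @rect_bound R (fun z => f z / (z - w)) a b c d (M / D) ab cd.
have E := cauchy_formula h1 h2 hf; rewrite E NcM in B.
have M0 : 0 <= M.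
  have h : onrect a b c d (a +i* c) by rewrite /onrect /inrect /= ab cd !lexx eqxx.
  exact: le_trans (Nc_ge0 _) (HM _ h).
have : Nc twoipi * Nc (f w) <= M / D * (2 * (b - a + (d - c))).
  apply: B.
    move=> z hz; apply: holo_ccont; apply: holoM; first exact/hf/on_in.
    apply: holoV; first exact: nz.
    by apply: holoB; [exact: holo_id|exact: holo_cst].
  move=> z hz; rewrite NcM NcV; apply: ler_pM; rewrite ?Nc_ge0 ?invr_ge0 ?Nc_ge0 //; first exact: HM.
  by rewrite lef_pV2 ?posrE ?Nc_gt0 ?nz //; exact: HD.
rewrite /twoipi NcM Nc_i mul1r Nc_real ger0_norm; last by rewrite mulr_ge0 // pi_ge0.
have p2 : 1 <= pi :> R by have := pi_ge2 R; rlra 0.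
move=> H; have : 2 * Nc (f w) <= M / D * (2 * (b - a + (d - c))).
  apply: le_trans H; apply: ler_wpM2r; [exact: Nc_ge0|ulra p2].
rlra 0.
Qed.

End Residues.

(** * Cauchy transforms: higher differentiability and uniform limits *)

Section HolomorphicTheory.
Variable R : realType.
Local Notation C := R[i].
Implicit Types (f g : C -> C) (z w s : C) (a b c d x y t e r p q : R).

Lemma geom_small (q : R) : 0 <= q < 1 -> forall K e : R, 0 < e -> exists n, K * q ^+ n <= e.
Proof.
move=> /andP[q0 q1] K e e0.
have : (fun n => q ^+ n) @ \oo --> (0 : R) by apply: cvg_expr; rewrite ger0_norm.
have K1 : 0 < `|K| + 1 by rewrite ltr_wpDl.
move=> /cvgrPdist_le /(_ (e / (`|K| + 1)) (divr_gt0 e0 K1)) [n _ /(_ n (leqnn n))].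
rewrite /= sub0r normrN ger0_norm ?exprn_ge0 // ler_pdivlMr // => h; exists n.
apply: le_trans h; rewrite mulrC; apply: ler_wpM2l; first exact: exprn_ge0.
by have := ler_norm K; lra.
Qed.

(** Differentiation under the integral sign, from a remainder of the kernel that is quadratic in
    [w' - w], uniformly on the boundary. *)
Lemma rect_param g (K K' : C -> C -> C) a b c d w (M r : R) : a <= b -> c <= d -> 0 < r -> 0 <= M ->
  bcont g a b c d ->
  (forall w', Nc (w' - w) < r -> forall z, onrect a b c d z -> ccont (fun u => K u w') z) ->
  (forall z, onrect a b c d z -> ccont (fun u => K' u w) z) ->
  (forall w' z, Nc (w' - w) < r -> onrect a b c d z ->
     Nc (g z * (K z w' - K z w - K' z w * (w' - w))) <= M * Nc (w' - w) ^+ 2) ->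
  cder (fun w => rect (fun z => g z * K z w) a b c d) w (rect (fun z => g z * K' z w) a b c d).
Proof.
move=> ab cd r0 M0 cg cK cK' H; apply/cderP => e e0.
pose P := 2 * ((b - a) + (d - c)).
have P0 : 0 <= P by rewrite /P; lra.
pose m := M * P + 1; have m0 : 0 < m by rewrite /m ltr_wpDl // mulr_ge0.
exists (Num.min r (e / m)); first by rewrite lt_min r0 divr_gt0.
move=> w'; rewrite lt_min => /andP[h1 h2].
have kw : forall z, onrect a b c d z -> ccont (fun u => K u w) z by apply: cK; rewrite subrr Nc0.
have b1 : bcont (fun z => g z * K z w') a b c d by move=> z hz; apply: ccontM; [exact: cg|exact: cK].
have b2 : bcont (fun z => g z * K z w) a b c d by move=> z hz; apply: ccontM; [exact: cg|exact: kw].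
have b3 : bcont (fun z => g z * K' z w) a b c d by move=> z hz; apply: ccontM; [exact: cg|exact: cK'].
have b4 : bcont (fun z => (w' - w) * (g z * K' z w)) a b c d.
  by move=> z hz; apply: ccontM; [exact: ccont_cst|exact: b3].
have b5 : bcont (fun z => g z * K z w' - g z * K z w) a b c d.
  by move=> z hz; apply: ccontD; [exact: b1|apply: ccontN; exact: b2].
rewrite -rectB // [_ * (w' - w)]mulrC -rectZ // -rectB //.
apply: le_trans (@rect_bound R _ a b c d (M * Nc (w' - w) ^+ 2) ab cd _ _) _.
- by move=> z hz; apply: ccontD; [exact: b5|apply: ccontN; exact: b4].
- move=> z hz; apply: le_trans (H _ _ h1 hz); rewrite le_eqVlt; apply/orP; left; apply/eqP.
  by congr Nc; ring.
rewrite -/P (_ : M * Nc (w' - w) ^+ 2 * P = M * P * Nc (w' - w) * Nc (w' - w)); last ring.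
apply: ler_wpM2r; first exact: Nc_ge0.
 apply: (@le_trans _ _ (m * Nc (w' - w))).
  by apply: ler_wpM2r; [exact: Nc_ge0|rewrite /m lerDl].
by move: h2; rewrite ltr_pdivlMr // mulrC => /ltW.
Qed.

Definition insq w r z := (`|Re z - Re w| <= r) && (`|Im z - Im w| <= r).

Notation sqrect f w r := (rect f (Re w - r) (Re w + r) (Im w - r) (Im w + r)).
Notation onsq w r := (onrect (Re w - r) (Re w + r) (Im w - r) (Im w + r)).

Lemma insqE w r z : inrect (Re w - r) (Re w + r) (Im w - r) (Im w + r) z = insq w r z.
Proof. by rewrite /inrect /insq !ler_distl. Qed.

Lemma onsq_dist w r z : 0 <= r -> onsq w r z -> r <= Nc (z - w).
Proof.
move=> r0 /andP[_ H].
have : (r <= `|Re (z - w)|) || (r <= `|Im (z - w)|).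
  rewrite !ReImE; case/or4P: H => /eqP ->.
  - by apply/orP; left; rewrite addrAC subrr add0r normrN ler_norm.
  - by apply/orP; left; rewrite addrAC subrr add0r ler_norm.
  - by apply/orP; right; rewrite addrAC subrr add0r normrN ler_norm.
  - by apply/orP; right; rewrite addrAC subrr add0r ler_norm.
by case/orP => h; apply: le_trans h _; [exact: Re_Nc|exact: Im_Nc].
Qed.

Lemma insq_Nc w r z : Nc (z - w) <= r -> insq w r z.
Proof.
move=> h; rewrite /insq; apply/andP; split.
  by apply: le_trans h; apply: le_trans (Re_Nc _); rewrite !ReImE.
by apply: le_trans h; apply: le_trans (Im_Nc _); rewrite !ReImE.
Qed.

Lemma onsq_in w r z : onsq w r z -> insq w r z.
Proof. by move=> /on_in; rewrite insqE. Qed.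

Lemma sq_le w r : 0 <= r -> Re w - r <= Re w + r /\ Im w - r <= Im w + r.
Proof. by move=> ?; split; lra. Qed.

Lemma insq_Nc2 w r z : insq w r z -> Nc (z - w) <= 2 * r.
Proof.
move=> /andP[h1 h2]; apply: le_trans (Nc_le _) _; rewrite !ReImE.
by move: h1 h2 => ? ?; lra.
Qed.

Lemma bcont_bounded f w r : 0 <= r -> bcont f (Re w - r) (Re w + r) (Im w - r) (Im w + r) ->
  exists2 M : R, 0 < M & forall z, onsq w r z -> Nc (f z) <= M.
Proof.
move=> r0 cf; have [h1 h2] := sq_le w r0; have [c1 c2 c3 c4] := bcont_sides h1 h2 cf.
have [K1 K10 B1] := segcont_bounded c1; have [K2 K20 B2] := segcont_bounded c2.
have [K3 K30 B3] := segcont_bounded c3; have [K4 K40 B4] := segcont_bounded c4.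
exists (K1 + K2 + K3 + K4); first by rewrite !addr_gt0.
case=> u v /andP[/andP[/= hu hv]] /or4P[] /eqP E; rewrite E.
- by have := B4 v; rewrite inseg_le // => /(_ hv); ulra K30 K20 K10.
- by have := B3 v; rewrite inseg_le // => /(_ hv); ulra K40 K20 K10.
- by have := B1 u; rewrite inseg_le // => /(_ hu); ulra K40 K30 K20.
- by have := B2 u; rewrite inseg_le // => /(_ hu); ulra K40 K30 K10.
Qed.

Lemma quad1 (u h : C) (d : R) : 0 < d -> d <= Nc u -> Nc h < d / 2 ->
  Nc ((u - h)^-1 - u^-1 - (u ^+ 2)^-1 * h) <= 2 / d ^+ 3 * Nc h ^+ 2.
Proof.
move=> d0 du hd.
have uh : d / 2 <= Nc (u - h) by have := NcB_ge u h; lra.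
have u0 : u != 0 by rewrite -Nc_gt0; apply: lt_le_trans du.
have uh0 : u - h != 0 by rewrite -Nc_gt0; apply: lt_le_trans uh; rewrite divr_gt0.
have -> : (u - h)^-1 - u^-1 - (u ^+ 2)^-1 * h = h ^+ 2 / ((u - h) * u ^+ 2).
  by field; rewrite u0 uh0.
rewrite !(NcX, NcV, NcM) mulrC; apply: ler_wpM2r; first by rewrite exprn_ge0 // Nc_ge0.
rewrite -[2 / _]invf_div lef_pV2 ?posrE; first last.
- by rewrite divr_gt0 // exprn_gt0.
- by rewrite mulr_gt0 ?exprn_gt0 // Nc_gt0.
have -> : d ^+ 3 / 2 = d / 2 * d ^+ 2 by field.
apply: ler_pM => //; first by rewrite divr_ge0 // ltW.
  by rewrite exprn_ge0 // ltW.
by rewrite lerXn2r // nnegrE ?Nc_ge0 // ltW.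
Qed.

Lemma quad2 (u h : C) (d : R) : 0 < d -> d <= Nc u -> Nc h < d / 2 ->
  Nc (((u - h) ^+ 2)^-1 - (u ^+ 2)^-1 - (2 * (u ^+ 3)^-1) * h) <= 16 / d ^+ 4 * Nc h ^+ 2.
Proof.
move=> d0 du hd.
have u0 : u != 0 by rewrite -Nc_gt0; apply: lt_le_trans du.
have uh : Nc u / 2 <= Nc (u - h) by have := NcB_ge u h; lra.
have Nu : 0 < Nc u by rewrite Nc_gt0.
have uh0 : u - h != 0 by rewrite -Nc_gt0; apply: lt_le_trans uh; rewrite divr_gt0.
have -> : ((u - h) ^+ 2)^-1 - (u ^+ 2)^-1 - (2 * (u ^+ 3)^-1) * h = h ^+ 2 * (3 * u - 2 * h) / (u ^+ 3 * (u - h) ^+ 2).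
  by field; rewrite u0 uh0.
rewrite !(NcX, NcV, NcM) -mulrA mulrC; apply: ler_wpM2r; first by rewrite exprn_ge0 // Nc_ge0.
have num : Nc (3 * u - 2 * h) <= 4 * Nc u.
  apply: le_trans (NcB _ _) _; rewrite !NcM -!realC_nat !Nc_real !ger0_norm //; lra.
have den : Nc u ^+ 5 / 4 <= Nc u ^+ 3 * Nc (u - h) ^+ 2.
  have -> : Nc u ^+ 5 / 4 = Nc u ^+ 3 * (Nc u / 2) ^+ 2 by field.
  apply: ler_wpM2l; first by rewrite exprn_ge0 // Nc_ge0.
  by rewrite lerXn2r // nnegrE ?Nc_ge0 // divr_ge0 // Nc_ge0.
have den0 : 0 < Nc u ^+ 5 / 4 by rewrite divr_gt0 // exprn_gt0.
rewrite ler_pdivrMr; last exact: lt_le_trans den.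
apply: le_trans num _; apply: (@le_trans _ _ (16 / d ^+ 4 * (Nc u ^+ 5 / 4))); last first.
  by apply: ler_wpM2l den; rewrite divr_ge0 // exprn_ge0 // ltW.
have -> : 16 / d ^+ 4 * (Nc u ^+ 5 / 4) = 4 * Nc u * (Nc u ^+ 4 / d ^+ 4) by field; lra.
rewrite ler_peMr //; first by rewrite mulr_ge0 // Nc_ge0.
by rewrite ler_pdivlMr ?exprn_gt0 // mul1r lerXn2r // nnegrE ?Nc_ge0 // ltW.
Qed.

Lemma ccont_subV w z n : z != w -> ccont (fun u => ((u - w) ^+ n)^-1) z.
Proof.
move=> zw; apply: holo_ccont; apply: holoV; first by rewrite expf_neq0 // subr_eq0.
by apply: holoX; apply: holoB; [exact: holo_id|exact: holo_cst].
Qed.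

Lemma cauchy_transform g w r : 0 < r -> bcont g (Re w - r) (Re w + r) (Im w - r) (Im w + r) ->
  cder (fun w' => sqrect (fun z => g z * (z - w')^-1) w r) w (sqrect (fun z => g z * ((z - w) ^+ 2)^-1) w r) /\
  cder (fun w' => sqrect (fun z => g z * ((z - w') ^+ 2)^-1) w r) w (sqrect (fun z => g z * (2 * ((z - w) ^+ 3)^-1)) w r).
Proof.
move=> r0 cg; have [h1 h2] := sq_le w (ltW r0).
have [M M0 HM] := bcont_bounded (ltW r0) cg.
have nw w' z : Nc (w' - w) < r / 2 -> onsq w r z -> z != w'.
  move=> hw /(onsq_dist (ltW r0)) hz; apply: contraTneq hz => ->; rewrite -ltNge.
  by apply: lt_trans hw _; lra.
have r2 : 0 < r / 2 by rewrite divr_gt0.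
split.
- apply: (@rect_param g (fun z w' => (z - w')^-1) (fun z w' => ((z - w') ^+ 2)^-1) _ _ _ _ w (M * (2 / r ^+ 3)) (r / 2)) => //.
  + by rewrite mulr_ge0 ?divr_ge0 ?exprn_ge0 // ltW.
  + move=> w' hw z /(nw _ _ hw) zw; have := @ccont_subV w' z 1 zw.
    by apply: (@ccont_loc _ _ _ _ 1) => // u _; rewrite expr1.
  + by move=> z hz; apply: ccont_subV; apply: nw hz; rewrite subrr Nc0.
  + move=> w' z hw hz; rewrite NcM -mulrA; apply: ler_pM; rewrite ?Nc_ge0 //; first exact: HM.
    have := @quad1 (z - w) (w' - w) r r0 (onsq_dist (ltW r0) hz) hw.
    by have -> : z - w - (w' - w) = z - w' by ring.
- apply: (@rect_param g (fun z w' => ((z - w') ^+ 2)^-1) (fun z w' => 2 * ((z - w') ^+ 3)^-1) _ _ _ _ w (M * (16 / r ^+ 4)) (r / 2)) => //.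
  + by rewrite mulr_ge0 ?divr_ge0 ?exprn_ge0 // ltW.
  + by move=> w' hw z /(nw _ _ hw) zw; apply: ccont_subV.
  + move=> z hz; apply: ccontM; first exact: ccont_cst.
    by apply: ccont_subV; apply: nw hz; rewrite subrr Nc0.
  + move=> w' z hw hz; rewrite NcM -mulrA; apply: ler_pM; rewrite ?Nc_ge0 //; first exact: HM.
    have := @quad2 (z - w) (w' - w) r r0 (onsq_dist (ltW r0) hz) hw.
    by have -> : z - w - (w' - w) = z - w' by ring.
Qed.

Lemma cder_uniq f s (d1 d2 : C) : cder f s d1 -> cder f s d2 -> d1 = d2.
Proof.
move=> h1 h2; apply/eqP; rewrite -subr_eq0 -Nc_eq0 eq_le Nc_ge0 andbT.
apply/ler_addgt0Pr => e e0; rewrite add0r.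
move/cderP: (cderB h1 h2) => /(_ _ e0)[r r0 H].
have := H (s + (r / 2)%:C); rewrite !subrr sub0r NcN [s + _]addrC addrK NcM Nc_real.
rewrite ger0_norm; last by rewrite divr_ge0 // ltW.
have r2 : 0 < r / 2 by rewrite divr_gt0.
by rewrite ler_pM2r //; apply; lra.
Qed.

Definition cD f z : C := xget 0 (fun d : C => cder f z d).

Lemma cDP f z : holo f z -> cder f z (cD f z).
Proof. by move=> [d hd]; rewrite /cD; apply: (xgetI 0 hd). Qed.

Lemma cDE f z (d : C) : cder f z d -> cD f z = d.
Proof. by move=> h; apply: (cder_uniq _ h); apply: cDP; exists d. Qed.

Lemma cauchy_sq f w r w' : 0 < r -> Nc (w' - w) < r -> (forall z, insq w r z -> holo f z) ->
  sqrect (fun z => f z * (z - w')^-1) w r = twoipi R * f w'.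
Proof.
move=> r0 hw hf.
have := Re_Nc (w' - w); have := Im_Nc (w' - w); rewrite !ReImE !ler_norml => /andP[? ?] /andP[? ?].
by apply: cauchy_formula; [apply/andP; split; rlra 5..|move=> z; rewrite insqE; exact: hf].
Qed.

(** Near [w] the derivative of [f] is itself a boundary integral, with kernel [(z - w')^-2], and can
    be differentiated once more under the integral sign. *)
Lemma holo_cD f w r : 0 < r -> (forall z, insq w r z -> holo f z) -> holo (cD f) w.
Proof.
move=> r0 hf.
have bc w' r' : 0 < r' -> (forall z, insq w' r' z -> holo f z) -> bcont f (Re w' - r') (Re w' + r') (Im w' - r') (Im w' + r').
  by move=> r'0 h z /onsq_in hz; apply: holo_ccont; apply: h.
have cD' w' : Nc (w' - w) < r / 2 ->
   cD f w' = (twoipi R)^-1 * sqrect (fun z => f z * ((z - w') ^+ 2)^-1) w r.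
  move=> hw; apply: cDE.
  have r2 : 0 < r / 2 by rewrite divr_gt0.
  have [h1 h2] := sq_le w (ltW r0).
  have [M M0 HM] := bcont_bounded (ltW r0) (bc _ _ r0 hf).
  have nw u z : Nc (u - w) < r -> onsq w r z -> z != u.
    move=> hu /(onsq_dist (ltW r0)) hz; apply: contraTneq hz => ->; rewrite -ltNge //.
  pose d := r - Nc (w' - w); have d0 : 0 < d by rewrite /d; lra.
  have near' u : Nc (u - w') < d / 2 -> Nc (u - w) < r.
    move=> hu; have -> : u - w = (u - w') + (w' - w) by ring.
    apply: le_lt_trans (NcD _ _) _; rewrite /d in hu d0; lra.
  have D : cder (fun w' => sqrect (fun z => f z * (z - w')^-1) w r) w' (sqrect (fun z => f z * ((z - w') ^+ 2)^-1) w r).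
    apply: (@rect_param f (fun z w' => (z - w')^-1) (fun z w' => ((z - w') ^+ 2)^-1) _ _ _ _ w' (M * (2 / d ^+ 3)) (d / 2)) => //.
    - by rewrite divr_gt0.
    - by rewrite mulr_ge0 ?divr_ge0 ?exprn_ge0 // ltW.
    - exact: bc.
    - move=> u hu z hz; have := @ccont_subV u z 1 (nw _ _ (near' _ hu) hz).
      by apply: (@ccont_loc _ _ _ _ 1) => // v _; rewrite expr1.
    - by move=> z hz; apply: ccont_subV; apply: nw hz; lra.
    - move=> u z hu hz; rewrite NcM -mulrA; apply: ler_pM; rewrite ?Nc_ge0 //; first exact: HM.
      have hd : d <= Nc (z - w').
        have := onsq_dist (ltW r0) hz; have := NcD (z - w') (w' - w).
        have -> : z - w' + (w' - w) = z - w by ring.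
        by rewrite /d; rlra 0.
      have := @quad1 (z - w') (u - w') d d0 hd hu.
      by have -> : z - w' - (u - w') = z - u by ring.
  apply: (@cder_loc _ (fun u => (twoipi R)^-1 * sqrect (fun z => f z * (z - u)^-1) w r) _ _ _ (d / 2)); first by rewrite divr_gt0.
    by move=> u /near' hu; rewrite cauchy_sq // mulKf // twoipi_neq0.
  exact: cderZ.
have r2 : 0 < r / 2 by rewrite divr_gt0.
apply: (@holo_loc _ (fun w' => (twoipi R)^-1 * sqrect (fun z => f z * ((z - w') ^+ 2)^-1) w r) _ _ (r / 2)) => //.
  by move=> w' /cD' ->.
apply: holoM; first exact: holo_cst.
by eexists; exact: (cauchy_transform r0 (bc _ _ r0 hf)).2.
Qed.

(** The limit inherits Cauchy's formula, hence is the Cauchy transform of a continuous function. The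
    formula is used on the square of half-side [r / 2], whose points have a neighbourhood on which
    the convergence is uniform, so that [f] is continuous there. *)
Lemma weierstrass (F : nat -> C -> C) f w r : 0 < r ->
  (forall n z, insq w r z -> holo (F n) z) ->
  (forall e, 0 < e -> exists n : nat, forall z, insq w r z -> Nc (F n z - f z) <= e) ->
  holo f w.
Proof.
move=> r0 hF lim.
have r2 : 0 < r / 2 by rewrite divr_gt0.
have cf z : insq w (r / 2) z -> ccont f z.
  move=> hz e e0; have [n Hn] := lim _ (ltac:(by rewrite divr_gt0) : 0 < e / 4).
  have hz' u : Nc (u - z) < r / 2 -> insq w r u.
    move=> hu; have /andP[a1 a2] := insq_Nc (ltW hu); move: hz => /andP[].
    move: a1 a2; rewrite /insq !ler_norml => /andP[? ?] /andP[? ?] /andP[? ?] /andP[? ?].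
    by apply/andP; split; apply/andP; split; rlra 8.
  have hzz : insq w r z by apply: hz'; rewrite subrr Nc0.
  have [d d0 hd] := holo_ccont (hF n z hzz) (ltac:(by rewrite divr_gt0) : 0 < e / 4).
  exists (Num.min d (r / 2)); first by rewrite lt_min d0.
  move=> u; rewrite lt_min => /andP[/hd u1 /hz' /Hn u2].
  have u3 := Hn z hzz.
  have -> : f u - f z = - (F n u - f u) + (F n u - F n z) + (F n z - f z) by ring.
  apply: le_lt_trans (NcD _ _) _; apply: le_lt_trans (lerD (NcD _ _) (lexx _)) _.
  by rewrite NcN; lra.
have bc : bcont f (Re w - r / 2) (Re w + r / 2) (Im w - r / 2) (Im w + r / 2).
  by move=> z /onsq_in; exact: cf.
have insub z : insq w (r / 2) z -> insq w r z.
  by move=> /andP[? ?]; rewrite /insq; apply/andP; split; lra.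
have [h1 h2] := sq_le w (ltW r2).
apply: (@holo_loc _ (fun w' => (twoipi R)^-1 * sqrect (fun z => f z * (z - w')^-1) w (r / 2)) _ _ (r / 4)).
- by rewrite divr_gt0.
- move=> w' hw; apply/eqP; rewrite -subr_eq0 -Nc_eq0 eq_le Nc_ge0 andbT.
  apply/ler_addgt0Pr => e e0; rewrite add0r.
  pose e1 := e / 64; have e10 : 0 < e1 by rewrite divr_gt0.
  have [n Hn] := lim _ e10.
  have hFn z : insq w (r / 2) z -> holo (F n) z by move=> /insub; exact: hF.
  have E := @cauchy_sq (F n) w (r / 2) w' r2 (ltac:(lra)) hFn.
  have nw z : onsq w (r / 2) z -> r / 4 <= Nc (z - w') /\ z - w' != 0.
    move=> /(onsq_dist (ltW r2)) hz; have A : r / 4 <= Nc (z - w').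
      have := NcD (z - w') (w' - w); have -> : z - w' + (w' - w) = z - w by ring.
      by ulra hz hw.
    by split => //; rewrite -Nc_gt0; apply: lt_le_trans A; rewrite divr_gt0.
  have ck z : onsq w (r / 2) z -> ccont (fun z => (z - w')^-1) z.
    move=> /nw[_ hz]; apply: holo_ccont; apply: holoV => //.
    by apply: holoB; [exact: holo_id|exact: holo_cst].
  have b1 : bcont (fun z => f z * (z - w')^-1) (Re w - r / 2) (Re w + r / 2) (Im w - r / 2) (Im w + r / 2).
    by move=> z hz; apply: ccontM; [exact: bc|exact: ck].
  have b2 : bcont (fun z => F n z * (z - w')^-1) (Re w - r / 2) (Re w + r / 2) (Im w - r / 2) (Im w + r / 2).
    move=> z hz; apply: ccontM; last exact: ck.
    by apply: holo_ccont; apply: hFn; exact: onsq_in.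
  have := @rect_bound R (fun z => f z * (z - w')^-1 - F n z * (z - w')^-1) _ _ _ _ (e1 * (4 / r)) h1 h2.
  rewrite rectB // E => B.
  have B' : Nc (sqrect (fun z => f z / (z - w')) w (r / 2) - twoipi R * F n w') <= 16 * e1.
    apply: le_trans (B _ _) _.
    - by move=> z hz; apply: ccontD; [exact: b1|apply: ccontN; exact: b2].
    - move=> z hz; rewrite -mulrBl NcM NcV (NcBC (f z)); apply: ler_pM; rewrite ?Nc_ge0 ?invr_ge0 ?Nc_ge0 //.
        by apply: Hn; apply: insub; exact: onsq_in.
      have [z1 z2] := nw _ hz.
      by rewrite -[4 / r]invf_div lef_pV2 ?posrE ?Nc_gt0 // divr_gt0.
    - rewrite le_eqVlt; apply/orP; left; apply/eqP; field; lra.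
  have hw' : insq w r w' by apply: insq_Nc; ulra hw h2.
  have -> : (twoipi R)^-1 * sqrect (fun z => f z / (z - w')) w (r / 2) - f w' =
     (twoipi R)^-1 * (sqrect (fun z => f z / (z - w')) w (r / 2) - twoipi R * F n w') + (F n w' - f w').
    by field; exact: twoipi_neq0.
  apply: le_trans (NcD _ _) _; rewrite NcM NcV.
  have N2 : 1 <= Nc (twoipi R).
    rewrite /twoipi NcM Nc_i mul1r Nc_real ger0_norm; last by rewrite mulr_ge0 // pi_ge0.
    by have := pi_ge2 R; rlra 0.
  have i1 : (Nc (twoipi R))^-1 <= 1 by rewrite invf_le1 //; ulra N2.
  have i0 : 0 <= (Nc (twoipi R))^-1 by rewrite invr_ge0 Nc_ge0.
  have := ler_pM i0 (Nc_ge0 _) i1 B'; rewrite mul1r.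
  by have := Hn _ hw'; rewrite /e1; ulra e0.
- apply: holoM; first exact: holo_cst.
  by eexists; exact: (cauchy_transform r2 bc).1.
Qed.

End HolomorphicTheory.
Notation sqrect f w r := (rect f (Re w - r) (Re w + r) (Im w - r) (Im w + r)).
Notation onsq w r := (onrect (Re w - r) (Re w + r) (Im w - r) (Im w + r)).

(** * Primitives and logarithms on vertical strips; the identity theorem *)

Section Primitives.
Variable R : realType.
Local Notation C := R[i].
Implicit Types (f g : C -> C) (z w s : C) (a b c d x y t e r p q : R) (P : R -> Prop).

Lemma chasles3 (F : R -> C) a b c : segcont F a b -> segcont F b c ->
  cint F a b + cint F b c = cint F a c.
Proof.
move=> h1 h2.
suff [d [e [h [ha [hb hc]]]]] : exists d e, segcont F d e /\ inseg d e a /\ inseg d e b /\ inseg d e c.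
  exact: cint_chasles h ha hb hc.
exists (Num.min a (Num.min b c)), (Num.max a (Num.max b c)).
split; last first.
  have le : Num.min a (Num.min b c) <= Num.max a (Num.max b c) by rewrite ge_min le_max lexx.
  by rewrite !inseg_le // !ge_min !le_max !lexx !orbT.
have le : Num.min a (Num.min b c) <= Num.max a (Num.max b c) by rewrite ge_min le_max lexx.
move=> t; rewrite inseg_le // !ge_min !le_max => /andP[A B].
have : inseg a b t || inseg b c t.
  rewrite /inseg; case: (leP t b) => h.
    case/or3P: A => A1; rewrite ?A1 ?orbT //.
    by rewrite (le_anti (introT andP (conj h A1))) andbT orbA le_total.
  case/or3P: B => B1; rewrite ?B1 ?(ltW h) ?orbT //.
  by move: B1; rewrite leNgt h.
by case/orP; [apply: h1|apply: h2].
Qed.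

Lemma rect_flipx f a b c d : rect f b a c d = - rect f a b c d.
Proof. by rewrite /rect (cintNn (fun x => f (x +i* c)) a b) (cintNn (fun x => f (x +i* d)) a b); ring. Qed.
Lemma rect_flipy f a b c d : rect f a b d c = - rect f a b c d.
Proof. by rewrite /rect (cintNn (fun y => f (b +i* y)) c d) (cintNn (fun y => f (a +i* y)) c d); ring. Qed.

Lemma goursat_or f a b c d : (forall z, inseg a b (Re z) -> inseg c d (Im z) -> holo f z) ->
  rect f a b c d = 0.
Proof.
wlog ab : a b / a <= b.
  move=> H h; have [ab|/ltW ba] := leP a b; first exact: H.
  by rewrite rect_flipx H ?oppr0 // => z; rewrite insegC; apply: h.
wlog cd : c d / c <= d.
  move=> H h; have [cd|/ltW dc] := leP c d; first exact: H.
  by rewrite rect_flipy H ?oppr0 // => z h1; rewrite insegC; apply: h.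
by move=> h; apply: goursat => // z /andP[? ?]; apply: h; rewrite inseg_le.
Qed.

(** An open interval of abscissas, given as a predicate: half-planes and the whole plane are treated
    alike, and all of them are simply connected. *)
Definition strip P := (forall x y t, P x -> P y -> inseg x y t -> P t) /\
  (forall x, P x -> exists2 r : R, 0 < r & forall y, `|y - x| < r -> P y).

Lemma strip_gt a : strip (fun x => a < x).
Proof.
split=> [x y t hx hy|x hx].
  by rewrite /inseg => /orP[]/andP[? ?]; lra.
by exists (x - a); rewrite ?subr_gt0 // => y; rewrite ltr_distl => /andP[? ?]; lra.
Qed.

Lemma strip_all : strip (fun=> True). Proof. by split=> // x _; exists 1. Qed.

Lemma strip_sq P w : strip P -> P (Re w) ->
  exists2 r : R, 0 < r & forall z, insq w r z -> P (Re z).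
Proof.
move=> [_ h] /h[r r0 H]; exists (r / 2); first by rewrite divr_gt0.
by move=> z /andP[h1 _]; apply: H; apply: le_lt_trans h1 _; lra.
Qed.

(** The primitive is the integral along a horizontal and then a vertical segment. Goursat's theorem
    moves the horizontal increment up to the height of [z], so that increments of [F] involve only
    values of [f] near [z]. *)
Lemma prim_strip P f x0 y0 : strip P -> P x0 -> (forall z, P (Re z) -> holo f z) ->
  exists F, F (x0 +i* y0) = 0 /\ forall z, P (Re z) -> cder F z (f z).
Proof.
move=> sP P0 hf; have [convP _] := sP.
pose F z := cint (fun t => f (t +i* y0)) x0 (Re z) +
  iC * cint (fun t => f (Re z +i* t)) y0 (Im z).
exists F; split.
  have E (G : R -> C) a : cint G a a = 0.
    by have /eqP := cintNn G a a; rewrite -addr_eq0 -mulr2n mulrn_eq0 => /eqP.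
  by rewrite /F /= !E mulr0 addr0.
move=> z Pz; have [r r0 Hr] := strip_sq sP Pz.
have cx y a b : P a -> P b -> segcont (fun t => f (t +i* y)) a b.
  by move=> Pa Pb t /(convP _ _ _ Pa Pb) Pt; apply: cont_x; apply: holo_ccont; apply: hf.
have cy x a b : P x -> segcont (fun t => f (x +i* t)) a b.
  by move=> Px t _; apply: cont_y; apply: holo_ccont; apply: hf.
apply/cderP => e e0; have e2 : 0 < e / 2 by rewrite divr_gt0.
have [d d0 Hd] := holo_ccont (hf z Pz) e2.
exists (Num.min r (d / 2)); first by rewrite lt_min r0 divr_gt0.
move=> z'; rewrite lt_min => /andP[h1 h2].
have Pz' : P (Re z') by apply: Hr; apply: insq_Nc; exact: ltW.
set x := Re z in Pz *; set y := Im z; set x' := Re z' in Pz' *; set y' := Im z'.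
have R0 : rect f x x' y0 y = 0.
  by apply: goursat_or => u hu _; apply: hf; apply: convP hu.
have E : F z' - F z = cint (fun t => f (t +i* y)) x x' + iC * cint (fun t => f (x' +i* t)) y y'.
  rewrite /F -/x -/y -/x' -/y'.
  rewrite -(@chasles3 (fun t => f (t +i* y0)) x0 x x'); [|exact: cx|exact: cx].
  rewrite -(@chasles3 (fun t => f (x' +i* t)) y0 y y'); [|exact: cy|exact: cy].
  move: R0; rewrite /rect => /eqP; rewrite addr_eq0 => /eqP R0.
  transitivity (cint (fun t => f (t +i* y)) x x' + iC * cint (fun t => f (x' +i* t)) y y' +
    ((cint (fun t => f (t +i* y0)) x x' - cint (fun t => f (t +i* y)) x x') +
     iC * (cint (fun y1 => f (x' +i* y1)) y0 y - cint (fun y1 => f (x +i* y1)) y0 y))); first ring.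
  by rewrite R0; ring.
have K0 (k : C) a b : cint (fun=> k) a b = k * (b - a)%:C.
  rewrite (cintE (F := fun t => t%:C * k)); first by rewrite realC_B; ring.
  move=> t _; apply: rcder_eq (rcderM (rcder_real (rder_id t)) (rcder_cst k t)).
  by rewrite mulr0 addr0 mul1r.
have sc (k : C) a b : segcont (fun=> k) a b by move=> t _; apply: rcder_cont (rcder_cst k t).
have -> : F z' - F z - f z * (z' - z) = cint (fun t => f (t +i* y) - f z) x x' + iC * cint (fun t => f (x' +i* t) - f z) y y'.
  rewrite E !cintB ?K0 //; [|exact: cy|exact: cx].
  have -> : z' - z = (x' - x)%:C + iC * (y' - y)%:C.
    by rewrite /x /x' /y /y'; apply: Ceq; rewrite !ReImE; ring.
  by ring.
have nx := Re_Nc (z' - z); have ny := Im_Nc (z' - z); rewrite !ReImE -/x -/x' -/y -/y' in nx ny.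
have near' u : inseg x x' (Re u) -> inseg y y' (Im u) -> Nc (u - z) < d.
  move=> hu hv; apply: le_lt_trans (Nc_le _) _; rewrite !ReImE -/x -/y.
  suff : `|Re u - x| <= `|x' - x| /\ `|Im u - y| <= `|y' - y| by move=> [? ?]; rlra 6.
  move: hu hv; rewrite /inseg => hu hv; split.
    case/orP: hu => /andP[? ?]; [rewrite !ger0_norm|rewrite !ler0_norm]; rlra 2.
  case/orP: hv => /andP[? ?]; [rewrite !ger0_norm|rewrite !ler0_norm]; rlra 2.
have B1 : Nc (cint (fun t => f (t +i* y) - f z) x x') <= e / 2 * `|x' - x|.
  apply: cint_bound => t ht.
    have [c1 _] := (cx y x x' Pz Pz' t ht, tt).
    by apply: (@ccont_rccont _ (fun u => u - f z) (fun t => f (t +i* y))) => //; apply: holo_ccont; apply: holoB; [exact: holo_id|exact: holo_cst].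
  by apply/ltW/Hd/near' => //=; exact: insegl.
have B2 : Nc (cint (fun t => f (x' +i* t) - f z) y y') <= e / 2 * `|y' - y|.
  apply: cint_bound => t ht.
    have [c1 _] := (cy x' y y' Pz' t ht, tt).
    by apply: (@ccont_rccont _ (fun u => u - f z) (fun t => f (x' +i* t))) => //; apply: holo_ccont; apply: holoB; [exact: holo_id|exact: holo_cst].
  by apply/ltW/Hd/near' => //=; exact: insegr.
apply: le_trans (NcD _ _) _; rewrite NcM Nc_i mul1r.
apply: le_trans (lerD B1 B2) _; rewrite -mulrDr.
apply: (@le_trans _ _ (e / 2 * (2 * Nc (z' - z)))); first by apply: ler_wpM2l; [exact: ltW|ulra ny nx].
by rewrite mulrA divfK.
Qed.

Lemma strip_const P f z1 z2 : strip P -> P (Re z1) -> P (Re z2) ->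
  (forall z, P (Re z) -> cder f z 0) -> f z1 = f z2.
Proof.
move=> [convP _]; case: z1 z2 => [a b] [c d] /= Pa Pc h.
have E1 : f (a +i* b) = f (c +i* b).
  apply/eqP; rewrite -subr_eq0 -Nc_eq0 eq_le Nc_ge0 andbT -(mul0r `|a - c|).
  apply: (@mvt_bound _ (fun t => f (t +i* b)) (fun=> 0)) => t ht; last by rewrite Nc0.
  by apply: cder_x; apply: h; apply: convP ht.
rewrite E1; apply/eqP; rewrite -subr_eq0 -Nc_eq0 eq_le Nc_ge0 andbT -(mul0r `|b - d|).
apply: (@mvt_bound _ (fun t => f (c +i* t)) (fun=> 0)) => t ht; last by rewrite Nc0.
by apply: rcder_eq (cder_y (d := 0) _); [rewrite mul0r|apply: h].
Qed.

(** [L] is the primitive of the logarithmic derivative of [g]; the product [g exp(-L)] has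
    derivative 0 and value 1 at [z0]. *)
Lemma log_exists P g z0 : strip P -> P (Re z0) -> g z0 = 1 ->
  (forall z, P (Re z) -> holo g z /\ g z != 0) ->
  exists L : C -> C, [/\ L z0 = 0, forall z, P (Re z) -> cexp (L z) = g z
    & forall z, P (Re z) -> cder L z (cD g z / g z)].
Proof.
move=> sP P0 g1 H.
have hq z : P (Re z) -> holo (fun u => cD g u / g u) z.
  move=> Pz; have [hz nz] := H _ Pz; apply: holoM; last exact: holoV.
  have [r r0 Hr] := strip_sq sP Pz; apply: (@holo_cD _ g z r) => // u /Hr Pu.
  by have [] := H _ Pu.
have [L [L0 DL]] := @prim_strip P (fun u => cD g u / g u) (Re z0) (Im z0) sP P0 hq.
have E0 : Re z0 +i* Im z0 = z0 by case: (z0).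
exists L; split => //; first by rewrite -E0.
move=> z Pz.
have D u : P (Re u) -> cder (fun u => g u * cexp (- L u)) u 0.
  move=> Pu; have [hu nu] := H _ Pu.
  apply: cder_eq (cderM (cDP hu) (cder_comp (cderN (DL _ Pu)) (cexp_der _))).
  by field.
have := strip_const sP Pz P0 D; rewrite /= -[in L z0]E0 L0 oppr0 cexp0 mulr1 g1 => E.
by rewrite cexpN in E; rewrite -[LHS]mul1r -E divfK // cexp_neq0.
Qed.

(* [f / (z - c)^n] is holomorphic for every n, so Cauchy's bound decays geometrically. *)
Lemma identity_sq f w r r0 z : 0 < r0 -> (forall u, insq w r u -> holo f u) ->
  (forall u, Nc (u - w) < r0 -> f u = 0) -> Nc (z - w) < r -> f z = 0.
Proof.
move=> r00 hf f0 hz.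
have r_gt0 : 0 < r by apply: le_lt_trans hz; exact: Nc_ge0.
have [h1 h2] := sq_le w (ltW r_gt0).
have bc : bcont f (Re w - r) (Re w + r) (Im w - r) (Im w + r).
  by move=> u /onsq_in hu; apply: holo_ccont; exact: hf.
have [M M0 HM] := bcont_bounded (ltW r_gt0) bc.
have [zr|zr] := ltP (Nc (z - w)) r0; first exact: f0.
have zw0 : 0 < Nc (z - w) by apply: lt_le_trans zr.
pose fn n u := f u / (u - w) ^+ n.
have hfn n u : insq w r u -> holo (fn n) u.
  move=> hu; have [uw|uw] := ltP (Nc (u - w)) r0.
    apply: (@holo_loc _ (fun=> 0) _ _ (r0 - Nc (u - w))); first by rewrite subr_gt0.
      move=> v hv; rewrite /fn f0 ?mul0r //.
      by have -> : v - w = (v - u) + (u - w); [ring|apply: le_lt_trans (NcD _ _) _; lra].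
    exact: holo_cst.
  have uw0 : u - w != 0 by rewrite -Nc_gt0; apply: lt_le_trans uw.
  apply: holoM; first exact: hf.
  apply: holoV; first by rewrite expf_neq0.
  by apply: holoX; apply: holoB; [exact: holo_id|exact: holo_cst].
pose D := r - Nc (z - w); have D0 : 0 < D by rewrite subr_gt0.
pose q := Nc (z - w) / r; have q0 : 0 <= q < 1.
  by rewrite divr_ge0 ?Nc_ge0 ?ltW //= ltr_pdivrMr // mul1r.
have key n : Nc (f z) <= M / D * (4 * r) * q ^+ n.
  have := Re_Nc (z - w); have := Im_Nc (z - w); rewrite !ReImE !ler_norml => /andP[? ?] /andP[? ?].
  have := @cauchy_bound R (fn n) _ _ _ _ z (M / r ^+ n) D (ltac:(apply/andP; split; rlra 13) : Re w - r < Re z < Re w + r) (ltac:(apply/andP; split; rlra 13) : Im w - r < Im z < Im w + r).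
  move=> H; have {H} : Nc (fn n z) <= M / r ^+ n / D * (Re w + r - (Re w - r) + (Im w + r - (Im w - r))).
    apply: H => //.
    - by move=> u; rewrite insqE; exact: hfn.
    - move=> u hu; rewrite /fn NcM NcV NcX; apply: ler_pM; rewrite ?Nc_ge0 ?invr_ge0 ?exprn_ge0 ?Nc_ge0 //; first exact: HM.
      have ru := onsq_dist (ltW r_gt0) hu.
      rewrite lef_pV2 ?posrE ?exprn_gt0 //; last exact: lt_le_trans ru.
      by rewrite lerXn2r // nnegrE ?Nc_ge0 // ltW.
    - move=> u /(onsq_dist (ltW r_gt0)) ru; have := NcD (u - z) (z - w).
      have -> : u - z + (z - w) = u - w by ring.
      by rewrite /D; ulra ru.
  rewrite /fn NcM NcV NcX ler_pdivrMr ?exprn_gt0 // => H; apply: le_trans H _.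
  rewrite le_eqVlt; apply/orP; left; apply/eqP.
  rewrite /q expr_div_n; field.
  by rewrite (gt_eqF D0) expf_neq0 ?gt_eqF.
apply/eqP; rewrite -Nc_eq0 eq_le Nc_ge0 andbT; apply/ler_addgt0Pr => e e0; rewrite add0r.
by have [n hn] := geom_small q0 (M / D * (4 * r)) e0; apply: le_trans (key n) hn.
Qed.

End Primitives.

(** * Continuation of zeta *)

Section RealPowers.
Variable R : realType.
Local Notation C := R[i].
Implicit Types (z w s : C) (a b c d x y t e r : R).

Lemma rder_exp (f : R -> R) x a : rder f x a -> rder (fun t => expR (f t)) x (expR (f x) * a).
Proof. exact: (@rder_comp _ (@expR R) f x _ _ (is_derive_expR _)). Qed.
Lemma rder_ln x : 0 < x -> rder (@ln R) x x^-1.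
Proof. exact: is_derive1_ln. Qed.

Definition npow x s : C := cexp (- s * (ln x)%:C).

Lemma Nc_npow x s : Nc (npow x s) = expR (- Re s * ln x).
Proof. by rewrite /npow Nc_cexp !ReImE mulr0 subr0. Qed.

Lemma npow1 s : npow 1 s = 1.
Proof. by rewrite /npow ln1 mulr0 cexp0. Qed.

Lemma npowM x y s : 0 < x -> 0 < y -> npow (x * y) s = npow x s * npow y s.
Proof. by move=> x0 y0; rewrite /npow lnM ?posrE // realC_D mulrDr cexpD. Qed.

Lemma npowD x s w : npow x (s + w) = npow x s * npow x w.
Proof. by rewrite /npow opprD mulrDl cexpD. Qed.

Lemma npow_one x : 0 < x -> npow x 1 = (x^-1)%:C.
Proof. by move=> x0; rewrite /npow mulN1r -realC_N cexp_real expRN lnK. Qed.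

Lemma holo_npow x s : holo (npow x) s.
Proof.
apply: holo_exp; apply: holoM; last exact: holo_cst.
by apply: holoN; exact: holo_id.
Qed.

Lemma rcder_npow s x : 0 < x -> rcder (fun x => npow x s) x (- s * npow x (s + 1)).
Proof.
move=> x0; have D : rcder (fun x => - s * (ln x)%:C) x (- s * (x^-1)%:C).
  by apply: rcderZ; apply: rcder_real; exact: is_derive1_ln.
apply: rcder_eq (cder_path D (cexp_der _)).
by rewrite npowD npow_one // /npow; ring.
Qed.

Lemma expR_ln_le a x y : 0 <= a -> 0 < x -> x <= y -> expR (- a * ln y) <= expR (- a * ln x).
Proof.
move=> a0 x0 xy; rewrite ler_expR !mulNr lerN2; apply: ler_wpM2l => //.
by rewrite ler_ln // posrE //; apply: lt_le_trans xy.
Qed.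

Lemma nat1_gt0 n : 0 < n.+1%:R :> R. Proof. by rewrite ltr0n. Qed.

Lemma npow_diff s x y (m : R) : 0 < m -> m <= x -> x <= y -> -1 <= Re s ->
  Nc (npow y s - npow x s) <= Nc s * expR (- (Re s + 1) * ln m) * (y - x).
Proof.
move=> m0 mx xy hs; have := @mvt_bound _ (fun x => npow x s) (fun x => - s * npow x (s + 1)) x y.
move=> /(_ (Nc s * expR (- (Re s + 1) * ln m))); rewrite (ger0_norm (_ : 0 <= y - x)) ?subr_ge0 //.
apply.
  by move=> t; rewrite inseg_le // => /andP[? ?]; apply: rcder_npow; rlra 6.
move=> t; rewrite inseg_le // => /andP[h1 h2].
rewrite NcM NcN Nc_npow; apply: ler_wpM2l; first exact: Nc_ge0.
rewrite ReD (_ : Re 1 = 1) //; apply: expR_ln_le => //; first lra.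
by apply: le_trans mx h1.
Qed.

(** The increment of [epart] below. It is the integral of [(s - 1) (m^-s - x^-s)] over
    [m <= x <= m + 1] with [m = n + 1], hence [O(m^(- Re s - 1))], which is summable for
    [Re s > 0]. *)
Definition eterm s n : C := (s - 1) * npow n.+1%:R s + npow n.+2%:R (s - 1) - npow n.+1%:R (s - 1).

Lemma eterm_bound s n : 0 <= Re s ->
  Nc (eterm s n) <= Nc s * Nc (s - 1) * expR (- (Re s + 1) * ln n.+1%:R).
Proof.
move=> hs; have m0 := nat1_gt0 n; set m : R := n.+1%:R in m0 *.
have Em : n.+2%:R = m + 1 :> R by rewrite /m -natr1.
pose F x := (s - 1) * (x%:C * npow m s) + npow x (s - 1).
have -> : eterm s n = F (m + 1) - F m.
  rewrite /eterm /F Em -/m realC_D; ring.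
have := @mvt_bound _ F (fun x => (s - 1) * (npow m s - npow x s)) m (m + 1)
  (Nc s * Nc (s - 1) * expR (- (Re s + 1) * ln m)).
rewrite [m + 1]addrC addrK normr1 mulr1 [1 + m]addrC; apply.
  move=> t; rewrite inseg_le ?lerDl // => /andP[h1 h2].
  have t0 : 0 < t by lra.
  apply: rcder_eq (rcderD (rcderZ _ (rcderM (rcder_real (rder_id t)) (rcder_cst _ t))) (rcder_npow _ t0)).
  by rewrite (_ : s - 1 + 1 = s); [rewrite mul1r mulr0 addr0; ring|ring].
move=> t; rewrite inseg_le ?lerDl // => /andP[h1 h2]; rewrite NcM mulrC.
rewrite -mulrA [Nc (s - 1) * _]mulrC mulrA; apply: ler_wpM2r; first exact: Nc_ge0.
rewrite NcBC; apply: le_trans (npow_diff m0 (lexx _) h1 _) _; first lra.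
rewrite ler_piMr //; last lra.
by rewrite mulr_ge0 ?Nc_ge0 ?expR_ge0.
Qed.

(** Comparison of the decreasing function [x^(-a-1)] with its integral over the preceding unit
    interval, in a form that telescopes. *)
Lemma tele_bound a n : 0 < a ->
  expR (- (a + 1) * ln n.+2%:R) <= (expR (- a * ln n.+1%:R) - expR (- a * ln n.+2%:R)) / a.
Proof.
move=> a0; have m0 := nat1_gt0 n.
have Em : n.+2%:R = n.+1%:R + 1 :> R by rewrite -natr1.
rewrite ler_pdivlMr // mulrC.
have D x : 0 < x -> rder (fun x => expR (- a * ln x)) x (- a * expR (- (a + 1) * ln x)).
  move=> x0; apply: rder_eq (rder_exp (rderZ (- a) (rder_ln x0))).
  have -> : - (a + 1) * ln x = - a * ln x + - ln x by ring.
  by rewrite expRD expRN lnK //; ring.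
have := @rder_mono _ (fun x => expR (- a * ln x)) (fun x => - a * expR (- (a + 1) * ln x))
  (fun x => (- a * expR (- (a + 1) * ln n.+2%:R)) * x) (fun=> - a * expR (- (a + 1) * ln n.+2%:R)) n.+1%:R n.+2%:R.
rewrite -mulrBr (_ : n.+2%:R - n.+1%:R = 1); last by rewrite Em addrC addKr.
rewrite mulr1 => H.
have : expR (- a * ln n.+2%:R) - expR (- a * ln n.+1%:R) <= - a * expR (- (a + 1) * ln n.+2%:R).
  apply: H.
  - by rewrite Em lerDl.
  - by move=> t /andP[? ?]; apply: D; lra.
  - by move=> t _; apply: rder_eq (rderZ _ (rder_id t)); rewrite mulr1.
  - move=> t /andP[h1 h2]; rewrite !mulNr lerN2 -!mulNr; apply: ler_wpM2l; first exact: ltW.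
    by apply: expR_ln_le => //; lra.
lra.
Qed.

(** Completeness with an explicit rate: in each real component the limit is the supremum of the
    lower bounds [v n - a n]. *)
Lemma cseq_lim (u : nat -> C) (a : nat -> R) :
  (forall n m, (n <= m)%N -> Nc (u m - u n) <= a n) -> exists l, forall n, Nc (u n - l) <= 2 * a n.
Proof.
move=> H.
have real (v : nat -> R) : (forall n m, (n <= m)%N -> `|v m - v n| <= a n) ->
   exists l, forall n, `|v n - l| <= a n.
  move=> Hv.
  have B n m : v n - a n <= v m + a m.
    have := Hv n (maxn n m) (leq_maxl _ _); have := Hv m (maxn n m) (leq_maxr _ _).
    by rewrite !ler_norml => /andP[? ?] /andP[? ?]; lra.
  exists (sup (range (fun n => v n - a n))) => n; rewrite ler_norml; apply/andP; split.
    rewrite -subr_ge0 opprK; have : sup (range (fun n => v n - a n)) <= v n + a n.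
      apply: ge_sup; first by exists (v 0%N - a 0%N), 0%N.
      by move=> _ [m _ <-]; apply: B.
    by move=> ?; lra.
  have : v n - a n <= sup (range (fun n => v n - a n)).
    apply: sup_upper_bound; last by exists n.
    by split; [exists (v 0%N - a 0%N), 0%N|exists (v 0%N + a 0%N) => _ [m _ <-]].
  by move=> ?; lra.
have [l1 h1] := real (fun n => Re (u n)) (fun n m nm => le_trans (eq_ind _ (fun x => `|x| <= _) (Re_Nc (u m - u n)) _ (etrans (ReD _ _) (congr1 _ (ReN _)))) (H n m nm)).
have [l2 h2] := real (fun n => Im (u n)) (fun n m nm => le_trans (eq_ind _ (fun x => `|x| <= _) (Im_Nc (u m - u n)) _ (etrans (ImD _ _) (congr1 _ (ImN _)))) (H n m nm)).
exists (l1 +i* l2) => n; apply: le_trans (Nc_le _) _; rewrite !ReImE.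
have := h1 n; have := h2 n; lra.
Qed.

(** These expressions converge to [(s - 1) zeta(s)] on all of [Re s > 0]: the last summand
    compensates the divergence of the partial sums of the Dirichlet series. *)
Definition epart s n : C := (s - 1) * \sum_(k < n) npow k.+1%:R s + npow n.+1%:R (s - 1).

Lemma epartS s n : epart s n.+1 = epart s n + eterm s n.
Proof. by rewrite /epart /eterm big_ord_recr /=; ring. Qed.

Lemma epart_cauchy s n m : 0 < Re s -> (n <= m)%N ->
  Nc (epart s m.+1 - epart s n.+1) <= Nc s * Nc (s - 1) * expR (- Re s * ln n.+1%:R) / Re s.
Proof.
move=> s0 /subnKC <-; set k := (m - n)%N; set A := Nc s * Nc (s - 1).
have A0 : 0 <= A by rewrite mulr_ge0 ?Nc_ge0.
suff : Nc (epart s (n + k).+1 - epart s n.+1) <= A * (expR (- Re s * ln n.+1%:R) - expR (- Re s * ln (n + k).+1%:R)) / Re s.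
  move=> h; apply: le_trans h _; rewrite ler_pM2r ?invr_gt0 //; apply: ler_wpM2l => //.
  by rewrite gerBl expR_ge0.
elim: k => [|k IH]; first by rewrite addn0 !subrr Nc0 mulr0 mul0r.
rewrite addnS epartS.
have -> : epart s (n + k).+1 + eterm s (n + k).+1 - epart s n.+1 = (epart s (n + k).+1 - epart s n.+1) + eterm s (n + k).+1 by ring.
apply: le_trans (NcD _ _) _; apply: le_trans (lerD IH (eterm_bound _ (ltW s0))) _.
have := ler_wpM2l A0 (tele_bound (n + k) s0); rewrite -/A.
set X := expR _; set Y := expR _; set Z := expR _; set W := expR _ => h.
have -> : A * (W - Z) / Re s = A * (W - Y) / Re s + A * ((Y - Z) / Re s) by field; lra.
by rewrite lerD2l.
Qed.

Lemma expR_ln_small a : 0 < a -> forall e, 0 < e -> exists N, forall n, (N <= n)%N -> expR (- a * ln n.+1%:R) <= e.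
Proof.
move=> a0 e e0; pose N := Num.bound (expR (- ln e / a)); exists N => n Nn.
rewrite -[e]lnK ?posrE // ler_expR mulNr lerNl.
have : expR (- ln e / a) <= n.+1%:R.
  apply: ltW; apply: lt_le_trans (archi_boundP (expR_ge0 _)) _.
  by rewrite ler_nat; apply: leq_trans Nn _.
rewrite -[n.+1%:R]lnK ?posrE ?nat1_gt0 // ler_expR ler_pdivrMr // mulrC.
by rewrite lnK ?posrE ?nat1_gt0.
Qed.

(** The limit of [epart], chosen through its rate of convergence, since locally uniform convergence
    and the value at 1 are both read off that rate. *)
Definition elim_ s : C := xget 0 (fun l => forall n, Nc (epart s n.+1 - l) <=
  2 * (Nc s * Nc (s - 1) * expR (- Re s * ln n.+1%:R) / Re s)).

Lemma elimP s n : 0 < Re s -> Nc (epart s n.+1 - elim_ s) <=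
  2 * (Nc s * Nc (s - 1) * expR (- Re s * ln n.+1%:R) / Re s).
Proof.
move=> s0; have [l hl] := @cseq_lim (fun n => epart s n.+1) _ (fun n m => @epart_cauchy s n m s0).
pose P : set C := fun l => forall n, Nc (epart s n.+1 - l) <=
  2 * (Nc s * Nc (s - 1) * expR (- Re s * ln n.+1%:R) / Re s).
have : P (elim_ s) by apply: (xgetI 0 (hl : P l)).
exact.
Qed.

Lemma holo_epart n s : holo (fun s => epart s n) s.
Proof.
apply: holoD; last first.
  apply: (@holo_comp _ (npow n.+1%:R) (fun s => s - 1)); last exact: holo_npow.
  by apply: holoB; [exact: holo_id|exact: holo_cst].
apply: holoM; first by apply: holoB; [exact: holo_id|exact: holo_cst].
elim: n => [|n IH].
  apply: (@holo_loc _ (fun=> 0) _ _ 1) => //; last exact: holo_cst.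
  by move=> u _; rewrite big_ord0.
apply: (@holo_loc _ (fun u => \sum_(k < n) npow k.+1%:R u + npow n.+1%:R u) _ _ 1) => //.
  by move=> u _; rewrite big_ord_recr.
by apply: holoD => //; exact: holo_npow.
Qed.

Lemma holo_elim s : 0 < Re s -> holo elim_ s.
Proof.
move=> s0; pose r := Re s / 2; have r0 : 0 < r by rewrite divr_gt0.
have inr z : insq s r z -> r <= Re z.
  by move=> /andP[+ _]; rewrite ler_distl /r => /andP[? ?]; lra.
apply: (@weierstrass _ (fun n z => epart z n.+1) _ s r) => //.
  by move=> n z _; exact: holo_epart.
pose M := Nc s + 2 * r + 1.
have M0 : 0 < M by rewrite /M ltr_wpDl // addr_ge0 ?Nc_ge0 // mulr_ge0 // ltW.
move=> e e0; have e1 : 0 < e * r / (2 * M ^+ 2) by rewrite divr_gt0 ?mulr_gt0 ?exprn_gt0.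
have [n Hn] := expR_ln_small r0 e1; exists n => z hz; have rz := inr _ hz.
apply: le_trans (elimP _ _) _; first exact: lt_le_trans rz.
have zM : Nc z <= M.
  have := insq_Nc2 hz; have := NcD (z - s) s; rewrite subrK /M; lra.
have zM1 : Nc (z - 1) <= M.
  have := insq_Nc2 hz; have := NcD (z - s) (s - 1); have := NcB s 1; rewrite Nc1.
  have -> : z - s + (s - 1) = z - 1 by ring.
  by rewrite /M; lra.
apply: (@le_trans _ _ (2 * (M * M * (e * r / (2 * M ^+ 2)) / r))); last first.
  by rewrite le_eqVlt; apply/orP; left; apply/eqP; field; rewrite !gt_eqF.
apply: ler_wpM2l => //; apply: ler_pM.
- by rewrite !mulr_ge0 ?Nc_ge0 ?expR_ge0.
- by rewrite invr_ge0 (le_trans _ rz) // ltW.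
- apply: ler_pM; rewrite ?mulr_ge0 ?Nc_ge0 ?expR_ge0 //; first by apply: ler_pM; rewrite ?Nc_ge0.
  apply: le_trans (Hn n (leqnn n)); rewrite ler_expR !mulNr lerN2; apply: ler_wpM2r => //.
  by rewrite ln_ge0 // ler1n.
- by rewrite lef_pV2 // posrE (lt_le_trans _ rz).
Qed.

(** The rate contains the factor [Nc (s - 1)], so at 1 the first partial expression already equals
    the limit. *)
Lemma elim1 : elim_ 1 = 1.
Proof.
have := @elimP 1 0 (@ltr01 R); rewrite subrr Nc0 mulr0 mul0r mul0r mulr0 => h.
have := le_anti (introT andP (conj h (Nc_ge0 _))) => /eqP.
rewrite Nc_eq0 subr_eq0 /epart subrr mul0r add0r /npow oppr0 mul0r cexp0.
by move=> /eqP.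
Qed.

Lemma elim_bound s : 0 < Re s ->
  Nc (elim_ s) <= Nc (s - 1) + 1 + expR ((1 - Re s) * ln 2) + 2 * Nc s * Nc (s - 1) / Re s.
Proof.
move=> s0; have := elimP 0 s0; rewrite ln1 mulr0 expR0 mulr1 NcBC => h.
have := NcD (elim_ s - epart s 1) (epart s 1); rewrite subrK => h'.
apply: le_trans h' _.
have : Nc (epart s 1) <= Nc (s - 1) + expR ((1 - Re s) * ln 2).
  rewrite /epart big_ord1 npow1 mulr1; apply: le_trans (NcD _ _) _.
  rewrite Nc_npow lerD2l // ler_expR ReD ReN (_ : Re 1 = 1) //.
  by rewrite opprB.
have -> : 2 * Nc s * Nc (s - 1) / Re s = 2 * (Nc s * Nc (s - 1) / Re s) by ring.
lra.
Qed.

End RealPowers.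

(** * The given zeta function coincides with this continuation on Re s > 0 *)

Section ZetaContinuation.
Variable R : realType.
Local Notation C := R[i].
Implicit Types (z w s : C) (a b c d x y t e r : R).

Lemma normC_Nc z : `|z| = (Nc z)%:C.
Proof. by []. Qed.

Lemma le_realC x y : (x%:C <= y%:C :> C) = (x <= y).
Proof. by rewrite lecR. Qed.

Lemma lt_realC x y : (x%:C < y%:C :> C) = (x < y).
Proof. by rewrite ltcR. Qed.

Lemma pos_realC z : 0 < z -> exists2 x : R, 0 < x & z = x%:C.
Proof.
by rewrite ltcE => /andP[/eqP E h]; exists (Re z) => //; apply: Ceq => //; rewrite E.
Qed.

Lemma derivable_holo (f : C -> C) s : derivable (f : C^o -> C^o) s 1 -> holo f s.
Proof.
move=> /cvg_ex[/= d hd]; exists d; apply/cderP => e e0.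
have e0' : 0 < e%:C :> C by rewrite lt_realC.
move: hd => /cvgrPdist_le /(_ _ e0').
rewrite /dnbhs /within /= => /nbhs_ballP[r /= /pos_realC[r' r0 ->] H].
exists r' => // z zr; have [->|zs] := eqVneq z s.
  by rewrite !subrr mulr0 subr0 Nc0 mulr0.
have zs0 : z - s != 0 by rewrite subr_eq0.
have := H (z - s); rewrite /ball /= sub0r normrN normC_Nc lt_realC => /(_ zr zs0).
rewrite [(z - s) *: 1]mulr1 subrK /GRing.scale /= normC_Nc le_realC => h.
have -> : f z - f s - d * (z - s) = - ((d - (z - s)^-1 * (f z - f s)) * (z - s)).
  by field.
by rewrite NcN NcM; apply: ler_wpM2r; [exact: Nc_ge0|].
Qed.

Variable zeta : C -> C.
Hypothesis hzeta : is_riemann_zeta zeta.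

Lemma holo_zeta s : s != 1 -> holo zeta s.
Proof. by move=> s1; apply: derivable_holo; apply: hzeta.1. Qed.

Lemma zeta_series s : 1 < Re s -> forall e, 0 < e -> exists N : nat,
  forall n, (N <= n)%N -> Nc (\sum_(k < n) npow k.+1%:R s - zeta s) <= e.
Proof.
move=> s1 e e0; have := hzeta.2 s s1.
have e0' : 0 < e%:C :> C by rewrite lt_realC.
move=> /cvgrPdist_le /(_ _ e0')[N _ H]; exists N => n /H /=.
by rewrite /series /= big_mkord normC_Nc le_realC NcBC.
Qed.

Lemma epart_lim s : 1 < Re s -> elim_ s = (s - 1) * zeta s.
Proof.
move=> s1; have s0 : 0 < Re s by lra.
apply/eqP; rewrite -subr_eq0 -Nc_eq0 eq_le Nc_ge0 andbT; apply/ler_addgt0Pr => e e0; rewrite add0r.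
have e3 : 0 < e / 3 by rewrite divr_gt0.
pose A := 2 * (Nc s * Nc (s - 1)) / Re s + 1.
have A0 : 0 < A by rewrite /A ltr_wpDl // divr_ge0 ?mulr_ge0 ?Nc_ge0 // ltW.
have [N1 H1] := expR_ln_small s0 (divr_gt0 e3 A0).
have s10 : 0 < Re s - 1 by lra.
have [N2 H2] := expR_ln_small s10 e3.
have B0 : 0 < Nc (s - 1) + 1 by rewrite ltr_wpDl ?Nc_ge0.
have [N3 H3] := zeta_series s1 (divr_gt0 e3 B0).
pose n := (N1 + N2 + N3)%N.
have l1 := H1 n (ltac:(rewrite /n -addnA; exact: leq_addr)).
have l2 := H2 n.+1 (ltac:(apply: leqW; rewrite /n addnAC; exact: leq_addl)).
have l3 := H3 n.+1 (ltac:(apply: leqW; exact: leq_addl)).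
have := elimP n s0; rewrite NcBC => h.
have -> : elim_ s - (s - 1) * zeta s = (elim_ s - epart s n.+1) + (s - 1) * (\sum_(k < n.+1) npow k.+1%:R s - zeta s) + npow n.+2%:R (s - 1).
  by rewrite /epart; ring.
have t1 : Nc (elim_ s - epart s n.+1) <= e / 3.
  apply: le_trans h _.
  have -> : 2 * (Nc s * Nc (s - 1) * expR (- Re s * ln n.+1%:R) / Re s) =
    (2 * (Nc s * Nc (s - 1)) / Re s) * expR (- Re s * ln n.+1%:R) by ring.
  apply: (@le_trans _ _ (A * expR (- Re s * ln n.+1%:R))).
    by apply: ler_wpM2r; [exact: expR_ge0|rewrite /A; rlra 0].
  by move: l1; rewrite ler_pdivlMr // mulrC.
have t2 : Nc ((s - 1) * (\sum_(k < n.+1) npow k.+1%:R s - zeta s)) <= e / 3.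
  rewrite NcM; apply: (@le_trans _ _ ((Nc (s - 1) + 1) * Nc (\sum_(k < n.+1) npow k.+1%:R s - zeta s))).
    by apply: ler_wpM2r; [exact: Nc_ge0|rlra 0].
  by move: l3; rewrite ler_pdivlMr // mulrC.
have t3 : Nc (npow n.+2%:R (s - 1)) <= e / 3.
  by rewrite Nc_npow ReD ReN (_ : Re 1 = 1).
apply: le_trans (NcD _ _) _; apply: le_trans (lerD (NcD _ _) (lexx _)) _.
by ulra t3 t2 t1.
Qed.

Definition zdiff s := (s - 1) * zeta s - elim_ s.

Lemma holo_zdiff s : s != 1 -> 0 < Re s -> holo zdiff s.
Proof.
move=> s1 s0; apply: holoB; last exact: holo_elim.
by apply: holoM; [apply: holoB; [exact: holo_id|exact: holo_cst]|exact: holo_zeta].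
Qed.

(* Squares of a fixed size are chained leftwards at constant height, avoiding the pole. *)
Lemma zdiff0_off s : 0 < Re s -> Im s != 0 -> zdiff s = 0.
Proof.
case: s => x t /= x0 t0.
have [x1|x1] := ltP 1 x; first by rewrite /zdiff epart_lim ?subrr.
have nt : 0 < `|t| by rewrite normr_gt0.
have [r [r0 rx rt]] : exists r : R, [/\ 0 < r, r < x & r < `|t|].
  exists (Num.min x `|t| / 2); have h : 0 < Num.min x `|t| by rewrite lt_min x0.
  have h1 : Num.min x `|t| <= x by rewrite ge_min lexx.
  have h2 : Num.min x `|t| <= `|t| by rewrite ge_min lexx orbT.
  by split; ulra h h1 h2.
pose Q y := exists2 r0 : R, 0 < r0 & forall u, Nc (u - (y +i* t)) < r0 -> zdiff u = 0.
have Q2 : Q 2.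
  exists 1 => // u hu; rewrite /zdiff epart_lim ?subrr //.
  have := Re_Nc (u - (2 +i* t)); rewrite !ReImE ler_norml => /andP[? ?]; lra.
have step y y' : x <= y -> x <= y' -> `|y - y'| < r -> Q y -> Q y'.
  move=> xy xy' yy [r1 r10 H].
  have hol u : insq (y +i* t) r u -> holo zdiff u.
    move=> /andP[]; rewrite /= !ler_distl => /andP[u1 u2] /andP[u3 u4]; apply: holo_zdiff; last by ulra u1 xy rx.
    apply: contraTneq rt => ue; rewrite -leNgt ler_norml.
    by move: u3 u4; rewrite ue (_ : Im 1 = 0) // => ? ?; apply/andP; split; rlra 2.
  exists (r - `|y - y'|); first by rewrite subr_gt0.
  move=> u hu; apply: (identity_sq r10 hol H).
  have -> : u - (y +i* t) = u - (y' +i* t) + (y' - y)%:C by apply: Ceq; rewrite !ReImE; ring.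
  by apply: le_lt_trans (NcD _ _) _; rewrite Nc_real distrC; move: hu; lra.
pose N := (Num.bound ((2 - x) / r)).+1.
have N0 : 0 < N%:R :> R by rewrite ltr0n.
pose h := (2 - x) / N%:R.
have h0 : 0 <= h by rewrite divr_ge0 ?ltW //; ulra x1.
have hr : h < r.
  rewrite /h ltr_pdivrMr // mulrC -ltr_pdivrMr //.
  have q0 : 0 <= (2 - x) / r by rewrite divr_ge0 ?ltW //; ulra x1.
  by apply: lt_le_trans (archi_boundP q0) _; rewrite ler_nat /N.
have all k : (k <= N)%N -> Q (2 - k%:R * h).
  elim: k => [|k IH] kN; first by rewrite mul0r subr0.
  have kN' : k.+1%:R * h <= 2 - x.
    have -> : 2 - x = N%:R * h by rewrite /h; field; rewrite gt_eqF.
    by apply: ler_wpM2r => //; rewrite ler_nat.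
  rewrite -natr1 in kN' *.
  apply: step (IH (ltnW kN)); [ulra kN' h0|ulra kN'|].
  have -> : 2 - k%:R * h - (2 - (k%:R + 1) * h) = h by ring.
  by rewrite ger0_norm.
have := all N (leqnn N); have -> : 2 - N%:R * h = x by rewrite /h; field; rewrite gt_eqF.
by case=> r1 r10; apply; rewrite subrr Nc0.
Qed.

(** A real [s] other than 1 is a limit of nonreal points, where [zdiff0_off] applies. *)
Lemma zdiff0 s : 0 < Re s -> s != 1 -> zdiff s = 0.
Proof.
move=> s0 s1; have [t0|t0] := eqVneq (Im s) 0; last exact: zdiff0_off.
apply/eqP; rewrite -Nc_eq0 eq_le Nc_ge0 andbT leNgt; apply/negP => h.
have [d d0 H] := holo_ccont (holo_zdiff s1 s0) h.
have := H (s + iC * (d / 2)%:C); rewrite [s + _]addrC addrK NcM Nc_i mul1r Nc_real.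
have d2 : 0 < d / 2 by rewrite divr_gt0.
rewrite ger0_norm ?ltW // zdiff0_off; first last.
- by rewrite !ReImE t0; lra.
- by rewrite !ReImE; lra.
rewrite sub0r NcN ltxx => /(_ (ltac:(lra) : d / 2 < d)) //.
Qed.

(** [(s - 1) zeta(s)] with the removable singularity filled by hand, as the value of [zeta] at 1 is
    unspecified. *)
Definition zE s : C := if s == 1 then 1 else (s - 1) * zeta s.

Lemma zE_elim s : 0 < Re s -> zE s = elim_ s.
Proof.
move=> s0; rewrite /zE; case: eqVneq => [->|s1]; first by rewrite elim1.
by apply/eqP; rewrite -subr_eq0; apply/eqP; exact: zdiff0.
Qed.

Lemma zE1 : zE 1 = 1. Proof. by rewrite /zE eqxx. Qed.

Lemma holo_zE s : holo zE s.
Proof.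
have [s1|s1] := eqVneq s 1.
  have c1 : Re s = 1 by rewrite s1.
  apply: (@holo_loc _ (@elim_ R) _ _ 1) => //; last by apply: holo_elim; rewrite c1.
  move=> u hu; rewrite zE_elim //.
  by have := Re_Nc (u - s); rewrite !ReImE c1 ler_norml => /andP[? ?]; lra.
apply: (@holo_loc _ (fun s => (s - 1) * zeta s) _ _ (Nc (s - 1))).
- by rewrite Nc_gt0 subr_eq0.
- by move=> u hu; rewrite /zE; case: eqVneq => // u1; move: hu; rewrite u1 NcBC ltxx.
- by apply: holoM; [apply: holoB; [exact: holo_id|exact: holo_cst]|exact: holo_zeta].
Qed.

(** The abscissa [2/5] leaves room to the left of the critical line for the rectangle of
    [three_lines]. *)
Lemma zE_bound s : 2 / 5 <= Re s -> Nc (zE s) <= 12 * (1 + Nc s) ^+ 2.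
Proof.
move=> hs; have s0 : 0 < Re s by lra.
rewrite zE_elim //; apply: le_trans (elim_bound s0) _.
have n0 := Nc_ge0 s; have n1 : Nc (s - 1) <= Nc s + 1.
  by have := NcB s 1; rewrite Nc1.
have e2 : expR ((1 - Re s) * ln 2) <= 2.
  rewrite -[leRHS]lnK ?posrE // ler_expR ger_pMl ?ln_gt0 ?ltr1n //; lra.
have : 2 * Nc s * Nc (s - 1) / Re s <= 5 * (Nc s * (Nc s + 1)).
  rewrite ler_pdivrMr //; apply: (@le_trans _ _ (5 * (Nc s * (Nc s + 1)) * (2 / 5))); last first.
    by apply: ler_wpM2l => //; rewrite !mulr_ge0 //; lra.
  have := ler_wpM2l n0 n1; lra.
have -> : 12 * (1 + Nc s) ^+ 2 = 12 + 24 * Nc s + 12 * Nc s ^+ 2 by ring.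
have -> : 5 * (Nc s * (Nc s + 1)) = 5 * Nc s ^+ 2 + 5 * Nc s by ring.
have : 0 <= Nc s ^+ 2 by rewrite exprn_ge0.
lra.
Qed.

Lemma zeta_real x : 1 < x -> Im (zeta x%:C) = 0.
Proof.
move=> x1; apply/eqP; rewrite -normr_eq0 eq_le normr_ge0 andbT; apply/ler_addgt0Pr => e e0; rewrite add0r.
have [N H] := zeta_series (x1 : 1 < Re x%:C) e0; have := H N (leqnn N) => h.
apply: le_trans h; apply: le_trans (Im_Nc _); rewrite ImD ImN.
suff -> : Im (\sum_(k < N) npow k.+1%:R x%:C) = 0 by rewrite sub0r normrN.
elim: N {H} => [|N IH]; first by rewrite big_ord0.
rewrite big_ord_recr /= ImD IH add0r /npow -realC_N -realC_M cexp_real //.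
Qed.

(** * Euler product *)

Definition rough (P n : nat) := [forall p : 'I_P.+1, prime p ==> ~~ (p %| n)%N].

Lemma roughP P n : reflect (forall p, prime p -> (p <= P)%N -> ~~ (p %| n)%N) (rough P n).
Proof.
apply: (iffP forallP) => [H p pp pP|H p]; last by apply/implyP => pp; apply: H => //; rewrite -ltnS.
by have /implyP := H (Ordinal (pP : (p < P.+1)%N)); apply.
Qed.

Definition rsum P s N : C := \sum_(k < N | rough P k.+1) npow k.+1%:R s.

Lemma rsum0 s N : rsum 0 s N = \sum_(k < N) npow k.+1%:R s.
Proof.
apply: eq_bigl => k; apply/roughP => p pp; rewrite leqn0 => /eqP p0; by rewrite p0 in pp.
Qed.

Lemma rough_comp P n : ~~ prime P.+1 -> rough P.+1 n = rough P n.
Proof.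
move=> np; apply/roughP/roughP => H p pp pP; apply: H => //.
  exact: leqW.
by move: pP; rewrite leq_eqVlt => /predU1P[E|//]; rewrite -E pp in np.
Qed.

Lemma rough_prime P n : prime P.+1 -> rough P.+1 n = rough P n && ~~ (P.+1 %| n)%N.
Proof.
move=> pp; apply/roughP/andP => [H|[/roughP H1 H2] p hp].
  split; last exact: H.
  by apply/roughP => p hp pP; apply: H => //; exact: leqW.
by rewrite leq_eqVlt => /predU1P[->//|]; exact: H1.
Qed.

Lemma rough_mul P n : prime P.+1 -> rough P (P.+1 * n) = rough P n.
Proof.
move=> pp; apply/roughP/roughP => H p hp pP; have := H p hp pP; rewrite Euclid_dvdM // negb_or.
  by case/andP.
by move=> ->; rewrite andbT dvdn_prime2 // ltn_eqF.
Qed.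

Lemma rsumS P s N : rsum P s N.+1 = rsum P s N + (if rough P N.+1 then npow N.+1%:R s else 0).
Proof. by rewrite /rsum big_mkcond big_ord_recr /= -big_mkcond. Qed.

(** One step of the sieve: the [P]-rough integers divisible by the prime [P + 1] are its multiples
    by [P]-rough integers. *)
Lemma rsum_prime P s N : prime P.+1 ->
  rsum P s N = rsum P.+1 s N + npow P.+1%:R s * rsum P s (N %/ P.+1).
Proof.
move=> pp; elim: N => [|N IH]; first by rewrite div0n /rsum !big_ord0 mulr0 addr0.
rewrite !rsumS IH rough_prime //.
have [d|d] := boolP (P.+1 %| N.+1)%N; last first.
  have -> : (N.+1 %/ P.+1 = N %/ P.+1)%N.
    by rewrite divnS // (negbTE d).
  by rewrite andbT; case: ifP => _; ring.
have E : (N.+1 %/ P.+1 = (N %/ P.+1).+1)%N by rewrite divnS // d add1n.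
have EN : (N.+1 = P.+1 * (N %/ P.+1).+1)%N by rewrite -E mulnC divnK.
rewrite E rsumS andbF.
rewrite [in rough P N.+1]EN rough_mul //.
case: ifP => _; last by rewrite !addr0.
rewrite EN natrM npowM ?ltr0n //; ring.
Qed.

Definition eprod P s : C := \prod_(p < P.+1 | prime p) (1 - npow p%:R s).

Lemma eprodS P s : eprod P.+1 s = eprod P s * (if prime P.+1 then 1 - npow P.+1%:R s else 1).
Proof. by rewrite /eprod big_mkcond big_ord_recr /= -big_mkcond. Qed.

(** By [rsum_prime], sieving by one more prime multiplies the limit by [1 - p^-s]; only finite
    products appear. *)
Lemma rsum_lim P s : 1 < Re s -> forall e, 0 < e -> exists N : nat,
  forall n, (N <= n)%N -> Nc (rsum P s n - zeta s * eprod P s) <= e.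
Proof.
move=> s1; elim: P => [|P IH] e e0.
  have [N H] := zeta_series s1 e0; exists N => n /H.
  have np : (fun p : 'I_1 => prime p) =1 xpred0 by move=> i; case: i; case.
  by rewrite rsum0 /eprod (eq_bigl _ _ np) big_pred0_eq mulr1.
rewrite eprodS; case: ifP => pp; last first.
  have [N H] := IH e e0; exists N => n /H; rewrite mulr1.
  by congr (Nc (_ - _) <= _); apply: eq_bigl => k; rewrite rough_comp ?pp.
have e2 : 0 < e / 2 by rewrite divr_gt0.
have [N H] := IH _ e2; exists (P.+1 * N)%N => n hn.
have n1 : (N <= n)%N by apply: leq_trans hn; rewrite leq_pmull.
have n2 : (N <= n %/ P.+1)%N by rewrite leq_divRL // mulnC.
have -> : rsum P.+1 s n - zeta s * (eprod P s * (1 - npow P.+1%:R s)) =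
  (rsum P s n - zeta s * eprod P s) - npow P.+1%:R s * (rsum P s (n %/ P.+1) - zeta s * eprod P s).
  by rewrite (rsum_prime s n pp); ring.
apply: le_trans (NcB _ _) _; rewrite NcM.
have : Nc (npow P.+1%:R s) * Nc (rsum P s (n %/ P.+1) - zeta s * eprod P s) <= 1 * (e / 2).
  apply: ler_pM; rewrite ?Nc_ge0 //; last exact: H.
  rewrite Nc_npow -[leRHS]expR0 ler_expR mulNr oppr_le0 mulr_ge0 //; first lra.
  by rewrite ln_ge0 // ler1n.
have := H _ n1; lra.
Qed.

End ZetaContinuation.

(** * The principal logarithm on the right half-plane *)

Section ComplexLog.
Variable R : realType.
Local Notation C := R[i].
Implicit Types (z w s : C) (a b c d x y t e r : R).

Definition is_Ln (L : C -> C) := [/\ L 1 = 0, forall z, 0 < Re z -> cexp (L z) = z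
  & forall z, 0 < Re z -> cder L z z^-1].

Lemma Ln_exists : exists L : C -> C, is_Ln L.
Proof.
have [||z hz|L [L1 LE LD]] := @log_exists R (fun x => 0 < x) id 1 (strip_gt 0).
- exact: ltr01.
- by [].
- split; first exact: holo_id.
  by apply: contraTneq hz => ->; rewrite ltxx.
exists L; split => // z hz; apply: cder_eq (LD _ hz).
by rewrite (cDE (cder_id z)) mul1r.
Qed.

Variable L : C -> C.
Hypothesis HL : is_Ln L.

(** [log (1 / (1 - w)) = w + w^2 / 2 + ...], the logarithm of an Euler factor when [w = p^-s]. *)
Definition lam w : C := - L (1 - w).

Lemma Re1B w : Nc w < 1 -> 0 < Re (1 - w).
Proof.
by move=> h; rewrite ReD ReN (_ : Re 1 = 1) //; have := Re_le_Nc w; lra.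
Qed.

Lemma lamE w : Nc w < 1 -> cexp (lam w) = (1 - w)^-1.
Proof. by case: HL => _ LE _ h; rewrite /lam cexpN LE // Re1B. Qed.

Lemma cder_lam w : Nc w < 1 -> cder lam w (1 - w)^-1.
Proof.
case: HL => _ _ LD h; apply: cder_eq (cderN (cder_comp (cderB (cder_cst 1 w) (cder_id w)) (LD _ (Re1B h)))).
by rewrite sub0r mulrN1 opprK.
Qed.

Lemma lam0 : lam 0 = 0. Proof. by case: HL => L1 _ _; rewrite /lam subr0 L1 oppr0. Qed.

Lemma Nc_geo w t (q : R) : Nc w <= q -> q < 1 -> 0 <= t <= 1 -> 1 - q <= Nc (1 - t%:C * w).
Proof.
move=> wq q1 /andP[t0 t1]; have := NcB_ge 1 (t%:C * w); rewrite Nc1 NcM Nc_real ger0_norm // => h.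
have : t * Nc w <= 1 * q by apply: ler_pM => //; exact: Nc_ge0.
lra.
Qed.

Lemma lam_path w t (q : R) : Nc w <= q -> q < 1 -> 0 <= t <= 1 ->
  rcder (fun x => lam (x%:C * w)) t (w / (1 - t%:C * w)).
Proof.
move=> wq q1 ht; have h : Nc (t%:C * w) < 1.
  rewrite NcM Nc_real; case/andP: ht => t0 t1; rewrite ger0_norm //.
  have : t * Nc w <= 1 * q by apply: ler_pM => //; exact: Nc_ge0.
  lra.
have E : lam \o (fun x => x%:C * w) =1 fun x => lam (0 + x%:C * w) by move=> x /=; rewrite add0r.
apply: rcder_ext (fun x => esym (E x)) _.
apply: rcder_eq (cder_line (d := (1 - t%:C * w)^-1) _); first by rewrite mulrC.
by rewrite add0r; exact: cder_lam.
Qed.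

Lemma lam_bound w (q : R) : Nc w <= q -> q < 1 -> Nc (lam w) <= Nc w / (1 - q).
Proof.
move=> wq q1; have := @mvt_bound _ (fun x => lam (x%:C * w)) (fun t => w / (1 - t%:C * w)) 0 1 (Nc w / (1 - q)).
rewrite subr0 normr1 mulr1 mul1r mul0r lam0 subr0; apply => t; rewrite inseg_le // => ht.
  exact: lam_path wq q1 ht.
rewrite NcM NcV; apply: ler_wpM2l; first exact: Nc_ge0.
have h := Nc_geo wq q1 ht; rewrite lef_pV2 // posrE ?subr_gt0 //; apply: lt_le_trans h; lra.
Qed.

Lemma lam_bound2 w (q : R) : Nc w <= q -> q < 1 -> Nc (lam w - w) <= Nc w ^+ 2 / (1 - q).
Proof.
move=> wq q1.
have := @mvt_bound _ (fun x => lam (x%:C * w) - x%:C * w) (fun t => w / (1 - t%:C * w) - w) 0 1 (Nc w ^+ 2 / (1 - q)).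
rewrite subr0 normr1 mulr1 mul1r mul0r lam0 !subr0; apply => t; rewrite inseg_le // => ht.
  apply: rcderB; first exact: lam_path wq q1 ht.
  by apply: rcder_ext (rcder_line 0 w t) => x; rewrite add0r.
have h := Nc_geo wq q1 ht; have p0 : 0 < Nc (1 - t%:C * w) by apply: lt_le_trans h; rewrite subr_gt0.
have n0 : 1 - t%:C * w != 0 by rewrite -Nc_gt0.
have -> : w / (1 - t%:C * w) - w = t%:C * w ^+ 2 / (1 - t%:C * w) by field.
rewrite NcM NcV NcM NcX Nc_real; apply: ler_pM.
- by rewrite mulr_ge0 // exprn_ge0 // Nc_ge0.
- by rewrite invr_ge0 Nc_ge0.
- by case/andP: ht => t0 t1; rewrite ger0_norm // ler_piMl // exprn_ge0 // Nc_ge0.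
- by rewrite lef_pV2 // posrE subr_gt0.
Qed.

Lemma rder_const (f : R -> R) a b : (forall t, inseg a b t -> rder f t 0) -> f a = f b.
Proof.
move=> h; have E : rint (fun=> 0) a b = f b - f a by apply: rintE.
have E' : rint (fun=> 0) a b = 0 by rewrite (@rintE _ (fun=> 0)) ?subrr // => t _; exact: rder_cst.
by apply/eqP; rewrite eq_sym -subr_eq0 -E E'.
Qed.

Lemma Ln_real x : 0 < x -> Im (L x%:C) = 0.
Proof.
case: HL => L1 _ LD x0.
have := @rder_const (fun t => Im (L (t +i* 0))) x 1.
rewrite (_ : 1 +i* 0 = 1) // L1 => -> // t ht.
have t0 : 0 < t by move: ht; rewrite /inseg => /orP[]/andP[? ?]; lra.
have [_ h] := cder_x (LD (t +i* 0) t0); apply: rder_eq h.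
have -> : t +i* 0 = t%:C by []. by rewrite -realC_V.
Qed.

End ComplexLog.

(** * The logarithm [G] and its expansion over primes *)

Section LogZeta.
Variable R : realType.
Local Notation C := R[i].
Implicit Types (z w s : C) (a b c d x y t e r : R).
Variable zeta : C -> C.
Hypothesis hzeta : is_riemann_zeta zeta.

Definition zT s : C := zE zeta s / s.

Definition is_logzeta (G : C -> C) := [/\ G 1 = 0,
  forall s, 2^-1 < Re s -> cexp (G s) = zT s &
  forall s, 2^-1 < Re s -> cder G s (cD zT s / zT s)].

Lemma Re_neq0 s : 0 < Re s -> s != 0.
Proof. by move=> h; apply: contraTneq h => ->; rewrite ltxx. Qed.

Lemma holo_zT s : s != 0 -> holo zT s.
Proof. by move=> s0; apply: holoM; [exact: holo_zE|apply: holoV => //; exact: holo_id]. Qed.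

Lemma logzeta_exists : riemann_hypothesis zeta -> exists G, is_logzeta G.
Proof.
move=> RH; apply: (@log_exists R (fun x => 2^-1 < x) zT 1 (strip_gt 2^-1)).
- by rewrite (_ : Re 1 = 1) //; lra.
- by rewrite /zT zE1 divr1.
- move=> s hs; have s0 : s != 0 by apply: Re_neq0; lra.
  split; first exact: holo_zT.
  suff zn : zE zeta s != 0 by rewrite /zT mulf_neq0 ?invr_eq0.
  rewrite /zE; have [_|s1] := eqVneq s 1; first by rewrite oner_eq0.
  apply: mulf_neq0; first by rewrite subr_eq0.
  apply/eqP => z0.
  (* A trivial zero has negative real part, so a zero here would be nontrivial and lie on the
     critical line. *)
  have := RH s; rewrite /nontrivial_zero => /(_ (ltac:(split => // n; apply: contraTneq hs => ->; rewrite ReN -realC_nat ReC -leNgt; apply: (@le_trans _ _ 0); [by rewrite oppr_le0 ler0n|lra]))) h.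
  by move: hs; rewrite h ltxx.
Qed.

Variables (G L : C -> C).
Hypothesis HG : is_logzeta G.
Hypothesis HL : is_Ln L.

Lemma holo_G s : 2^-1 < Re s -> holo G s.
Proof. by case: HG => _ _ h /h; eexists; eauto. Qed.

Lemma zT_real x : 1 < x -> Im (zT x%:C) = 0.
Proof.
move=> x1; have x1' : x%:C != 1 :> C by apply/eqP => /(congr1 (@Re R)) /=; lra.
rewrite /zT /zE (negbTE x1') -realC_V ImM ImC mulr0 add0r ImM zeta_real // mulr0 add0r.
by rewrite ImD ImN (_ : Im 1 = 0) // ImC subr0 !mul0r.
Qed.

Lemma zT_neq0 s : 2^-1 < Re s -> zT s != 0.
Proof. by case: HG => _ h _ /h <-; exact: cexp_neq0. Qed.

(** On the real axis the logarithmic derivative of [zT] is real, so [Im G] is constant to the right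
    of 1; continuity at 1, where [G] vanishes, makes it 0. *)
Lemma G_real x : 1 < x -> Im (G x%:C) = 0.
Proof.
case: HG => G1 GE GD x1.
have rd t : 1 < t -> rder (fun t => Im (G (t +i* 0))) t 0.
  move=> t1; have ht : 2^-1 < Re (t +i* 0) by rewrite /=; lra.
  have [_ h] := cder_x (GD _ ht); apply: rder_eq h.
  have h0 : t +i* 0 != 0 by apply: Re_neq0 => /=; lra.
  have [_ h1] := cder_x (cDP (holo_zT h0)).
  have dz : Im (cD zT (t +i* 0)) = 0.
    have h2 : rder (fun t => Im (zT (t +i* 0))) t 0.
      apply: rder_eps => e e0; exists (t - 1); first by rewrite subr_gt0.
      move=> k hk; have t1' : 1 < t + k by move: hk; rewrite ltr_norml => /andP[? ?]; lra.
      by rewrite (zT_real t1) (zT_real t1') mul0r !subr0 normr0 mulr_ge0 // ltW.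
    by have [_ e1] := h1; have [_ e2] := h2; rewrite -e1 e2.
  have zi := zT_real t1; have n0 := zT_neq0 ht.
  have -> : zT (t +i* 0) = (Re (zT (t +i* 0)))%:C by apply: Ceq => //; exact: zi.
  by rewrite -realC_V ImM ImC dz !(mulr0, mul0r) addr0.
have cst y : 1 < y -> Im (G (y +i* 0)) = Im (G (x +i* 0)).
  move=> y1; apply: (@rder_const _ (fun t => Im (G (t +i* 0)))) => t ht; apply: rd.
  by move: ht; rewrite /inseg => /orP[]/andP[? ?]; lra.
apply/eqP; rewrite -normr_eq0 eq_le normr_ge0 andbT; apply/ler_addgt0Pr => e e0; rewrite add0r.
have h1 : 2^-1 < Re (1 : C) by rewrite (_ : Re 1 = 1) //; lra.
have [d d0 H] := holo_ccont (holo_G h1) e0.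
have y1 : 1 < 1 + d / 2 by rewrite ltrDl divr_gt0.
rewrite -(cst _ y1); have := H ((1 + d / 2) +i* 0); rewrite G1 subr0 => h.
apply/ltW/(le_lt_trans (Im_Nc _)); apply: h.
have -> : (1 + d / 2) +i* 0 - 1 = (d / 2)%:C by apply: Ceq; rewrite !ReImE /=; ring.
by rewrite Nc_real ger0_norm ?divr_ge0 ?ltW //; lra.
Qed.

Lemma sq_inv_le (n : nat) : (n.+2%:R ^+ 2)^-1 <= n.+1%:R^-1 - n.+2%:R^-1 :> R.
Proof.
have m0 := nat1_gt0 R n; rewrite -[n.+2%:R]natr1; set m : R := n.+1%:R in m0 *.
have -> : m^-1 - (m + 1)^-1 = (m * (m + 1))^-1 by field; do ?(apply/andP; split); apply: lt0r_neq0; lra.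
rewrite lef_pV2 ?posrE ?mulr_gt0 ?exprn_gt0 //; lra.
Qed.

(** A bound for the sum of [n^(- Re s)] over [n > P]: the excess of the exponent over 2 is evaluated
    at [n = P + 1], and the remaining sum of [n^-2] is at most [(P + 1)^-2 + (P + 1)^-1]. *)
Definition rP_bound P s : R := expR (- (Re s - 2) * ln P.+1%:R) * ((P.+1%:R ^+ 2)^-1 + P.+1%:R^-1).

(** A rough integer other than 1 exceeds [P], because its least prime factor does. After the term 1
    only a tail remains. *)
Lemma rsum_bound P s N : (0 < P)%N -> 2 <= Re s ->
  Nc (rsum P s N.+1 - 1) <= rP_bound P s.
Proof.
move=> P0 s2; set q := expR (- (Re s - 2) * ln P.+1%:R).
have q0 : 0 <= q by exact: expR_ge0.
have term n : (P <= n)%N -> Nc (npow n.+1%:R s) <= q * (n.+1%:R ^+ 2)^-1.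
  move=> Pn; rewrite Nc_npow.
  have -> : - Re s * ln n.+1%:R = - (Re s - 2) * ln n.+1%:R + (- ln n.+1%:R + - ln n.+1%:R) by ring.
  rewrite expRD; apply: ler_pM; rewrite ?expR_ge0 //.
    apply: expR_ln_le; [lra|exact: nat1_gt0|by rewrite ler_nat ltnS].
  by rewrite expRD expRN lnK ?posrE ?nat1_gt0 // expr2 invfM.
have small k : (k < P)%N -> (0 < k)%N -> rough P k.+1 = false.
  move=> kP k0; apply/roughP => /(_ (pdiv k.+1) (pdiv_prime (k0 : (1 < k.+1)%N))) H.
  by move: H; rewrite pdiv_dvd => /(_ (leq_trans (pdiv_leq (ltn0Sn k)) kP)).
have one : rough P 1.
  by apply/roughP => p pp _; rewrite dvdn1; case: eqP pp => // ->.
have early n : (n < P)%N -> rsum P s n.+1 = 1.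
  elim: n => [|n IH] nP; first by rewrite rsumS one npow1 /rsum big_ord0 add0r.
  by rewrite rsumS IH ?(ltnW nP) // small // addr0.
have late k : Nc (rsum P s (P + k).+1 - 1) <= q * ((P.+1%:R ^+ 2)^-1 + P.+1%:R^-1 - (P + k).+1%:R^-1).
  elim: k => [|k IH].
    rewrite addn0 addrK rsumS; have -> : rsum P s P = 1 by move: P0; case: (P) early => // n h _; apply: h.
    by case: ifP => _; rewrite addrC addrA addNr add0r ?Nc0 ?term // mulr_ge0 // invr_ge0 exprn_ge0.
  rewrite addnS rsumS addrAC.
  have : Nc (if rough P (P + k).+2 then npow (P + k).+2%:R s else 0) <= q * ((P + k).+1%:R^-1 - (P + k).+2%:R^-1).
    apply: (@le_trans _ _ (q * ((P + k).+2%:R ^+ 2)^-1)); last by apply: ler_wpM2l => //; exact: sq_inv_le.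
    case: ifP => _; first by apply: term; rewrite -addnS leq_addr.
    by rewrite Nc0 mulr_ge0 // invr_ge0 exprn_ge0.
  by move=> h; apply: le_trans (NcD _ _) _; apply: le_trans (lerD IH h) _; rewrite -mulrDr addrA subrK.
have [NP|PN] := ltnP N P.
  by rewrite early // subrr Nc0 /rP_bound mulr_ge0 // addr_ge0 ?invr_ge0 ?exprn_ge0.
rewrite -(subnKC PN); apply: le_trans (late _) _; rewrite /rP_bound -/q; apply: ler_wpM2l => //.
by rewrite gerBl invr_ge0.
Qed.

Lemma rP_le P s : (0 < P)%N -> 2 <= Re s -> Nc (zeta s * eprod P s - 1) <= rP_bound P s.
Proof.
move=> P0 s2; apply/ler_addgt0Pr => e e0.
have [N H] := rsum_lim hzeta P (ltac:(lra) : 1 < Re s) e0.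
have := H N.+1 (leqnSn N); rewrite NcBC => h1; have h2 := @rsum_bound P s N P0 s2.
have -> : zeta s * eprod P s - 1 = (zeta s * eprod P s - rsum P s N.+1) + (rsum P s N.+1 - 1) by ring.
by apply: le_trans (NcD _ _) _; lra.
Qed.

Lemma rP_bound34 P s : (0 < P)%N -> 2 <= Re s -> rP_bound P s <= 3 / 4.
Proof.
move=> P0 s2; rewrite /rP_bound.
have P2 : 2 <= P.+1%:R :> R by rewrite ler_nat.
apply: (@le_trans _ _ (1 * (4^-1 + 2^-1))); last lra.
apply: ler_pM; rewrite ?expR_ge0 //.
- rewrite -[leRHS]expR0 ler_expR mulNr oppr_le0 mulr_ge0 //; first lra.
  by rewrite ln_ge0; lra.
- apply: lerD; rewrite lef_pV2 ?posrE //; try lra.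
  have -> : 4 = 2 ^+ 2 :> R by ring.
  by rewrite lerXn2r // nnegrE; lra.
Qed.

Definition esum_lam P s : C := \sum_(p < P.+1 | prime p) lam L (npow p%:R s).

Lemma npow_prime_lt1 p s : prime p -> 1 < Re s -> Nc (npow p%:R s) < 1.
Proof.
move=> pp s1; rewrite Nc_npow -[ltRHS]expR0 ltr_expR mulNr oppr_lt0 mulr_gt0 //; first lra.
by rewrite ln_gt0 // ltr1n prime_gt1.
Qed.

Lemma cexp_esum P s : 1 < Re s -> cexp (- esum_lam P s) = eprod P s.
Proof.
move=> s1; elim: P => [|P IH].
  have np : (fun p : 'I_1 => prime p) =1 xpred0 by move=> i; case: i; case.
  by rewrite /esum_lam /eprod !(eq_bigl _ _ np) !big_pred0_eq oppr0 cexp0.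
rewrite eprodS -IH /esum_lam [in LHS]big_mkcond big_ord_recr /= -big_mkcond opprD cexpD; congr (_ * _).
case: ifP => pp; last by rewrite oppr0 cexp0.
by rewrite cexpN lamE // ?invrK //; exact: npow_prime_lt1.
Qed.

Lemma holo_esum P s : 1 < Re s -> holo (esum_lam P) s.
Proof.
move=> s1; elim: P => [|P IH].
  apply: (@holo_loc _ (fun=> 0) _ _ 1) => //; last exact: holo_cst.
  have np : (fun p : 'I_1 => prime p) =1 xpred0 by move=> i; case: i; case.
  by move=> u _; rewrite /esum_lam (eq_bigl _ _ np) big_pred0_eq.
apply: (@holo_loc _ (fun u => esum_lam P u + (if prime P.+1 then lam L (npow P.+1%:R u) else 0)) _ _ 1) => //.
  by move=> u _; rewrite /esum_lam [in RHS]big_mkcond big_ord_recr /= -big_mkcond.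
apply: holoD => //; case: (boolP (prime P.+1)) => pp; last exact: holo_cst.
apply: (@holo_comp _ (lam L) (npow P.+1%:R)); first exact: holo_npow.
by eexists; apply: cder_lam => //; exact: npow_prime_lt1.
Qed.

Lemma esum_real P x : 1 < x -> Im (esum_lam P x%:C) = 0.
Proof.
move=> x1; elim: P => [|P IH].
  have np : (fun p : 'I_1 => prime p) =1 xpred0 by move=> i; case: i; case.
  by rewrite /esum_lam (eq_bigl _ _ np) big_pred0_eq.
rewrite /esum_lam [in LHS]big_mkcond big_ord_recr /= -big_mkcond ImD IH add0r.
case: ifP => pp //; have := @npow_prime_lt1 P.+1 x%:C pp x1.
have -> : npow P.+1%:R x%:C = (expR (- x * ln P.+1%:R))%:C :> C.
  by rewrite /npow -realC_N -realC_M cexp_real.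
rewrite Nc_real ger0_norm ?expR_ge0 // => h.
rewrite /lam (_ : 1 - _%:C = (1 - expR (- x * ln P.+1%:R))%:C); last by rewrite realC_B.
by rewrite ImN Ln_real ?oppr0 // subr_gt0.
Qed.

(** For [Re s > 2] this is the logarithm of zeta without its Euler factors up to [P]; [1 - s^-1] is
    the factor [(s - 1) / s] of [zT]. *)
Definition gdiff P s : C := G s - L (1 - s^-1) - esum_lam P s.

Lemma inv_lt s : 2 < Re s -> Nc (s^-1) <= 2^-1.
Proof.
move=> s2; rewrite NcV lef_pV2 ?posrE //; first by have := Re_le_Nc s; lra.
by rewrite Nc_gt0 Re_neq0 //; lra.
Qed.

Lemma cexp_gdiff P s : 2 < Re s -> cexp (gdiff P s) = zeta s * eprod P s.
Proof.
move=> s2; have s0 : s != 0 by apply: Re_neq0; lra.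
have i1 : Nc (s^-1) < 1 by have := inv_lt s2; lra.
case: HG => _ GE _; case: HL => _ LE _.
rewrite /gdiff cexpD cexp_esum; last lra.
rewrite cexpB GE; last lra.
rewrite LE ?Re1B //.
have s1 : s != 1 by apply: contraTneq s2 => ->; rewrite (_ : Re 1 = 1) // -leNgt; lra.
rewrite /zT /zE (negbTE s1); congr (_ * _); field.
by rewrite s0 subr_eq0 s1.
Qed.

Lemma holo_gdiff P s : 2 < Re s -> holo (gdiff P) s.
Proof.
move=> s2; have s0 : s != 0 by apply: Re_neq0; lra.
have i1 : Nc (s^-1) < 1 by have := inv_lt s2; lra.
case: HL => _ _ LD.
apply: holoB; last by apply: holo_esum; lra.
apply: holoB; first by apply: holo_G; lra.
apply: (@holo_comp _ L (fun s => 1 - s^-1)); last by eexists; apply: LD; exact: Re1B.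
by apply: holoB; [exact: holo_cst|apply: holoV => //; exact: holo_id].
Qed.

(* [gdiff] and [Ln (1 + r)] have equal exponentials and are both real on the real axis. *)
Lemma gdiff_Ln P s : (0 < P)%N -> 2 < Re s -> gdiff P s = L (zeta s * eprod P s).
Proof.
move=> P0 s2.
have pos u : 2 < Re u -> Nc (zeta u * eprod P u - 1) <= 3 / 4.
  by move=> hu; apply: le_trans (rP_le P0 _) (rP_bound34 P0 _); lra.
have repos u : 2 < Re u -> 0 < Re (zeta u * eprod P u).
  move=> /pos; have := Re_Nc (zeta u * eprod P u - 1); rewrite ReD ReN (_ : Re 1 = 1) //.
  by rewrite ler_norml => /andP[? ?]; lra.
case: (HL) => L1 LE LD.
pose D u := gdiff P u - L (cexp (gdiff P u)).
have DE u : 2 < Re u -> cexp (D u) = 1.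
  move=> hu; rewrite /D cexpB LE; last by rewrite cexp_gdiff //; exact: repos.
  by rewrite divff ?cexp_neq0.
have hD u : 2 < Re u -> holo D u.
  move=> hu; have h := @holo_gdiff P u hu; apply: holoB => //.
  apply: (@holo_comp _ L (fun u => cexp (gdiff P u))); first exact: holo_exp.
  by eexists; apply: LD; rewrite cexp_gdiff //; exact: repos.
have dD u : 2 < Re u -> cder D u 0.
  move=> hu; have [k hk] := hD u hu; have := cder_comp hk (cexp_der _).
  have c1 : cder (fun u => cexp (D u)) u 0.
    apply: (@cder_loc _ (fun=> 1) _ _ _ (Re u - 2)); first by rewrite subr_gt0.
      move=> v hv; rewrite DE //; have := Re_Nc (v - u); rewrite !ReImE ler_norml => /andP[? ?]; lra.
    exact: cder_cst.
  move=> c2; have := cder_uniq c1 c2; rewrite DE // mul1r => k0.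
  by rewrite k0.
have E : D s = D 3%:C by apply: (strip_const (strip_gt 2) s2 _ dD) => /=; lra.
have h3 : 2 < Re (3%:C : C) by rewrite /=; lra.
have Im3 : Im (D 3%:C) = 0.
  have g3 : Im (gdiff P 3%:C) = 0.
    rewrite /gdiff !ImD !ImN G_real ?esum_real; [|lra|lra].
    rewrite -realC_V (_ : 1 - _%:C = (1 - 3^-1)%:C); last by rewrite realC_B.
    by rewrite Ln_real ?oppr0 ?addr0 //; lra.
  rewrite /D ImD ImN g3 (_ : gdiff P 3%:C = (Re (gdiff P 3%:C))%:C); last by apply: Ceq.
  by rewrite cexp_real Ln_real ?oppr0 ?addr0 // expR_gt0.
have Re3 : Re (D 3%:C) = 0.
  have := Nc_cexp (D 3%:C); rewrite DE // Nc1 => /esym h.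
  by apply: expR_inj; rewrite h expR0.
have D0 : D 3%:C = 0 by apply: Ceq.
by move: E; rewrite D0 /D cexp_gdiff // => /eqP; rewrite subr_eq0 => /eqP.
Qed.

Lemma gdiff_bound P s : (0 < P)%N -> 2 < Re s -> Nc (gdiff P s) <= 4 * rP_bound P s.
Proof.
move=> P0 s2; rewrite gdiff_Ln //.
have h1 := rP_le P0 (ltW s2); have h2 := rP_bound34 P0 (ltW s2).
have -> : L (zeta s * eprod P s) = - lam L (1 - zeta s * eprod P s) by rewrite /lam opprK subKr.
rewrite NcN; have := @lam_bound _ L HL (1 - zeta s * eprod P s) (3 / 4).
rewrite NcBC => /(_ (le_trans h1 h2) (ltac:(lra))) => h; apply: le_trans h _.
have -> : (1 - 3 / 4)^-1 = 4 :> R by field.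
lra.
Qed.

(** The case [P = 1], in which no prime is removed: [4 * rP_bound 1 s] is [12 * 2^(- Re s)], and the
    second term comes from [log (1 - 1/s)]. *)
Lemma G_bound3 s : 3 <= Re s -> Nc (G s) <= 12 * expR (- Re s * ln 2) + 2 / Nc s.
Proof.
move=> s3; have s2 : 2 < Re s by lra.
have := @gdiff_bound 1 s isT s2; rewrite /gdiff /esum_lam.
have np : (fun p : 'I_2 => prime p) =1 xpred0 by move=> i; case: i; case=> [|[|m]].
rewrite (eq_bigl _ _ np) big_pred0_eq.
rewrite subr0 => h.
have i1 := inv_lt s2; have := @lam_bound _ L HL (s^-1) 2^-1 i1 (ltac:(lra)).
rewrite /lam NcN NcV => h'.
have := NcD (G s - L (1 - s^-1)) (L (1 - s^-1)); rewrite subrK => h''.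
apply: le_trans h'' _; apply: lerD.
  apply: le_trans h _; rewrite /rP_bound.
  have -> : - (Re s - 2) * ln 2 = - Re s * ln 2 + (ln 2 + ln 2) by ring.
  by rewrite !expRD lnK ?posrE // le_eqVlt; apply/orP; left; apply/eqP; field.
apply: le_trans h' _; rewrite le_eqVlt; apply/orP; left; apply/eqP; field.
by rewrite gt_eqF // Nc_gt0 Re_neq0 //; lra.
Qed.

Lemma gdiff_small P s : (0 < P)%N -> 2 < Re s -> Nc (gdiff P s) <= 8 / P.+1%:R.
Proof.
move=> P0 s2; apply: le_trans (gdiff_bound P0 s2) _.
have p0 := nat1_gt0 R P; have p1 : 1 <= P.+1%:R :> R by rewrite ler1n.
have -> : 8 / P.+1%:R = 4 * (1 * (P.+1%:R^-1 + P.+1%:R^-1)) :> R by field; rewrite gt_eqF.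
apply: ler_wpM2l => //; apply: ler_pM; rewrite ?expR_ge0 //.
- rewrite -[leRHS]expR0 ler_expR mulNr oppr_le0 mulr_ge0 //; first lra.
  by rewrite ln_ge0.
- rewrite lerD2r lef_pV2 ?posrE ?exprn_gt0 // expr2 ler_peMl //; exact: ltW.
Qed.

End LogZeta.

(** * Upper bounds to the right of the critical line *)

Section MaximumPrinciple.
Variable R : realType.
Local Notation C := R[i].
Implicit Types (f g : C -> C) (z w s : C) (a b c d x y t e r : R).

(** The tensor power trick: applied to all powers of a function, it removes the constant from
    Cauchy's bound. *)
Lemma pow_bounded (q K : R) : 0 <= q -> (forall n, q ^+ n.+1 <= K) -> q <= 1.
Proof.
move=> q0 H; rewrite leNgt; apply/negP => q1.
have K0 : 0 < K by apply: lt_le_trans (H 0%N); rewrite expr1; lra.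
have i01 : 0 <= q^-1 < 1 by rewrite invr_ge0 q0 invf_lt1 //; lra.
have [n hn] := geom_small i01 K (ltr01 : 0 < (1:R)).
have qn : 0 < q ^+ n by apply: exprn_gt0; lra.
move: hn; rewrite exprVn ler_pdivrMr // mul1r => hn.
have := le_trans (H n) hn; rewrite exprS ger_pMl //; lra.
Qed.

Lemma on_dist a b c d w : a < Re w < b -> c < Im w < d ->
  exists2 D : R, 0 < D & forall z, onrect a b c d z -> D <= Nc (z - w).
Proof.
move=> /andP[h1 h2] /andP[h3 h4].
exists (Num.min (Num.min (Re w - a) (b - Re w)) (Num.min (Im w - c) (d - Im w))).
  by rewrite !lt_min !subr_gt0 h1 h2 h3 h4.
move=> z /andP[_ H]; set m := Num.min _ _.
have m1 : m <= Re w - a by rewrite !ge_min lexx.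
have m2 : m <= b - Re w by rewrite !ge_min lexx orbT.
have m3 : m <= Im w - c by rewrite !ge_min lexx !orbT.
have m4 : m <= d - Im w by rewrite !ge_min lexx !orbT.
have := Re_Nc (z - w); have := Im_Nc (z - w); rewrite !ReImE !ler_norml => /andP[? ?] /andP[? ?].
by move: m1 m2 m3 m4; case/or4P: H => /eqP E; rewrite -E; rlra 5.
Qed.

(* Cauchy's bound applied to all powers of [f]. *)
Lemma max_rect f a b c d w : a < Re w < b -> c < Im w < d ->
  (forall z, inrect a b c d z -> holo f z) ->
  (forall z, onrect a b c d z -> Nc (f z) <= 1) -> Nc (f w) <= 1.
Proof.
move=> h1 h2 hf H; have [D D0 HD] := on_dist h1 h2.
apply: (@pow_bounded _ (1 / D * ((b - a) + (d - c)))) => [|n]; first exact: Nc_ge0.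
rewrite -NcX; apply: (cauchy_bound (f := fun z => f z ^+ n.+1) h1 h2) => //.
- by move=> z hz; apply: holoX; exact: hf.
- by move=> z hz; rewrite NcX exprn_ile1 ?Nc_ge0 // H.
Qed.

(* [h^(n+1) / (z - c)^n] is differentiable at [c], so no removable-singularity theorem is needed. *)
Lemma schwarz_sq h (c : C) r w : 0 < r -> h c = 0 -> (forall z, insq c r z -> holo h z) ->
  (forall z, onsq c r z -> Nc (h z) <= 1) -> Nc (w - c) < r -> Nc (h w) <= Nc (w - c) / r.
Proof.
move=> r0 hc hh H wr.
have [->|wc] := eqVneq w c; first by rewrite hc subrr Nc0 mul0r.
have wc0 : 0 < Nc (w - c) by rewrite Nc_gt0 subr_eq0.
pose F n z := h z ^+ n.+2 / (z - c) ^+ n.+1.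
have hF n z : insq c r z -> holo (F n) z.
  move=> hz; have [zc|zc] := eqVneq z c.
    have [k] := hh z hz; rewrite zc => -[phi [cphi _ hE]].
    exists (phi c ^+ n.+2); exists (fun z => phi z ^+ n.+2); split => //.
      have cX m : ccont (fun z => phi z ^+ m) c.
        elim: m => [|m IH]; first exact: ccont_cst.
        apply: (@ccont_loc _ (fun z => phi z * phi z ^+ m) _ _ 1) => //; last exact: ccontM.
        by move=> u _; rewrite exprS.
      exact: cX.
    move=> u; rewrite /F hc !expr0n /= mul0r add0r.
    have [->|uc] := eqVneq u c; first by rewrite subrr mulr0 hc !expr0n /= mul0r.
    have E : (phi u * (u - c)) ^+ n.+2 = phi u ^+ n.+2 * ((u - c) * (u - c) ^+ n.+1).
      by rewrite exprMn [(u - c) ^+ n.+2]exprS.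
    rewrite (hE u) hc add0r E.
    have u0 : u - c != 0 by rewrite subr_eq0.
    by rewrite mulrA mulfK // expf_neq0.
  apply: holoM; first by apply: holoX; exact: hh.
  apply: holoV; first by rewrite expf_neq0 // subr_eq0.
  by apply: holoX; apply: holoB; [exact: holo_id|exact: holo_cst].
have := Re_Nc (w - c); have := Im_Nc (w - c); rewrite !ReImE !ler_norml => /andP[i1 i2] /andP[i3 i4].
have h1 : Re c - r < Re w < Re c + r by apply/andP; split; ulra i3 wr i4.
have h2 : Im c - r < Im w < Im c + r by apply/andP; split; ulra i1 wr i2.
have [D D0 HD] := on_dist h1 h2.
have [x0|x0] := eqVneq (Nc (h w)) 0; first by rewrite x0 divr_ge0 ?Nc_ge0 // ltW.
have hw0 : 0 < Nc (h w) by rewrite lt_def x0 Nc_ge0.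
set p := Nc (w - c) / r; have p0 : 0 < p by rewrite divr_gt0.
pose K := 1 / D * ((Re c + r - (Re c - r)) + (Im c + r - (Im c - r))).
suff : Nc (h w) / p <= 1 by rewrite ler_pdivrMr // mul1r.
apply: (@pow_bounded _ (K / Nc (h w))) => [|n]; first by rewrite divr_ge0 ?Nc_ge0 // ltW.
have B : Nc (F n w) <= (r ^+ n.+1)^-1 / D * ((Re c + r - (Re c - r)) + (Im c + r - (Im c - r))).
  apply: (cauchy_bound (f := F n) h1 h2) => //.
  - by move=> z; rewrite insqE; exact: hF.
  - move=> z hz; rewrite /F NcM NcV !NcX -[leRHS]mul1r; apply: ler_pM.
    + by rewrite exprn_ge0 // Nc_ge0.
    + by rewrite invr_ge0 exprn_ge0 // Nc_ge0.
    + by rewrite exprn_ile1 ?Nc_ge0 // H.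
    + have hz' := onsq_dist (ltW r0) hz.
      rewrite lef_pV2 ?posrE ?exprn_gt0 //; last exact: lt_le_trans hz'.
      by rewrite lerXn2r // nnegrE ?Nc_ge0 // ltW.
move: B; rewrite /F NcM NcV !NcX => B.
rewrite ler_pdivlMr // /p invf_div exprMn exprMn exprVn.
have -> : Nc (h w) ^+ n.+1 * (r ^+ n.+1 * (Nc (w - c) ^+ n.+1)^-1) * Nc (h w) =
  r ^+ n.+1 * (Nc (h w) ^+ n.+2 / Nc (w - c) ^+ n.+1) by rewrite [Nc (h w) ^+ n.+2]exprS; ring.
rewrite -ler_pdivlMl ?exprn_gt0 //; apply: le_trans B _.
by rewrite /K le_eqVlt; apply/orP; left; apply/eqP; ring.
Qed.

(** Borel-Caratheodory: [k / (2 A - k)] sends the half-plane [Re k <= A] into the unit disc and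
    vanishes at [c], so Schwarz's lemma applies to it. *)
Lemma borel_sq g (c : C) r w (A q : R) : 0 < r -> 0 < A -> 0 <= q < 1 ->
  (forall z, insq c r z -> holo g z) ->
  (forall z, insq c r z -> Re (g z - g c) <= A) -> Nc (w - c) <= q * r ->
  Nc (g w - g c) <= 2 * A * q / (1 - q).
Proof.
move=> r0 A0 /andP[q0 q1] hg HA hw.
have wr : Nc (w - c) < r by apply: le_lt_trans hw _; rewrite gtr_pMl.
pose k z := g z - g c; pose h z := k z / ((2 * A)%:C - k z).
have den z : insq c r z -> (2 * A)%:C - k z != 0.
  move=> hz; rewrite -Nc_gt0; apply: lt_le_trans (Re_le_Nc _).
  by rewrite ReD ReN ReC; have := HA z hz; rewrite -/(k z); lra.
have hk z : insq c r z -> holo k z by move=> hz; apply: holoB; [exact: hg|exact: holo_cst].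
have hle z : insq c r z -> Nc (h z) <= 1.
  move=> hz; rewrite /h NcM NcV ler_pdivrMr ?Nc_gt0 ?den // mul1r.
  have := HA z hz; rewrite -/(k z); move: (k z) => v hA.
  rewrite -(@ler_pXn2r _ 2) ?nnegrE ?Nc_ge0 // !Nc_sqr !ReImE sub0r sqrrN lerD2r.
  have := mulr_ge0 (ltW A0) (_ : 0 <= A - Re v); rewrite subr_ge0 => /(_ hA).
  by move=> ?; rewrite sqrrB; lra.
have S : Nc (h w) <= Nc (w - c) / r.
  apply: schwarz_sq => //.
  - by rewrite /h /k subrr mul0r.
  - move=> z hz; apply: holoM; first exact: hk.
    by apply: holoV; [exact: den|apply: holoB; [exact: holo_cst|exact: hk]].
  - by move=> z /onsq_in; exact: hle.
have hq : Nc (h w) <= q by apply: le_trans S _; rewrite ler_pdivrMr.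
have inw : insq c r w by apply: insq_Nc; exact: ltW.
have kE : k w = h w * ((2 * A)%:C - k w) by rewrite /h divfK // den.
rewrite ler_pdivlMr ?subr_gt0 // -/(k w).
have : Nc (k w) <= q * (2 * A + Nc (k w)).
  rewrite {1}kE NcM; apply: ler_pM; rewrite ?Nc_ge0 //.
  apply: le_trans (NcB _ _) _; rewrite Nc_real ger0_norm //; lra.
lra.
Qed.

End MaximumPrinciple.

(** * First estimates of [G], and the shift of the abscissa *)

Section MLemma.
Variable R : realType.
Local Notation C := R[i].
Implicit Types (z w s : C) (a b c d x y t e r : R).
Variable zeta : C -> C.
Hypothesis hzeta : is_riemann_zeta zeta.
Variables (G L : C -> C).
Hypothesis HG : is_logzeta zeta G.
Hypothesis HL : is_Ln L.

(** The summand [7 = 1 + 6] makes [7 + |t|] dominate [1 + |s|] for [Re s <= 6], and is large enough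
    for its fourth power to absorb the constants in [zT_le]. *)
Definition lg t : R := ln (7 + `|t|).

Lemma lg_gt0 t : 0 < lg t.
Proof. by rewrite /lg ln_gt0 //; have := normr_ge0 t; lra. Qed.

Lemma lg_le t : lg t <= 6 + `|t|.
Proof.
rewrite /lg (_ : 7 + `|t| = 1 + (6 + `|t|)); last ring.
by apply: le_ln1Dx; have := normr_ge0 t; lra.
Qed.

Lemma lg_mono t u : `|t| <= `|u| -> lg t <= lg u.
Proof.
by move=> h; rewrite /lg ler_ln ?posrE ?lerD2l //; have := normr_ge0 t; have := normr_ge0 u; lra.
Qed.

Lemma zT_le s : 2 / 5 <= Re s <= 6 -> Nc (zT zeta s) <= expR (4 * lg (Im s)).
Proof.
move=> /andP[h1 h2].
have n1 : 2 / 5 <= Nc s by apply: le_trans h1 (Re_le_Nc _).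
have n0 : 0 < Nc s by lra.
set y := 7 + `|Im s|; have y7 : 7 <= y by rewrite /y; have := normr_ge0 (Im s); lra.
have n2 : 1 + Nc s <= y.
  by have := Nc_le s; rewrite (@ger0_norm _ (Re s)) /y; lra.
rewrite /lg -/y expRM_natl lnK; last by rewrite posrE; lra.
rewrite /zT NcM NcV ler_pdivrMr //; apply: le_trans (zE_bound hzeta h1) _.
have y2 : 49 * y ^+ 2 <= y ^+ 4.
  rewrite (_ : y ^+ 4 = y ^+ 2 * y ^+ 2); last ring.
  by apply: ler_wpM2r; [rewrite exprn_ge0 //; ulra y7|rewrite (_ : 49 = 7 ^+ 2); [rewrite lerXn2r // nnegrE; ulra y7|ring]].
have nn : (1 + Nc s) ^+ 2 <= y ^+ 2 by rewrite lerXn2r // nnegrE; lra.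
have y20 : 0 <= y ^+ 2 by rewrite exprn_ge0; ulra nn y7.
have : y ^+ 4 * (2 / 5) <= y ^+ 4 * Nc s by apply: ler_wpM2l => //; rewrite exprn_ge0; ulra y20 y7.
lra.
Qed.

Lemma Nc_expG s : 2^-1 < Re s -> expR (Re (G s)) = Nc (zT zeta s).
Proof. by case: HG => _ GE _ h; rewrite -Nc_cexp GE. Qed.

Lemma ReG_le s : 2^-1 < Re s <= 6 -> Re (G s) <= 4 * lg (Im s).
Proof.
move=> /andP[h1 h2]; rewrite -ler_expR Nc_expG //; apply: zT_le; apply/andP; split; lra.
Qed.

Lemma G3 s : 3 <= Re s -> Nc (G s) <= 3.
Proof.
move=> h; apply: le_trans (G_bound3 hzeta HG HL h) _.
have n3 : 3 <= Nc s by apply: le_trans h (Re_le_Nc _).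
have : 2 / Nc s <= 2 / 3 by rewrite ler_pM2l // lef_pV2 ?posrE; lra.
have : expR (- Re s * ln 2) <= 8^-1.
  have -> : 8^-1 = expR (- 3 * ln 2) :> R.
    by rewrite mulNr expRN expRM_natl lnK ?posrE //; congr (_^-1); ring.
  by rewrite ler_expR; apply: ler_wpM2r; [rewrite ln_ge0 ?ler1n|lra].
lra.
Qed.

(** Borel-Caratheodory about [3 + it] on a square that stops at abscissa [1/2 + e/2]. The constant
    blows up as [e] tends to 0; it only serves to discard horizontal sides of contours for fixed
    [e]. *)
Lemma G_poly e : 0 < e <= 1 -> exists2 K : R, 0 < K & forall s, 2^-1 + e <= Re s <= 3 ->
  Nc (G s) <= K * (1 + `|Im s|).
Proof.
move=> /andP[e0 e1]; pose q := (5 / 2 - e) / (5 / 2 - e / 2).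
have d0 : 0 < 5 / 2 - e / 2 by lra.
have q01 : 0 <= q < 1 by rewrite /q divr_ge0 ?ltr_pdivrMr //=; lra.
have qE : q * (5 / 2 - e / 2) = 5 / 2 - e by rewrite /q divfK // gt_eqF.
clearbody q.
have K0 : 0 <= 2 * 39 * q / (1 - q).
  by case/andP: q01 => q0 q1; rewrite divr_ge0 ?subr_ge0 ?(ltW q1) // mulr_ge0.
exists (3 + 2 * 39 * q / (1 - q)); first lra.
case=> x t /= /andP[h1 h2]; pose c := 3 +i* t.
have t0 := normr_ge0 t.
(* [39 = 4 (6 + 3) + 3]: the bound [4 lg] on the square, where heights exceed [|t|] by at most 3,
   plus [Nc (G c) <= 3]. *)
have A0 : 0 < 39 * (1 + `|t|) by lra.
have hz z : insq c (5 / 2 - e / 2) z -> [/\ 2^-1 < Re z, Re z <= 6 & `|Im z| <= `|t| + 3].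
  move=> /andP[]; rewrite /c /= !ler_distl => /andP[? ?] /andP[? ?]; split; try lra.
  by have := ler_norm t; have := ler_norm (- t); rewrite normrN ler_norml => ? ?; apply/andP; split; rlra 17.
have B := @borel_sq R G c (5 / 2 - e / 2) (x +i* t) (39 * (1 + `|t|)) q d0 A0 q01.
have Gc : Nc (G c) <= 3 by apply: G3.
have := NcD (G (x +i* t) - G c) (G c); rewrite subrK => h; apply: le_trans h _.
have : Nc (G (x +i* t) - G c) <= 2 * (39 * (1 + `|t|)) * q / (1 - q).
  apply: B.
  - by move=> z /hz[? _ _]; exact: (holo_G HG).
  - move=> z /hz[z1 z2 z3]; rewrite ReD ReN.
    have r1 := @ReG_le z (ltac:(rewrite z1 z2 //)).
    have r2 := lg_le (Im z); have := Re_Nc (G c); rewrite ler_norml => /andP[? _].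
    rlra 10.
  - rewrite qE.
    have -> : x +i* t - c = (x - 3)%:C by rewrite /c; apply: Ceq; rewrite !ReImE; ring.
    by rewrite Nc_real ler0_norm; ulra h1 h2.
have -> : 2 * (39 * (1 + `|t|)) * q / (1 - q) = 2 * 39 * q / (1 - q) * (1 + `|t|) by ring.
ulra Gc t0.
Qed.

(* Maximum principle for [zT] times the exponential of a quadratic polynomial: moving the abscissa
   left by [r] costs [O(r log t)]. *)
Lemma three_lines b r t (M : R) : 2^-1 < b -> 0 < r -> b + r <= 11 / 10 -> 0 <= M ->
  (forall t', `|t' - t| <= 1 -> Re (G ((b + r) +i* t')) <= M) ->
  Re (G (b +i* t)) <= M + 44 * lg (`|t| + 1) * r.
Proof.
move=> b1 r0 br M0 HM.
pose K := 4 * lg (`|t| + 1); have K0 : 0 < K by rewrite mulr_gt0 // lg_gt0.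
pose x0 := b + r.
pose p z : C := z - (x0 +i* t).
(* With [p = x + iy] the real part added to [M] is [K (y^2 - x^2 - 11 x)]. It is nonnegative on the
   side [x = 0] and at least [K] on the other three, where [x <= -1/10] or [|y| = 1]. At the point
   of interest it is at most [11 K r]. *)
pose h z : C := M%:C + K%:C * (- (p z * p z) - 11%:C * p z).
have Reh z : Re (h z) = M + K * ((Im z - t) ^+ 2 - (Re z - x0) ^+ 2 - 11 * (Re z - x0)).
  by rewrite /h /p !ReImE /x0; ring.
have hh z : holo h z.
  have hp : holo p z by apply: holoB; [exact: holo_id|exact: holo_cst].
  apply: holoD; first exact: holo_cst.
  apply: holoM; first exact: holo_cst.
  apply: holoB; first by apply: holoN; exact: holoM.
  by apply: holoM; [exact: holo_cst|].
pose f z := zT zeta z * cexp (- h z).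
have key z : 2 / 5 <= Re z <= x0 -> `|Im z - t| <= 1 -> Nc (zT zeta z) <= expR K.
  move=> /andP[z1 z2] z3; apply: le_trans (@zT_le z _) _.
    by apply/andP; split => //; rewrite /x0 in z2; lra.
  rewrite ler_expR /K ler_pM2l //; apply: lg_mono.
  have := ler_normD (Im z - t) t; rewrite subrK => h'.
  by rewrite [leRHS]ger0_norm; have := normr_ge0 t; ulra h' z3.
have sqle (u : R) : `|u| <= 1 -> u ^+ 2 <= 1 by move=> hu; rewrite -(expr1n R 2) le_sqr_norm.
have F1 : Nc (f (b +i* t)) <= 1.
  apply: (@max_rect R f (2 / 5) x0 (t - 1) (t + 1)).
  - by rewrite /= /x0; apply/andP; split; lra.
  - by rewrite /=; apply/andP; split; rlra 0.
  - move=> z /andP[/andP[z1 _] _]; apply: holoM; first by apply: holo_zT => //; apply: Re_neq0; lra.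
    by apply: holo_exp; apply: holoN.
  - case=> u v /andP[/andP[/= /andP[z1 z2] /andP[z3 z4]] H].
    have vt : `|v - t| <= 1 by rewrite ler_norml; apply/andP; split; ulra z3 z4.
    rewrite /f NcM Nc_cexp ReN Reh /= expRN -ler_pdivlMr ?invr_gt0 ?expR_gt0 // invrK mul1r.
    set m := u - x0; have m0 : -1 <= m <= 0 by rewrite /m; move: z1 z2; rewrite /x0 => ? ?; apply/andP; split; rlra 8.
    have mm : 0 <= - m ^+ 2 - m.
      by rewrite (_ : - m ^+ 2 - m = - m * (1 + m)); [apply: mulr_ge0; case/andP: m0 => ? ?; rlra 2|ring].
    have v2 : 0 <= (v - t) ^+ 2 by exact: sqr_ge0.
    have P1 : Nc (zT zeta (u +i* v)) <= expR K by apply: key => //=; rewrite z1 z2.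
    have goalK : 1 <= (v - t) ^+ 2 - m ^+ 2 - 11 * m -> Nc (zT zeta (u +i* v)) <= expR (M + K * ((v - t) ^+ 2 - m ^+ 2 - 11 * m)).
      move=> h1; apply: le_trans P1 _; rewrite ler_expR.
      by apply: (@le_trans _ _ (K * ((v - t) ^+ 2 - m ^+ 2 - 11 * m))); [rewrite ler_peMr // ltW|rewrite lerDr].
    case/or4P: H => /eqP E.
    + apply: goalK; have : m <= - (1 / 10) by rewrite /m E /x0; ulra r0 b1.
      by case/andP: m0 => ? ?; ulra v2 mm.
    + have m00 : m = 0 by rewrite /m E subrr.
      rewrite m00 expr0n /= mulr0 !subr0 -Nc_expG; last by rewrite /= E /x0; ulra r0 b1.
      rewrite ler_expR E; apply: le_trans (HM _ vt) _.
      by rewrite lerDl mulr_ge0 // ltW.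
    + apply: goalK; rewrite E (_ : t - 1 - t = -1) ?sqrrN ?expr1n; last ring.
      by case/andP: m0 => ? ?; rlra 6.
    + apply: goalK; rewrite E (_ : t + 1 - t = 1) ?expr1n; last ring.
      by case/andP: m0 => ? ?; rlra 6.
move: F1; rewrite /f NcM Nc_cexp ReN Reh /= -Nc_expG // -expRD -[leRHS]expR0 ler_expR subr_le0 => F1.
apply: le_trans F1 _; rewrite lerD2l subrr expr0n /= sub0r.
have -> : b - x0 = - r by rewrite /x0; ring.
rewrite sqrrN (_ : 44 * lg (`|t| + 1) * r = K * (11 * r)); last by rewrite /K; ring.
apply: ler_wpM2l; first exact: ltW.
by have := sqr_ge0 r; lra.
Qed.

End MLemma.

(** * Estimates for a kernel that is nonnegative on a vertical line *)

Section ArctanBounds.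
Variable R : realType.
Local Notation C := R[i].
Implicit Types (a b c d x y t e r : R).

Lemma rder_atan c u t : 0 < c -> rder (fun y => c^-1 * atan (c^-1 * (y - u))) t (c ^+ 2 + (t - u) ^+ 2)^-1.
Proof.
move=> c0; have D : rder (fun y => c^-1 * (y - u)) t c^-1.
  apply: rder_eq (rderZ c^-1 (rderB (rder_id t) (rder_cst u t))); ring.
apply: rder_eq (rderZ c^-1 (@rder_comp _ (@atan R) _ _ _ _ (is_derive1_atan _) D)).
have P : 0 <= (t - u) ^+ 2 by exact: sqr_ge0.
have Q : 0 < c ^+ 2 by exact: exprn_gt0.
by field; do ?(apply/andP; split); apply: lt0r_neq0; lra.
Qed.

Lemma atan_diff c u x y : 0 < c -> c^-1 * atan (c^-1 * (y - u)) - c^-1 * atan (c^-1 * (x - u)) <= pi / c.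
Proof.
move=> c0; rewrite -mulrBr mulrC ler_pdivrMr // divfK ?gt_eqF //.
have := atan_ltpi2 (c^-1 * (y - u)); have := atan_gtNpi2 (c^-1 * (x - u)); lra.
Qed.

Lemma Re_cint_le (f : R -> C) (G g : R -> R) a b : a <= b -> segcont f a b ->
  (forall t, a <= t <= b -> rder G t (g t)) ->
  (forall t, a <= t <= b -> Re (f t) <= g t) -> Re (cint f a b) <= G b - G a.
Proof.
move=> ab /prim_ex[F hF] DG H; rewrite (cintE hF) ReD ReN.
apply: (@rder_mono _ (fun t => Re (F t)) (fun t => Re (f t)) G g a b ab _ DG H) => t ht.
by have [] := hF t; rewrite ?inseg_le.
Qed.

Lemma Nc_expI (v : R) : cexp (iC * v%:C) = cos v +i* sin v.
Proof. by rewrite /cexp !ReImE !(mul0r, mulr0, subr0, mul1r, addr0, add0r) expR0 !mul1r. Qed.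

Lemma le_sqr_mul (q x y : R) : 0 <= x -> 0 <= y -> q <= x ^+ 2 -> q <= y ^+ 2 -> q <= x * y.
Proof.
move=> x0 y0 qx qy; have [xy|/ltW yx] := leP x y.
  by apply: le_trans qx _; rewrite expr2; apply: ler_wpM2l.
by apply: le_trans qy _; rewrite expr2; apply: ler_wpM2r.
Qed.

(** Twice [1 + cosh (a p)]: on the imaginary axis it equals [2 + 2 cos (a v) >= 0], while at a real
    point [r] it grows like [e^(a r)]. *)
Definition coshk a (p : C) : C := 2%:C + cexp (a%:C * p) + cexp (- (a%:C * p)).

Lemma coshk_bound a p (m : R) : 0 <= a -> `|Re p| <= m -> Nc (coshk a p) <= 4 * expR (a * m).
Proof.
move=> a0; rewrite ler_norml => /andP[h1 h2].
have am : 0 <= a * m by apply: mulr_ge0 => //; lra.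
have e1 : 1 <= expR (a * m) by rewrite -expR0 ler_expR.
apply: le_trans (NcD _ _) _; apply: le_trans (lerD (NcD _ _) (lexx _)) _.
rewrite !Nc_cexp Nc_real ger0_norm // ReN !ReImE mul0r subr0.
have : expR (a * Re p) <= expR (a * m) by rewrite ler_expR; apply: ler_wpM2l.
have : expR (- (a * Re p)) <= expR (a * m).
  by rewrite ler_expR -mulrN; apply: ler_wpM2l => //; lra.
lra.
Qed.

Lemma coshk_im a v : coshk a (iC * v%:C) = (2 + 2 * cos (a * v))%:C.
Proof.
rewrite /coshk.
have -> : a%:C * (iC * v%:C) = iC * (a * v)%:C :> C by rewrite realC_M; ring.
have -> : - (iC * (a * v)%:C) = iC * (- (a * v))%:C :> C by rewrite realC_N; ring.
rewrite !Nc_expI cosN sinN; apply: Ceq; rewrite !ReImE; ring.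
Qed.

Lemma coshk_real a r : coshk a r%:C = (2 + expR (a * r) + expR (- (a * r)))%:C.
Proof. by rewrite /coshk -realC_M -realC_N !cexp_real -!realC_D. Qed.

Lemma holo_coshk a p : holo (coshk a) p.
Proof.
have h : holo (fun p => a%:C * p) p by apply: holoM; [exact: holo_cst|exact: holo_id].
apply: holoD; first by apply: holoD; [exact: holo_cst|exact: holo_exp].
by apply: holo_exp; exact: holoN.
Qed.

Lemma ker_right (c r v : R) : 24 / 10 <= c <= 25 / 10 -> 0 < r <= 4 / 10 ->
  2 ^+ 2 + v ^+ 2 <= Nc (c +i* v + r%:C) * Nc (c +i* v - r%:C) * (Nc (c +i* v - 4%:C) * Nc (c +i* v + 4%:C)).
Proof.
move=> /andP[c1 c2] /andP[r0 r1].
have m2 (u : R) : `|u| <= r -> 2 ^+ 2 + v ^+ 2 <= Nc (c +i* v + u%:C) ^+ 2.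
  rewrite ler_norml => /andP[h1 h2].
  have h5 : (2 : R) ^+ 2 <= (c + u) ^+ 2 by apply: lerXn2r; rewrite ?nnegrE; lra.
  by rewrite Nc_sqr ImD ReD ReC ImC addr0 /= lerD2r.
have p1 : 2 ^+ 2 + v ^+ 2 <= Nc (c +i* v + r%:C) ^+ 2 by apply: m2; rewrite ger0_norm; lra.
have p2 : 2 ^+ 2 + v ^+ 2 <= Nc (c +i* v - r%:C) ^+ 2 by rewrite -realC_N; apply: m2; rewrite normrN ger0_norm; lra.
have p3 : 1 <= Nc (c +i* v - 4%:C).
  have h : 1 <= `|c - 4| by rewrite ler0_norm; ulra c2.
  by apply: le_trans h _; have := Re_Nc (c +i* v - 4%:C); rewrite ReD ReN ReC.
have p4 : 1 <= Nc (c +i* v + 4%:C).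
  have h : 1 <= `|c + 4| by rewrite ger0_norm; ulra c1.
  by apply: le_trans h _; have := Re_Nc (c +i* v + 4%:C); rewrite ReD ReC.
have Q0 : 0 <= 2 ^+ 2 + v ^+ 2 by rewrite addr_ge0 ?sqr_ge0.
have p12 := le_sqr_mul (Nc_ge0 _) (Nc_ge0 _) p1 p2.
have p34 := ler_pM ler01 ler01 p3 p4.
by apply: le_trans (ler_pM Q0 _ p12 p34); rewrite !mulr1 ?ler01.
Qed.

(** The factor [16 + v^2 >= 16] is spent on [N] and [v^2 <= r^2 + v^2] on [K v^2], which leaves one
    integrable factor in each summand. *)
Lemma ker_left (a r v N K X : R) : 0 < r -> 0 <= N -> 0 <= K -> X <= N + K * v ^+ 2 ->
  X * ((2 + 2 * cos (a * v)) * ((r ^+ 2 + v ^+ 2)^-1 * (4 ^+ 2 + v ^+ 2)^-1)) <=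
  N / 4 * (r ^+ 2 + v ^+ 2)^-1 + 4 * K * (4 ^+ 2 + v ^+ 2)^-1.
Proof.
move=> r0 N0 K0 HX.
have v2 : 0 <= v ^+ 2 := sqr_ge0 v.
have r2 : 0 < r ^+ 2 := exprn_gt0 2 r0.
have d1 : 0 < r ^+ 2 + v ^+ 2 by lra.
have d2 : 0 < 4 ^+ 2 + v ^+ 2 by lra.
have cb : 0 <= 2 + 2 * cos (a * v) <= 4.
  by have := cos_geN1 (a * v); have := cos_le1 (a * v) => ? ?; apply/andP; split; lra.
set k := (2 + 2 * cos (a * v)) * _.
have k0 : 0 <= k by rewrite /k; case/andP: cb => ? ?; rewrite mulr_ge0 // mulr_ge0 // invr_ge0 ltW.
have k4 : k <= 4 * ((r ^+ 2 + v ^+ 2)^-1 * (4 ^+ 2 + v ^+ 2)^-1).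
  by rewrite /k; apply: ler_wpM2r; [rewrite mulr_ge0 ?invr_ge0 ?ltW|case/andP: cb].
apply: le_trans (ler_wpM2r k0 HX) _.
have NK : 0 <= N + K * v ^+ 2 by rewrite addr_ge0 // mulr_ge0.
apply: le_trans (ler_wpM2l NK k4) _.
set i1 := (r ^+ 2 + v ^+ 2)^-1; set i2 := (4 ^+ 2 + v ^+ 2)^-1.
have i10 : 0 <= i1 by rewrite invr_ge0 ltW.
have i20 : 0 <= i2 by rewrite invr_ge0 ltW.
have i2b : i2 <= 16^-1.
  by rewrite /i2 lef_pV2 ?posrE //; lra.
have i1b : v ^+ 2 * i1 <= 1 by rewrite /i1 ler_pdivrMr // mul1r; ulra r2.
have -> : (N + K * v ^+ 2) * (4 * (i1 * i2)) = 4 * (N * i1) * i2 + 4 * (K * i2) * (v ^+ 2 * i1) by ring.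
have -> : N / 4 * i1 + 4 * K * i2 = 4 * (N * i1) * 16^-1 + 4 * (K * i2) * 1 by field.
by apply: lerD; apply: ler_wpM2l; rewrite ?mulr_ge0.
Qed.

(** Up to sign, the residue at [p = r] of [coshk a p / ((r^2 - p^2) (16 - p^2))]. *)
Definition kercoef a r : R := (2 + expR (a * r) + expR (- (a * r))) / (2 * r * (16 - r ^+ 2)).

Lemma kercoefE a r : 0 < r <= 4 / 10 ->
  (kercoef a r)%:C = coshk a r%:C * (r%:C + r%:C)^-1 * (16%:C - r%:C * r%:C)^-1 :> C.
Proof.
move=> /andP[r0 r1]; have r2 : r ^+ 2 <= 1 by rewrite expr_le1 //; lra.
rewrite coshk_real -realC_D -realC_M -realC_B -!realC_V -!realC_M; congr (_%:C); rewrite /kercoef.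
by field; do ?(apply/andP; split); apply: lt0r_neq0; lra.
Qed.

(** [e^3 >= 8] makes the numerator at least 10, and the denominator is at most [32 r]. *)
Lemma kercoef_ge a r : 0 < r <= 4 / 10 -> a * r = 3 -> 5 / (16 * r) <= kercoef a r.
Proof.
move=> /andP[r0 r1] ar; have r2 : r ^+ 2 <= 1 by rewrite expr_le1 //; lra.
have r2' : 0 <= r ^+ 2 := sqr_ge0 r.
have e8 : 8 <= expR (a * r).
  rewrite ar (_ : 3 = 3 * 1); last by rewrite mulr1.
  rewrite expRM_natl (_ : 8 = 2 ^+ 3); last ring.
  by rewrite lerXn2r // ?nnegrE ?expR_ge0 //; have := expR_ge1Dx (1:R); lra.
rewrite /kercoef ler_pdivlMr; last by rewrite !mulr_gt0 //; lra.
have -> : 5 / (16 * r) * (2 * r * (16 - r ^+ 2)) = 5 / 8 * (16 - r ^+ 2) by field; lra.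
have := expR_ge0 (- (a * r)); lra.
Qed.

Lemma ker_assemble (c0 g N K E r p i3 i4 j : R) : 0 < r -> 0 <= N -> 0 <= K -> 1 <= E -> 2 <= p -> 0 <= g ->
  5 / (16 * r) <= c0 -> i4 = i3 + j + 2 * p * c0 * g -> `|j| <= 2 -> `|i3| <= 6 * E * p ->
  i4 <= N / 4 * (p / r) + 4 * K * (p / 4) -> g <= 2 / 5 * N + 2 * K * r + 12 * r * E.
Proof.
move=> r0 N0 K0 E1 p2 g0 c0b EQ; rewrite !ler_norml => /andP[i12 _] /andP[i3l _] B4.
have main : 2 * p * c0 * g <= p * (N / (4 * r) + K + 7 * E).
  have -> : p * (N / (4 * r) + K + 7 * E) = (N / 4 * (p / r) + 4 * K * (p / 4)) + 6 * E * p + E * p by field; lra.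
  have : 2 * 1 <= p * E by apply: ler_pM => //; lra.
  lra.
have {}main : 2 * c0 * g <= N / (4 * r) + K + 7 * E.
  rewrite -(@ler_pM2l _ p); last lra.
  by apply: le_trans main; rewrite le_eqVlt; apply/orP; left; apply/eqP; ring.
have : 2 * (5 / (16 * r)) * g <= N / (4 * r) + K + 7 * E.
  by apply: le_trans main; apply: ler_wpM2r => //; lra.
have -> : 2 * (5 / (16 * r)) * g = g / (8 * r / 5) by field; lra.
rewrite ler_pdivrMr; last by rewrite divr_gt0 // mulr_gt0.
have -> : (N / (4 * r) + K + 7 * E) * (8 * r / 5) = 2 / 5 * N + 8 / 5 * (K * r) + 56 / 5 * (r * E) by field; lra.
have : 0 <= K * r by rewrite mulr_ge0 // ltW.
have : 0 <= r * E by rewrite mulr_ge0 ?ltW //; lra.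
lra.
Qed.

End ArctanBounds.

(** * From the line Re s = b to the line Re s = b + r *)

Section KernelStep.
Variable R : realType.
Local Notation C := R[i].
Implicit Types (z w s : C) (a b c d x y t e r : R).
Variable zeta : C -> C.
Hypothesis hzeta : is_riemann_zeta zeta.
Variables (G L : C -> C).
Hypothesis HG : is_logzeta zeta G.
Hypothesis HL : is_Ln L.

(* The kernel [(1 + cosh (a p)) / ((r^2 - p^2) (16 - p^2))] is nonnegative on the line [Re p = 0], and
   its residue at [r] dominates its mass there once [a r >= 3]. *)
Lemma kernel_step a b r tau (N K : R) : 0 < a -> 2^-1 < b <= 6 / 10 -> 0 < r <= 4 / 10 -> a * r = 3 ->
  0 <= N -> 0 <= K ->
  (forall v, Re (G (b +i* (tau + v))) <= N + K * v ^+ 2) ->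
  Re (G ((b + r) +i* tau)) <= 2 / 5 * N + 2 * K * r + 12 * r * expR (5 / 2 * a).
Proof.
move=> a0 /andP[b1 b2] /andP[r0 r1] ar N0 K0 H.
have rN : 0 <= 2 / 5 * N + 2 * K * r + 12 * r * expR (5 / 2 * a).
  by rewrite !addr_ge0 ?mulr_ge0 ?expR_ge0 // ltW.
(* The right side is nonnegative, so only a nonnegative value matters; [ker_assemble] multiplies it
   by a lower bound of the residue. *)
have [neg|/ltW pos] := leP (Re (G ((b + r) +i* tau))) 0; first exact: le_trans neg rN.
pose E := expR (5 / 2 * a); have E1 : 1 <= E by rewrite -expR0 ler_expR; lra.
have e0 : 0 < b - 2^-1 <= 1 by apply/andP; split; ulra b1 b2.
have [K1 K10 HK1] := G_poly hzeta HG HL e0.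
(* So high that each horizontal side contributes at most 1: there [f] is [O(Y / Y^4)]. *)
pose Y := K1 * (2 + `|tau|) * 12 * E + 1.
have t0 := normr_ge0 tau.
have KE : 0 < K1 * (2 + `|tau|) * 12 * E by rewrite !mulr_gt0 //; ulra E1.
have Y1 : 1 <= Y by rewrite /Y; ulra KE.
pose w := b +i* tau; pose s1 := (b + r) +i* tau.
(* The pole [s1], that is [p = r], is split off for Cauchy's formula; the other poles [p = -r],
   [p = 4] and [p = -4] lie outside the rectangle, where [0 <= Re p <= 5/2]. *)
pose g z := G z * coshk a (z - w) * (- (z - w + r%:C)^-1) * (16%:C - (z - w) * (z - w))^-1.
pose f z := g z / (z - s1).
have s1w z : z - s1 = z - w - r%:C by rewrite /s1 /w; apply: Ceq; rewrite !ReImE; ring.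
have h16 z : Re (z - w) <= 3 -> 0 <= Re (z - w) -> 16%:C - (z - w) * (z - w) != 0.
  move=> h1 h2; have -> : 16%:C - (z - w) * (z - w) = (4%:C - (z - w)) * (4%:C + (z - w)).
    by rewrite (_ : 16%:C = 4%:C * 4%:C :> C); [ring|rewrite -realC_M; congr (_%:C); ring].
  by apply: mulf_neq0; apply: Re_neq0; rewrite !(ReD, ReN) ReC in h1 h2 *; lra.
have hpr z : 0 <= Re (z - w) -> z - w + r%:C != 0.
  by move=> h; apply: Re_neq0; rewrite ReD ReC; ulra h r0.
have zw x y : x +i* y - w = (x - b) +i* (y - tau) by rewrite /w; apply: Ceq; rewrite !ReImE.
have hg z : inrect b 3 (tau - Y) (tau + Y) z -> holo g z.
  move=> /andP[/andP[z1 z2] _].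
  have hzw : holo (fun z => z - w) z by apply: holoB; [exact: holo_id|exact: holo_cst].
  have rz : Re (z - w) = Re z - b by rewrite ReD ReN.
  apply: holoM; last first.
    apply: holoV; first by apply: h16; rewrite rz; ulra z2 e0 z1.
    by apply: holoB; [exact: holo_cst|exact: holoM].
  apply: holoM; last first.
    apply: holoN; apply: holoV; first by apply: hpr; rewrite rz; ulra z1.
    by apply: holoD => //; exact: holo_cst.
  apply: holoM; first by apply: (holo_G HG); ulra z1 e0.
  by apply: (@holo_comp _ (coshk a) (fun z => z - w)) => //; exact: holo_coshk.
have b3 : b <= 3 by ulra e0.
have tY : tau - Y <= tau + Y by ulra Y1.
have CF := @cauchy_formula R g b 3 (tau - Y) (tau + Y) s1 (ltac:(rewrite /=; apply/andP; split; rlra 17)) (ltac:(rewrite /=; apply/andP; split; ulra Y1)) hg.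
have bc : bcont f b 3 (tau - Y) (tau + Y).
  move=> z hz; apply: holo_ccont; apply: holoM; first exact/hg/on_in.
  apply: holoV; last by apply: holoB; [exact: holo_id|exact: holo_cst].
  move: hz => /andP[_ hz]; rewrite subr_eq0; apply: contraTneq hz => ->; rewrite /s1 /=.
  by rewrite !negb_or; repeat (apply/andP; split); apply/eqP; ulra r0 r1 b2 Y1.
have [c1 c2 c3 c4] := bcont_sides b3 tY bc.
have Nf z : Nc (f z) = Nc (G z) * Nc (coshk a (z - w)) / (Nc (z - w + r%:C) * Nc (z - w - r%:C) * Nc (16%:C - (z - w) * (z - w))).
  by rewrite /f /g s1w !(NcM, NcN, NcV) !invfM; ring.
have N16 z : Nc (16%:C - (z - w) * (z - w)) = Nc (z - w - 4%:C) * Nc (z - w + 4%:C).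
  rewrite -NcM -NcN; congr Nc; rewrite (_ : 16%:C = 4%:C * 4%:C :> C); [ring|rewrite -realC_M; congr (_%:C); ring].
have hor y : `|y - tau| = Y -> forall x, inseg b 3 x -> Nc (f (x +i* y)) <= 1 / 3.
  move=> hy x; rewrite inseg_le // => /andP[x1 x2].
  have im u : Y <= Nc ((x +i* y) - w + u%:C).
    by have := Im_Nc ((x +i* y) - w + u%:C); rewrite zw ImD ImC addr0 /= hy.
  have im' u : Y <= Nc ((x +i* y) - w - u%:C).
    by have := im (- u); rewrite realC_N.
  have ay : `|y| <= `|tau| + Y.
    by have := ler_normD (y - tau) tau; rewrite subrK hy; rlra 0.
  rewrite Nf N16.
  have G1 : Nc (G (x +i* y)) <= K1 * ((2 + `|tau|) * Y).
    apply: le_trans (HK1 _ _) _; first by rewrite /=; apply/andP; split; ulra x1 x2.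
    rewrite ler_pM2l //=; have : `|tau| * 1 <= `|tau| * Y by apply: ler_wpM2l.
    ulra ay Y1.
  have C1 : Nc (coshk a (x +i* y - w)) <= 4 * E.
    have := @coshk_bound _ a (x +i* y - w) (5 / 2) (ltW a0); rewrite zw /= => /(_ (ltac:(rewrite ger0_norm; ulra x2 e0 x1))).
    by rewrite mulrC [a * _]mulrC.
  have Y0 : 0 < Y by ulra Y1.
  have D1 : Y * Y * (Y * Y) <= Nc (x +i* y - w + r%:C) * Nc (x +i* y - w - r%:C) * (Nc (x +i* y - w - 4%:C) * Nc (x +i* y - w + 4%:C)).
    have Y2 : 0 <= Y * Y by rewrite mulr_ge0 ?ltW.
    by apply: ler_pM => //; apply: ler_pM; rewrite ?(ltW Y0).
  have YY : 0 < Y * Y * (Y * Y) by rewrite !mulr_gt0.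
  rewrite ler_pdivrMr; last exact: lt_le_trans D1.
  apply: (@le_trans _ _ (1 / 3 * (Y * Y * (Y * Y)))); last by apply: ler_wpM2l => //; lra.
  apply: (@le_trans _ _ (K1 * ((2 + `|tau|) * Y) * (4 * E))); first by apply: ler_pM; rewrite ?Nc_ge0.
  have -> : K1 * ((2 + `|tau|) * Y) * (4 * E) = (K1 * (2 + `|tau|) * 12 * E) * Y / 3 by field.
  have : (K1 * (2 + `|tau|) * 12 * E) * Y <= Y * Y by apply: ler_wpM2r; rewrite ?ltW // /Y; rlra 0.
  have : 1 * (Y * Y) <= Y * Y * (Y * Y) by apply: ler_wpM2r; [rewrite mulr_ge0 // ltW|exact: mulr_ege1].
  rlra 0.
have B1 : Nc (cint (fun x => f (x +i* (tau - Y))) b 3) <= 1.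
  apply: le_trans (cint_bound c1 (hor _ _)) _.
    by rewrite addrAC subrr add0r normrN ger0_norm //; ulra tY.
  by rewrite ger0_norm; ulra e0 b3.
have B2 : Nc (cint (fun x => f (x +i* (tau + Y))) b 3) <= 1.
  apply: le_trans (cint_bound c2 (hor _ _)) _.
    by rewrite addrAC subrr add0r ger0_norm //; ulra tY.
  by rewrite ger0_norm; ulra e0 b3.
have B3 : Nc (cint (fun y => f (3 +i* y)) (tau - Y) (tau + Y)) <= 6 * E * pi.
  have D t : tau - Y <= t <= tau + Y -> rder (fun y => 12 * E * (2^-1 * atan (2^-1 * (y - tau)))) t (12 * E * (2 ^+ 2 + (t - tau) ^+ 2)^-1).
    by move=> _; apply: rderZ; exact: rder_atan.
  apply: le_trans (cint_le tY c3 D _) _.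
    move=> t _; rewrite Nf N16.
    have D1 : 2 ^+ 2 + (t - tau) ^+ 2 <= Nc (3 +i* t - w + r%:C) * Nc (3 +i* t - w - r%:C) * (Nc (3 +i* t - w - 4%:C) * Nc (3 +i* t - w + 4%:C)).
      by rewrite zw; apply: ker_right; apply/andP; split; ulra b2 e0 r0 r1.
    have Q0 : 0 < 2 ^+ 2 + (t - tau) ^+ 2 by rewrite ltr_pwDl ?sqr_ge0 // exprn_gt0.
    rewrite ler_pdivrMr; last exact: lt_le_trans D1.
    rewrite mulrAC ler_pdivlMr //.
    have C1 : Nc (coshk a (3 +i* t - w)) <= 4 * E.
      have := @coshk_bound _ a (3 +i* t - w) (5 / 2) (ltW a0); rewrite zw /= => /(_ (ltac:(rewrite ger0_norm; ulra e0 b3))).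
      by rewrite mulrC [a * _]mulrC.
    have G3' : Nc (G (3 +i* t)) <= 3 by apply: (G3 hzeta HG HL).
    have P1 : Nc (G (3 +i* t)) * Nc (coshk a (3 +i* t - w)) <= 12 * E.
      by have -> : 12 * E = 3 * (4 * E); [ring|apply: ler_pM; rewrite ?Nc_ge0].
    by apply: ler_pM => //; [rewrite mulr_ge0 ?Nc_ge0|exact: ltW].
  have -> : 6 * E * pi = 12 * E * (pi / 2) by field.
  rewrite -mulrBr; apply: ler_wpM2l; first by apply: mulr_ge0 => //; ulra E1.
  exact: atan_diff.
have B4 : Re (cint (fun y => f (b +i* y)) (tau - Y) (tau + Y)) <= N / 4 * (pi / r) + 4 * K * (pi / 4).
  have D t : tau - Y <= t <= tau + Y -> rder (fun y => N / 4 * (r^-1 * atan (r^-1 * (y - tau))) + 4 * K * (4^-1 * atan (4^-1 * (y - tau)))) t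
      (N / 4 * (r ^+ 2 + (t - tau) ^+ 2)^-1 + 4 * K * (4 ^+ 2 + (t - tau) ^+ 2)^-1).
    by move=> _; apply: rderD; apply: rderZ; exact: rder_atan.
  apply: le_trans (Re_cint_le tY c4 D _) _; last first.
    set A1 := r^-1 * atan _; set A2 := 4^-1 * atan _; set A3 := r^-1 * atan _; set A4 := 4^-1 * atan _.
    have -> : N / 4 * A1 + 4 * K * A2 - (N / 4 * A3 + 4 * K * A4) = N / 4 * (A1 - A3) + 4 * K * (A2 - A4) by ring.
    apply: lerD; apply: ler_wpM2l; [by rewrite divr_ge0|exact: atan_diff|by rewrite mulr_ge0|exact: atan_diff].
  move=> t _; set v := t - tau.
  have pE : b +i* t - w = iC * v%:C by rewrite zw subrr /v; apply: Ceq; rewrite !ReImE; ring.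
  have fE : f (b +i* t) = G (b +i* t) * ((2 + 2 * cos (a * v)) * ((r ^+ 2 + v ^+ 2)^-1 * (4 ^+ 2 + v ^+ 2)^-1))%:C.
    rewrite /f /g s1w pE coshk_im.
    have e1 : (r ^+ 2 + v ^+ 2)%:C = - (iC * v%:C + r%:C) * (iC * v%:C - r%:C).
      have -> : - (iC * v%:C + r%:C) * (iC * v%:C - r%:C) = r%:C * r%:C - (iC * iC) * (v%:C * v%:C) by ring.
      by rewrite ii realC_D !expr2 !realC_M; ring.
    have e2 : (4 ^+ 2 + v ^+ 2)%:C = 16%:C - (iC * v%:C) * (iC * v%:C).
      have -> : 16%:C - (iC * v%:C) * (iC * v%:C) = 16%:C - (iC * iC) * (v%:C * v%:C) by ring.
      rewrite ii realC_D !expr2 !realC_M -[in LHS]realC_M (_ : 4 * 4 = 16); [ring|ring].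
    rewrite !realC_M !realC_V e1 e2 invfM invrN; ring.
  rewrite fE ReM ReC ImC mulr0 subr0.
  by apply: ker_left => //; have := H v; rewrite /v addrC subrK.
have gs1 : g s1 = - (G s1 * (kercoef a r)%:C).
  have e1 : s1 - w = r%:C by rewrite /s1 zw; apply: Ceq; rewrite !ReImE /=; ring.
  by rewrite /g e1 kercoefE ?r0 //; ring.
move: CF; rewrite -/(f) gs1 /rect.
set I1 := cint _ b 3; set I2 := cint _ b 3; set I3 := cint _ _ (tau + Y); set I4 := cint _ _ (tau + Y).
move=> CF.
have EQ : Re I4 = Re I3 + Im (I1 - I2) + 2 * pi * kercoef a r * Re (G s1).
  move/(congr1 (@Im R)): CF; rewrite /twoipi; clear; move: I1 I2 I3 I4 (G s1) => I1 I2 I3 I4 z.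
  rewrite !ReImE; rlra 0.
apply: (@ker_assemble R (kercoef a r) _ N K E r pi (Re I3) (Re I4) (Im (I1 - I2))) => //.
- exact: pi_ge2.
- by apply: kercoef_ge; rewrite ?r0.
- by apply: le_trans (Im_Nc _) _; apply: le_trans (NcB _ _) _; rewrite (_ : 2 = 1 + 1); [exact: lerD|ring].
- exact: le_trans (Re_Nc _) B3.
Qed.

End KernelStep.

(** * Elementary inequalities for iterated logarithms *)

Section RealLogs.
Variable R : realType.
Implicit Types (x y T l : R).

Lemma ln_le_sub1 x : 0 < x -> ln x <= x - 1.
Proof. by move=> x0; have := expR_ge1Dx (ln x); rewrite lnK ?posrE //; lra. Qed.

(** [ln] is 0 on nonpositive arguments, so a positive lower bound for [ln (ln T)] already forces [T]
    and [ln T] above 1. *)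
Lemma lnln_gt T m : 0 < m -> m <= ln (ln T) -> [/\ 1 < ln T, 1 < T & expR m <= ln T].
Proof.
move=> m0 h; have h1 : 1 < ln T.
  have [l1|//] := leP (ln T) 1.
  have [l0|l0] := leP (ln T) 0; first by move: h; rewrite ln0 //; lra.
  by have := ln_le_sub1 l0; lra.
have T1 : 1 < T.
  have [t1|//] := leP T 1.
  have [t0|t0] := leP T 0; first by move: h1; rewrite ln0 //; lra.
  by have := ln_le_sub1 t0; lra.
split=> //; rewrite -[leRHS]lnK ?posrE ?ler_expR //; lra.
Qed.

Lemma sqr_le_exp x : 0 <= x -> x ^+ 2 / 4 <= expR x.
Proof.
move=> x0; have -> : x = 2%:R * (x / 2) by field.
rewrite expRM_natl; have h := expR_ge1Dx (x / 2).
have -> : (2 * (x / 2)) ^+ 2 / 4 = (x / 2) ^+ 2 by field.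
by apply: lerXn2r; rewrite ?nnegrE ?expR_ge0 //; lra.
Qed.

Lemma le_norm_sqr x : 1 <= `|x| -> `|x| <= x ^+ 2.
Proof.
move=> h; rewrite -real_normK ?num_real // expr2 -[X in X <= _]mul1r.
by apply: ler_wpM2r.
Qed.

Lemma lg_shift T t x : 0 <= T -> `|t| <= 2 * T -> lg (t + x) <= ln (7 + 2 * T) + `|x|.
Proof.
move=> T0 ht; have x0 := normr_ge0 x; have tx := ler_normD t x; have tx0 := normr_ge0 (t + x).
rewrite /lg -ler_expR expRD lnK ?posrE; last lra.
rewrite lnK ?posrE; last lra.
have e1 := expR_ge1Dx `|x|.
have : (7 + 2 * T) * (1 + `|x|) <= (7 + 2 * T) * expR `|x| by apply: ler_wpM2l => //; lra.
have : 0 <= T * `|x| by apply: mulr_ge0.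
lra.
Qed.

End RealLogs.

(** * The bound log T / log log T for the real part of [G] *)

Section MBound.
Variable R : realType.
Local Notation C := R[i].
Implicit Types (z w s : C) (a b c d x y t e r : R).
Variable zeta : C -> C.
Hypothesis hzeta : is_riemann_zeta zeta.
Variables (G L : C -> C).
Hypothesis HG : is_logzeta zeta G.
Hypothesis HL : is_Ln L.

(** [kernel_step] turns a bound [N] on the line [b] into [2/5 N + 36 r l] at [b + r], and
    [three_lines] returns to [b] for another [88 r l]. As [248 = 2 (36 + 88)], one round halves the
    first term. It costs 1 in height for the window of [three_lines] and 1 for the part [|v| <= 1]
    of the kernel; for larger [v] the trivial bound is absorbed by [12 l v^2]. *)
Lemma M_iter (T l r a : R) : 1 <= l -> 1 <= T -> ln (7 + 2 * T) <= 2 * l -> 0 < a -> a * r = 3 -> 0 < r <= 4 / 10 ->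
  expR (5 / 2 * a) <= l ->
  forall j : nat, forall b t, 2^-1 < b <= 6 / 10 -> `|t| <= 2 * T - 2 * j%:R ->
  Re (G (b +i* t)) <= 12 * l / 2 ^+ j + 248 * (r * l).
Proof.
move=> l1 T1 lT a0 ar /andP[r0 r1] El.
have rl : 0 < r * l by rewrite mulr_gt0 //; lra.
have lgb t : `|t| <= 2 * T -> lg t <= 2 * l.
  move=> ht; apply: le_trans lT; have := normr_ge0 t => h; rewrite /lg ler_ln ?posrE; ulra ht h.
elim=> [|j IH] b t /andP[b1 b2] ht.
  rewrite mulr0 subr0 in ht; apply: le_trans (ReG_le hzeta HG _) _; first by rewrite /=; apply/andP; split; ulra b1 b2.
  by have := lgb _ ht; rewrite /= expr0 divr1; lra.
have j0 : 0 <= j%:R :> R by rewrite ler0n.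
have jS : j.+1%:R = j%:R + 1 :> R by rewrite -natr1.
have t0 := normr_ge0 t.
pose N := 12 * l / 2 ^+ j + 248 * (r * l).
have p2 : 0 < 2 ^+ j :> R by rewrite exprn_gt0.
have q0 : 0 <= 12 * l / 2 ^+ j by rewrite divr_ge0 ?ltW //; ulra l1.
have N0 : 0 <= N by rewrite /N; ulra q0 rl.
have step tau : `|tau - t| <= 1 -> Re (G ((b + r) +i* tau)) <= 2 / 5 * N + 36 * (r * l).
  move=> htau.
  have ta : `|tau| <= 2 * T - 2 * j%:R - 1.
    by have := ler_normD (tau - t) t; rewrite subrK jS in ht *; ulra ht htau.
  apply: le_trans (kernel_step hzeta HG HL a0 _ _ ar N0 (_ : 0 <= 12 * l) _) _; rewrite ?b1 ?r0 //; first rlra 23.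
    move=> v; have := normr_ge0 v; have tn := normr_ge0 tau => v0; have tv := ler_normD tau v.
    have K0 : 0 <= 12 * l * v ^+ 2 by apply: mulr_ge0; [ulra l1|exact: sqr_ge0].
    have [v1|v1] := leP `|v| 1.
      apply: le_trans (IH b (tau + v) _ _) _; rewrite ?b1 //; first lra.
      by rewrite -/N; ulra K0.
    apply: le_trans (ReG_le hzeta HG _) _; first by rewrite /=; apply/andP; split; ulra b1 b2.
    rewrite [Im _]/=.
    have v2 : `|v| <= v ^+ 2.
      exact: le_norm_sqr (ltW v1).
    have h : lg (tau + v) <= ln (7 + 2 * T) + `|v|.
      by apply: lg_shift; ulra t0 j0 ht ta.
    have vq : 1 <= v ^+ 2 := le_trans (ltW v1) v2.
    have : 2 * l * 1 <= 2 * l * v ^+ 2 by apply: ler_wpM2l; ulra l1 vq.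
    have : 1 * v ^+ 2 <= l * v ^+ 2 by apply: ler_wpM2r; ulra l1 vq.
    by rewrite -[2 * l * _]mulrA -[12 * l * _]mulrA; lra.
  have : r * expR (5 / 2 * a) <= r * l by apply: ler_wpM2l => //; exact: ltW.
  by rewrite -[12 * r * _]mulrA; rlra 0.
apply: le_trans (three_lines hzeta HG b1 r0 _ _ step) _; [ulra b2 r1|ulra N0 rl|].
have h : lg (`|t| + 1) <= 2 * l by apply: lgb; rewrite jS in ht; rewrite ger0_norm; ulra ht j0 t0.
have : r * lg (`|t| + 1) <= r * (2 * l) by apply: ler_wpM2l => //; exact: ltW.
have -> : 12 * l / 2 ^+ j.+1 = 12 * l / 2 ^+ j / 2 by rewrite exprS; field; exact: lt0r_neq0.
rewrite /N; ulra q0 rl.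
Qed.

Definition M0 : R := 12 + 248 * 18.

Lemma M0_ge : 12 <= M0.
Proof. by rewrite /M0; lra. Qed.

(** With [a = ll / 6] and [r = 18 / ll] one has [a r = 3] and [e^(5 a / 2) <= l], while [r l] has
    the desired size. About [ll] rounds bring [12 l / 2^J] below [12 l / ll]. The threshold 45 means
    [r <= 4/10]. *)
Lemma M_lemma T b t : 45 <= ln (ln T) -> 2^-1 < b <= 6 / 10 -> `|t| <= T ->
  Re (G (b +i* t)) <= M0 * (ln T / ln (ln T)).
Proof.
move=> h45 hb ht; set l := ln T; set ll := ln l.
have [l1 T1 le] := lnln_gt (ltac:(lra) : 0 < 45 :> R) h45; rewrite -/l -/ll in h45 l1 le.
have ll0 : 0 < ll by lra.
have l100 : 46 <= l by have := expR_ge1Dx (45:R); lra.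
have Tl : l ^+ 2 / 4 <= T by have := sqr_le_exp (ltac:(ulra l100) : 0 <= l); rewrite /l lnK ?posrE //; ulra T1.
have T8 : 11 * l <= T.
  apply: le_trans Tl; rewrite expr2; have : 46 * l <= l * l by apply: ler_wpM2r; ulra l100.
  lra.
have lT : ln (7 + 2 * T) <= 2 * l.
  have -> : 2 * l = ln (T ^+ 2) by rewrite lnXn ?mulr_natl //; lra.
  have T0 : 0 < T by lra.
  rewrite ler_ln ?posrE ?exprn_gt0 //; last lra.
  rewrite expr2; have : 46 * T <= T * T by apply: ler_wpM2r; ulra T0 T8 l100.
  lra.
have E : expR (5 / 2 * (ll / 6)) <= l.
  by rewrite -[leRHS]lnK ?posrE ?ler_expR -/ll; ulra ll0 l100.
have [J [J1 J2]] : exists J : nat, ll < J%:R /\ J%:R <= ll + 1.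
  exists (Num.truncn ll).+1; split; first by rewrite -truncn_le_nat.
  by rewrite -natr1 lerD2r -truncn_ge_nat // ltW.
have lll : ll <= l - 1 by apply: ln_le_sub1; lra.
apply: le_trans (@M_iter T l (18 / ll) (ll / 6) _ _ lT _ _ _ E J b t hb _) _; try lra.
- by field; ulra ll0.
- by rewrite divr_gt0 //= ler_pdivrMr //; ulra h45.
have p2 : ll <= 2 ^+ J.
  have h : (J < 2 ^ J)%N by exact: ltn_expl.
  by apply: le_trans (ltW J1) _; rewrite -natrX ler_nat ltnW.
have : 12 * l / 2 ^+ J <= 12 * l / ll.
  by apply: ler_wpM2l; [ulra l100|rewrite lef_pV2 ?posrE // exprn_gt0].
have -> : M0 * (l / ll) = 12 * l / ll + 248 * (18 / ll * l) by rewrite /M0; ring.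
rlra 0.
Qed.

(** Up to [2 T] the bound of [M_lemma] at height [2 T] is at most twice the one at [T]; beyond,
    [(|t| - T)^2 >= |t| / 2] absorbs the trivial bound. *)
Lemma M_all T b t : 45 <= ln (ln T) -> 2^-1 < b <= 6 / 10 ->
  Re (G (b +i* t)) <= 2 * M0 * (ln T / ln (ln T)) * (1 + (`|t| - T) ^+ 2).
Proof.
have m0 := M0_ge; move=> h45 hb; set l := ln T; set ll := ln l.
have [l1 T1 le] := lnln_gt (ltac:(lra) : 0 < 45 :> R) h45; rewrite -/l -/ll in h45 l1 le.
have ll0 : 0 < ll by lra.
have lll : ll <= l - 1 by apply: ln_le_sub1; lra.
have M1 : 1 <= l / ll by rewrite ler_pdivlMr //; lra.
have s0 : 0 <= (`|t| - T) ^+ 2 := sqr_ge0 _.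
have [tT|tT] := leP `|t| T.
  have := M_lemma h45 hb tT; rewrite -/l -/ll.
  have h1 : l / ll * 1 <= l / ll * (1 + (`|t| - T) ^+ 2) by apply: ler_wpM2l; ulra M1 s0.
  move=> h; apply: le_trans h _; rewrite -mulrA; have : M0 * (l / ll * 1) <= M0 * (l / ll * (1 + (`|t| - T) ^+ 2)) by apply: ler_wpM2l => //; ulra m0.
  have : 0 <= M0 * (l / ll * (1 + (`|t| - T) ^+ 2)) by apply: mulr_ge0; [ulra m0|apply: mulr_ge0; ulra M1 s0].
  lra.
have [t2|t2] := leP `|t| (2 * T).
  have l2 : l <= ln (2 * T) by rewrite ler_ln ?posrE; ulra t2 tT.
  have l2' : ln (2 * T) <= 2 * l.
    have h2 : ln 2 <= l / 2 by have := @ln_le_sub1 R 2 (ltac:(rlra 0)); have := expR_ge1Dx (45:R); ulra le.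
    by rewrite lnM ?posrE -/l; ulra h2 lll ll0 t2 tT.
  have ll2 : ll <= ln (ln (2 * T)) by rewrite ler_ln ?posrE; ulra l2 lll ll0.
  have h452 : 45 <= ln (ln (2 * T)) by ulra ll2 h45.
  apply: le_trans (M_lemma h452 hb t2) _.
  have : ln (2 * T) / ln (ln (2 * T)) <= 2 * l / ll.
    by apply: ler_pM; [ulra l2' l2|rewrite invr_ge0; ulra h452|ulra l2'|rewrite lef_pV2 ?posrE; ulra ll2 h452 ll0].
  have h1 : l / ll * 1 <= l / ll * (1 + (`|t| - T) ^+ 2) by apply: ler_wpM2l; ulra M1 s0.
  rewrite -[2 * l / ll]mulrA => h; rewrite -!mulrA [X in _ <= X]mulrCA; apply: ler_wpM2l; ulra m0 h h1.
apply: le_trans (ReG_le hzeta HG _) _; first by move: hb => /andP[? ?]; rewrite /=; apply/andP; split; rlra 2.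
have := lg_le t; rewrite [Im _]/=.
have h : `|t| / 2 * 1 <= (`|t| - T) ^+ 2 by rewrite expr2; apply: ler_pM; ulra tT T1 t2.
have h1 : 1 * (1 + (`|t| - T) ^+ 2) <= l / ll * (1 + (`|t| - T) ^+ 2) by apply: ler_wpM2r; ulra s0 M1.
have : 12 * (l / ll * (1 + (`|t| - T) ^+ 2)) <= M0 * (l / ll * (1 + (`|t| - T) ^+ 2)) by apply: ler_wpM2r => //; ulra h1 s0.
rewrite -!mulrA; ulra h h1 tT T1 t2.
Qed.

End MBound.

(** * Majorants of exponential type *)

Section ExponentialType.
Variable R : realType.
Local Notation C := R[i].
Implicit Types (f g : C -> C) (z w : C) (a b x y t r : R) (n m : nat).

(** The removable singularity is filled with the Cauchy transform [T] of [f(z) / (z - w)], which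
    agrees with the quotient near [w]. [g] is holomorphic wherever [f] is, not only in the
    square. *)
Lemma holo_div_at f w r : 0 < r -> (forall z, insq w r z -> holo f z) -> f w = 0 ->
  exists2 g, (forall z, holo f z -> holo g z) & forall z, f z = (z - w) * g z.
Proof.
move=> r0 hf fw.
pose T w' := (twoipi R)^-1 * sqrect (fun z => f z / (z - w) * (z - w')^-1) w r.
pose g z := if z == w then T w else f z / (z - w).
have nz z : onsq w r z -> z - w != 0.
  by move=> /(onsq_dist (ltW r0)) h; rewrite -Nc_gt0; apply: lt_le_trans h.
have bc : bcont (fun z => f z / (z - w)) (Re w - r) (Re w + r) (Im w - r) (Im w + r).
  move=> z hz; apply: holo_ccont; apply: holoM; first exact/hf/onsq_in.
  apply: holoV; first exact: nz.
  by apply: holoB; [exact: holo_id|exact: holo_cst].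
have [h1 h2] := sq_le w (ltW r0).
exists g; last first.
  by move=> z; rewrite /g; case: eqVneq => [->|zw]; rewrite ?fw ?subrr ?mul0r // mulrC divfK // subr_eq0.
have gT w' : Nc (w' - w) < r -> T w' = g w'.
  move=> hw; rewrite /g; case: eqVneq => [->//|ww].
  have ww' : w' - w != 0 by rewrite subr_eq0.
  have nz' z : onsq w r z -> z - w' != 0.
    move=> /(onsq_dist (ltW r0)) h; rewrite subr_eq0; apply: contraTneq h => ->.
    by rewrite -ltNge.
  have b0 u : (forall z, onsq w r z -> z - u != 0) ->
     bcont (fun z => f z * (z - u)^-1) (Re w - r) (Re w + r) (Im w - r) (Im w + r).
    move=> h z hz; apply: holo_ccont; apply: holoM; first exact/hf/onsq_in.
    apply: holoV; first exact: h.
    by apply: holoB; [exact: holo_id|exact: holo_cst].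
  have -> : T w' = (twoipi R)^-1 * sqrect (fun z => (w' - w)^-1 * (f z * (z - w')^-1 - f z * (z - w)^-1)) w r.
    congr (_ * _); apply: rect_ext => // z hz.
    by field; rewrite nz // nz' // ww'.
  rewrite rectZ //; last first.
    by move=> z hz; apply: ccontD; [exact: b0 nz' z hz|apply: ccontN; exact: b0 nz z hz].
  rewrite rectB //; last exact: b0.
  rewrite !cauchy_sq // ?subrr ?Nc0 // fw mulr0 subr0.
  by field; rewrite ww' twoipi_neq0.
move=> z fz; have [->|zw] := eqVneq z w.
  apply: (@holo_loc _ T _ _ r) => //.
  apply: holoM; first exact: holo_cst.
  by eexists; exact: (cauchy_transform r0 bc).1.
have zw0 : 0 < Nc (z - w) by rewrite Nc_gt0 subr_eq0.
apply: (@holo_loc _ (fun z => f z / (z - w)) _ _ (Nc (z - w))) => //.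
  move=> u hu; rewrite /g; case: eqVneq => // E; move: hu.
  by rewrite E NcBC ltxx.
apply: holoM => //; apply: holoV; first by rewrite subr_eq0.
by apply: holoB; [exact: holo_id|exact: holo_cst].
Qed.

Lemma holo_div f w : (forall z, holo f z) -> f w = 0 ->
  exists2 g, (forall z, holo g z) & forall z, f z = (z - w) * g z.
Proof.
move=> hf fw; have [g hg fg] := @holo_div_at f w 1 ltr01 (fun z _ => hf z) fw.
by exists g => // z; exact: hg.
Qed.

(** Exponential type [a] with decay of order [n] along horizontal lines. *)
Definition expdec f a n := exists2 c : R, 0 < c &
  forall z, Nc (f z) * (1 + Nc z) ^+ n <= c * expR (a * `|Im z|).

Lemma onep_gt0 z : 0 < 1 + Nc z. Proof. by have := Nc_ge0 z; lra. Qed.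

Lemma expdecM f g a b n m : expdec f a n -> expdec g b m -> expdec (fun z => f z * g z) (a + b) (n + m).
Proof.
move=> [c c0 hc] [d d0 hd]; exists (c * d); first exact: mulr_gt0.
move=> z; rewrite NcM exprD mulrDl expRD mulrACA [c * d * _]mulrACA.
by apply: ler_pM => //; rewrite mulr_ge0 ?Nc_ge0 ?exprn_ge0 ?ltW ?onep_gt0.
Qed.

Lemma expdecD f g a n : expdec f a n -> expdec g a n -> expdec (fun z => f z + g z) a n.
Proof.
move=> [c c0 hc] [d d0 hd]; exists (c + d); first exact: addr_gt0.
move=> z; rewrite [X in _ <= X]mulrDl; apply: le_trans (lerD (hc z) (hd z)); rewrite -mulrDl.
by apply: ler_wpM2r; [rewrite exprn_ge0 ?ltW ?onep_gt0|exact: NcD].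
Qed.

Lemma expdecZ (k : C) f a n : expdec f a n -> expdec (fun z => k * f z) a n.
Proof.
move=> [c c0 hc]; exists ((1 + Nc k) * c); first by rewrite mulr_gt0 ?onep_gt0.
move=> z; have p := ltW (exprn_gt0 n (onep_gt0 z)).
rewrite NcM -!mulrA; apply: ler_pM; rewrite ?Nc_ge0 //; first by rewrite mulr_ge0 ?Nc_ge0.
by rewrite lerDr.
Qed.

Lemma expdecW f a b n m : a <= b -> (m <= n)%N -> expdec f a n -> expdec f b m.
Proof.
move=> ab mn [c c0 hc]; exists c => // z; apply: le_trans (le_trans (hc z) _).
  apply: ler_wpM2l; first exact: Nc_ge0.
  by apply: ler_weXn2l => //; have := Nc_ge0 z; lra.
by apply: ler_wpM2l; [exact: ltW|rewrite ler_expR; apply: ler_wpM2r].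
Qed.

Lemma expdec_near f a n (r : R) : 0 <= a -> 0 <= r -> expdec f a n -> exists2 c : R, 0 < c &
  forall z w, Nc (w - z) <= r -> Nc (f w) * (1 + Nc z) ^+ n <= c * expR (a * `|Im z|).
Proof.
move=> a0 r0 [c c0 hc]; exists (c * expR (a * r) * (1 + r) ^+ n).
  by rewrite !mulr_gt0 ?expR_gt0 ?exprn_gt0 //; lra.
move=> z w wz.
have h1 : 1 + Nc z <= (1 + Nc w) * (1 + r).
  have := NcD (z - w) w; rewrite subrK NcBC => h.
  have : 0 <= Nc w * r by rewrite mulr_ge0 ?Nc_ge0.
  by rewrite mulrDl !mulrDr !mul1r !mulr1; lra.
have h2 : expR (a * `|Im w|) <= expR (a * r) * expR (a * `|Im z|).
  rewrite -expRD -mulrDr ler_expR; apply: ler_wpM2l => //.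
  have := ler_normD (Im (w - z)) (Im z); rewrite -ImD subrK.
  by have := Im_Nc (w - z); lra.
have p0 : 0 <= (1 + r) ^+ n by rewrite exprn_ge0 //; lra.
apply: (@le_trans _ _ (Nc (f w) * ((1 + Nc w) * (1 + r)) ^+ n)).
  apply: ler_wpM2l; first exact: Nc_ge0.
  have q0 := onep_gt0 z.
  by apply: lerXn2r; rewrite ?nnegrE //; ulra q0 h1.
rewrite exprMn mulrA; have -> : c * expR (a * r) * (1 + r) ^+ n * expR (a * `|Im z|) =
  c * (expR (a * r) * expR (a * `|Im z|)) * (1 + r) ^+ n by ring.
apply: ler_wpM2r => //; apply: le_trans (hc w) _.
by apply: ler_wpM2l h2; exact: ltW.
Qed.

Lemma expdec_shift f a n x : 0 <= a -> expdec f a n -> expdec (fun z => f (z - x%:C)) a n.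
Proof.
move=> a0 /(expdec_near a0 (normr_ge0 x))[c c0 hc]; exists c => // z; apply: hc.
by rewrite addrAC subrr add0r NcN Nc_real.
Qed.

Lemma cD_cauchy f w r : 0 < r -> (forall z, insq w r z -> holo f z) ->
  cD f w = (twoipi R)^-1 * sqrect (fun z => f z * ((z - w) ^+ 2)^-1) w r.
Proof.
move=> r0 hf.
have bc : bcont f (Re w - r) (Re w + r) (Im w - r) (Im w + r).
  by move=> z hz; apply: holo_ccont; exact/hf/onsq_in.
apply: cDE; apply: (@cder_loc _ (fun w' => (twoipi R)^-1 * sqrect (fun z => f z * (z - w')^-1) w r) _ _ _ r) => //.
  by move=> w' h; rewrite cauchy_sq // mulrA mulVf ?mul1r // twoipi_neq0.
by apply: cderZ; exact: (cauchy_transform r0 bc).1.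
Qed.

(** Cauchy's formula on a square of fixed size about [w], on which the bound of [f] changes only by
    a constant factor. *)
Lemma expdec_cD f a n : 0 <= a -> (forall z, holo f z) -> expdec f a n -> expdec (cD f) a n.
Proof.
move=> a0 hf /(expdec_near a0 (ler0n R 2))[c c0 hc]; exists (8 * c / (2 * pi)).
  by rewrite divr_gt0 ?mulr_gt0 ?pi_gt0.
move=> w; rewrite (@cD_cauchy f w 1) // NcM NcV.
have -> : Nc (twoipi R) = 2 * pi :> R.
  by rewrite /twoipi NcM Nc_i mul1r Nc_real ger0_norm // mulr_ge0 // ltW // pi_gt0.
have P0 : 0 < (1 + Nc w) ^+ n by rewrite exprn_gt0 ?onep_gt0.
have [h1 h2] := sq_le w (@ler01 R).
pose K := c * expR (a * `|Im w|) / (1 + Nc w) ^+ n.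
have nz z : onsq w 1 z -> 1 <= Nc (z - w) by apply: onsq_dist.
have B : Nc (sqrect (fun z => f z * ((z - w) ^+ 2)^-1) w 1) <= K * 8.
  have -> : (8 : R) = 2 * ((Re w + 1 - (Re w - 1)) + (Im w + 1 - (Im w - 1))) by ring.
  apply: rect_bound => //.
    move=> z hz; have h := nz z hz; apply: holo_ccont; apply: holoM => //; apply: holoV.
      by rewrite -Nc_gt0 NcX exprn_gt0 //; lra.
    by apply: holoX; apply: holoB; [exact: holo_id|exact: holo_cst].
  move=> z hz; have h := nz z hz; rewrite NcM NcV NcX /K.
  have fz : Nc (f z) <= c * expR (a * `|Im w|) / (1 + Nc w) ^+ n.
    rewrite ler_pdivlMr //; apply: hc.
    by have := insq_Nc2 (onsq_in hz); rewrite mulr1.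
  apply: le_trans fz; rewrite -[X in _ <= X]mulr1; apply: ler_wpM2l; first exact: Nc_ge0.
  by rewrite invf_le1 ?exprn_ege1 // exprn_gt0 //; lra.
rewrite -mulrA ler_pdivrMl ?mulr_gt0 ?pi_gt0 // mulrA.
have -> : 2 * pi * (8 * c / (2 * pi)) * expR (a * `|Im w|) = K * 8 * (1 + Nc w) ^+ n.
  rewrite /K; move: P0 (pi_gt0 R); clear; move: (expR _) (_ ^+ n) (@pi R) => e P p P0 p0.
  by field; rewrite !lt0r_neq0.
by apply: ler_wpM2r B; exact: ltW.
Qed.

Definition csin z : C := (cexp (iC * z) - cexp (- (iC * z))) / (iC * 2).

Lemma holo_csin z : holo csin z.
Proof.
have h : holo (fun z => iC * z) z by apply: holoM; [exact: holo_cst|exact: holo_id].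
apply: holoM; last exact: holo_cst.
by apply: holoB; apply: holo_exp => //; exact: holoN.
Qed.

Lemma csin_real x : csin x%:C = (sin x)%:C.
Proof.
have -> : csin x%:C = (cexp (iC * x%:C) - cexp (iC * (- x)%:C)) / (iC * 2) by rewrite /csin realC_N mulrN.
rewrite !Nc_expI cosN sinN.
have -> : cos x +i* sin x - (cos x +i* - sin x) = (sin x)%:C * (iC * 2).
  by apply: Ceq; rewrite -[2 : C]realC_nat !ReImE; ring.
by rewrite mulfK // mulf_neq0 ?i_neq0 // pnatr_eq0.
Qed.

Lemma csin_bound z : Nc (csin z) <= expR `|Im z|.
Proof.
rewrite /csin NcM NcV NcM Nc_i mul1r -[2 : C]realC_nat Nc_real ger0_norm // ler_pdivrMr //.
apply: le_trans (NcB _ _) _; rewrite !Nc_cexp !ReImE.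
have h y : y <= `|Im z| -> expR y <= expR `|Im z| by rewrite ler_expR.
have h1 := h _ (ler_norm (Im z)).
have h2 := h (- Im z) (ltac:(rewrite -normrN; exact: ler_norm)).
by rewrite !(mul0r, mul1r, add0r, sub0r, opprK); lra.
Qed.

(** [sin z / z]: dividing by [z] gives the decay away from 0, and Cauchy's bound on a fixed square
    takes care of the neighbourhood of 0. *)
Lemma sinc_exists : exists S, [/\ forall z, holo S z, forall z, csin z = z * S z & expdec S 1 1].
Proof.
have s0 : csin 0 = 0 by rewrite /csin mulr0 oppr0 subrr mul0r.
have [S hS ES] := holo_div holo_csin s0.
have {}ES z : csin z = z * S z by rewrite ES subr0.
exists S; split => //.
have bc : bcont S (Re (0 : C) - 2) (Re (0 : C) + 2) (Im (0 : C) - 2) (Im (0 : C) + 2).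
  by move=> z _; exact: holo_ccont.
have [M M0 HM] := bcont_bounded (ler0n R 2) bc.
exists (M * 16 + 2) => [|z]; first lra.
have e1 : 1 <= expR (1 * `|Im z|) by rewrite -expR0 ler_expR mulr_ge0.
rewrite expr1; have n0 := Nc_ge0 z.
have p : M * 16 * 1 <= M * 16 * expR (1 * `|Im z|) by apply: ler_wpM2l => //; lra.
have [z1|z1] := leP (Nc z) 1.
  have B : Nc (S z) <= M / 1 * (4 + 4).
    have := @cauchy_bound R S (-2) 2 (-2) 2 z M 1; rewrite !opprK.
    have -> : 2 + 2 = 4 :> R by ring.
    have := Re_Nc z; have := Im_Nc z; rewrite !ler_norml => /andP[i1 i2] /andP[i3 i4].
    apply; rewrite //=; try (apply/andP; split; ulra i3 z1 i4 i1 i2).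
      by move=> u hu; apply: HM; rewrite /= !sub0r !add0r.
    move=> u; rewrite -[X in onrect X]sub0r -[X in onrect _ X]add0r -[X in onrect _ _ X]sub0r -[X in onrect _ _ _ X]add0r => hu.
    have := @onsq_dist R 0 2 u (ler0n R 2) hu; rewrite subr0 => h.
    by have := NcB_ge u z; ulra h z1.
  have : Nc (S z) * (1 + Nc z) <= M / 1 * (4 + 4) * 2 by apply: ler_pM; rewrite ?Nc_ge0 //; ulra n0 z1.
  rewrite mulrDl; lra.
have : Nc (S z) * Nc z <= expR (1 * `|Im z|).
  by rewrite -NcM mulrC -ES mul1r; exact: csin_bound.
have : Nc (S z) * 1 <= Nc (S z) * Nc z by apply: ler_wpM2l; [exact: Nc_ge0|exact: ltW].
rewrite mulrDr [(_ + 2) * _]mulrDl; lra.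
Qed.

End ExponentialType.

(** * One-sided smooth steps built from the sinc function *)

Section Majorants.
Variable R : realType.
Local Notation C := R[i].
Implicit Types (f g : C -> C) (z w : C) (a b x y t r : R) (n m : nat).

Lemma rder_uniq (f : R -> R) x a b : rder f x a -> rder f x b -> a = b.
Proof. by move=> [_ <-] [_ <-]. Qed.

Lemma cder_csin0 : cder (@csin R) 0 (1 : C).
Proof.
have h : cder (fun z : C => iC * z) 0 (iC * 1) by apply: cderZ; exact: cder_id.
have e1 := @cder_comp _ _ _ 0 _ _ h (cexp_der _).
have e2 := @cder_comp _ _ _ 0 _ _ (cderN h) (cexp_der _).
have e3 := cderM (cderB e1 e2) (cder_cst ((iC * 2)^-1) 0).
apply: cder_eq e3; rewrite mulr0 oppr0 cexp0 mulr0 addr0 mulr1 !mul1r opprK -mulr2n -[iC *+ 2]mulr_natr.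
by rewrite mulfV // mulf_neq0 ?i_neq0 // pnatr_eq0.
Qed.

Lemma sinc_real (S : C -> C) : (forall z, holo S z) -> (forall z, csin z = z * S z) ->
  exists2 s : R -> R, (forall x, S x%:C = (s x)%:C) & [/\ forall x, x * s x = sin x, s 0 = 1 & forall x, s (- x) = s x].
Proof.
move=> hS ES; have S0 : S 0 = 1.
  have [d hd] := hS 0.
  have h := cderM (@cder_id R 0) hd.
  have h' : cder (@csin R) 0 (1 * S 0 + 0 * d) by apply: cder_ext h => z; rewrite -ES.
  by have := cder_uniq h' cder_csin0; rewrite mul1r mul0r addr0.
have E x : S x%:C = (Re (S x%:C))%:C.
  have [->|x0] := eqVneq x 0; first by rewrite S0.
  have : x%:C * S x%:C = (sin x)%:C by rewrite -ES csin_real.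
  move/(congr1 (fun z => x%:C^-1 * z)); rewrite mulrA mulVf ?realC_eq0 // mul1r -realC_V -realC_M => -> //.
exists (fun x => Re (S x%:C)) => //.
have P x : x * Re (S x%:C) = sin x.
  have := congr1 (@Re R) (esym (csin_real x)); rewrite ES E -realC_M !ReC => <- //.
split=> // [|x]; first by rewrite S0.
have [->|x0] := eqVneq x 0; first by rewrite oppr0.
apply: (mulfI x0); rewrite P -[sin x]opprK -sinN -(P (- x)); ring.
Qed.

Lemma cD_real f (h : R -> R) x : (forall z, holo f z) -> (forall x, f x%:C = (h x)%:C) ->
  Im (cD f x%:C) = 0 /\ rder h x (Re (cD f x%:C)).
Proof.
move=> hf E; have D := cDP (hf x%:C).
have [h1 h2] := cder_x (D : cder f (x +i* 0) _); split.
  by apply: rder_uniq h2 _; apply: rder_ext (rder_cst 0 x) => t; have := E t => ->.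
by apply: rder_ext h1 => t; have := E t => ->.
Qed.

Lemma expdec_pow2 f a n : expdec f a n -> expdec (fun z => f z * f z) (2 * a) n.*2.
Proof. by move=> h; have -> : 2 * a = a + a; [ring|rewrite -addnn; exact: expdecM]. Qed.

Lemma wsum_ge (u v a b q : R) : u * a + v * b = 1 -> u * a <= 8 * q * a -> v * b <= 8 * q * b -> 1 <= 8 * ((a + b) * q).
Proof. lra. Qed.

(** [sinc(x)^2 + sinc(x - pi/2)^2] has no real zero: [x^2] times the first square plus
    [(x - pi/2)^2] times the second is [sin^2 + cos^2 = 1]. So the sum is at least a multiple of
    [(1 + |x|)^-2], and its cube a multiple of [(1 + |x|)^-6]. *)
Lemma bump_exists : exists2 B : C -> C, (forall z, holo B z) & expdec B 6 6 /\
  exists h : R -> R, (forall x, B x%:C = (h x)%:C) /\ forall x, 1 <= 8 ^+ 3 * (h x * (1 + `|x|) ^+ 6).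
Proof.
have [S [hS ES dS]] := sinc_exists R.
have [s Es [P s0 sN]] := sinc_real hS ES.
pose p := pi / 2 : R; have [/andP[p0 p2] cp] := pihalf_02_cos_pihalf R.
pose S1 z := S (z - p%:C).
have hS1 z : holo S1 z.
  by apply: (holo_comp _ (hS _)); apply: holoB; [exact: holo_id|exact: holo_cst].
have dS1 : expdec S1 1 1 by apply: expdec_shift.
pose B z := S z * S z + S1 z * S1 z.
have hB z : holo B z by apply: holoD; apply: holoM.
have dB : expdec B (1 + 1) (1 + 1) by apply: expdecD; apply: expdecM.
pose b x := s x ^+ 2 + s (x - p) ^+ 2.
have Eb x : B x%:C = (b x)%:C by rewrite /B /S1 -realC_B !Es /b realC_D !expr2 !realC_M.
have b0 x : 0 <= b x by rewrite addr_ge0 ?sqr_ge0.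
have lb x : 1 <= 8 * (b x * (1 + `|x|) ^+ 2).
  have E1 : x ^+ 2 * s x ^+ 2 + (x - p) ^+ 2 * s (x - p) ^+ 2 = 1.
    by rewrite -!exprMn !P sinBpihalf sqrrN addrC cos2Dsin2.
  have m1 : x ^+ 2 <= 8 * (1 + `|x|) ^+ 2.
    rewrite -real_normK ?num_real //; have := normr_ge0 x; move: `|x| => y y0; rewrite !expr2; nra.
  have m2 : (x - p) ^+ 2 <= 8 * (1 + `|x|) ^+ 2.
    have h : `|x - p| <= 2 * (1 + `|x|).
      by apply: le_trans (ler_normB _ _) _; rewrite [`|p|]ger0_norm; have := normr_ge0 x; rewrite /p; lra.
    rewrite -real_normK ?num_real //; apply: (@le_trans _ _ ((2 * (1 + `|x|)) ^+ 2)).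
      by apply: lerXn2r; rewrite ?nnegrE //; have := normr_ge0 x; lra.
    by rewrite exprMn; apply: ler_wpM2r; [exact: sqr_ge0|lra].
  have := ler_wpM2r (sqr_ge0 (s x)) m1; have := ler_wpM2r (sqr_ge0 (s (x - p))) m2; rewrite /b.
  by move=> h2 h1; apply: wsum_ge E1 h1 h2.
exists (fun z => B z * (B z * B z)) => [z|]; first by do 2!apply: holoM => //.
split.
  have -> : (6 : R) = (1 + 1) + ((1 + 1) + (1 + 1)) by ring.
  by apply: (@expdecM _ _ _ _ _ 2 4) => //; apply: (@expdecM _ _ _ _ _ 2 2).
exists (fun x => b x * (b x * b x)); split => [x|x]; first by rewrite Eb !realC_M.
have -> : 8 ^+ 3 * (b x * (b x * b x) * (1 + `|x|) ^+ 6) = (8 * (b x * (1 + `|x|) ^+ 2)) ^+ 3.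
  rewrite exprMn; congr (_ * _); rewrite exprMn -exprM; congr (_ * _); ring.
exact: exprn_ege1 (lb x).
Qed.

(** [k] is the odd primitive of [sinc^8], which increases to its limit [kap]; it serves as a
    smoothed sign function. The power 6 in the tail matches the lower bound of [bump_exists]. *)
Lemma step_exists : exists2 K : C -> C, (forall z, holo K z) & expdec K 8 8 /\
  exists k kr : R -> R, [/\ forall x, K x%:C = (kr x)%:C, forall x, rder k x (kr x),
    forall x, k (- x) = - k x & exists2 kap : R, 0 < kap &
    exists2 c : R, 0 < c & forall x, 0 <= x -> 0 <= kap - k x <= c / (1 + x) ^+ 6].
Proof.
have [S [hS ES dS]] := sinc_exists R.
have [s Es [P s0 sN]] := sinc_real hS ES.
pose S2 z := S z * S z; pose S4 z := S2 z * S2 z; pose K z := S4 z * S4 z.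
have hS2 z : holo S2 z by exact: holoM.
have hS4 z : holo S4 z by exact: holoM.
have hK z : holo K z by exact: holoM.
exists K => //.
have dK : expdec K 8 8.
  have -> : (8 : R) = 2 * (2 * (2 * 1)) by ring.
  exact: (expdec_pow2 (expdec_pow2 (expdec_pow2 dS))).
split=> //.
pose kr x := (s x ^+ 2 ^+ 2) ^+ 2.
have Ek x : K x%:C = (kr x)%:C by rewrite /K /S4 /S2 Es /kr !expr2 !realC_M.
have [k0 [k00 hk0]] := @prim_strip R (fun=> True) K 0 0 (@strip_all R) I (fun z _ => hK z).
pose k x := Re (k0 x%:C).
have dk x : rder k x (kr x).
  by have [h _] := cder_x (hk0 (x +i* 0) I); have := Ek x => Ex; rewrite Ex in h; exact: h.
have k_0 : k 0 = 0 by rewrite /k; have -> : (0%:C : C) = 0 +i* 0; rewrite ?k00.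
have krN x : kr (- x) = kr x by rewrite /kr sN.
have kr0 x : 0 <= kr x by exact: sqr_ge0.
have kN x : k (- x) = - k x.
  have D t : rder (fun t => k t + k (- t)) t 0.
    have h : rder (fun t => - t) t (- 1) by apply: rderN; exact: rder_id.
    by apply: rder_eq (rderD (dk t) (rder_comp (dk _) h)); rewrite krN; ring.
  have := @rder_const _ (fun t => k t + k (- t)) x 0 (fun t _ => D t).
  by rewrite oppr0 k_0 addr0 => /eqP; rewrite addrC addr_eq0 => /eqP.
have mono x y : x <= y -> k x <= k y.
  move=> xy; have := rder_mono xy (fun t _ => rder_cst 0 t) (fun t _ => dk t) (fun t _ => kr0 t).
  lra.
have [c c0 hc] := dK.
have krb t : 0 <= t -> kr t <= c / (1 + t) ^+ 8.
  move=> t0; have := hc t%:C; rewrite Ek !Nc_real ImC normr0 mulr0 expR0 mulr1 !ger0_norm //.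
  by rewrite ler_pdivlMr // exprn_gt0 //; lra.
have tail x y : 0 <= x -> x <= y -> k y - k x <= c / (1 + x) ^+ 6.
  move=> x0 xy.
  have D t : x <= t <= y -> rder (fun t => - c * ((1 + t)^-1) ^+ 7) t (7 * c / (1 + t) ^+ 8).
    move=> /andP[xt _]; have t1 : 1 + t != 0 by apply: lt0r_neq0; lra.
    have h : rder (fun t => 1 + t) t 1 by apply: rder_eq (rderD (rder_cst 1 t) (rder_id t)); ring.
    apply: rder_eq (rderZ _ (rderX 7 (rderV t1 h))).
    by field.
  have := rder_mono xy (fun t _ => dk t) D _; move=> /(_ _)/le_trans -> //.
    move=> t /andP[xt _]; apply: le_trans (krb t _) _; first lra.
    by apply: ler_wpM2r; [rewrite invr_ge0 exprn_ge0 //; lra|lra].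
  have y1 : 0 <= c * (1 + y)^-1 ^+ 7 by rewrite mulr_ge0 ?exprn_ge0 ?invr_ge0 ?ltW //; lra.
  have x1 : (1 + x)^-1 ^+ 7 <= (1 + x)^-1 ^+ 6.
    by apply: ler_wiXn2l => //; [rewrite invr_ge0; ulra x0|rewrite invf_le1; ulra x0].
  have := ler_wpM2l (ltW c0) x1; rewrite -[c / _]/(c * _) -exprVn; lra.
exists k, kr; split => //.
pose E := [set y | exists x, y = k x].
have Eub : ubound E (c / (1 + 0) ^+ 6).
  move=> _ [x ->]; have [x0|x0] := leP 0 x; first by have := tail 0 x (lexx _) x0; rewrite k_0 subr0.
  apply: le_trans (mono x 0 (ltW x0)) _; rewrite k_0 divr_ge0 ?exprn_ge0 //; lra.
have En : E !=set0 by exists (k 0), 0.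
have kap x : k x <= sup E by apply: ub_le_sup; [eexists; exact: Eub|exists x].
exists (sup E).
  have [r r0 hr] := rder_epsE (dk 0) (ltac:(lra) : 0 < 2^-1 :> R).
  have rn : `|r / 2| = r / 2 by rewrite ger0_norm; lra.
  have rr : `|r / 2| < r by rewrite rn; lra.
  have := hr _ rr; rewrite add0r k_0 subr0 /kr s0 !expr1n mul1r rn.
  rewrite ler_norml => /andP[h _]; apply: lt_le_trans (kap (r / 2)); ulra h rr rn.
exists c => // x x0; rewrite subr_ge0 kap /= lerBlDr; apply: ge_sup => // _ [y ->].
have [xy|xy] := leP x y; first by have := tail x y x0 xy; rlra 0.
apply: le_trans (mono _ _ (ltW xy)) _; rewrite lerDr divr_ge0 ?exprn_ge0 ?ltW //; lra.
Qed.

(* [chi] is a one-sided approximation of the indicator of the negative half-line, whose derivative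
   extends to an entire function of exponential type. *)
Lemma majorant_exists (sg : R) : sg ^+ 2 = 1 -> exists (chi : R -> R) (Q : C -> C),
  [/\ forall z, holo Q z, expdec Q 8 6, forall x, Im (Q x%:C) = 0,
    forall x, rder chi x (- Re (Q x%:C)) &
    exists2 c : R, 0 < c & (forall x, x <= 0 -> 0 <= sg * (chi x - 1) <= c / (1 + `|x|) ^+ 6) /\
      (forall x, 0 <= x -> 0 <= sg * chi x <= c / (1 + `|x|) ^+ 6)].
Proof.
move=> sg2.
have [B hB [dB [h [Eh hlow]]]] := bump_exists.
have [K hK [dK [k [kr [Ek dk kN [kap kap0 [c c0 hk]]]]]]] := step_exists.
have [cb cb0 hcb] := dB.
pose A := 8 ^+ 3 * (c / (2 * kap)).
have A0 : 0 < A by rewrite !mulr_gt0 // invr_gt0 mulr_gt0.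
(* A smoothed step plus [sg] times a bump, where [A] makes the bump dominate the deviation of the
   step from the indicator: [sg = 1] gives a majorant, [sg = -1] a minorant. *)
exists (fun x => 2^-1 - (2 * kap)^-1 * k x + sg * A * h x).
exists (fun z => ((2 * kap)^-1)%:C * K z - (sg * A)%:C * cD B z).
have hupp x : h x <= cb / (1 + `|x|) ^+ 6.
  have P0 : 0 < (1 + `|x|) ^+ 6 by rewrite exprn_gt0 //; have := normr_ge0 x; lra.
  rewrite ler_pdivlMr //; have := hcb x%:C; rewrite Eh !Nc_real ImC normr0 mulr0 expR0 mulr1.
  by apply: le_trans; apply: ler_wpM2r; [exact: ltW|exact: ler_norm].
have dev x : 0 <= (2 * kap)^-1 * (kap - k `|x|) <= A * h x.
  have x0 := normr_ge0 x; have /andP[h1 h2] := hk _ x0; apply/andP; split.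
    by rewrite mulr_ge0 // invr_ge0 mulr_ge0 // ltW.
  have P0 : 0 < (1 + `|x|) ^+ 6 by rewrite exprn_gt0 //; lra.
  have i0 : 0 <= (2 * kap)^-1 by rewrite invr_ge0 mulr_ge0 // ltW.
  apply: le_trans (ler_wpM2l i0 h2) _.
  have h4 : 0 <= c / (2 * kap) by rewrite divr_ge0 ?mulr_ge0 ?ltW.
  rewrite mulrA ler_pdivrMr // mulrC -[leLHS]mulr1.
  have -> : A * h x * (1 + `|x|) ^+ 6 = c / (2 * kap) * (8 ^+ 3 * (h x * (1 + `|x|) ^+ 6)) by rewrite /A; ring.
  exact: ler_wpM2l.
clearbody A; have dB' : expdec (cD B) 8 6 by apply: expdecW (expdec_cD _ hB dB) => //; lra.
split.
- move=> z; apply: holoB; apply: holoM => //; try exact: holo_cst.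
  exact: (@holo_cD _ B z 1 ltr01 (fun z _ => hB z)).
- have -> : (fun z => ((2 * kap)^-1)%:C * K z - (sg * A)%:C * cD B z) =
    (fun z => ((2 * kap)^-1)%:C * K z + (- (sg * A)%:C) * cD B z) by apply: funext => z; rewrite mulNr.
  by apply: expdecD; apply: expdecZ => //; apply: expdecW dK.
- by move=> x; rewrite ImD ImN !ImM !ImC !mul0r !addr0 Ek ImC (cD_real x hB Eh).1 !mulr0 subr0.
- move=> x; have [h1 h2] := cD_real x hB Eh.
  apply: rder_eq (rderD (rderB (rder_cst 2^-1 x) (rderZ (2 * kap)^-1 (dk x))) (rderZ (sg * A) h2)).
  rewrite ReD ReN !ReM !ImC !mul0r !subr0 !ReC Ek ReC; ring.
have kk : (2 * kap)^-1 * kap = 2^-1 by field; exact: lt0r_neq0.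
exists (2 * (A * cb)); first by apply: mulr_gt0 => //; exact: mulr_gt0.
have Ah x : 2 * (A * h x) <= 2 * (A * cb) / (1 + `|x|) ^+ 6.
  by rewrite -!mulrA ler_pM2l // ler_pM2l //; exact: hupp.
have sgA x : sg * (sg * A * h x) = A * h x by rewrite !mulrA -expr2 sg2 mul1r.
split=> x x0; have := dev x; have := Ah x; move: (2 * (A * cb) / _) => U.
  rewrite ler0_norm // kN => HU /andP[h1 h2].
  have -> : sg * (2^-1 - (2 * kap)^-1 * k x + sg * A * h x - 1) = - (sg * ((2 * kap)^-1 * (kap - - k x))) + A * h x.
    have -> : (2 * kap)^-1 * (kap - - k x) = 2^-1 + (2 * kap)^-1 * k x by rewrite opprK mulrDr kk.
    by rewrite !(mulrBr, mulrDr) sgA; move: (_ * k x) (A * _) => X Y; field.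
  move: h1 h2 HU sg2; clear; move: (_ * (kap - _)) (A * _) => X Y h1 h2 HU /eqP.
  by rewrite sqrf_eq1 => /orP[]/eqP ->; apply/andP; split; lra.
rewrite ger0_norm // => HU /andP[h1 h2].
have -> : sg * (2^-1 - (2 * kap)^-1 * k x + sg * A * h x) = sg * ((2 * kap)^-1 * (kap - k x)) + A * h x.
  by rewrite mulrDr sgA [in RHS]mulrBr kk.
move: h1 h2 HU sg2; clear; move: (_ * (kap - _)) (A * _) => X Y h1 h2 HU /eqP.
by rewrite sqrf_eq1 => /orP[]/eqP ->; apply/andP; split; lra.
Qed.

End Majorants.

(** * From an upper bound of the integrand to a two-sided bound of its integral *)

Section Tauberian.
Variable R : realType.
Local Notation C := R[i].
Implicit Types (f g : C -> C) (z w : C) (a b x y t r : R) (n m : nat).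

Lemma rder_atan1 (d u t : R) : 0 < d -> rder (fun y => d^-1 * atan (d * (y - u))) t (1 + (d * (t - u)) ^+ 2)^-1.
Proof.
move=> d0; have D : rder (fun y => d * (y - u)) t d.
  by apply: rder_eq (rderZ d (rderB (rder_id t) (rder_cst u t))); ring.
apply: rder_eq (rderZ d^-1 (@rder_comp _ (@atan R) _ _ _ _ (is_derive1_atan _) D)).
have P : 0 <= (d * (t - u)) ^+ 2 by exact: sqr_ge0.
by field; do ?(apply/andP; split); apply: lt0r_neq0; lra.
Qed.

Lemma atan1_diff (d u x y k : R) : 0 < d -> 0 <= k ->
  k * (d^-1 * atan (d * (y - u))) - k * (d^-1 * atan (d * (x - u))) <= k * 4 / d.
Proof.
move=> d0 k0; rewrite -mulrBr -mulrA; apply: ler_wpM2l => //.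
rewrite -mulrBr mulrC; apply: ler_wpM2r; first by rewrite invr_ge0 ltW.
have := atan_ltpi2 (d * (y - u)); have := atan_gtNpi2 (d * (x - u)).
have [/andP[_ p2] _] := pihalf_02_cos_pihalf R; lra.
Qed.

(** Six powers of decay of the weight pay for the growth [(1 + d^2)^2] allowed to the integrand and
    leave the integrable factor [1 / (1 + (del d)^2)]. *)
Lemma bump_int (del d : R) : 1 <= del -> (1 + d ^+ 2) ^+ 2 * (1 + (del * d) ^+ 2) <= (1 + `|del * d|) ^+ 6.
Proof.
move=> d1; set q := (del * d) ^+ 2; have q0 : 0 <= q := sqr_ge0 _.
have h1 : 1 + d ^+ 2 <= 1 + q.
  by rewrite lerD2l /q exprMn -[X in X <= _]mul1r; apply: ler_wpM2r; [exact: sqr_ge0|exact: exprn_ege1].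
have h2 : 1 + q <= (1 + `|del * d|) ^+ 2.
  by rewrite /q -real_normK ?num_real //; have := normr_ge0 (del * d); move: `|_| => u u0; rewrite !expr2; nra.
have d0 := sqr_ge0 d.
apply: (@le_trans _ _ ((1 + q) ^+ 2 * (1 + q))).
  by apply: ler_wpM2r; [lra|apply: lerXn2r; rewrite ?nnegrE //; lra].
rewrite -exprSr; have -> : (1 + `|del * d|) ^+ 6 = ((1 + `|del * d|) ^+ 2) ^+ 3 by rewrite -exprM.
by apply: lerXn2r; rewrite ?nnegrE ?sqr_ge0 //; lra.
Qed.

Lemma bump_int1 (del d : R) : 1 <= del -> (1 + d ^+ 2) * (1 + (del * d) ^+ 2) <= (1 + `|del * d|) ^+ 6.
Proof.
move=> d1; apply: le_trans (bump_int d d1); apply: ler_wpM2r; first by have := sqr_ge0 (del * d); lra.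
by have := sqr_ge0 d; rewrite expr2; nra.
Qed.

Lemma quad_aux (p q s : R) : p <= 2 * q + 2 * s -> 0 <= s -> 0 <= q -> 0 <= q * s -> 1 * (1 + p) <= 2 * (1 + s) * (9 + q).
Proof. lra. Qed.

Section OneSided.
Variables (sg : R) (chi : R -> R) (Q : C -> C) (cc cq : R).
Hypothesis sg2 : sg ^+ 2 = 1.
Hypothesis hQ : forall z, holo Q z.
Hypothesis (cq0 : 0 < cq) (hcq : forall z, Nc (Q z) * (1 + Nc z) ^+ 6 <= cq * expR (8 * `|Im z|)).
Hypothesis Qreal : forall x, Im (Q x%:C) = 0.
Hypothesis dchi : forall x, rder chi x (- Re (Q x%:C)).
Hypothesis (cc0 : 0 < cc) (chil : forall x, x <= 0 -> 0 <= sg * (chi x - 1) <= cc / (1 + `|x|) ^+ 6).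
Hypothesis chir : forall x, 0 <= x -> 0 <= sg * chi x <= cc / (1 + `|x|) ^+ 6.
Variables (W H : C -> C) (tau A del Y c1 eta V : R).
Hypothesis dW : forall z, 2^-1 <= Re z -> cder W z (H z).
Hypothesis A0 : 0 <= A.
Hypothesis HA : forall t, Re (H (2^-1 +i* t)) <= A * (1 + (t - tau) ^+ 2) ^+ 2.
Hypothesis (c10 : 0 <= c1) (eta0 : 0 <= eta).
Hypothesis W3 : forall t, `|t| <= Y -> Nc (W (3 +i* t)) <= c1 / (9 + t ^+ 2) + eta.
Hypothesis V0 : 0 <= V.
Hypothesis WY : forall x t, 2^-1 <= x <= 3 -> `|t| = Y -> Nc (W (x +i* t)) <= V.
Hypothesis (del1 : 1 <= del) (tauY : `|tau| < Y).
Ltac section_fact H ::= first [constr_eq H cq0 | constr_eq H c10 | constr_eq H eta0 | constr_eq H A0 | constr_eq H V0 | constr_eq H del1 | constr_eq H tauY | constr_eq H cc0].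

Let v t := Im (W (2^-1 +i* t)).
(** On [Re z = 1/2] the argument of [Q] is the real number [del (t - tau)], and the second factor is
    minus the derivative in [t] of [chi (del (t - tau))]. *)
Let f z := W z * (del%:C * Q (del%:C * (- iC * (z - (2^-1 +i* tau))))).
Let EY := (1 + del * (Y - `|tau|)) ^+ 6.

Lemma ts_del0 : 0 < del. Proof. exact: lt_le_trans del1. Qed.

Lemma ts_arg x y : del%:C * (- iC * (x +i* y - (2^-1 +i* tau))) = (del * (y - tau)) +i* (- (del * (x - 2^-1))) :> C.
Proof. by apply: Ceq; rewrite !ReImE; ring. Qed.

(** [20 del] is the type 8 times [del] times the width [5/2] of the strip. *)
Lemma ts_f x y : 2^-1 <= x <= 3 -> Nc (f (x +i* y)) * (1 + `|del * (y - tau)|) ^+ 6 <= Nc (W (x +i* y)) * (del * cq * expR (20 * del)).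
Proof.
move=> /andP[x1 x2]; rewrite /f ts_arg NcM -mulrA; apply: ler_wpM2l; first exact: Nc_ge0.
have d0 := ts_del0; rewrite NcM Nc_real (ger0_norm (ltW d0)) -!mulrA; apply: ler_wpM2l; first exact: ltW.
set z := _ +i* _; have Rz : `|del * (y - tau)| <= Nc z by exact: Re_Nc z.
apply: le_trans (le_trans (hcq z) _).
  apply: ler_wpM2l; first exact: Nc_ge0.
  by apply: lerXn2r; rewrite ?nnegrE; have := normr_ge0 (del * (y - tau)); have := Nc_ge0 z; ulra Rz.
apply: ler_wpM2l; first exact: ltW.
have e : del * (x - 2^-1) <= del * (5 / 2) by rewrite ler_pM2l //; lra.
have e0 : 0 <= del * (x - 2^-1) by apply: mulr_ge0; lra.
by rewrite ler_expR (_ : Im z = - (del * (x - 2^-1))) // normrN ger0_norm //; lra.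
Qed.

Lemma ts_holo z : 2^-1 <= Re z -> holo f z.
Proof.
move=> hz; apply: holoM; first by exists (H z); exact: dW.
apply: holoM; first exact: holo_cst.
apply: (@holo_comp _ Q) (hQ _).
by do 2!(apply: holoM; first exact: holo_cst); apply: holoB; [exact: holo_id|exact: holo_cst].
Qed.

Lemma ts_EY0 : 0 < EY.
Proof. by rewrite exprn_gt0 // ltr_wpDr // mulr_ge0 ?subr_ge0 ?ltW // ts_del0. Qed.

Lemma ts_far t : `|t| = Y -> EY <= (1 + `|del * (t - tau)|) ^+ 6.
Proof.
move=> tY; have d0 := ts_del0; have := ler_normD (t - tau) tau; rewrite subrK tY => h.
have e : del * (Y - `|tau|) <= `|del * (t - tau)|.
  by rewrite normrM (ger0_norm (ltW d0)) ler_pM2l //; lra.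
have e0 : 0 <= del * (Y - `|tau|) by rewrite mulr_ge0 ?subr_ge0 ?ltW.
by apply: lerXn2r; rewrite ?nnegrE; lra.
Qed.

Let YY : - Y <= Y. Proof. by have := normr_ge0 tau; move: tauY; lra. Qed.
Let half3 : (2^-1 : R) <= 3. Proof. lra. Qed.

Lemma ts_bcont : bcont f 2^-1 3 (- Y) Y.
Proof. by move=> z /on_in/andP[/andP[h _] _]; apply: holo_ccont; exact: ts_holo. Qed.

Lemma ts_hor t : `|t| = Y -> Nc (cint (fun x => f (x +i* t)) 2^-1 3) <= 3 * (V * (del * cq * expR (20 * del)) / EY).
Proof.
move=> tY; set K := _ / EY.
have K0 : 0 <= K by rewrite divr_ge0 ?(ltW ts_EY0) // mulr_ge0 // !mulr_ge0 ?expR_ge0 ?ltW // ts_del0.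
have sc : segcont (fun x => f (x +i* t)) 2^-1 3.
  by apply: (@segcont_x _ f) => [|x /andP[h _]]; [lra|apply/holo_ccont/ts_holo].
apply: le_trans (cint_bound (K := K) sc _) _.
  move=> x; rewrite inseg_le // => hx; rewrite /K ler_pdivlMr ?ts_EY0 //.
  apply: le_trans (ler_wpM2l (Nc_ge0 _) (ts_far tY)) _; apply: le_trans (ts_f t hx) _.
  by apply: ler_wpM2r; [rewrite !mulr_ge0 ?expR_ge0 ?ltW // ts_del0|exact: WY].
by rewrite ger0_norm; [rewrite mulrC; apply: ler_wpM2r => //; lra|lra].
Qed.

(** [1 / (9 + t^2)] is replaced by [1 / (1 + tau^2)] at the cost of a factor [1 + (t - tau)^2],
    which the decay of the weight absorbs. *)
Lemma ts_right : Nc (cint (fun y => f (3 +i* y)) (- Y) Y) <= 4 * cq * expR (20 * del) * (2 * c1 / (1 + tau ^+ 2) + eta).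
Proof.
have d0 := ts_del0; have t0 := sqr_ge0 tau; have e0 := expR_ge0 (20 * del).
have h33 : (2^-1 : R) <= (3 : R) <= (3 : R) by apply/andP; split; lra.
set U := 2 * c1 / _ + eta; have U0 : 0 <= U.
  by rewrite addr_ge0 // divr_ge0 ?mulr_ge0 // addr_ge0.
pose k := U * (del * cq * expR (20 * del)).
have dq : 0 <= del * cq * expR (20 * del) by rewrite !mulr_ge0 // ltW.
have k0 : 0 <= k by rewrite mulr_ge0.
have [_ _ sc _] := bcont_sides half3 YY ts_bcont.
have D t : - Y <= t <= Y -> rder (fun y => k * (del^-1 * atan (del * (y - tau)))) t (k * (1 + (del * (t - tau)) ^+ 2)^-1).
  by move=> _; apply: rderZ; exact: rder_atan1.
apply: le_trans (cint_le YY sc D _) _; last first.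
  apply: le_trans (atan1_diff _ _ _ d0 k0) _.
  by rewrite /k ler_pdivrMr // le_eqVlt; apply/orP; left; apply/eqP; ring.
move=> t /andP[t1 t2]; have q0 := sqr_ge0 (del * (t - tau)).
have P1 : 0 < 1 + (del * (t - tau)) ^+ 2 by lra.
rewrite ler_pdivlMr //.
have dt := sqr_ge0 (t - tau); have tt := sqr_ge0 t.
have Wt : Nc (W (3 +i* t)) <= U * (1 + (t - tau) ^+ 2).
  apply: le_trans (W3 _) _; first by rewrite ler_norml t1.
  rewrite [U * _]mulrDl; apply: lerD; last first.
    by rewrite -[X in X <= _]mulr1; apply: ler_wpM2l => //; lra.
  rewrite ler_pdivrMr; last lra.
  have -> : 2 * c1 / (1 + tau ^+ 2) * (1 + (t - tau) ^+ 2) * (9 + t ^+ 2) = c1 * (2 * (1 + (t - tau) ^+ 2) * (9 + t ^+ 2) / (1 + tau ^+ 2)) by ring.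
  rewrite -[X in X <= _]mulr1; apply: ler_wpM2l => //; rewrite ler_pdivlMr; last ulra t0.
  have tE : tau ^+ 2 <= 2 * t ^+ 2 + 2 * (t - tau) ^+ 2.
    have -> : 2 * t ^+ 2 + 2 * (t - tau) ^+ 2 = tau ^+ 2 + (2 * t - tau) ^+ 2 by ring.
    by have := sqr_ge0 (2 * t - tau); lra.
  have : 0 <= t ^+ 2 * (t - tau) ^+ 2 by rewrite mulr_ge0.
  by move=> h; apply: quad_aux.
have B1 := bump_int1 (t - tau) del1.
have F := ts_f t h33; have N0 := Nc_ge0 (f (3 +i* t)).
have D0 : 0 < 1 + (t - tau) ^+ 2 by ulra dt.
rewrite -(ler_pM2r D0).
apply: (@le_trans _ _ (Nc (f (3 +i* t)) * (1 + `|del * (t - tau)|) ^+ 6)).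
  by rewrite -mulrA; apply: ler_wpM2l => //; rewrite mulrC.
apply: le_trans F _; rewrite /k [X in _ <= X]mulrAC; apply: ler_wpM2r => //.
Qed.

Lemma ts_int : `|Im (cint (fun y => f (2^-1 +i* y)) (- Y) Y)| <=
  4 * cq * expR (20 * del) * (2 * c1 / (1 + tau ^+ 2) + eta) + 6 * (V * (del * cq * expR (20 * del)) / EY).
Proof.
have G : rect f 2^-1 3 (- Y) Y = 0 by apply: goursat => // z /andP[/andP[h _] _]; exact: ts_holo.
have Y0 : 0 < Y by have := normr_ge0 tau; move: tauY; lra.
have := ts_hor (_ : `|- Y| = Y) => /(_ (ltac:(rewrite normrN ger0_norm ?ltW //))).
have := ts_hor (_ : `|Y| = Y) => /(_ (ltac:(rewrite ger0_norm ?ltW //))).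
have := ts_right; move: G; rewrite /rect.
set I1 := cint _ _ 3; set I2 := cint _ _ 3; set I3 := cint _ _ Y; set I4 := cint _ _ Y => G.
have E4 : I4 = I3 - iC * (I1 - I2).
  have : iC * (I1 - I2 + iC * (I3 - I4)) = 0 by rewrite G mulr0.
  rewrite mulrDr mulrA ii mulN1r opprB => e; apply/eqP; rewrite -subr_eq0 -e; apply/eqP; ring.
move=> h3 h2 h1; rewrite E4.
apply: le_trans (Im_Nc _) _; apply: le_trans (NcB _ _) _; apply: lerD => //.
by rewrite NcM Nc_i mul1r; apply: le_trans (NcB _ _) _; lra.
Qed.

Lemma ts_dv t : rder v t (Re (H (2^-1 +i* t))).
Proof.
have d : cder W (2^-1 +i* t) (H (2^-1 +i* t)) by exact/dW/lexx.
have [_ h] := cder_y d.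
by apply: rder_eq h; rewrite ImM Rei Imi mulr0 mulr1 addr0.
Qed.

(** By parts, [P + v (ch - 1)] and [P + v ch] have the derivatives [Re H (ch - 1)] and [Re H ch],
    used on the left and on the right of [tau]. Times [sg] the second factors are nonnegative there,
    so an upper bound of [Re H] suffices. The two functions differ by [v tau] at [tau], and
    [P Y - P (- Y)] is the imaginary part of the integral that [ts_int] bounds on the line
    [Re z = 3]. *)
Lemma one_sided : - (8 * A * cc / del + 4 * cq * expR (20 * del) * (2 * c1 / (1 + tau ^+ 2) + eta) +
  V * (2 * cc + 6 * (del * cq * expR (20 * del))) / EY) <= sg * v tau.
Proof.
have d0 := ts_del0; have [_ _ _ sc] := bcont_sides half3 YY ts_bcont.
have [F hF] := prim_ex sc; pose P t := Im (F t).
have fE t : Im (f (2^-1 +i* t)) = del * v t * Re (Q (del * (t - tau))%:C).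
  rewrite /f ts_arg subrr mulr0 oppr0; move: (Qreal (del * (t - tau))); rewrite /v.
  by move: (W _) (Q _) => w q hq; rewrite !ReImE hq; ring.
have dP t : - Y <= t <= Y -> rder P t (del * v t * Re (Q (del * (t - tau))%:C)).
  by move=> ht; rewrite -fE; have [] := hF t; rewrite ?inseg_le.
have dc t : rder (fun t => chi (del * (t - tau))) t (- Re (Q (del * (t - tau))%:C) * del).
  apply: (@rder_comp _ chi); first exact: dchi.
  by apply: rder_eq (rderZ del (rderB (rder_id t) (rder_cst tau t))); ring.
have Ac0 : 0 <= A * cc by rewrite mulr_ge0 // ltW.
have Datan t : rder (fun y => A * cc * (del^-1 * atan (del * (y - tau)))) t (A * cc * (1 + (del * (t - tau)) ^+ 2)^-1).
  by apply: rderZ; exact: rder_atan1.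
have pt t X : 0 <= X <= cc / (1 + `|del * (t - tau)|) ^+ 6 -> Re (H (2^-1 +i* t)) * X <= A * cc * (1 + (del * (t - tau)) ^+ 2)^-1.
  move=> /andP[X0 X1]; have q0 := sqr_ge0 (del * (t - tau)).
  apply: le_trans (ler_wpM2r X0 (HA t)) _.
  have AA : 0 <= A * (1 + (t - tau) ^+ 2) ^+ 2 by rewrite mulr_ge0 // exprn_ge0 // addr_ge0 ?sqr_ge0.
  apply: le_trans (ler_wpM2l AA X1) _.
  have P6 : 0 < (1 + `|del * (t - tau)|) ^+ 6 by rewrite exprn_gt0 // ltr_wpDr.
  rewrite ler_pdivlMr; last lra.
  rewrite mulrA mulrAC ler_pdivrMr //.
  have -> : A * (1 + (t - tau) ^+ 2) ^+ 2 * cc * (1 + (del * (t - tau)) ^+ 2) = A * cc * ((1 + (t - tau) ^+ 2) ^+ 2 * (1 + (del * (t - tau)) ^+ 2)) by ring.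
  by apply: ler_wpM2l => //; exact: bump_int.
have /andP[tl tr] : - Y <= tau <= Y by rewrite -ler_norml ltW.
pose ch t := chi (del * (t - tau)).
have L1 : sg * (P tau + v tau * (ch tau - 1)) - sg * (P (- Y) + v (- Y) * (ch (- Y) - 1)) <= A * cc * 4 / del.
  apply: le_trans (atan1_diff tau (- Y) tau d0 Ac0).
  apply: (@rder_mono _ (fun t => sg * (P t + v t * (ch t - 1))) (fun t => Re (H (2^-1 +i* t)) * (sg * (ch t - 1))) _ _ _ _ tl) (fun t _ => Datan t) _.
    move=> t /andP[t1 t2]; have t3 : - Y <= t <= Y by rewrite t1 (le_trans t2).
    apply: rder_eq (rderZ sg (rderD (dP t t3) (rderM (ts_dv t) (rderB (dc t) (rder_cst 1 t))))).
    by rewrite -/(ch t); ring.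
  by move=> t /andP[_ t2]; apply: pt; apply: chil; rewrite pmulr_rle0 // subr_le0.
have L2 : sg * (P Y + v Y * ch Y) - sg * (P tau + v tau * ch tau) <= A * cc * 4 / del.
  apply: le_trans (atan1_diff tau tau Y d0 Ac0).
  apply: (@rder_mono _ (fun t => sg * (P t + v t * ch t)) (fun t => Re (H (2^-1 +i* t)) * (sg * ch t)) _ _ _ _ tr) (fun t _ => Datan t) _.
    move=> t /andP[t1 t2]; have t3 : - Y <= t <= Y by rewrite t2 (le_trans tl).
    apply: rder_eq (rderZ sg (rderD (dP t t3) (rderM (ts_dv t) (dc t)))).
    by rewrite -/(ch t); ring.
  by move=> t /andP[t1 _]; apply: pt; apply: chir; rewrite pmulr_rge0 // subr_ge0.
have Y0 : 0 <= Y by apply: le_trans (ltW tauY).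
have ends t X : `|t| = Y -> 0 <= sg * X <= cc / (1 + `|del * (t - tau)|) ^+ 6 -> `|sg * (v t * X)| <= V * cc / EY.
  move=> tY /andP[X0 X1]; rewrite mulrCA normrM [`|sg * X|]ger0_norm // -mulrA; apply: ler_pM => //.
    by apply: le_trans (Im_Nc _) _; apply: WY => //; rewrite lexx.
  apply: le_trans X1 _; apply: ler_wpM2l; first exact: ltW.
  by rewrite lef_pV2 ?posrE ?ts_EY0 ?(lt_le_trans ts_EY0) ?ts_far.
have eY := ends Y (ch Y) (ger0_norm Y0) (chir _).
have eN := ends (- Y) (ch (- Y) - 1) (ltac:(by rewrite normrN ger0_norm)) (chil _).
move: eY => /(_ (ltac:(rewrite pmulr_rge0 // subr_ge0 //))); move: eN => /(_ (ltac:(rewrite pmulr_rle0 // subr_le0 //))).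
rewrite !ler_norml => /andP[a1 a2] /andP[a3 a4].
have IE : Im (cint (fun y => f (2^-1 +i* y)) (- Y) Y) = P Y - P (- Y) by rewrite (cintE hF) ImD ImN.
have sgI : `|sg * (P Y - P (- Y))| = `|P Y - P (- Y)|.
  by rewrite normrM -[X in X * _]sqrtr_sqr sg2 sqrtr1 mul1r.
have := ts_int; rewrite IE -sgI ler_norml => /andP[i1 _].
have -> : V * (2 * cc + 6 * (del * cq * expR (20 * del))) / EY = 2 * (V * cc / EY) + 6 * (V * (del * cq * expR (20 * del)) / EY) by ring.
have -> : 8 * A * cc / del = 2 * (A * cc * 4 / del) by ring.
move: L1 L2 a1 a2 a3 a4 i1.
move: (A * cc * 4 / del) (4 * cq * expR _ * _) (V * cc / EY) (V * _ / EY) (P tau) (P Y) (P (- Y)) (v tau) (v Y) (v (- Y)) (ch tau) (ch Y) (ch (- Y)).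
move=> x1 x2 x3 x4 x5 x6 x7 x8 x9 x10 x11 x12 x13; rlra 0.
Qed.

End OneSided.
Lemma tauber_arith (p q eta E cc cq del V D P : R) : 0 <= p -> 0 <= q -> 0 <= eta -> 1 <= E -> 0 < cc -> 0 < cq ->
  1 <= del -> 0 <= V -> 0 < D -> D <= P ->
  8 * (cc * p) + 4 * cq * E * (2 * q + eta) + V * (2 * cc + 6 * (del * cq * E)) / P <=
  8 * (cc + cq) * (p + E * (q + eta)) + V * (8 * (cc + cq) * del * E) / D.
Proof.
move=> p0 q0 e0 E1 cc0 cq0 del1 V0 D0 DP.
have h1 : 0 <= cq * p by rewrite mulr_ge0 // ltW.
have h2 : 0 <= cc * E * q by rewrite !mulr_ge0 ?(ltW cc0) //; lra.
have h3 : 0 <= cc * E * eta by rewrite !mulr_ge0 ?(ltW cc0) //; lra.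
have h4 : 0 <= cq * E * eta by rewrite !mulr_ge0 ?(ltW cq0) //; lra.
have h5 : 1 <= del * E by exact: mulr_ege1.
have h6 : 0 <= cq * (del * E) by rewrite mulr_ge0 ?(ltW cq0) //; lra.
have h7 : cc * 1 <= cc * (del * E) by rewrite ler_pM2l.
apply: lerD; first by move: h1 h2 h3 h4; clear; lra.
apply: ler_pM; [apply: mulr_ge0 => //; ulra h6 cc0|rewrite invr_ge0; ulra DP D0|apply: ler_wpM2l => //; ulra h7 h6 cc0|].
by rewrite lef_pV2 ?posrE //; ulra DP D0.
Qed.

(** Majorant and minorant give the two signs; [C0] depends on these weights only. *)
Lemma tauber_abs : exists2 C0 : R, 0 < C0 & forall (W H : C -> C) (tau A del Y c1 eta V : R),
  (forall z, 2^-1 <= Re z -> cder W z (H z)) -> 0 <= A ->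
  (forall t, Re (H (2^-1 +i* t)) <= A * (1 + (t - tau) ^+ 2) ^+ 2) -> 0 <= c1 -> 0 <= eta ->
  (forall t, `|t| <= Y -> Nc (W (3 +i* t)) <= c1 / (9 + t ^+ 2) + eta) -> 0 <= V ->
  (forall x t, 2^-1 <= x <= 3 -> `|t| = Y -> Nc (W (x +i* t)) <= V) -> 1 <= del -> `|tau| < Y ->
  `|Im (W (2^-1 +i* tau))| <= C0 * (A / del + expR (20 * del) * (c1 / (1 + tau ^+ 2) + eta)) +
     V * (C0 * del * expR (20 * del)) / (Y - `|tau|).
Proof.
have side (sg : R) : sg ^+ 2 = 1 -> exists2 C0 : R, 0 < C0 & forall (W H : C -> C) (tau A del Y c1 eta V : R),
  (forall z, 2^-1 <= Re z -> cder W z (H z)) -> 0 <= A ->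
  (forall t, Re (H (2^-1 +i* t)) <= A * (1 + (t - tau) ^+ 2) ^+ 2) -> 0 <= c1 -> 0 <= eta ->
  (forall t, `|t| <= Y -> Nc (W (3 +i* t)) <= c1 / (9 + t ^+ 2) + eta) -> 0 <= V ->
  (forall x t, 2^-1 <= x <= 3 -> `|t| = Y -> Nc (W (x +i* t)) <= V) -> 1 <= del -> `|tau| < Y ->
  - (sg * Im (W (2^-1 +i* tau))) <= C0 * (A / del + expR (20 * del) * (c1 / (1 + tau ^+ 2) + eta)) +
     V * (C0 * del * expR (20 * del)) / (Y - `|tau|).
  move=> sg2; have [chi [Q [hQ [cq cq0 hcq] Qr dchi [cc cc0 [chil chir]]]]] := majorant_exists sg2.
  exists (8 * (cc + cq)); first by rewrite mulr_gt0 // addr_gt0.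
  move=> W H tau A del Y c1 eta V dW A0 HA c10 eta0 W3 V0 WY del1 tauY.
  have O := one_sided sg2 hQ cq0 hcq Qr dchi cc0 chil chir dW A0 HA c10 eta0 W3 V0 WY del1 tauY.
  rewrite lerNl; apply: le_trans O; rewrite lerN2.
  have E1 : 1 <= expR (20 * del) by rewrite -expR0 ler_expR mulr_ge0 //; exact: le_trans del1.
  have D0 : 0 < Y - `|tau| by rewrite subr_gt0.
  have d0 : 0 < del by exact: lt_le_trans del1.
  have -> : 8 * A * cc / del = 8 * (cc * (A / del)) by ring.
  have -> : 2 * c1 / (1 + tau ^+ 2) = 2 * (c1 / (1 + tau ^+ 2)) by ring.
  apply: tauber_arith => //; first by rewrite divr_ge0 // ltW.
    by rewrite divr_ge0 // addr_ge0 ?sqr_ge0.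
  have B : Y - `|tau| <= del * (Y - `|tau|) by rewrite -[X in X <= _]mul1r ler_pM2r.
  have B1 : 1 <= 1 + del * (Y - `|tau|) by rewrite lerDl mulr_ge0 ?ltW.
  apply: le_trans (_ : 1 + del * (Y - `|tau|) <= _); first by apply: le_trans B _; rewrite lerDr.
  by rewrite -[X in X <= _]expr1; apply: ler_weXn2l.
have [Ca Ca0 ha] := side 1 (expr1n _ _).
have [Cb Cb0 hb] := side (-1) (ltac:(by rewrite sqrrN expr1n)).
exists (Ca + Cb); first exact: addr_gt0.
move=> W H tau A del Y c1 eta V dW A0 HA c10 eta0 W3 V0 WY del1 tauY.
have := ha W H tau A del Y c1 eta V dW A0 HA c10 eta0 W3 V0 WY del1 tauY.
have := hb W H tau A del Y c1 eta V dW A0 HA c10 eta0 W3 V0 WY del1 tauY.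
rewrite mul1r mulN1r opprK => h1 h2.
have D0 : 0 < Y - `|tau| by rewrite subr_gt0.
have d0 : 0 < del by exact: lt_le_trans del1.
have p0 : 0 <= A / del + expR (20 * del) * (c1 / (1 + tau ^+ 2) + eta).
  by rewrite addr_ge0 ?divr_ge0 ?mulr_ge0 ?expR_ge0 ?addr_ge0 ?divr_ge0 ?addr_ge0 ?sqr_ge0 // ltW.
have q0 (c : R) : 0 <= c -> 0 <= V * (c * del * expR (20 * del)) / (Y - `|tau|).
  by move=> cc; rewrite divr_ge0 ?(ltW D0) // mulr_ge0 // !mulr_ge0 ?expR_ge0 // ltW.
have -> : V * ((Ca + Cb) * del * expR (20 * del)) / (Y - `|tau|) = V * (Ca * del * expR (20 * del)) / (Y - `|tau|) + V * (Cb * del * expR (20 * del)) / (Y - `|tau|) by ring.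
have qa := q0 _ (ltW Ca0); have qb := q0 _ (ltW Cb0).
have pa := mulr_ge0 (ltW Ca0) p0; have pb := mulr_ge0 (ltW Cb0) p0.
rewrite [(Ca + Cb) * _]mulrDl; move: h1 h2 qa qb pa pb.
move: (Ca * (_ + _)) (Cb * (_ + _)) (V * (Ca * _ * _) / _) (V * (Cb * _ * _) / _) (Im _) => x1 x2 x3 x4 x5.
move=> h1 h2 qa qb pa pb; rewrite ler_norml; apply/andP; split; ulra pb qb h2 pa qa h1.
Qed.

End Tauberian.

Lemma sq_half (R : realType) (x u : R) : ((x + u) / 2) ^+ 2 <= x ^+ 2 + u ^+ 2 /\ (x + u) ^+ 2 / 2 <= x ^+ 2 + u ^+ 2.
Proof. by have := sqr_ge0 (x - u); have := sqr_ge0 x; have := sqr_ge0 u; rewrite !expr2; split; lra. Qed.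

(** * The upper bound for the shifted integrals *)

Section UpperBound.
Variable R : realType.
Local Notation C := R[i].
Implicit Types (z w s : C) (a b c d x y t e r : R).
Variable zeta : C -> C.
Hypothesis hzeta : is_riemann_zeta zeta.
Variables (G L : C -> C).
Hypothesis HG : is_logzeta zeta G.
Hypothesis HL : is_Ln L.

Definition Jint (e T : R) : R := rint (fun t => Re (G ((2^-1 + e) +i* t)) / (4^-1 + t ^+ 2)) (- T) T.

Section FixedShift.
Variable e : R.
Hypothesis e01 : 0 < e <= 10^-1.
Ltac section_fact H ::= first [constr_eq H e01].

Variable g1 : C.
Hypothesis g1E : g1 = G (1 + e%:C).

Lemma us_e0 : 0 < e. Proof. by case/andP: e01. Qed.
Lemma us_e1 : e <= 10^-1. Proof. by case/andP: e01. Qed.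

Lemma us_shift z : 2^-1 - e < Re z -> 2^-1 < Re (z + e%:C).
Proof. by rewrite ReD ReC; lra. Qed.

(** The numerator vanishes at 1, so the quotient by [1 - z] is holomorphic there and [H] has a
    primitive on [Re z > 1/2 - e]. On the critical line [Re H] is the integrand of [Jint] up to the
    term with [Re g1]. *)
Lemma us_exists : exists H W0 : C -> C, (forall z, 2^-1 - e < Re z -> cder W0 z (H z)) /\
  forall z, z != 1 -> 0 < Re z -> H z = (G (z + e%:C) - g1) / (z * (1 - z)).
Proof.
have e0 := us_e0; have e1 := us_e1.
pose f z := G (z + e%:C) - g1.
have hf z : 2^-1 - e < Re z -> holo f z.
  move=> hz; apply: holoB; last exact: holo_cst.
  apply: holo_comp; first by apply: holoD; [exact: holo_id|exact: holo_cst].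
  by apply: (holo_G HG); exact: us_shift.
have [|||g hg fg] := @holo_div_at R f 1 2^-1.
- lra.
- move=> z /andP[]; rewrite /= ler_norml => /andP[h _] _; apply: hf; lra.
- by rewrite /f g1E subrr.
pose H z := - (g z / z).
have hH z : 2^-1 - e < Re z -> holo H z.
  move=> hz; apply: holoN; apply: holoM; first exact/hg/hf.
  by apply: holoV; [apply: Re_neq0; lra|exact: holo_id].
have [W0 [_ hW]] := @prim_strip R (fun x => 2^-1 - e < x) H 1 0 (strip_gt _) (ltac:(rewrite /=; lra)) hH.
exists H, W0; split=> // z z1 z0; rewrite -/(f z) fg /H.
have z00 := Re_neq0 z0; have z10 : 1 - z != 0 by rewrite subr_eq0 eq_sym.
by field; rewrite z10 z00.
Qed.

Variables H W0 : C -> C.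
Hypothesis dW0 : forall z, 2^-1 - e < Re z -> cder W0 z (H z).
Hypothesis HE : forall z, z != 1 -> 0 < Re z -> H z = (G (z + e%:C) - g1) / (z * (1 - z)).

Lemma us_right x t : 3 <= x ->
  Nc (H (x +i* t)) <= 3 / 2 * (12 / (9 + t ^+ 2) * expR (- (x * ln 2)) + 8 / (x + `|t|) ^+ 3 + Nc g1 / x ^+ 2).
Proof.
move=> x3; set z := x +i* t; have e0 := us_e0.
have Rz : Re z = x by [].
have Iz : Im z = t by [].
clearbody z.
have zn : x <= Nc z by rewrite -Rz; exact: Re_le_Nc.
have z1 : z != 1 by apply/eqP => E; move: Rz; rewrite E /=; lra.
rewrite HE //; last by rewrite Rz; lra.
have tn := normr_ge0 t.
have nsq : Nc z ^+ 2 = x ^+ 2 + `|t| ^+ 2 by rewrite Nc_sqr Rz Iz real_normK ?num_real.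
have z1n : 2 / 3 * Nc z <= Nc (1 - z) by have := NcB_ge z 1; rewrite NcBC Nc1; lra.
have ze : Nc z <= Nc (z + e%:C).
  rewrite -ler_sqr ?nnegrE ?Nc_ge0 // !Nc_sqr ReD ImD ReC ImC addr0 Rz lerD2r.
  by apply: lerXn2r; rewrite ?nnegrE; ulra x3 e0.
have zp : 0 < Nc z by lra.
have GB : Nc (G (z + e%:C)) <= 12 * expR (- (x * ln 2)) + 2 / Nc z.
  apply: le_trans (G_bound3 hzeta HG HL _) _; first by rewrite ReD ReC Rz; lra.
  apply: lerD; apply: ler_wpM2l => //; last by rewrite lef_pV2 ?posrE //; lra.
  rewrite ler_expR ReD ReC Rz mulNr lerN2; apply: ler_wpM2r; [by rewrite ln_ge0 //; rlra 0|ulra e0].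
have n2 : 0 < Nc z ^+ 2 by rewrite exprn_gt0.
rewrite NcM NcV NcM.
apply: (@le_trans _ _ ((12 * expR (- (x * ln 2)) + 2 / Nc z + Nc g1) * (3 / 2 * (Nc z ^+ 2)^-1))).
  apply: ler_pM; rewrite ?Nc_ge0 ?invr_ge0 ?mulr_ge0 ?Nc_ge0 //.
    by apply: le_trans (NcB _ _) _; rewrite lerD2r.
  have -> : 3 / 2 * (Nc z ^+ 2)^-1 = (Nc z * (2 / 3 * Nc z))^-1 by field; lra.
  rewrite lef_pV2 ?posrE ?mulr_gt0 //; [by apply: ler_wpM2l; [ulra zp|exact: z1n]|ulra zp z1n].
have -> : (12 * expR (- (x * ln 2)) + 2 / Nc z + Nc g1) * (3 / 2 * (Nc z ^+ 2)^-1) =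
  3 / 2 * (12 * expR (- (x * ln 2)) * (Nc z ^+ 2)^-1 + 2 * (Nc z ^+ 3)^-1 + Nc g1 * (Nc z ^+ 2)^-1) by field; ulra zp.
have x2 : 9 <= x ^+ 2 by rewrite expr2; have := ler_pM (ler0n R 3) (ler0n R 3) x3 x3; rlra 0.
have t2 := sqr_ge0 `|t|.
apply: ler_wpM2l; first rlra 0.
apply: lerD; first apply: lerD.
- rewrite mulrAC; apply: ler_wpM2r; first exact: expR_ge0.
  apply: ler_wpM2l => //; rewrite lef_pV2 ?posrE //; last by have := sqr_ge0 t; rlra 0.
  by rewrite nsq real_normK ?num_real // lerD2r.
- have xt : 0 < x + `|t| by ulra tn x3.
  have h : (x + `|t|) / 2 <= Nc z.
    rewrite -ler_sqr ?nnegrE; [|ulra xt|ulra zp]; rewrite nsq.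
    exact: (sq_half _ _).1.
  have h2 : (x + `|t|) ^+ 2 / 2 <= Nc z ^+ 2.
    by rewrite nsq; exact: (sq_half _ _).2.
  have h3 : (x + `|t|) ^+ 3 / 4 <= Nc z ^+ 3.
    have -> : (x + `|t|) ^+ 3 / 4 = ((x + `|t|) / 2) * ((x + `|t|) ^+ 2 / 2) by field.
    by rewrite exprS; apply: ler_pM => //; [ulra xt|rewrite divr_ge0 ?sqr_ge0].
  have -> : 8 / (x + `|t|) ^+ 3 = 2 * ((x + `|t|) ^+ 3 / 4)^-1 by field; ulra xt.
  by apply: ler_wpM2l => //; rewrite lef_pV2 ?posrE ?divr_gt0 ?exprn_gt0.
- apply: ler_wpM2l; first exact: Nc_ge0.
  by rewrite lef_pV2 ?posrE ?exprn_gt0 //; ulra t2 nsq x3.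
Qed.

Lemma ln2_ge : 2^-1 <= ln 2 :> R.
Proof.
have := @ln_le_sub1 R (2^-1) (ltac:(lra)); rewrite lnV ?posrE; lra.
Qed.

Lemma expR3ln2 : expR (- (3 * ln 2)) = 8^-1 :> R.
Proof.
rewrite expRN expRM_natl lnK ?posrE //; congr (_^-1); ring.
Qed.

(** [A] is a primitive of the bound of [us_right]. Its value at 3 alone gives the right side,
    whatever [X] is, so [X] may later be taken as large as desired. *)
Lemma us_W3 X t : 3 <= X -> Nc (W0 (3 +i* t) - W0 (X +i* t)) <= 11 / (9 + t ^+ 2) + Nc g1.
Proof.
move=> X3; have e0 := us_e0; have l2 := ln2_ge; have tn := normr_ge0 t; have t2 := sqr_ge0 t.
pose A x := 3 / 2 * (- (12 / (9 + t ^+ 2) / ln 2) * expR (- (x * ln 2)) - 4 * ((x + `|t|)^-1) ^+ 2 - Nc g1 * x^-1).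
have D x : 3 <= x <= X -> rder A x (3 / 2 * (12 / (9 + t ^+ 2) * expR (- (x * ln 2)) + 8 / (x + `|t|) ^+ 3 + Nc g1 / x ^+ 2)).
  move=> /andP[x3 _]; have x0 : x != 0 by apply: lt0r_neq0; lra.
  have xt : x + `|t| != 0 by apply: lt0r_neq0; lra.
  have d1 : rder (fun x => expR (- (x * ln 2))) x (expR (- (x * ln 2)) * (- ln 2)).
    by apply: rder_exp; apply: rder_eq (rderN (rderM (rder_id x) (rder_cst (ln 2) x))); ring.
  have d2 := rderX 2 (@rderV R (fun x => x + `|t|) x _ xt (rderD (rder_id x) (rder_cst `|t| x))).
  have d3 := rderV x0 (rder_id x).
  apply: rder_eq (rderZ (3 / 2) (rderB (rderB (rderZ _ d1) (rderZ 4 d2)) (rderZ (Nc g1) d3))).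
  move: (expR _) (Nc g1) => E g; move: xt; move: `|t| => u xt; field.
  by do ?(apply/andP; split) => //; apply: lt0r_neq0; ulra t2 l2.
have WD x : 3 <= x <= X -> rcder (fun x => W0 (x +i* t)) x (H (x +i* t)).
  by move=> /andP[x3 _]; apply: cder_x; apply: dW0; rewrite /=; lra.
have := mvt_ineq X3 WD D (fun x hx => us_right t (proj1 (andP hx))).
rewrite NcBC => h; apply: le_trans h _.
have AX : A X <= 0.
  rewrite /A pmulr_rle0; last lra.
  have a1 : 0 <= 12 / (9 + t ^+ 2) / ln 2 * expR (- (X * ln 2)).
    by rewrite mulr_ge0 ?expR_ge0 // divr_ge0 ?divr_ge0 //; ulra t2 l2.
  have a2 : 0 <= 4 * (X + `|t|)^-1 ^+ 2 by rewrite mulr_ge0 ?sqr_ge0.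
  have a3 : 0 <= Nc g1 * X^-1 by rewrite mulr_ge0 ?Nc_ge0 // invr_ge0; lra.
  by rewrite mulNr; lra.
have A3 : - A 3 <= 11 / (9 + t ^+ 2) + Nc g1.
  rewrite /A expR3ln2; have g0 := Nc_ge0 g1.
  have q0 : 0 < (9 + t ^+ 2)^-1 by rewrite invr_gt0; lra.
  have b1 : 12 / (9 + t ^+ 2) / ln 2 * 8^-1 <= 3 * (9 + t ^+ 2)^-1.
    have : (ln 2)^-1 <= 2 :> R by rewrite -[leRHS]invrK lef_pV2 ?posrE //; ulra l2.
    move=> h2; have := ler_wpM2l (ltW q0) h2; lra.
  have b2 : 4 * (3 + `|t|)^-1 ^+ 2 <= 4 * (9 + t ^+ 2)^-1.
    apply: ler_wpM2l => //; rewrite exprVn lef_pV2 ?posrE ?exprn_gt0 //; last ulra t2.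
    rewrite -[t ^+ 2]real_normK ?num_real //; move: tn; move: `|t| => u; rewrite !expr2; rlra 0.
  rewrite -[11 / _]/(11 * (9 + t ^+ 2)^-1); lra.
lra.
Qed.

Hypothesis g1s' : forall x, 1 <= x -> Nc g1 <= x.
Let g1s := g1s' (lexx 1).

Lemma us_gr : - Re g1 <= 1.
Proof. by have := Re_Nc g1; have := g1s; rewrite ler_norml => ? /andP[? _]; lra. Qed.

Lemma us_half t : Re (H (2^-1 +i* t)) = (Re (G ((2^-1 + e) +i* t)) - Re g1) / (4^-1 + t ^+ 2).
Proof.
have E : (2^-1 +i* t) * (1 - (2^-1 +i* t)) = (4^-1 + t ^+ 2)%:C :> C.
  have -> : 1 - (2^-1 +i* t) = 2^-1 +i* (- t) :> C.
    by apply: Ceq; rewrite !ReImE; [change (1 - 2^-1 = 2^-1 :> R)|change (0 - t = - t)]; lra.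
  by apply: Ceq; rewrite !ReImE; field.
have t2 := sqr_ge0 t.
have z0 : 0 < Re (2^-1 +i* t) by rewrite ReI; lra.
have z1 : 2^-1 +i* t != 1 :> C.
  by apply/eqP => /(congr1 (@Re R)); rewrite ReI; change (2^-1 = 1 :> R -> False); lra.
rewrite (HE z1 z0) E.
have -> : 2^-1 +i* t + e%:C = (2^-1 + e) +i* t by apply: Ceq; rewrite !ReImE ?addr0.
by rewrite -realC_V ReM ReC ImC mulr0 subr0 ReD ReN.
Qed.

(** [T^2 <= 8 (1 + (t - tau)^2) (1/4 + t^2)] turns the weight into [1 / T^2] at the cost of one
    factor [1 + (t - tau)^2]; [M_all] costs the other. *)
Lemma us_A T tau t : 45 <= ln (ln T) -> `|tau| = T ->
  Re (H (2^-1 +i* t)) <= 8 * (2 * M0 R + 1) * (ln T / ln (ln T)) / T ^+ 2 * (1 + (t - tau) ^+ 2) ^+ 2.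
Proof.
move=> h45 tT; have [l1 T1 _] := lnln_gt (ltac:(lra) : 0 < 45 :> R) h45.
have e0 := us_e0; have e1 := us_e1.
have hb : 2^-1 < 2^-1 + e <= 6 / 10 by apply/andP; split; lra.
have := M_all hzeta HG HL t h45 hb; rewrite us_half; set M := ln T / ln (ln T); set u := Re (G _) => hu.
have M1 : 1 <= M.
  by rewrite ler_pdivlMr ?mul1r; [have := @ln_le_sub1 R (ln T) (ltac:(ulra l1)); rlra 0|ulra h45].
set d2 := (t - tau) ^+ 2; have d0 : 0 <= d2 := sqr_ge0 _.
have h1 : (`|t| - T) ^+ 2 <= d2.
  by rewrite /d2 -[(t - tau) ^+ 2]real_normK ?num_real // -[_ ^+ 2]real_normK ?num_real // -tT lerXn2r ?nnegrE // ler_dist_dist.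
have t2 := sqr_ge0 t; have gr := us_gr.
have m0 := M0_ge R.
have N1 : u - Re g1 <= (2 * M0 R + 1) * M * (1 + d2).
  have : 2 * M0 R * M * (1 + (`|t| - T) ^+ 2) <= 2 * M0 R * M * (1 + d2).
    by apply: ler_wpM2l; [apply: mulr_ge0; ulra m0 M1|ulra h1].
  have : 1 * 1 <= M * (1 + d2) by apply: ler_pM; ulra M1 d0.
  have -> : (2 * M0 R + 1) * M * (1 + d2) = 2 * M0 R * M * (1 + d2) + M * (1 + d2) by ring.
  ulra gr hu.
have T2 : 0 < T ^+ 2 by rewrite exprn_gt0 //; ulra T1.
rewrite ler_pdivrMr; last ulra t2.
apply: le_trans N1 _.
have TE : T ^+ 2 <= 8 * (1 + d2) * (4^-1 + t ^+ 2).
  have -> : T ^+ 2 = tau ^+ 2 by rewrite -tT real_normK ?num_real.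
  have tE : tau ^+ 2 <= 2 * t ^+ 2 + 2 * d2.
    by have := sqr_ge0 (2 * t - tau); rewrite /d2 !expr2; rlra 0.
  have : 0 <= d2 * t ^+ 2 by rewrite mulr_ge0.
  ulra tE t2.
have -> : 8 * (2 * M0 R + 1) * M / T ^+ 2 * (1 + d2) ^+ 2 * (4^-1 + t ^+ 2) =
  (2 * M0 R + 1) * M * (1 + d2) * (8 * (1 + d2) * (4^-1 + t ^+ 2) / T ^+ 2) by ring.
rewrite -[X in X <= _]mulr1; apply: ler_wpM2l; last by rewrite ler_pdivlMr // mul1r.
by apply: mulr_ge0; [apply: mulr_ge0|]; ulra m0 M1 d0.
Qed.

Lemma us_V : exists2 K : R, 0 < K & forall Y x t, 1 <= Y -> 2^-1 <= x <= 3 -> `|t| = Y -> Nc (H (x +i* t)) <= K.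
Proof.
have [K K0 HK] := G_poly hzeta HG HL (ltac:(have := us_e0; have := us_e1; move=> *; apply/andP; split; lra) : 0 < e <= 1).
have e0 := us_e0.
exists (2 * (K + 3) + 1); first lra.
move=> Y x t Y1 /andP[x1 x3] tY.
have z0 : 0 < Re (x +i* t) by rewrite /=; lra.
have z1 : x +i* t != 1.
  by apply/eqP => /(congr1 (@Im R)) /= t0; move: tY; rewrite t0 normr0; lra.
rewrite HE // NcM NcV NcM.
have n1 : Y <= Nc (x +i* t) by have := Im_Nc (x +i* t); rewrite /= tY.
have n2 : Y <= Nc (1 - (x +i* t)) by have := Im_Nc (1 - (x +i* t)); rewrite ImD ImN /= sub0r normrN tY.
have Gb : Nc (G (x +i* t + e%:C)) <= (K + 3) * (2 * Y).
  have [h|h] := leP (x + e) 3.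
    apply: le_trans (HK _ _) _; first by rewrite ReD ReC /=; apply/andP; split; ulra x1 h.
    by rewrite ImD ImC addr0 /= tY; apply: ler_pM; ulra K0 Y1.
  apply: le_trans (G3 hzeta HG HL _) _; first by rewrite ReD ReC /=; lra.
  have : 0 <= K * Y by apply: mulr_ge0; ulra K0 Y1.
  lra.
have YY : Y * Y <= Nc (x +i* t) * Nc (1 - (x +i* t)) by apply: ler_pM; ulra Y1 n1 n2.
have Y2 : 1 * Y <= Y * Y by apply: ler_wpM2r; ulra Y1.
rewrite ler_pdivrMr; last ulra Y2 YY Y1.
apply: le_trans (NcB _ _) _; have g1b := g1s; apply: le_trans (lerD Gb g1b) _.
have : (2 * (K + 3) + 1) * Y <= (2 * (K + 3) + 1) * (Nc (x +i* t) * Nc (1 - (x +i* t))) by apply: ler_wpM2l; ulra K0 Y2 YY.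
ulra Y1.
Qed.

(** The same [w] serves for [tau = T] and [tau = - T] and cancels in [Jint]. It comes from the value
    of [W0] far to the right, which normalizes the primitive to be small on [Re z = 3]. With
    [del = ln (ln T) / 80] the loss [e^(20 del)] is [(log T)^(1/4)], and [del >= 1] is the threshold
    80. *)
Lemma us_center (C0 T : R) : (forall (W H : C -> C) (tau A del Y c1 eta V : R),
  (forall z, 2^-1 <= Re z -> cder W z (H z)) -> 0 <= A ->
  (forall t, Re (H (2^-1 +i* t)) <= A * (1 + (t - tau) ^+ 2) ^+ 2) -> 0 <= c1 -> 0 <= eta ->
  (forall t, `|t| <= Y -> Nc (W (3 +i* t)) <= c1 / (9 + t ^+ 2) + eta) -> 0 <= V ->
  (forall x t, 2^-1 <= x <= 3 -> `|t| = Y -> Nc (W (x +i* t)) <= V) -> 1 <= del -> `|tau| < Y ->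
  `|Im (W (2^-1 +i* tau))| <= C0 * (A / del + expR (20 * del) * (c1 / (1 + tau ^+ 2) + eta)) +
     V * (C0 * del * expR (20 * del)) / (Y - `|tau|)) -> 0 < C0 -> 80 <= ln (ln T) ->
  let del := ln (ln T) / 80 in
  let A := 8 * (2 * M0 R + 1) * (ln T / ln (ln T)) / T ^+ 2 in
  forall th : R, 0 < th -> exists w : R, forall tau, `|tau| = T -> 
    `|Im (W0 (2^-1 +i* tau)) - w| <= C0 * (A / del + expR (20 * del) * (11 / (1 + T ^+ 2) + (Nc g1 + th))) + th.
Proof.
move=> tb C00 h80 del A th th0; have e0 := us_e0.
have [l1 T1 _] := lnln_gt (ltac:(lra) : 0 < 80 :> R) h80.
have [K K0 HK] := us_V.
have g0 := Nc_ge0 g1.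
have del1 : 1 <= del by rewrite /del; lra.
pose V := 13 + th + 3 * K; have V0 : 0 < V by rewrite /V; ulra K0 th0.
pose B := V * (C0 * del * expR (20 * del)).
have B0 : 0 < B by rewrite mulr_gt0 // !mulr_gt0 ?expR_gt0 //; ulra h80.
(* This height makes the term with [V] at most [th]; the abscissa [X] below makes [W0] vary by at
   most [th] on [Re z = X] up to height [Y]. *)
pose Y := T + 1 + B / th.
have Bt : 0 < B / th by rewrite divr_gt0.
pose X := 3 + 23 * Y / th.
have Y0 : 0 < 23 * Y / th by rewrite divr_gt0 // mulr_gt0 // /Y; ulra Bt T1.
have X3 : 3 <= X by rewrite /X; ulra Y0.
pose w := W0 (X +i* 0); exists (Im w) => tau tT.
pose W z := W0 z - w.
have HX t : Nc (H (X +i* t)) <= 23 / X.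
  apply: le_trans (us_right t X3) _.
  have t0 := normr_ge0 t; have t2 := sqr_ge0 t.
  have eX : 12 / (9 + t ^+ 2) * expR (- (X * ln 2)) <= 12 / 9 * (2 / X).
    apply: ler_pM; rewrite ?expR_ge0 ?divr_ge0 //; [ulra t2|by apply: ler_wpM2l => //; rewrite lef_pV2 ?posrE //; ulra t2|].
    have := expR_ge1Dx (X * ln 2); have l2 := ln2_ge => h.
    have h2 : X * 2^-1 <= X * ln 2 by apply: ler_wpM2l => //; ulra X3.
    have -> : 2 / X = (X / 2)^-1 by field; ulra X3.
    rewrite expRN lef_pV2 ?posrE ?expR_gt0 //; ulra h2 h X3.
  have cX : 8 / (X + `|t|) ^+ 3 <= 8 / X.
    apply: ler_wpM2l => //; rewrite lef_pV2 ?posrE ?exprn_gt0 //; [|ulra t0 X3|ulra X3].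
    by apply: le_trans (_ : X + `|t| <= _); [ulra t0|rewrite -[X in X <= _]expr1; apply: ler_weXn2l => //; ulra t0 X3].
  have gX : Nc g1 / X ^+ 2 <= 1 / X.
    apply: ler_pM; rewrite ?invr_ge0 ?sqr_ge0 // lef_pV2 ?posrE ?exprn_gt0 //; [|ulra X3|ulra X3].
    by rewrite -[X in X <= _]expr1; apply: ler_weXn2l => //; ulra X3.
  have iX : 0 <= X^-1 by rewrite invr_ge0; ulra X3.
  rewrite -[12 / 9 * _]mulrA -/(_ / _) in eX *; ulra eX iX gX cX.
have WX t : `|t| <= Y -> Nc (W0 (X +i* t) - w) <= th.
  move=> tY; have d (s : R) : inseg 0 t s -> rcder (fun y => W0 (X +i* y)) s (H (X +i* s) * iC).
    by move=> _; apply: cder_y; apply: dW0; rewrite /=; ulra X3 e0.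
  have hb (s : R) : inseg 0 t s -> Nc (H (X +i* s) * iC) <= 23 / X.
    by move=> _; rewrite NcM Nc_i mulr1; exact: HX.
  have h := mvt_bound d hb; apply: le_trans h _; rewrite subr0.
  apply: (@le_trans _ _ (23 / X * Y)); first by apply: ler_wpM2l => //; rewrite divr_ge0 //; ulra X3.
  rewrite mulrAC ler_pdivrMr; last ulra X3.
  have : th * (23 * Y / th) = 23 * Y by field; ulra th0.
  by rewrite [th * X]mulrDr => ->; ulra th0.
have W3 t : `|t| <= Y -> Nc (W (3 +i* t)) <= 11 / (9 + t ^+ 2) + (Nc g1 + th).
  move=> tY; have -> : W (3 +i* t) = (W0 (3 +i* t) - W0 (X +i* t)) + (W0 (X +i* t) - w) by rewrite /W; ring.
  apply: le_trans (NcD _ _) _; rewrite addrA; apply: lerD; [exact: us_W3|exact: WX].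
have WY x t : 2^-1 <= x <= 3 -> `|t| = Y -> Nc (W (x +i* t)) <= V.
  move=> hx tY; have Y1 : 1 <= Y by rewrite /Y; ulra Bt T1.
  have d (s : R) : inseg 3 x s -> rcder (fun y => W0 (y +i* t)) s (H (s +i* t)).
    rewrite insegC inseg_le; last by case/andP: hx.
    by move=> hs; apply: cder_x; apply: dW0; move: hx hs => /andP[? ?] /andP[? ?]; rewrite /=; rlra 23.
  have b (s : R) : inseg 3 x s -> Nc (H (s +i* t)) <= K.
    rewrite insegC inseg_le; last by case/andP: hx.
    by move=> hs; apply: (HK Y) => //; move: hx hs => /andP[? ?] /andP[? ?]; apply/andP; split; rlra 4.
  have := mvt_bound d b => h.
  have -> : W (x +i* t) = (W0 (x +i* t) - W0 (3 +i* t)) + W (3 +i* t) by rewrite /W; ring.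
  apply: le_trans (NcD _ _) _.
  have h3 := W3 t (ltac:(by rewrite tY)).
  have h4 : K * `|x - 3| <= K * 3.
    by apply: ler_wpM2l; [exact: ltW|move: hx => /andP[? ?]; rewrite ler0_norm; rlra 2].
  have h5 : 11 / (9 + t ^+ 2) <= 11 by rewrite ler_pdivrMr; have := sqr_ge0 t; rlra 0.
  by have g1b := g1s; rewrite /V; ulra g1b h5 h4 h3 h.
have tY : `|tau| < Y by rewrite tT /Y; ulra Bt.
have A0 : 0 <= A.
  have m0 := M0_ge R.
  by rewrite /A divr_ge0 ?sqr_ge0 // mulr_ge0 //; [ulra m0|rewrite divr_ge0; ulra m0 l1 h80].
have dW z : 2^-1 <= Re z -> cder W z (H z).
  move=> hz; apply: cder_eq (cderB (dW0 _) (cder_cst w z)); [by rewrite subr0|ulra hz e0].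
have h45 : 45 <= ln (ln T) by ulra h80.
have := tb W H tau A del Y 11 (Nc g1 + th) V dW A0 (fun t => us_A t h45 tT) (ler0n _ _) _ W3 (ltW V0) WY del1 tY.
move=> /(_ (ltac:(ulra g0 th0))) h.
have -> : Im (W0 (2^-1 +i* tau)) - Im w = Im (W (2^-1 +i* tau)) by rewrite ImD ImN.
apply: le_trans h _; have -> : tau ^+ 2 = T ^+ 2 by rewrite -tT real_normK ?num_real.
rewrite lerD2l -/B tT ler_pdivrMr; last by rewrite /Y; ulra Bt.
have -> : th * (Y - T) = th + B by rewrite /Y; field; ulra th0.
ulra th0.
Qed.

(** The increment of [Im W0] misses the part with [Re g1], whose primitive is [Re g1] times
    [2 atan (2 t)]; this accounts for [8 Nc g1]. *)
Lemma us_J (T : R) (w b : R) : 0 <= T -> (forall tau, `|tau| = T -> `|Im (W0 (2^-1 +i* tau)) - w| <= b) ->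
  `|Jint e T| <= 2 * b + 8 * Nc g1.
Proof.
move=> T0 Hb; have e0 := us_e0.
pose F t := Im (W0 (2^-1 +i* t)) + Re g1 * (4 * (2^-1 * atan (2 * (t - 0)))).
have D t : inseg (- T) T t -> rder F t (Re (G ((2^-1 + e) +i* t)) / (4^-1 + t ^+ 2)).
  move=> _; have t2 := sqr_ge0 t.
  have d : cder W0 (2^-1 +i* t) (H (2^-1 +i* t)) by apply: dW0; rewrite /=; lra.
  have [_ h] := cder_y d.
  have a := rderZ (Re g1) (rderZ 4 (@rder_atan1 R 2 0 t (ltac:(lra)))).
  apply: rder_eq (rderD h a); rewrite ImM Rei Imi mulr0 mulr1 addr0 us_half subr0 exprMn.
  by field; do ?(apply/andP; split); apply: lt0r_neq0; lra.
rewrite /Jint (rintE D) /F.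
have h1 := Hb T (ger0_norm T0); have h2 := Hb (- T) (ltac:(by rewrite normrN ger0_norm)).
have h3 := @atan1_diff R 2 0 (- T) T 4 (ltac:(lra)) (ltac:(lra)).
have h4 : 0 <= 4 * (2^-1 * atan (2 * (T - 0))) - 4 * (2^-1 * atan (2 * (- T - 0))).
  have := @rder_mono R _ _ _ _ (- T) T (ltac:(ulra T0)) (fun t _ => rder_cst 0 t) (fun t _ => rderZ 4 (@rder_atan1 R 2 0 t (ltac:(rlra 0)))).
  rewrite subrr; apply => t _; have := sqr_ge0 (2 * (t - 0)) => q.
  by rewrite mulr_ge0 // invr_ge0; ulra q.
move: h3 h4; set a1 := 4 * _; set a2 := 4 * _ => h3 h4.
have h5 : `|Re g1 * (a1 - a2)| <= Nc g1 * 8.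
  by rewrite normrM; apply: ler_pM => //; [exact: Re_Nc|rewrite ger0_norm; ulra h3 h4].
move: h1 h2 h5; rewrite !ler_norml => /andP[? ?] /andP[? ?] /andP[? ?]; apply/andP; split; rlra 6.
Qed.

End FixedShift.
End UpperBound.

(** [l = e^(ll / 4) e^(3 ll / 4)], and the second factor exceeds [ll^2 / 8]. So what the line
    [Re s = 3] contributes stays below the main term. *)
Lemma exp_quarter (R : realType) (l : R) : 1 < ln l -> expR (ln l / 4) <= 8 * (l / ln l ^+ 2).
Proof.
move=> h; have l0 : 0 < l by have [//|l0] := ltP 0 l; move: h; rewrite ln0 //; lra.
have l2 : 0 < ln l ^+ 2 by rewrite exprn_gt0 //; lra.
rewrite mulrA ler_pdivlMr //.
have E : l = expR (ln l / 4) * expR (3 / 4 * ln l).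
  by rewrite -expRD -[LHS]lnK ?posrE //; congr expR; field.
rewrite [in X in _ <= 8 * X]E [leRHS]mulrCA; apply: ler_wpM2l; first exact: expR_ge0.
have := @sqr_le_exp R (3 / 4 * ln l) (ltac:(lra)).
have -> : (3 / 4 * ln l) ^+ 2 / 4 = 9 / 64 * ln l ^+ 2 by field.
lra.
Qed.

Lemma upper_arith (R : realType) (C0 E X P Q Z g gam th : R) : 0 < C0 -> 0 < E -> X = P * Z -> E * Q <= 88 * Z -> g <= gam ->
  gam * (4 * (C0 * E) + 10) <= th ->
  2 * (C0 * (X + E * (Q + (g + gam))) + gam) + 8 * g <= 2 * C0 * (P + 88) * Z + th.
Proof.
move=> C00 E0 -> h1 h2 h3.
have h4 : C0 * (E * Q) <= C0 * (88 * Z) by rewrite ler_pM2l.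
have h5 : (C0 * E) * g <= (C0 * E) * gam by rewrite ler_pM2l // mulr_gt0.
move: h1 h2 h3 h4 h5; clear; lra.
Qed.

(** * Passage to the critical line *)

Section ZeroFactors.
Variable R : realType.
Local Notation C := R[i].
Implicit Types (f g h : C -> C) (z w s : C) (a b x y t e r : R) (zs : seq C).

Lemma onsq_far w r z rho : 0 < r -> onsq w (4 * r) z -> insq w r rho -> 3 * r <= Nc (z - rho).
Proof.
move=> r0 hz /andP[h1 h2].
have R1 := Re_Nc (z - rho); have I1 := Im_Nc (z - rho).
move: hz h1 h2 R1 I1; rewrite /onrect !ReD !ImD !ReN !ImN => /andP[_ H].
move: H; rewrite !ler_norml => /or4P[]/eqP -> /andP[? ?] /andP[? ?] /andP[? ?] /andP[? ?]; rlra 8.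
Qed.

Lemma prod_norm_ge zs z (m : R) : 0 <= m -> (forall rho, rho \in zs -> m <= Nc (z - rho)) ->
  m ^+ size zs <= Nc (\prod_(rho <- zs) (z - rho)).
Proof.
move=> m0; elim: zs => [|u zs IH] H; first by rewrite big_nil Nc1.
rewrite big_cons NcM exprS; apply: ler_pM; rewrite ?exprn_ge0 //; first by apply: H; rewrite mem_head.
by apply: IH => v hv; apply: H; rewrite inE hv orbT.
Qed.

Lemma prod_norm_le zs z (m : R) : (forall rho, rho \in zs -> Nc (z - rho) <= m) ->
  Nc (\prod_(rho <- zs) (z - rho)) <= m ^+ size zs.
Proof.
elim: zs => [|u zs IH] H; first by rewrite big_nil Nc1.
rewrite big_cons NcM exprS; apply: ler_pM; rewrite ?Nc_ge0 //; first by apply: H; rewrite mem_head.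
by apply: IH => v hv; apply: H; rewrite inE hv orbT.
Qed.

(** If zeros in the square could be divided out forever, Cauchy's bound on the square of half-side
    [4 r] would give [Nc (h 1) <= 4 M / (3 r)^n] after [n] steps, while the removed factors have
    product at most [(2 r)^n] at 1. This contradicts [f 1 = 1] for large [n]. *)
Lemma zeros_factor f r : 0 < r -> (forall z, holo f z) -> f 1 = 1 ->
  exists zs h, [/\ forall z, holo h z, forall z, f z = (\prod_(rho <- zs) (z - rho)) * h z &
    forall z, insq 1 r z -> h z != 0].
Proof.
move=> r0 hf f1; apply: contrapT => none.
have all_n n : exists zs h, [/\ size zs = n, forall z, holo h z, forall rho, rho \in zs -> insq 1 r rho &
    forall z, f z = (\prod_(rho <- zs) (z - rho)) * h z].
  elim: n => [|n [zs [h [sz hh hin E]]]].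
    by exists [::], f; split=> // z; rewrite big_nil mul1r.
  have [w hw hw0] : exists2 w, insq 1 r w & h w = 0.
    apply: contrapT => nz; apply: none; exists zs, h; split=> // z hz.
    by apply/eqP => h0; apply: nz; exists z.
  have [g hg Eg] := holo_div hh hw0.
  exists (w :: zs), g; split => //=; first by rewrite sz.
    by move=> rho; rewrite inE => /orP[/eqP ->|/hin].
  by move=> z; rewrite E Eg big_cons; ring.
have r4 : 0 < 4 * r by rewrite mulr_gt0.
have bc : bcont f (Re (1 : C) - 4 * r) (Re (1 : C) + 4 * r) (Im (1 : C) - 4 * r) (Im (1 : C) + 4 * r).
  by move=> z _; exact: holo_ccont.
have [M M0 HM] := bcont_bounded (ltW r4) bc.
have [n hn] := @geom_small R (2 / 3) (ltac:(apply/andP; split; rlra 0)) (4 * M) 2^-1 (ltac:(rlra 0)).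
have [zs [h [sz hh hin E]]] := all_n n.
have r3 : 0 < (3 * r) ^+ n by rewrite exprn_gt0 // mulr_gt0.
have hb z : onsq 1 (4 * r) z -> Nc (h z) <= M / (3 * r) ^+ n.
  move=> hz; have := HM z hz; rewrite E NcM => HMz; rewrite ler_pdivlMr // mulrC; apply: le_trans HMz; apply: ler_wpM2r; first exact: Nc_ge0.
  rewrite -sz; apply: prod_norm_ge => [|rho /hin hr]; first by rewrite mulr_ge0 ?ltW.
  exact: onsq_far hz hr.
have h1 : Nc (h 1) <= 4 * (M / (3 * r) ^+ n).
  have -> : 4 * (M / (3 * r) ^+ n) = M / (3 * r) ^+ n / (4 * r) * ((Re (1 : C) + 4 * r - (Re (1 : C) - 4 * r)) + (Im (1 : C) + 4 * r - (Im (1 : C) - 4 * r))).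
    by move: (M / _) => m; field; exact: lt0r_neq0.
  apply: cauchy_bound => //; try (apply/andP; split; ulra r4).
  by move=> z; exact: onsq_dist (ltW r4).
have p1 : Nc (\prod_(rho <- zs) (1 - rho)) <= (2 * r) ^+ n.
  rewrite -sz; apply: prod_norm_le => rho /hin hr.
  by rewrite NcBC; exact: insq_Nc2.
have : 1 <= (2 * r) ^+ n * (4 * (M / (3 * r) ^+ n)).
  have e1 : Nc (\prod_(rho <- zs) (1 - rho)) * Nc (h 1) = 1 by rewrite -NcM -E f1 Nc1.
  rewrite -[X in X <= _]e1; by apply: ler_pM; rewrite ?Nc_ge0.
have -> : (2 * r) ^+ n * (4 * (M / (3 * r) ^+ n)) = 4 * M * (2 / 3) ^+ n.
  rewrite !exprMn exprVn; have : r ^+ n != 0 by rewrite expf_neq0 // lt0r_neq0.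
  have : (3 : R) ^+ n != 0 by rewrite expf_neq0.
  by move: (2 ^+ n) (3 ^+ n) (r ^+ n) => p q u q0 u0; field; rewrite q0 u0.
move=> hh1; have := le_trans hh1 hn; lra.
Qed.

Lemma ln_sqr x : 0 < x -> ln (x ^+ 2) = 2 * ln x.
Proof. by move=> x0; rewrite lnXn // mulr_natl. Qed.

Lemma rder_lnNc (F : R -> C) t d : F t != 0 -> rcder F t d -> rder (fun x => ln (Nc (F x))) t (Re (d / F t)).
Proof.
move=> F0 [h1 h2].
have P : 0 < Re (F t) ^+ 2 + Im (F t) ^+ 2 by rewrite -Nc_sqr exprn_gt0 // Nc_gt0.
have E x : ln (Nc (F x)) = 2^-1 * ln (Re (F x) ^+ 2 + Im (F x) ^+ 2).
  rewrite -Nc_sqr; have [z|z] := eqVneq (F x) 0; first by rewrite z Nc0 expr0n /= ln0 // mulr0.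
  by rewrite ln_sqr ?Nc_gt0 // mulrA mulVf ?mul1r // pnatr_eq0.
apply: rder_ext (fsym E) _.
have h := @rder_comp _ (@ln R) (fun t => Re (F t) ^+ 2 + Im (F t) ^+ 2) _ _ _ (rder_ln P) (rderD (rderX 2 h1) (rderX 2 h2)).
apply: rder_eq (rderZ 2^-1 h).
move: P; case: (F t) F0 => u v F0 /= P; case: (d) => p q /=.
by field; lra.
Qed.

(** [log |b + i x|] for [b != 0]; [Ab b] below is a primitive of it when [b > 0]. A zero at
    horizontal distance [b] from the line of integration contributes such a term. *)
Definition Nb b x : R := 2^-1 * ln (b ^+ 2 + x ^+ 2).
Definition Ab b x : R := x * Nb b x - x + b * atan (x / b).

Lemma rder_Nb b x : 0 < b -> rder (Nb b) x (x / (b ^+ 2 + x ^+ 2)).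
Proof.
move=> b0; have P : 0 < b ^+ 2 + x ^+ 2 by rewrite ltr_pwDl ?sqr_ge0 // exprn_gt0.
apply: rder_eq (rderZ 2^-1 (@rder_comp _ (@ln R) (fun x => b ^+ 2 + x ^+ 2) _ _ _ (rder_ln P) (rderD (rder_cst (b ^+ 2) x) (rderX 2 (rder_id x))))).
by rewrite /=; field; lra.
Qed.

Lemma rder_Ab b x : 0 < b -> rder (Ab b) x (Nb b x).
Proof.
move=> b0; have P : 0 < b ^+ 2 + x ^+ 2 by rewrite ltr_pwDl ?sqr_ge0 // exprn_gt0.
have x2 := sqr_ge0 (x / b).
have h1 := rderM (rder_id x) (rder_Nb x b0).
have h2 : rder (fun x => atan (x / b)) x ((1 + (x / b) ^+ 2)^-1 * b^-1).
  apply: (@rder_comp _ (@atan R)); first exact: is_derive1_atan.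
  by apply: rder_eq (rderM (rder_id x) (rder_cst b^-1 x)); ring.
apply: rder_eq (rderD (rderB h1 (rder_id x)) (rderZ b h2)).
have E : (1 + (x / b) ^+ 2)^-1 = b ^+ 2 / (b ^+ 2 + x ^+ 2).
  by rewrite exprMn exprVn; field; do ?(apply/andP; split); apply: lt0r_neq0; lra.
by rewrite E; move: (Nb b x) => n; field; do ?(apply/andP; split); apply: lt0r_neq0; lra.
Qed.

Lemma Nb_mono b b' x : 0 < b' -> b' <= b -> Nb b' x <= Nb b x.
Proof.
move=> b0 bb; apply: ler_wpM2l; first by rewrite invr_ge0.
have x2 := sqr_ge0 x; have b2 : 0 < b' ^+ 2 by rewrite exprn_gt0.
have b3 : b' ^+ 2 <= b ^+ 2 by apply: lerXn2r; rewrite ?nnegrE //; lra.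
by rewrite ler_ln ?posrE //; lra.
Qed.

(** Uniform in [x] and valid for arbitrarily small [b'], so that zeros on the critical line are
    covered. The square root comes from [log (1 + u) <= u] with [u] of the form [q / |x|], the other
    term from the mean value theorem in [b]. *)
Lemma Ab_diff b b' x : 0 < b' -> b' <= b -> `|Ab b x - Ab b' x| <= Num.sqrt (b ^+ 2 - b' ^+ 2) + 4 * (b - b').
Proof.
move=> b0 bb; have x2 := sqr_ge0 x; have b2 : 0 < b' ^+ 2 by rewrite exprn_gt0.
have b3 : b' ^+ 2 <= b ^+ 2 by apply: lerXn2r; rewrite ?nnegrE //; lra.
have -> : Ab b x - Ab b' x = x * (Nb b x - Nb b' x) + (b * atan (x / b) - b' * atan (x / b')) by rewrite /Ab; ring.
apply: le_trans (ler_normD _ _) _; apply: lerD.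
  rewrite normrM [`|Nb _ _ - _|]ger0_norm ?subr_ge0 ?Nb_mono //.
  have [->|x0] := eqVneq x 0; first by rewrite normr0 mul0r sqrtr_ge0.
  set q := Num.sqrt _; have q0 : 0 <= q by exact: sqrtr_ge0.
  have qq : q ^+ 2 = b ^+ 2 - b' ^+ 2 by rewrite sqr_sqrtr // subr_ge0.
  have xp : 0 < `|x| by rewrite normr_gt0.
  have e : Nb b x - Nb b' x = 2^-1 * ln ((b ^+ 2 + x ^+ 2) / (b' ^+ 2 + x ^+ 2)).
    by rewrite /Nb -mulrBr ln_div ?posrE //; ulra b3 b2 x2.
  have h : (b ^+ 2 + x ^+ 2) / (b' ^+ 2 + x ^+ 2) <= (1 + q / `|x|) ^+ 2.
    rewrite ler_pdivrMr; last lra.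
    have -> : b ^+ 2 = b' ^+ 2 + q ^+ 2 by rewrite qq; ring.
    have h1 : (1 + q / `|x|) ^+ 2 * x ^+ 2 = (`|x| + q) ^+ 2.
      by rewrite -[x ^+ 2]real_normK ?num_real // -exprMn mulrDl mul1r divfK // lt0r_neq0.
    have h2 : 1 * b' ^+ 2 <= (1 + q / `|x|) ^+ 2 * b' ^+ 2.
      by apply: ler_wpM2r; [exact: ltW|apply: exprn_ege1; rewrite lerDl divr_ge0].
    rewrite mulrDr h1; have : x ^+ 2 + q ^+ 2 <= (`|x| + q) ^+ 2.
      by rewrite -[x ^+ 2]real_normK ?num_real // sqrrD lerD2r lerDl mulrn_wge0 // mulr_ge0.
    ulra h2.
  have p : 0 < 1 + q / `|x| by rewrite ltr_pwDl // divr_ge0.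
  have l : ln ((b ^+ 2 + x ^+ 2) / (b' ^+ 2 + x ^+ 2)) <= 2 * (q / `|x|).
    apply: le_trans (_ : ln ((1 + q / `|x|) ^+ 2) <= _).
      by rewrite ler_ln ?posrE ?exprn_gt0 // divr_gt0 //; ulra b3 b2 x2.
    rewrite ln_sqr // ler_pM2l //; have := ln_le_sub1 p; rlra 0.
  rewrite e; apply: le_trans (_ : `|x| * (2^-1 * (2 * (q / `|x|))) <= _).
    by apply: ler_wpM2l => //; apply: ler_wpM2l => //; rewrite invr_ge0.
  by rewrite le_eqVlt; apply/orP; left; apply/eqP; field; exact: lt0r_neq0.
have D t : b' <= t <= b -> rder (fun t => t * atan (x / t)) t (atan (x / t) - (x / t) / (1 + (x / t) ^+ 2)).
  move=> /andP[t1 _]; have t0 : t != 0 by apply: lt0r_neq0; lra.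
  have h2 : rder (fun t => atan (x / t)) t ((1 + (x / t) ^+ 2)^-1 * (x * (- 1 / t ^+ 2))).
    by apply: (@rder_comp _ (@atan R)); [exact: is_derive1_atan|apply: rderZ; exact: rderV t0 (rder_id t)].
  apply: rder_eq (rderM (rder_id t) h2).
  have := sqr_ge0 (x / t) => q; have : 1 + (x / t) ^+ 2 != 0 by apply: lt0r_neq0; lra.
  by move=> q1; field; rewrite t0; move: q1; rewrite exprMn exprVn => q1; apply: contra q1 => /eqP e; apply/eqP; rewrite -[RHS](mul0r (t ^+ 2)^-1) -e; field.
have bd (u : R) : -4 <= atan u - u / (1 + u ^+ 2) <= 4.
  have [/andP[_ p2] _] := pihalf_02_cos_pihalf R.
  have a1 := atan_ltpi2 u; have a2 := atan_gtNpi2 u.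
  have u2 := sqr_ge0 u.
  have : `|u / (1 + u ^+ 2)| <= 1.
    rewrite normrM normrV ?unitfE ?lt0r_neq0 //; last ulra u2.
    rewrite [`|1 + _|]ger0_norm; last lra.
    rewrite ler_pdivrMr; last lra.
    by have := sqr_ge0 (`|u| - 1); have := sqr_ge0 `|u|; rewrite -[u ^+ 2]real_normK ?num_real // !expr2; rlra 0.
  by rewrite ler_norml => /andP[? ?]; apply/andP; split; rlra 6.
have u1 := @rder_mono R _ _ _ _ b' b bb D (fun t _ => rder_aff 0 4 t) (fun t _ => proj2 (andP (bd (x / t)))).
have u2 := @rder_mono R _ _ _ _ b' b bb (fun t _ => rder_aff 0 (-4) t) D (fun t _ => proj1 (andP (bd (x / t)))).
by rewrite ler_norml; apply/andP; split; ulra u2 u1.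
Qed.

End ZeroFactors.

(** * Comparison of [G] on two lines close to the critical line *)

Section LogDominated.
Variable R : realType.
Local Notation C := R[i].
Implicit Types (z w s rho : C) (a b c d x y t e r : R) (zs : seq C).
Variable zeta : C -> C.
Hypothesis hzeta : is_riemann_zeta zeta.
Variables (G L : C -> C).
Hypothesis HG : is_logzeta zeta G.
Hypothesis HL : is_Ln L.

Lemma zE_zero_re z : zE zeta z = 0 -> Re z <= 2^-1.
Proof.
move=> z0; rewrite leNgt; apply/negP => h; have := zT_neq0 HG h.
by rewrite /zT z0 mul0r eqxx.
Qed.

Lemma ln_Nc_Nb b x : b != 0 -> ln (Nc (b +i* x)) = Nb b x.
Proof.
move=> b0; have n : 0 < Nc (b +i* x) by rewrite Nc_gt0; apply: contra b0 => /eqP[-> _].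
rewrite /Nb -[b ^+ 2 + _]/(Re (b +i* x) ^+ 2 + Im (b +i* x) ^+ 2) -Nc_sqr ln_sqr //.
by rewrite mulrA mulVf ?mul1r // pnatr_eq0.
Qed.

Lemma ReG_ln s : 2^-1 < Re s -> Re (G s) = ln (Nc (zT zeta s)).
Proof. by move=> h; rewrite -(Nc_expG HG h) expRK. Qed.

Lemma ReG_zE b t : 2^-1 < b -> Re (G (b +i* t)) = ln (Nc (zE zeta (b +i* t))) - Nb b t.
Proof.
move=> b1; have h := zT_neq0 HG (b1 : 2^-1 < Re (b +i* t)).
have b0 : b != 0 by apply: lt0r_neq0; lra.
have s0 : b +i* t != 0 by apply: contra b0 => /eqP[-> _].
have z0 : zE zeta (b +i* t) != 0 by apply: contra h => /eqP E; rewrite /zT E mul0r.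
by rewrite ReG_ln // /zT NcM NcV ln_div ?posrE ?Nc_gt0 // ln_Nc_Nb.
Qed.

Lemma ln_prod zs (h : C -> C) s : (forall rho, rho \in zs -> s != rho) -> h s != 0 ->
  ln (Nc ((\prod_(rho <- zs) (s - rho)) * h s)) = (\sum_(rho <- zs) ln (Nc (s - rho))) + ln (Nc (h s)).
Proof.
move=> H h0; elim: zs H => [|u zs IH] H; first by rewrite !big_nil mul1r add0r.
have su : s - u != 0 by rewrite subr_eq0; apply: H; rewrite mem_head.
have Hz rho : rho \in zs -> s != rho by move=> hr; apply: H; rewrite inE hr orbT.
have p0 : \prod_(rho <- zs) (s - rho) != 0.
  by rewrite prodf_seq_neq0; apply/allP => v /Hz hv; rewrite subr_eq0.
by rewrite !big_cons -mulrA NcM lnM ?posrE ?Nc_gt0 ?mulf_neq0 // IH // addrA.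
Qed.

Lemma rder_sum (I : Type) (l : seq I) (F f : I -> R -> R) t : (forall i, rder (F i) t (f i t)) ->
  rder (fun t => \sum_(i <- l) F i t) t (\sum_(i <- l) f i t).
Proof.
move=> H; elim: l => [|i l IH].
  by rewrite big_nil; apply: rder_ext (rder_cst 0 t) => x; rewrite big_nil.
by rewrite big_cons; apply: rder_ext (rderD (H i) IH) => x; rewrite big_cons.
Qed.

Let ga rho : R := 2^-1 - Re rho.

(** What the zero [rho] contributes to the difference of [log |zE|] on the lines [1/2 + e] and
    [1/2 + e']; [Ad] is its primitive. With no zero to the right of the critical line it is
    nonnegative for [e' <= e], so its integral is its L1 norm. *)
Definition Nd e e' rho t : R := Nb (ga rho + e) (t - Im rho) - Nb (ga rho + e') (t - Im rho).
Definition Ad e e' rho t : R := Ab (ga rho + e) (t - Im rho) - Ab (ga rho + e') (t - Im rho).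

Lemma shift_rder (f : R -> R) c t d : rder f (t - c) d -> rder (fun t => f (t - c)) t d.
Proof.
move=> h; apply: rder_eq (@rder_comp _ f (fun t => t - c) t d _ h (rderB (rder_id t) (rder_cst c t))); by rewrite subr0 mulr1.
Qed.

Lemma Nd_ge0 e e' rho t : Re rho <= 2^-1 -> 0 < e' -> e' <= e -> 0 <= Nd e e' rho t.
Proof. by move=> h1 h2 h3; rewrite subr_ge0; apply: Nb_mono; rewrite /ga; lra. Qed.

Lemma rder_Ad e e' rho t : Re rho <= 2^-1 -> 0 < e' -> e' <= e -> rder (Ad e e' rho) t (Nd e e' rho t).
Proof.
move=> h1 h2 h3; apply: rderB; apply: (shift_rder (f := Ab _)); apply: rder_Ab; rewrite /ga; lra.
Qed.

Lemma Ad_bound e e' rho t : Re rho <= 2^-1 -> 0 < e' -> e' <= e -> e <= 1 ->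
  `|Ad e e' rho t| <= (Num.sqrt (2 * ga rho + 1) + 4) * Num.sqrt e.
Proof.
move=> h1 h2 h3 h4; have g0 : 0 <= ga rho by rewrite /ga; lra.
apply: le_trans (Ab_diff _ _ _) _; [lra|lra|].
rewrite [X in _ <= X]mulrDl; apply: lerD.
  rewrite -sqrtrM; last lra.
  rewrite ler_sqrt; last by apply: mulr_ge0; lra.
  have : e ^+ 2 <= e by rewrite expr2 -[X in _ <= X]mulr1; apply: ler_wpM2l; lra.
  have : 0 <= ga rho * e' by apply: mulr_ge0; lra.
  have := sqr_ge0 e'; move: (ga rho) => g.
  have -> : (g + e) ^+ 2 - (g + e') ^+ 2 = 2 * g * e + e ^+ 2 - 2 * (g * e') - e' ^+ 2 by ring.
  by move: (e ^+ 2) (e' ^+ 2) (g * e') => u v w; lra.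
rewrite ler_pM2l //; apply: le_trans (_ : e <= _); first lra.
have e0 : 0 <= e by lra.
by rewrite -[X in X <= _]sqr_sqrtr // expr2 -[X in _ <= X]mulr1; apply: ler_wpM2l; rewrite ?sqrtr_ge0 // -sqrtr1 ler_sqrt.
Qed.

Lemma Im_norm_sub (u v : R) : `|u| <= v -> - v <= u <= v. Proof. by rewrite ler_norml. Qed.

Lemma logz_factor Y : 1 <= Y -> exists zs (h : C -> C), [/\ forall rho, rho \in zs -> Re rho <= 2^-1,
  forall z, holo h z, forall z, zE zeta z = (\prod_(rho <- zs) (z - rho)) * h z &
  forall z, insq 1 (Y + 1) z -> h z != 0].
Proof.
move=> Y1; have [zs [h [hh E nz]]] := zeros_factor (ltac:(lra) : 0 < Y + 1) (holo_zE hzeta) (zE1 zeta).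
exists zs, h; split=> // rho hr; apply: zE_zero_re; rewrite E.
have -> : \prod_(rho0 <- zs) (rho - rho0) = 0 by apply/eqP; rewrite prodf_seq_eq0; apply/hasP; exists rho => //=; rewrite subrr.
by rewrite mul0r.
Qed.

Lemma ts_zeros Y : 1 <= Y -> exists ts : seq R, forall t, `|t| <= Y -> zeta (2^-1 +i* t) = 0 -> t \in ts.
Proof.
move=> Y1; have [zs [h [_ hh E nz]]] := logz_factor Y1.
exists (map (@Im R) zs) => t tY z0.
have s1 : 2^-1 +i* t != 1 by apply/eqP => /(congr1 (@Re R)) /=; lra.
have : zE zeta (2^-1 +i* t) = 0 by rewrite /zE (negbTE s1) z0 mulr0.
rewrite E => /eqP; rewrite mulf_eq0 => /orP[|/eqP h0].
  rewrite prodf_seq_eq0 => /hasP[rho hr] /=; rewrite subr_eq0 => /eqP e.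
  by apply/mapP; exists rho => //; rewrite -e.
have : h (2^-1 +i* t) != 0.
  apply: nz; rewrite /insq /= subr0; apply/andP; split; last lra.
  by rewrite ler0_norm; lra.
by rewrite h0 eqxx.
Qed.

(** [log |h|] has the horizontal derivative [Re (h' / h)], and [h' / h] is holomorphic, hence
    bounded, where [h] has no zero. *)
Lemma log_h_lip (h : C -> C) Y : 1 <= Y -> (forall z, holo h z) -> (forall z, insq 1 (Y + 1) z -> h z != 0) ->
  exists2 K : R, 0 < K & forall t x x', `|t| <= Y -> 2^-1 <= x' -> x' <= x -> x <= 6 / 10 ->
  `|ln (Nc (h (x +i* t))) - ln (Nc (h (x' +i* t)))| <= K * (x - x').
Proof.
move=> Y1 hh nz; pose k z := cD h z / h z.
have hk z : insq 1 (Y + 1) z -> holo k z.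
  move=> hz; apply: holoM; first exact: (@holo_cD _ h z 1 ltr01 (fun z _ => hh z)).
  by apply: holoV; [exact: nz|exact: hh].
have Y0 : 0 <= Y + 1 by lra.
have bc : bcont k (Re (1 : C) - (Y + 1)) (Re (1 : C) + (Y + 1)) (Im (1 : C) - (Y + 1)) (Im (1 : C) + (Y + 1)).
  by move=> z hz; apply: holo_ccont; apply: hk; exact: onsq_in.
have [M M0 HM] := bcont_bounded Y0 bc.
have box x t : `|t| <= Y -> 2^-1 <= x -> x <= 6 / 10 -> insq 1 (Y + 1) (x +i* t).
  by move=> tY x1 x2; rewrite /insq /= subr0; apply/andP; split; [rewrite ler0_norm; ulra x1 Y1 x2|ulra tY].
have kb x t : `|t| <= Y -> 2^-1 <= x -> x <= 6 / 10 -> Nc (k (x +i* t)) <= M * (4 * (Y + 1)).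
  move=> tY x1 x2; have /andP[t1 t2] := Im_norm_sub tY.
  have B := @cauchy_bound R k (Re (1 : C) - (Y + 1)) (Re (1 : C) + (Y + 1)) (Im (1 : C) - (Y + 1)) (Im (1 : C) + (Y + 1)) (x +i* t) M 1.
  have -> : M * (4 * (Y + 1)) = M / 1 * (Re (1 : C) + (Y + 1) - (Re (1 : C) - (Y + 1)) + (Im (1 : C) + (Y + 1) - (Im (1 : C) - (Y + 1)))) by field.
  have r1 : Re (1 : C) = 1 by [].
  have i1 : Im (1 : C) = 0 by [].
  apply: B => //; rewrite ?ReI ?ImI ?r1 ?i1; try (apply/andP; split; ulra t2 t1 x1 x2).
    by move=> z; rewrite -r1 -i1 => hz; apply: hk; rewrite -insqE.
  move=> z /andP[_] /or4P[]/eqP e.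
  - by apply: le_trans (Re_Nc _); rewrite ReD ReN e ReI ler0_norm; ulra x1 Y1 t2 t1.
  - by apply: le_trans (Re_Nc _); rewrite ReD ReN e ReI ger0_norm; ulra t2 t1 x2.
  - by apply: le_trans (Im_Nc _); rewrite ImD ImN e ImI ler0_norm; ulra t1.
  - by apply: le_trans (Im_Nc _); rewrite ImD ImN e ImI ger0_norm; ulra t2.
exists (M * (4 * (Y + 1))); first by rewrite !mulr_gt0 //; lra.
move=> t x x' tY x1 xx x2.
have D y : x' <= y <= x -> rder (fun y => ln (Nc (h (y +i* t)))) y (Re (k (y +i* t))).
  move=> /andP[y1 y2]; apply: rder_lnNc; first by apply: nz; apply: box => //; ulra y1 x1 y2 x2.
  by apply: cder_x; exact: cDP.
have kb' y : x' <= y <= x -> - (M * (4 * (Y + 1))) <= Re (k (y +i* t)) <= M * (4 * (Y + 1)).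
  by move=> /andP[y1 y2]; rewrite -ler_norml; apply: le_trans (Re_Nc _) _; apply: kb => //; ulra y1 x1 y2 x2.
have u1 := @rder_mono R _ _ _ _ x' x xx D (fun t _ => rder_aff 0 _ t) (fun t ht => proj2 (andP (kb' t ht))).
have u2 := @rder_mono R _ _ _ _ x' x xx (fun t _ => rder_aff 0 _ t) D (fun t ht => proj1 (andP (kb' t ht))).
move: u1 u2; move: (M * _) => K; rewrite ler_norml => u1 u2; apply/andP; split; ulra u2 u1.
Qed.

(** An L1 estimate that is uniform in [e'], so that [e'] may tend to 0. The majorant [p] collects
    the finitely many zeros up to height [Y], the factor [1 / s], and a Lipschitz term. *)
Lemma logz_L1 Y : 1 <= Y -> exists2 K : R, 0 < K & forall e e', 0 < e' -> e' <= e -> e <= 10^-1 ->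
  exists P p : R -> R, [/\ forall t, rder P t (p t), forall t, {for t, continuous p},
    forall t, `|t| <= Y -> `|Re (G ((2^-1 + e) +i* t)) - Re (G ((2^-1 + e') +i* t))| <= p t &
    P Y - P (- Y) <= K * Num.sqrt e].
Proof.
move=> Y1; have [zs [h [hre hh E nz]]] := logz_factor Y1.
have [K1 K10 HK1] := log_h_lip Y1 hh nz.
(* 0 stands for the denominator [s] of [zT], whose logarithm has the shape of that of a zero at
   0. *)
pose zs0 := 0 :: zs.
have hre0 rho : rho \in zs0 -> Re rho <= 2^-1.
  by rewrite inE => /orP[/eqP ->|/hre //]; rewrite /=; lra.
pose S := \sum_(rho <- zs0) (2 * (Num.sqrt (2 * ga rho + 1) + 4)).
have S0 : 0 <= S by apply: sumr_ge0 => rho _; rewrite mulr_ge0 // addr_ge0 ?sqrtr_ge0.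
have KY : 0 < 2 * Y * K1 by rewrite !mulr_gt0 //; lra.
exists (S + 2 * Y * K1); first lra.
move=> e e' e0 ee e1.
(* Clipping lets the derivative lemmas apply to every summand without tracking membership in the
   list. *)
pose cl rho : C := if Re rho <= 2^-1 then rho else 0.
have clr rho : Re (cl rho) <= 2^-1 by rewrite /cl; case: ifP => // _; rewrite /=; lra.
have cle rho : rho \in zs0 -> cl rho = rho by move=> /hre0; rewrite /cl => ->.
pose p t := \sum_(rho <- zs0) Nd e e' (cl rho) t + K1 * e.
pose P t := \sum_(rho <- zs0) Ad e e' (cl rho) t + K1 * e * t.
have ls : 0 <= e by lra.
exists P, p; split.
- move=> t; apply: rderD; first exact: (@rder_sum C zs0 (fun rho => Ad e e' (cl rho)) (fun rho => Nd e e' (cl rho)) t (fun rho => rder_Ad t (clr rho) e0 ee)).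
  by apply: rder_eq (rderZ (K1 * e) (rder_id t)); rewrite mulr1.
- move=> t; have [d hd] : exists d, rder p t d; last exact: rder_cont hd.
  eexists; apply: rderD; last exact: rder_cst.
  apply: (@rder_sum C zs0 (fun rho => Nd e e' (cl rho)) (fun rho t => (t - Im (cl rho)) / ((ga (cl rho) + e) ^+ 2 + (t - Im (cl rho)) ^+ 2) - (t - Im (cl rho)) / ((ga (cl rho) + e') ^+ 2 + (t - Im (cl rho)) ^+ 2))) => rho.
  have := clr rho => c1; apply: rderB; apply: (shift_rder (f := Nb _)); apply: rder_Nb; rewrite /ga; ulra c1 ee e0.
- move=> t tY; have b1 : 2^-1 < 2^-1 + e by ulra ee e0.
  have b2 : 2^-1 < 2^-1 + e' by ulra e0.
  rewrite !ReG_zE // !E.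
  have nzh x : 2^-1 <= x -> x <= 6 / 10 -> h (x +i* t) != 0.
    move=> x1 x2; apply: nz; rewrite /insq /= subr0; apply/andP; split; last ulra tY.
    by rewrite ler0_norm; ulra x1 Y1 x2.
  have sr x : 0 < x -> forall rho, rho \in zs -> (2^-1 + x) +i* t != rho.
    move=> x0 rho /hre hr; apply: contraTneq hr => <-; rewrite /= -ltNge; ulra x0.
  rewrite !ln_prod ?nzh //; try (by apply: sr; ulra b2 b1); try lra.
  have sumE : \sum_(rho <- zs) ln (Nc ((2^-1 + e) +i* t - rho)) - \sum_(rho <- zs) ln (Nc ((2^-1 + e') +i* t - rho)) = \sum_(rho <- zs) Nd e e' (cl rho) t.
    rewrite -sumrB; apply: eq_big_seq => rho hr; rewrite cle ?inE ?hr ?orbT //.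
    have lE x : 0 < x -> ln (Nc ((2^-1 + x) +i* t - rho)) = Nb (ga rho + x) (t - Im rho).
      move=> x0; have -> : (2^-1 + x) +i* t - rho = (ga rho + x) +i* (t - Im rho).
        by apply: Ceq; rewrite !ReImE /ga; ring.
      by rewrite ln_Nc_Nb //; apply: lt0r_neq0; have := hre _ hr; rewrite /ga; ulra x0.
    by rewrite !lE //; ulra b1.
  have d0 : Nb (2^-1 + e) t - Nb (2^-1 + e') t = Nd e e' (cl 0) t.
    by rewrite cle ?mem_head // /Nd /ga /= !subr0.
  have n0 : 0 <= Nd e e' (cl 0) t by apply: Nd_ge0.
  have n1 : 0 <= \sum_(rho <- zs) Nd e e' (cl rho) t by apply: sumr_ge0 => rho _; exact: Nd_ge0.
  have lh := HK1 t (2^-1 + e) (2^-1 + e') tY (ltac:(ulra b2)) (ltac:(ulra ee)) (ltac:(ulra e1)).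
  have lh2 : K1 * (2^-1 + e - (2^-1 + e')) <= K1 * e by apply: ler_wpM2l; ulra K10 b2.
  rewrite /p big_cons; move: sumE d0 n0 n1 lh lh2.
  move: (\sum_(rho <- zs) ln _) (\sum_(rho <- zs) ln _) (\sum_(rho <- zs) Nd _ _ _ _) (Nd _ _ _ _) (Nb _ _) (Nb _ _) (ln _) (ln _) (K1 * e) (K1 * _).
  move=> x1 x2 x3 x4 x5 x6 x7 x8 x9 x10 h1 h2 h3 h4; rewrite !ler_norml => /andP[h5 h6] h7.
  by apply/andP; split; rlra 8.
- have se : e <= Num.sqrt e.
    by rewrite -[X in X <= _]sqr_sqrtr // expr2 -[X in _ <= X]mulr1; apply: ler_wpM2l; rewrite ?sqrtr_ge0 // -sqrtr1 ler_sqrt //; ulra e1.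
  have -> : P Y - P (- Y) = \sum_(rho <- zs0) (Ad e e' (cl rho) Y - Ad e e' (cl rho) (- Y)) + 2 * Y * K1 * e.
    by rewrite sumrB /P; ring.
  rewrite [X in _ <= X]mulrDl; apply: lerD; last by rewrite ler_pM2l.
  rewrite /S mulr_suml big_seq [leRHS]big_seq; apply: ler_sum => rho hr.
  have a1 := Ad_bound Y (clr rho) e0 ee (ltac:(ulra e1)); have a2 := Ad_bound (- Y) (clr rho) e0 ee (ltac:(ulra e1)).
  rewrite (cle _ hr) in a1 a2 *; move: a1 a2; rewrite -mulrA; move: (_ * Num.sqrt e) => q.
  by rewrite !ler_norml => /andP[? ?] /andP[? ?]; rlra 3.
Qed.

End LogDominated.

(** * The Lebesgue integral as the limit of the shifted integrals *)

Section LebesgueLink.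
Variable R : realType.
Local Notation C := R[i].
Local Notation mu := (@lebesgue_measure R).
Implicit Types (z w s : C) (a b c d x y t e r T : R) (n : nat).

Lemma ftc_cont (p P : R -> R) a b : a < b -> (forall t, a <= t <= b -> rder P t (p t)) ->
  (forall t, {for t, continuous p}) -> (\int[mu]_(x in `[a, b]) (p x)%:E = (P b - P a)%:E)%E.
Proof.
move=> ab DP cp; rewrite EFinB; apply: continuous_FTC2 => //.
- by apply: continuous_subspaceT => x; exact: cp.
- split.
  + by move=> x; rewrite in_itv /= => /andP[h1 h2]; have [] := DP x (ltac:(by rewrite !ltW)).
  + by apply: cvg_at_right_filter; apply: (rder_cont (DP a _)); rewrite lexx ltW.
  + by apply: cvg_at_left_filter; apply: (rder_cont (DP b _)); rewrite lexx ltW.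
- move=> x; rewrite in_itv /= => /andP[h1 h2]; rewrite derive1E.
  by have [_ <-] := DP x (ltac:(by rewrite !ltW)).
Qed.

Lemma fatou_bound (D : set R) (f : nat -> R -> R) (g : R -> R) (K : R) : measurable D ->
  (forall n, measurable_fun D (f n)) -> (forall n x, 0 <= f n x) ->
  (forall x, D x -> f n x @[n --> \oo] --> g x) ->
  (forall n, \int[mu]_(x in D) (f n x)%:E <= K%:E)%E -> (\int[mu]_(x in D) (g x)%:E <= K%:E)%E.
Proof.
move=> mD mf f0 fg HK.
pose F n x := (f n x)%:E.
have -> : (\int[mu]_(x in D) (g x)%:E = \int[mu]_(x in D) limn_einf (F^~ x))%E.
  apply: eq_integral => x /set_mem Dx.
  have c : F n x @[n --> \oo] --> (g x)%:E by apply: cvg_EFin; [exact: nearW|exact: fg].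
  rewrite is_cvg_limn_einfE; last by apply/cvg_ex; exists (g x)%:E.
  by apply/esym/cvg_lim.
apply: le_trans (@fatou _ _ R mu D mD F _ _) _.
- by move=> n; apply/measurable_EFinP; exact: mf.
- by move=> n x _; rewrite lee_fin.
rewrite limn_einf_lim; apply: lime_le; first exact: is_cvg_einfs.
apply: nearW => n; apply: le_trans (HK n).
by apply: ereal_inf_lbound; exists n => //=.
Qed.

Lemma cont_NcF (f : C -> C) x t : ccont f (x +i* t) -> {for t, continuous (fun t => Nc (f (x +i* t)))}.
Proof.
move=> cf; apply/cvgrPdist_lt => e e0; have [d d0 hd] := cf e e0.
near=> u; have ut : Nc (x +i* u - x +i* t) < d.
  have -> : x +i* u - x +i* t = iC * (u - t)%:C by apply: Ceq; rewrite !ReImE; ring.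
  rewrite NcM Nc_i mul1r Nc_real distrC; near: u.
  by apply: cvgr_dist_lt.
apply: le_lt_trans (hd _ ut).
have h1 := NcB_ge (f (x +i* t)) (f (x +i* u)); have h2 := NcB_ge (f (x +i* u)) (f (x +i* t)).
by rewrite ler_norml; apply/andP; split; [lra|rewrite NcBC; lra].
Unshelve. all: by end_near.
Qed.

Variable zeta : C -> C.
Hypothesis hzeta : is_riemann_zeta zeta.
Variables (G L : C -> C).
Hypothesis HG : is_logzeta zeta G.
Hypothesis HL : is_Ln L.

Definition ge e t : R := Re (G ((2^-1 + e) +i* t)) / (4^-1 + t ^+ 2).
Definition g0 t : R := ln (Nc (zeta (2^-1 +i* t))) / (4^-1 + t ^+ 2).

Lemma wden t : 0 < 4^-1 + t ^+ 2. Proof. by have := sqr_ge0 t; lra. Qed.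

Lemma w_le4 t : `|(4^-1 + t ^+ 2)^-1| <= 4.
Proof.
rewrite ger0_norm ?invr_ge0 ?(ltW (wden t)) // -[leRHS]invrK lef_pV2 ?posrE ?wden ?invr_gt0 //.
by rewrite lerDl sqr_ge0.
Qed.

Lemma cont_w t : {for t, continuous (fun t : R => (4^-1 + t ^+ 2)^-1)}.
Proof.
apply: (@rder_cont _ _ _ (- (2 * t ^+ 1 * 1) / (4^-1 + t ^+ 2) ^+ 2)).
apply: rder_eq (@rderV R (fun t => 4^-1 + t ^+ 2) t _ (lt0r_neq0 (wden t)) (rderD (rder_cst 4^-1 t) (rderX 2 (rder_id t)))).
by rewrite add0r.
Qed.

Lemma cont_ge e t : 0 < e -> {for t, continuous (ge e)}.
Proof.
move=> e0; apply: continuousM; last exact: cont_w.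
have h : holo G ((2^-1 + e) +i* t) by apply: (holo_G HG); rewrite /=; lra.
have [d hd] := h; exact: (rder_cont (cder_y hd).1).
Qed.

Lemma s_neq1 t : 2^-1 +i* t != 1 :> C.
Proof. by apply/eqP => /(congr1 (@Re R)) /=; lra. Qed.

Lemma meas_g0 : measurable_fun setT g0.
Proof.
apply: measurable_funM.
  apply: measurableT_comp; first exact: measurable_ln.
  apply: continuous_measurable_fun => t; apply: cont_NcF; apply: holo_ccont.
  by apply: (holo_zeta hzeta); exact: s_neq1.
by apply: continuous_measurable_fun => t; exact: cont_w.
Qed.

Lemma Jint_ge e T : 0 < e -> 0 < T -> (\int[mu]_(x in `[(- T)%R, T]) (ge e x)%:E = (Jint G e T)%:E)%E.
Proof.
move=> e0 T0; have [P hP] : exists P : R -> R, forall t, inseg (- T) T t -> rder P t (ge e t).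
  by apply: rprim_ex => t _; exact: cont_ge.
rewrite /Jint (rintE hP); apply: ftc_cont => [|t ht|t]; [lra| |exact: cont_ge].
by apply: hP; rewrite inseg_le //; lra.
Qed.

(** On the critical line [|s - 1| = |s|], so [zT] and zeta have the same modulus there, and
    [log |zT|] is continuous at points where zeta does not vanish. *)
Lemma ge_cvg t : zeta (2^-1 +i* t) != 0 -> ge (n.+1%:R^-1) t @[n --> \oo] --> g0 t.
Proof.
move=> z0; have s0 : 2^-1 +i* t != 0 :> C by apply: Re_neq0; rewrite /=; lra.
pose F x := ln (Nc (zT zeta ((2^-1 + x) +i* t))).
have E0 : zT zeta (2^-1 +i* t) = (2^-1 +i* t - 1) * zeta (2^-1 +i* t) / (2^-1 +i* t).
  by rewrite /zT /zE (negbTE (s_neq1 t)).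
have nn : Nc (2^-1 +i* t - 1) = Nc (2^-1 +i* t).
  have -> : 2^-1 +i* t - 1 = (- 2^-1) +i* t by apply: Ceq; rewrite /=; lra.
  by rewrite /= sqrrN.
have z1 : zT zeta (2^-1 +i* t) != 0.
  by rewrite E0 !mulf_neq0 ?invr_eq0 // subr_eq0 s_neq1.
have F0 : F 0 = ln (Nc (zeta (2^-1 +i* t))).
  rewrite /F addr0 E0 !NcM NcV nn mulrAC mulfV ?mul1r //.
  by apply: lt0r_neq0; rewrite Nc_gt0.
have cF : {for 0, continuous F}.
  have [d hd] := @holo_zT _ _ hzeta _ s0.
  have D : rcder (fun x => zT zeta (x +i* t)) (2^-1 + 0) d by rewrite addr0; exact: cder_x.
  have D2 : rcder (fun x => zT zeta ((2^-1 + x) +i* t)) 0 (d * 1%:C).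
    by apply: (rcder_comp (k := fun x => 2^-1 + x)) D _; apply: rder_eq (rderD (rder_cst 2^-1 0) (rder_id 0)); rewrite add0r.
  by apply: rder_cont (rder_lnNc (F := fun x => zT zeta ((2^-1 + x) +i* t)) _ D2); rewrite addr0.
have -> : (fun n => ge n.+1%:R^-1 t) = (fun n => F n.+1%:R^-1 / (4^-1 + t ^+ 2)).
  apply: funext => n; rewrite /ge /F (ReG_ln HG) //=.
  by rewrite ltrDl invr_gt0 ltr0n.
rewrite /g0 -F0; apply: cvgMr_tmp.
by apply: (@cvg_comp _ _ _ (fun n : nat => n.+1%:R^-1) F _ (nbhs (0 : R))) => //; exact: cvg_harmonic.
Qed.

(** Fatou's lemma lets [e'] tend to 0 in [logz_L1]. The zeros up to height [Y] are finitely many,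
    hence a null set, on which the convention [ln 0 = 0] is harmless. *)
Lemma L1_limit Y : 1 <= Y -> exists2 K : R, 0 < K & forall e, 0 < e -> e <= 10^-1 ->
  (\int[mu]_(x in `[(- Y)%R, Y]) (`|g0 x - ge e x|)%:E <= (K * Num.sqrt e)%:E)%E.
Proof.
move=> Y1; have [K K0 HK] := logz_L1 hzeta HG Y1.
have [ts Hts] := ts_zeros hzeta HG Y1.
exists (4 * K); first by rewrite mulr_gt0.
move=> e e0 e1.
pose Z := [set` ts] : set R.
have cZ : countable Z by apply: finite_set_countable; exact: finite_seq.
have mZ : measurable Z by apply: countable_measurable => // t; exact: measurable_set1.
have Z0 : mu Z = 0%E by exact: countable_lebesgue_measure0.
pose D : set R := `[- Y, Y]%classic.
have mD : measurable D by exact: measurable_itv.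
have mge x : 0 < x -> measurable_fun setT (ge x).
  by move=> x0; apply: continuous_measurable_fun => t; exact: cont_ge.
have md (f : R -> R) A : measurable_fun setT f -> measurable A -> measurable_fun A (fun x => `|f x - ge e x|).
  move=> mf mA; apply: measurable_funTS; apply: measurableT_comp => //.
  by apply: measurable_funB => //; exact: mge.
rewrite (@ge0_negligible_integral _ _ _ mu D Z) //; last first.
  by apply/measurable_EFinP; apply: md => //; exact: meas_g0.
have [N hN] : exists N : nat, forall n, (N + n).+1%:R^-1 <= e.
  exists (Num.truncn e^-1) => n; rewrite -[leRHS]invrK lef_pV2 ?posrE ?invr_gt0 ?ltr0n //.
  apply: ltW; apply: lt_le_trans (_ : (Num.truncn e^-1).+1%:R <= _); last by rewrite ler_nat ltnS leq_addr.
  by rewrite -truncn_le_nat.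
have mDZ : measurable (D `\` Z) by exact: measurableD.
apply: (@fatou_bound _ (fun n x => `|ge (N + n).+1%:R^-1 x - ge e x|)) => //.
- by move=> n; apply: md => //; apply: mge; rewrite invr_gt0 ltr0n.
- move=> x [Dx Zx]; apply: cvg_norm; apply: cvgB; last exact: cvg_cst.
  have := @ge_cvg x; have zn : zeta (2^-1 +i* x) != 0.
    apply/eqP => z0; apply: Zx; rewrite /Z /=; apply: Hts => //.
    by move: Dx; rewrite /D /= in_itv /= ler_norml.
  move=> /(_ zn); rewrite -(cvg_shiftn N) /=.
  by under eq_fun do rewrite addnC.
- move=> n; set en := _^-1; have en0 : 0 < en by rewrite invr_gt0 ltr0n.
  have [P [p [dP cp hp PY]]] := HK e en en0 (hN n) e1.
  apply: (@le_trans _ _ (\int[mu]_(x in D) (4 * p x)%:E)%E); last first.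
    rewrite (@ftc_cont _ (fun x => 4 * P x)).
    - by rewrite lee_fin -mulrBr -mulrA ler_pM2l.
    - by ulra Y1.
    - by move=> t _; apply: rderZ; exact: dP.
    - by move=> t; apply: continuousM; [exact: cvg_cst|exact: cp].
  have p0 x : D x -> 0 <= p x.
    move=> Dx; apply: le_trans (hp x _); first exact: normr_ge0.
    by move: Dx; rewrite /D /= in_itv /= ler_norml.
  have mp : measurable_fun setT (fun x => 4 * p x).
    by apply: continuous_measurable_fun => t; apply: (@cvgM _ _ _ _ (cst 4) p); [exact: cvg_cst|exact: cp].
  apply: (@le_trans _ _ (\int[mu]_(x in D) `|ge en x - ge e x|%:E)%E).
    apply: ge0_subset_integral => //; first by apply/measurable_EFinP; apply: md => //; exact: mge.
  apply: ge0_le_integral => //.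
  + by apply/measurable_EFinP; apply: md => //; exact: mge.
  + by apply/measurable_EFinP; exact: measurable_funTS.
  + move=> x Dx; rewrite lee_fin /ge -mulrBl normrM.
    have w4 := w_le4 x.
    rewrite [leRHS]mulrC; apply: ler_pM => //; rewrite distrC; apply: hp.
    by move: Dx; rewrite /D /= in_itv /= ler_norml.
Qed.

(** The L1 bound on [[-Y, Y]] controls every [T <= Y] with the same [e]; the lower bound needs one
    shift for a whole range of heights. *)
Lemma integral_limit Y eta : 1 <= Y -> 0 < eta -> exists2 e0 : R, 0 < e0 & forall e T, 0 < e < e0 -> 0 < T <= Y ->
  `|log_zeta_integral zeta T - Jint G e T| <= eta.
Proof.
move=> Y1 eta0; have [K K0 HK] := L1_limit Y1.
exists (Num.min 10^-1 ((eta / K) ^+ 2)).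
  by rewrite lt_min invr_gt0 ltr0n exprn_gt0 // divr_gt0.
move=> e T; rewrite lt_min => /andP[e0 /andP[e1 e2]] /andP[T0 TY].
have He := HK e e0 (ltW e1).
have se : K * Num.sqrt e <= eta.
  rewrite mulrC -ler_pdivlMr // -[leRHS](ger0_norm (divr_ge0 (ltW eta0) (ltW K0))) -sqrtr_sqr.
  by apply: ler_wsqrtr; exact: (ltW e2).
pose D : set R := `[- T, T]%classic.
have mD : measurable D by exact: measurable_itv.
have mge : measurable_fun setT (ge e).
  by apply: continuous_measurable_fun => t; exact: cont_ge.
have mdiff : measurable_fun setT (fun x => g0 x - ge e x) by apply: measurable_funB => //; exact: meas_g0.
have sub : (\int[mu]_(x in D) (`|g0 x - ge e x|)%:E <= eta%:E)%E.
  apply: le_trans (le_trans _ He) _; last by rewrite lee_fin.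
  apply: ge0_subset_integral => //.
    apply/measurable_EFinP; apply: measurable_funTS; exact: measurableT_comp.
  by move=> x; rewrite /D /= !in_itv /= => /andP[? ?]; apply/andP; split; rlra 5.
have i1 : mu.-integrable D (EFin \o (fun x => g0 x - ge e x)).
  apply/integrableP; split; first by apply/measurable_EFinP; exact: measurable_funTS.
  by apply: le_lt_trans sub _; rewrite ltry.
have i2 : mu.-integrable D (EFin \o ge e).
  apply: continuous_compact_integrable; first exact: segment_compact.
  by apply: continuous_subspaceT => x; exact: cont_ge.
have i3 : mu.-integrable D (EFin \o g0).
  have -> : EFin \o g0 = (EFin \o (fun x => g0 x - ge e x)) \+ (EFin \o ge e).
    by apply: funext => x /=; rewrite -EFinD subrK.
  exact: integrableD.
have -> : Jint G e T = (\int[mu]_(x in D) ge e x)%R by rewrite /Rintegral Jint_ge.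
rewrite /log_zeta_integral -/g0 -/D.
rewrite -[X in X - _]/((\int[mu]_(x in D) g0 x)%R) -RintegralB //.
apply: le_trans (le_normr_Rintegral _ _) _ => //.
rewrite /Rintegral -lee_fin fineK // ge0_fin_numE; last by apply: integral_ge0 => x _; rewrite lee_fin.
by apply: le_lt_trans sub _; rewrite ltry.
Qed.

End LebesgueLink.

(** * Chebyshev bounds and Dirichlet approximation *)

Section Chebyshev.
Local Open Scope nat_scope.
Implicit Types (n m k p : nat).

Definition primepi n := \sum_(0 <= p < n.+1 | prime p) 1.
Definition primes_in m n := \sum_(m.+1 <= p < n.+1 | prime p) 1.

Lemma primepi_cat m n : m <= n -> primepi n = primepi m + primes_in m n.
Proof. by move=> mn; rewrite /primepi /primes_in (@big_cat_nat _ _ _ m.+1). Qed.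

Lemma prod_primes_dvd (s : seq nat) n : uniq s -> (forall p, p \in s -> prime p && (p %| n)) ->
  \prod_(p <- s) p %| n.
Proof.
elim: s => [|p s IH] /=; first by rewrite big_nil dvd1n.
move=> /andP[ps us] H; have /andP[pp pn] := H p (mem_head _ _).
have Hs q : q \in s -> prime q && (q %| n) by move=> qs; apply: H; rewrite inE qs orbT.
rewrite big_cons Gauss_dvd ?pn /=; first exact: IH.
rewrite prime_coprime // Euclid_dvd_prod // big_has; apply/hasPn => q qs /=.
by have /andP[qp _] := Hs q qs; rewrite dvdn_prime2 //; apply: contraNneq ps => ->.
Qed.

Lemma prime_ndvd_fact p n : prime p -> n < p -> ~~ (p %| n`!).
Proof.
move=> pp; elim: n => [|n IH] np; first by rewrite Euclid_dvd1.
by rewrite factS Euclid_dvdM // negb_or gtnNdvd //= IH // ltnW.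
Qed.

Lemma bin_double_le n : 'C(n.*2, n) <= 2 ^ n.*2.
Proof.
rewrite -[2]/(1 + 1) expnDn.
have h : n < n.*2.+1 by rewrite ltnS -addnn leq_addr.
by rewrite (bigD1 (Ordinal h)) //= !exp1n !muln1 leq_addr.
Qed.

Lemma bin_double_ge n : 2 ^ n <= 'C(n.*2, n).
Proof.
elim: n => // n IH; rewrite doubleS !binS expnS.
case: n IH => [|n] IH; first by [].
by rewrite doubleS !binS in IH *; lia.
Qed.

Lemma prod_exp_count m n x : \prod_(m.+1 <= p < n.+1 | prime p) x = x ^ primes_in m n.
Proof. by rewrite /primes_in (big_morph (expn x) (expnD x) (expn0 x)); apply: eq_bigr => i _; rewrite expn1. Qed.

(** With [n = 2^k], the primes in [(n, 2 n]] divide the central binomial coefficient, which is at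
    most [2^(2 n)], and each of them exceeds [2^k]. *)
Lemma dyadic_primes k : k * primes_in (2 ^ k) (2 ^ k.+1) <= 2 ^ k.+1.
Proof.
rewrite -(@leq_exp2l 2) // expnM; set n := 2 ^ k.
have n0 : 0 < n by rewrite expn_gt0.
have E : 2 ^ k.+1 = n.*2 by rewrite expnS mul2n.
rewrite E; apply: leq_trans (bin_double_le n); rewrite -prod_exp_count.
apply: (@leq_trans (\prod_(p <- [seq p <- index_iota n.+1 n.*2.+1 | prime p]) p)).
  rewrite big_filter big_seq_cond [leqRHS]big_seq_cond; apply: leq_prod => p.
  by rewrite mem_index_iota => /andP[/andP[h _] _]; exact: ltnW.
apply: dvdn_leq; first by rewrite bin_gt0 -addnn leq_addr.
apply: prod_primes_dvd; first by rewrite filter_uniq // iota_uniq.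
move=> p; rewrite mem_filter mem_index_iota => /andP[pp /andP[np pn]]; rewrite pp /=.
have h : p %| n.*2`! by apply: dvdn_fact; rewrite prime_gt0 // -ltnS.
have nd : n <= n.*2 by rewrite -addnn leq_addr.
have E2 : n.*2 - n = n by rewrite -addnn addnK.
move: h; rewrite -(bin_fact nd) E2 !Euclid_dvdM //.
by rewrite (negbTE (prime_ndvd_fact pp np)) !orbF.
Qed.

Lemma divn_double n m : 0 < m -> n.*2 %/ m <= (n %/ m).*2 + (m <= n.*2).
Proof.
move=> m0; have [h|h] := leqP m n.*2; last by rewrite divn_small.
by rewrite -addnn; apply: leq_trans (leq_divDl _ _ _) _; rewrite addnn.
Qed.

(** Legendre's formula: each power of [p] up to [2 n] adds at most 1 to the exponent, which is
    therefore at most [log_p (2 n)]. *)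
Lemma bin_pfactor_le p n : prime p -> 0 < n -> p ^ logn p 'C(n.*2, n) <= n.*2.
Proof.
move=> pp n0; have p1 := prime_gt1 pp; have d0 : 0 < n.*2 by rewrite double_gt0.
have nd : n <= n.*2 by rewrite -addnn leq_addr.
have E2 : n.*2 - n = n by rewrite -addnn addnK.
suff h : logn p 'C(n.*2, n) <= trunc_log p n.*2.
  by apply: leq_trans (trunc_logP p1 d0); rewrite leq_exp2l.
have E : logn p 'C(n.*2, n) + (logn p n`!).*2 = logn p n.*2`!.
  rewrite -(bin_fact nd) E2 !lognM ?muln_gt0 ?fact_gt0 ?bin_gt0 //.
  by rewrite addnn.
have F : logn p n`! = \sum_(1 <= k < n.*2.+1) n %/ p ^ k.
  rewrite logn_fact // [RHS](@big_cat_nat _ _ _ n.+1) //= [X in _ + X]big_nat_cond.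
  rewrite [X in _ + X]big1 ?addn0 // => k /andP[/andP[h _] _].
  by rewrite divn_small //; apply: leq_trans (ltn_expl _ p1) _; rewrite leq_exp2l // ltnW.
have S : logn p n.*2`! <= (logn p n`!).*2 + \sum_(1 <= k < n.*2.+1) (p ^ k <= n.*2).
  rewrite F logn_fact // -[(\sum_(_ <= _ < _) _).*2]mul2n big_distrr -big_split /=.
  by apply: leq_sum => k _; rewrite mul2n; apply: divn_double; rewrite expn_gt0 prime_gt0.
have T : \sum_(1 <= k < n.*2.+1) (p ^ k <= n.*2) <= trunc_log p n.*2.
  apply: (@leq_trans (\sum_(1 <= k < n.*2.+1) (k <= trunc_log p n.*2))).
    apply: leq_sum => k _; have [h|//] := leqP (p ^ k) n.*2.
    by rewrite (trunc_log_max p1 h).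
  move: (trunc_log _ _) => t; elim: n.*2 => [|m IH]; first by rewrite big_geq.
  have [h|h] := leqP m.+1 t.
    apply: (@leq_trans (\sum_(1 <= k < m.+2) 1)); first by apply: leq_sum => k _; case: (k <= t).
    by rewrite sum_nat_const_nat; lia.
  by rewrite big_nat_recr //= [(m.+1 <= t)]leqNgt h addn0.
by move: S T; rewrite -E; lia.
Qed.

Lemma primepi_lower n : 0 < n -> 2 ^ n <= n.*2 ^ primepi n.*2.
Proof.
move=> n0; apply: leq_trans (bin_double_ge n) _.
have nd : n <= n.*2 by rewrite -addnn leq_addr.
have C0 : 0 < 'C(n.*2, n) by rewrite bin_gt0.
rewrite -{1}(partnT C0) (@widen_partn (n.*2 + 'C(n.*2, n))) ?leq_addl //.
rewrite (@big_cat_nat _ _ _ n.*2.+1) //=; last by rewrite ltnS leq_addr.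
rewrite [X in _ * X]big_nat_cond [X in _ * X]big1 ?muln1; last first.
  move=> p /andP[/andP[h _] _]; case pp : (prime p); last by rewrite lognE pp.
  suff -> : logn p 'C(n.*2, n) = 0 by [].
  rewrite lognE pp C0 /= ifF //; apply: contraTF h => h; rewrite -leqNgt.
  have : p %| n.*2`! by rewrite -(bin_fact nd) dvdn_mulr.
  by apply: contraTT; rewrite -ltnNge; exact: prime_ndvd_fact.
apply: (@leq_trans (\prod_(0 <= p < n.*2.+1 | prime p) n.*2)); last first.
  by rewrite /primepi (big_morph (expn n.*2) (expnD _) (expn0 _)); apply: leq_prod => p _; rewrite expn1.
rewrite [leqRHS]big_mkcond; apply: leq_prod => p _; case: ifP => pp; first exact: bin_pfactor_le.
by rewrite lognE pp.
Qed.

Lemma primepi_pow_lower m : 2 ^ m <= m.+1 * primepi (2 ^ m.+1).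
Proof.
rewrite -(@leq_exp2l 2) // expnM; have := @primepi_lower (2 ^ m); rewrite expn_gt0 => /(_ isT).
by rewrite -mul2n -expnS.
Qed.

Lemma primepi_pow_upper k : k * primepi (2 ^ k) <= 6 * 2 ^ k.
Proof.
elim: k => // k IH; case: k IH => [|k] IH.
  by rewrite mul1n /primepi !big_mkcond /= unlock.
rewrite (@primepi_cat (2 ^ k.+1)); last by rewrite leq_exp2l.
case: k IH => [|k] IH; first by rewrite /primepi /primes_in !big_mkcond /= unlock.
have h := dyadic_primes k.+2; rewrite !expnS in IH h *.
move: (primepi _) (primes_in _ _) IH h => a b; move: (2 ^ k) => e; nia.
Qed.

(** Six dyadic scales let the lower bound at [2^m] beat the upper bound at [2^(m - 6)]: with
    [e = 2^(m - 6)] these are [32 e / m] and [6 e / (m - 6) <= 12 e / m]. *)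
Lemma primes_in_lower m : 12 <= m -> 2 ^ m <= 4 * (m * primes_in (2 ^ (m - 6)) (2 ^ m)).
Proof.
move=> m12; have h1 := primepi_pow_lower m.-1; have h2 := primepi_pow_upper (m - 6).
rewrite prednK in h1; last lia.
rewrite (@primepi_cat (2 ^ (m - 6))) in h1; last by rewrite leq_exp2l; lia.
have E1 : 2 ^ m = 64 * 2 ^ (m - 6) by rewrite -[64]/(2 ^ 6) -expnD subnKC //; lia.
have E2 : 2 ^ m.-1 = 32 * 2 ^ (m - 6) by rewrite -[32]/(2 ^ 5) -expnD; congr (_ ^ _); lia.
rewrite E1 in h1 *; rewrite E2 in h1.
move: (primepi _) (primes_in _ _) h1 h2 => a b; move: (2 ^ _) => e h1 h2.
have h3 : m * a <= 12 * e by nia.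
nia.
Qed.

End Chebyshev.

Section Dirichlet.
Variable R : realType.
Implicit Types (x y t a : R).

Lemma cos_ge x : 1 - x ^+ 2 / 2 <= cos x.
Proof.
pose f (t : R) := t ^+ 2 / 2 + cos t; wlog x0 : x / 0 <= x.
  move=> H; have [h|h] := lerP 0 x; first exact: H.
  by rewrite -cosN -sqrrN; apply: H; lra.
have D t : rder (@cos R) t (- sin t) by exact: is_derive_cos.
have D2 t : rder (@sin R) t (cos t) by exact: is_derive_sin.
have sx t : 0 <= t -> sin t <= t.
  move=> t0; have := @rder_mono _ (@sin R) (@cos R) id (fun=> 1) 0 t t0.
  rewrite sin0 !subr0; apply => u _; [exact: D2|exact: rder_id|exact: cos_le1].
have := @rder_mono _ (fun t => - cos t) (fun t => sin t) (fun t => t ^+ 2 / 2) id 0 x x0.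
rewrite cos0 expr0n /= mul0r subr0 => h; suff : - cos x - -1 <= x ^+ 2 / 2 by lra.
apply: h => u /andP[u0 _].
- by apply: rder_eq (rderN (D u)); rewrite opprK.
- apply: rder_ext (rder_eq _ (rderZ 2^-1 (rderX 2 (rder_id u)))) => [t|]; first by rewrite mulrC.
  by field.
- exact: sx.
Qed.

Lemma cos_int x (m : int) : cos (x + m%:~R * (2 * pi)) = cos x.
Proof.
case: m => n.
  elim: n => [|n IH]; first by rewrite mul0r addr0.
  by rewrite -addn1 PoszD intrD mulrDl mul1r addrA [2 * pi]mulr_natl cosD2pi -[pi *+ 2]mulr_natl.
rewrite NegzE; elim: n x => [|n IH] x.
  by rewrite mulrNz mulN1r -[LHS]cosD2pi -[pi *+ 2]mulr_natl subrK.
rewrite -[LHS]cosD2pi -[RHS]IH -[pi *+ 2]mulr_natl; congr cos.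
by rewrite !mulrNz -[n.+2]addn1 PoszD intrD; ring.
Qed.

Lemma frac_arith (k1 k2 t b p u1 u2 : R) : p != 0 ->
  (k2 - k1) * t * b = (k2 * t * b / p - u2 - (k1 * t * b / p - u1)) * p + (u2 - u1) * p.
Proof. by move=> p0; field. Qed.

(** Pigeonhole with 8 boxes per frequency: two multiples of [tau] fall into the same boxes, so their
    difference moves every angle by at most [2 pi / 8 <= 1] modulo [2 pi], where the cosine is at
    least [1/2]. *)
Lemma dirichlet (s : seq R) (tau : R) : exists2 j : nat, (1 <= j <= 8 ^ size s)%N &
  forall a, a \in s -> 2^-1 <= cos (j%:R * tau * a).
Proof.
pose fr (k : nat) (a : R) : R := k%:R * tau * a / (2 * pi) - (Num.floor (k%:R * tau * a / (2 * pi)))%:~R.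
have fr0 k a : 0 <= fr k a < 1.
  have /andP[h1 h2] := floor_itv (k%:R * tau * a / (2 * pi)).
  by move: h1 h2; rewrite /fr intrD; lra.
pose bx (k : nat) (a : R) : 'I_8 := inord (Num.truncn (8 * fr k a)).
have bxP k a : (bx k a)%:R <= 8 * fr k a < (bx k a)%:R + 1.
  have /andP[h1 h2] := fr0 k a; have h3 : 0 <= 8 * fr k a by rewrite mulr_ge0.
  have /andP[h4 h5] := truncn_itv h3.
  rewrite /bx inordK; first by rewrite natr1 h4.
  by rewrite -(ltr_nat R); apply: le_lt_trans h4 _; lra.
pose f (k : 'I_(8 ^ size s).+1) : {ffun 'I_(size s) -> 'I_8} := [ffun i : 'I_(size s) => bx k (nth 0 s i)].
have /injectivePn[k1 [k2 k12 E]] : ~~ injectiveb f.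
  by apply/injectiveP => inj; have := leq_card f inj; rewrite card_ffun !card_ord ltnn.
wlog lt12 : k1 k2 k12 E / (k1 < k2)%N.
  move=> H; have [h|h|h] := ltngtP k1 k2; [exact: H k12 E h|apply: (H k2 k1) => //; by rewrite eq_sym|].
  by move: k12; rewrite (val_inj h) eqxx.
exists (k2 - k1)%N; first by rewrite subn_gt0 lt12 /=; apply: leq_trans (leq_subr _ _) _; rewrite -ltnS.
move=> a /(nthP 0)[i si <-]; set b := nth 0 s i.
have Eb : bx k1 b = bx k2 b by move: E => /ffunP /(_ (Ordinal si)); rewrite !ffunE.
have /andP[b1 b2] := bxP k1 b; have /andP[b3 b4] := bxP k2 b; rewrite Eb in b1 b2.
have [/andP[p0 p2] _] := @pihalf_02_cos_pihalf R.
have pi0 : pi != 0 :> R by rewrite gt_eqF // pi_gt0.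
pose m : int := Num.floor (k2%:R * tau * b / (2 * pi)) - Num.floor (k1%:R * tau * b / (2 * pi)).
have -> : (k2 - k1)%:R * tau * b = (fr k2 b - fr k1 b) * (2 * pi) + m%:~R * (2 * pi).
  rewrite /fr /m natrB; last exact: ltnW.
  by rewrite intrB; apply: frac_arith; rewrite mulf_neq0.
rewrite cos_int; apply: le_trans (cos_ge _).
set d := fr k2 b - fr k1 b; have d8 : `|d * (2 * pi)| <= 1.
  rewrite normrM [X in _ * X]ger0_norm; last by ulra p0.
  have d1 : `|d| <= 8^-1 by rewrite ler_norml; apply/andP; split; rewrite /d; ulra b2 b3 b1 b4.
  by apply: le_trans (ler_pM (normr_ge0 _) _ d1 (_ : 2 * pi <= 8)) _; ulra p0 p2.
have : (d * (2 * pi)) ^+ 2 <= 1.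
  by rewrite -real_normK ?num_real // expr_le1.
rlra 0.
Qed.

End Dirichlet.

(** * The lower bound *)

Section GaussKernel.
Variable R : realType.
Local Notation C := R[i].
Implicit Types (f : C -> C) (z w s p : C) (a b c d x y t u v e r la T Y l : R).

Definition ga v : R := expR (- (v ^+ 2 / 2)).

Lemma ga_ge0 v : 0 <= ga v. Proof. exact: expR_ge0. Qed.

Lemma gauss_decay_ex : exists c : R, 0 < c /\ forall v, (1 + v ^+ 2) ^+ 4 * expR (- (v ^+ 2 / 4)) <= c.
Proof.
exists ((16 ^+ 2) ^+ 2 * 2); split; first by rewrite mulr_gt0 ?ltr0n // !exprn_gt0 // ltr0n.
move=> v; have v2 := sqr_ge0 v; set q := v ^+ 2 in v2 *.
rewrite expRN ler_pdivrMr ?expR_gt0 //.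
have h := @sqr_le_exp R ((1 + q) / 8) (ltac:(lra)).
have h1 : (1 + q) ^+ 2 <= 16 ^+ 2 * expR ((1 + q) / 8) by move: h; rewrite expr_div_n; lra.
move: h1; set M : R := 16 ^+ 2; have M0 : 0 < M by rewrite exprn_gt0 // ltr0n.
clearbody M => h1.
have h2 : (1 + q) ^+ 4 <= (M * expR ((1 + q) / 8)) ^+ 2.
  by rewrite -[4%N]/(2 * 2)%N exprM; apply: lerXn2r; rewrite ?nnegrE ?sqr_ge0 // mulr_ge0 ?expR_ge0 ?ltW.
apply: le_trans h2 _; rewrite exprMn -expRM_natl -[leRHS]mulrA; apply: ler_wpM2l; first exact: sqr_ge0.
have -> : 2 * ((1 + q) / 8) = 4^-1 + q / 4 by field.
rewrite expRD; apply: ler_wpM2r; first exact: expR_ge0.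
have := expR_ge1Dx (- 4^-1 : R); rewrite expRN => h3.
have p0 := expR_gt0 (4^-1 : R); have : expR 4^-1 * (expR 4^-1)^-1 = 1 :> R by rewrite mulfV // gt_eqF.
move: h3 p0; set e := expR _; set e' := e^-1; nra.
Qed.

(** Fixed once by choice, so that all estimates of polynomial times Gaussian share one constant. *)
Definition cG : R := xget 0 [set c | 0 < c /\ forall v, (1 + v ^+ 2) ^+ 4 * expR (- (v ^+ 2 / 4)) <= c].

Lemma cGP : 0 < cG /\ forall v, (1 + v ^+ 2) ^+ 4 * expR (- (v ^+ 2 / 4)) <= cG.
Proof. have [c hc] := gauss_decay_ex; rewrite /cG; case: xgetP => [y _ //|/(_ c) h]; by case: h. Qed.

Lemma cG_gt0 : 0 < cG. Proof. by case: cGP. Qed.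

Lemma gauss_decay v : (1 + v ^+ 2) ^+ 4 * expR (- (v ^+ 2 / 4)) <= cG.
Proof. by case: cGP. Qed.

Lemma gauss_decay1 v k : (k <= 4)%N -> (1 + v ^+ 2) ^+ k * expR (- (v ^+ 2 / 4)) <= cG.
Proof.
move=> k4; apply: le_trans (gauss_decay v); apply: ler_wpM2r; first exact: expR_ge0.
by apply: ler_weXn2l => //; rewrite lerDl sqr_ge0.
Qed.

Lemma ga_le4 v : ga v <= expR (- (v ^+ 2 / 4)).
Proof. by rewrite ler_expR lerN2; have := sqr_ge0 v; lra. Qed.

Lemma ga_bump v : (1 + v ^+ 2) * ga v <= cG * (1 + v ^+ 2)^-1.
Proof.
have v2 := sqr_ge0 v; have p : 0 < 1 + v ^+ 2 by lra.
rewrite ler_pdivlMr // mulrAC -expr2; apply: le_trans (@gauss_decay1 v 2 isT).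
by apply: ler_wpM2l; [exact: sqr_ge0|exact: ga_le4].
Qed.

Lemma rder_ga v : rder ga v (- v * ga v).
Proof.
have d : rder (fun v => - (v ^+ 2 / 2)) v (- v).
  apply: rder_ext (rder_eq _ (rderZ (- 2^-1) (rderX 2 (rder_id v)))) => [x|]; first by rewrite mulrC mulrN.
  by rewrite mulr1 expr1; field.
by apply: rder_eq (rder_exp d); rewrite mulrC.
Qed.

Definition gk la p : C := cexp ((2^-1)%:C * (p * p)) * ((2^-1)%:C * (cexp (la%:C * p) + cexp (- (la%:C * p)))).

(** [gk] is [e^(p^2 / 2) cosh (la p)]. Two humps make the function even and real on [Re s = b], as
    only integrals over symmetric intervals are under control. *)
Definition gkT la b T s : C := gk la (s - (b +i* T)) + gk la (s - (b +i* (- T))).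

Lemma holo_gk la p : holo (gk la) p.
Proof.
have h : holo (fun p => la%:C * p) p by apply: holoM; [exact: holo_cst|exact: holo_id].
apply: holoM.
  by apply: holo_exp; apply: holoM; [exact: holo_cst|apply: holoM; exact: holo_id].
apply: holoM; first exact: holo_cst.
by apply: holoD; [exact: holo_exp|apply: holo_exp; exact: holoN].
Qed.

Lemma holo_gkT la b T s : holo (gkT la b T) s.
Proof.
by apply: holoD; apply: (@holo_comp _ (gk la)) (holo_gk _ _); apply: holoB; [exact: holo_id|exact: holo_cst|exact: holo_id|exact: holo_cst].
Qed.

Lemma Nc_gk la x v : 0 <= la -> Nc (gk la (x +i* v)) <= expR (x ^+ 2 / 2 + la * `|x|) * ga v.
Proof.
move=> la0; rewrite /gk !NcM Nc_real ger0_norm ?invr_ge0 // Nc_cexp.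
have -> : Re ((2^-1)%:C * ((x +i* v) * (x +i* v))) = x ^+ 2 / 2 + - (v ^+ 2 / 2) by rewrite !ReImE; field.
rewrite expRD -!/(ga _) expRD -!mulrA; apply: ler_wpM2l; first exact: expR_ge0.
rewrite mulrC; apply: ler_wpM2r; first exact: ga_ge0.
rewrite mulrC ler_pdivrMr //; apply: le_trans (NcD _ _) _.
have e1 : la * x <= la * `|x| by apply: ler_wpM2l => //; exact: ler_norm.
have e2 : - (la * x) <= la * `|x| by rewrite -mulrN; apply: ler_wpM2l => //; rewrite -normrN; exact: ler_norm.
rewrite !Nc_cexp ReN !ReImE mul0r subr0.
move: e1 e2; rewrite -(ler_expR (la * x)) -(ler_expR (- (la * x))); lra.
Qed.

Lemma gk_im la v : gk la (0 +i* v) = (ga v * cos (la * v))%:C.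
Proof.
have -> : 0 +i* v = iC * v%:C :> C by apply: Ceq; rewrite !ReImE; ring.
rewrite /gk.
have -> : la%:C * (iC * v%:C) = iC * (la * v)%:C :> C by rewrite realC_M; ring.
have -> : - (iC * (la * v)%:C) = iC * (- (la * v))%:C :> C by rewrite realC_N; ring.
have -> : (2^-1)%:C * (iC * v%:C * (iC * v%:C)) = (- (v ^+ 2 / 2))%:C :> C by apply: Ceq; rewrite !ReImE; field.
by rewrite cexp_real !Nc_expI cosN sinN -/(ga v); apply: Ceq; rewrite !ReImE; field.
Qed.

Lemma subI x y b T : x +i* y - (b +i* T) = (x - b) +i* (y - T) :> C.
Proof. by apply: Ceq; rewrite !ReImE. Qed.

Lemma Nc_gkT la b T x y : 0 <= la -> Nc (gkT la b T (x +i* y)) <= expR ((x - b) ^+ 2 / 2 + la * `|x - b|) * (ga (y - T) + ga (y + T)).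
Proof.
move=> la0; rewrite /gkT !subI opprK; apply: le_trans (NcD _ _) _.
by rewrite mulrDr; apply: lerD; exact: Nc_gk.
Qed.

Lemma gkT_im la b T y : gkT la b T (b +i* y) = (ga (y - T) * cos (la * (y - T)) + ga (y + T) * cos (la * (y + T)))%:C.
Proof. by rewrite /gkT !subI opprK subrr !gk_im -realC_D. Qed.

Lemma int_bumps (F : R -> C) A T Y : 0 <= Y -> segcont F (- Y) Y -> 0 <= A ->
  (forall t, Nc (F t) <= A * ((1 + (t - T) ^+ 2)^-1 + (1 + (t + T) ^+ 2)^-1)) ->
  Nc (cint F (- Y) Y) <= 8 * A.
Proof.
move=> Y0 sc A0 H.
pose P t := A * (1^-1 * atan (1 * (t - T))) + A * (1^-1 * atan (1 * (t - - T))).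
have D t : rder P t (A * ((1 + (t - T) ^+ 2)^-1 + (1 + (t + T) ^+ 2)^-1)).
  apply: rder_eq (rderD (rderZ A (rder_atan1 T t ltr01)) (rderZ A (rder_atan1 (- T) t ltr01))).
  by rewrite !mul1r opprK mulrDr.
apply: le_trans (cint_le (G := P) _ sc (fun t _ => D t) (fun t _ => H t)) _; first by move: Y0; lra.
have h1 := @atan1_diff R 1 T (- Y) Y A ltr01 A0; have h2 := @atan1_diff R 1 (- T) (- Y) Y A ltr01 A0.
rewrite /P; move: h1 h2; rewrite !divr1; lra.
Qed.

Lemma line_bound f la b T x A Y : 0 <= la -> 0 <= A -> 0 <= Y -> (forall t, ccont f (x +i* t)) ->
  (forall t, Nc (f (x +i* t)) <= A * (1 + (t - T) ^+ 2)) -> (forall t, Nc (f (x +i* t)) <= A * (1 + (t + T) ^+ 2)) ->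
  Nc (cint (fun t => f (x +i* t) * gkT la b T (x +i* t)) (- Y) Y) <= 8 * (A * (cG * expR ((x - b) ^+ 2 / 2 + la * `|x - b|))).
Proof.
move=> la0 A0 Y0 cf h1 h2; set E := expR _; have E0 : 0 <= E := expR_ge0 _.
apply: (@int_bumps _ _ T) => //.
- move=> t _; apply: (@cont_y R (fun z => f z * gkT la b T z)); apply: ccontM; first exact: cf.
  by apply: holo_ccont; exact: holo_gkT.
- by rewrite !mulr_ge0 // (ltW cG_gt0).
move=> t; rewrite NcM; apply: le_trans (ler_wpM2l (Nc_ge0 _) (Nc_gkT b T x t la0)) _; rewrite -/E.
rewrite mulrCA mulrDr.
have k1 : Nc (f (x +i* t)) * ga (t - T) <= A * (cG * (1 + (t - T) ^+ 2)^-1).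
  apply: le_trans (ler_wpM2r (ga_ge0 _) (h1 t)) _; rewrite -mulrA; apply: ler_wpM2l => //; exact: ga_bump.
have k2 : Nc (f (x +i* t)) * ga (t + T) <= A * (cG * (1 + (t + T) ^+ 2)^-1).
  apply: le_trans (ler_wpM2r (ga_ge0 _) (h2 t)) _; rewrite -mulrA; apply: ler_wpM2l => //; exact: ga_bump.
apply: le_trans (ler_wpM2l E0 (lerD k1 k2)) _.
by rewrite le_eqVlt; apply/orP; left; apply/eqP; ring.
Qed.

Lemma ga_far v Y : 1 <= Y -> Y / 2 <= v -> (1 + Y) * ga v <= 8 * cG / Y.
Proof.
move=> Y1 hv; have cg := cG_gt0; rewrite ler_pdivlMr; last lra.
have v2 : Y ^+ 2 / 4 <= v ^+ 2.
  have -> : Y ^+ 2 / 4 = (Y / 2) ^+ 2 by field.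
  by apply: lerXn2r; rewrite ?nnegrE; lra.
have h : (1 + v ^+ 2) ^+ 1 * ga v <= cG.
  apply: le_trans (@gauss_decay1 v 1 isT); apply: ler_wpM2l; last exact: ga_le4.
  by rewrite expr1; have := sqr_ge0 v; lra.
have g0 := ga_ge0 v; rewrite mulrAC.
have h3 : (1 + Y) * Y <= 8 * (1 + v ^+ 2) by move: v2; rewrite !expr2; nra.
apply: le_trans (ler_wpM2r g0 h3) _; by rewrite -mulrA ler_pM2l.
Qed.

Lemma gkT_far la b T x t Y : 0 <= la -> 0 <= T -> 1 <= Y -> 2 * T <= Y -> `|t| = Y -> `|x - b| <= 3 ->
  (1 + Y) * Nc (gkT la b T (x +i* t)) <= 16 * cG * expR (9 / 2 + la * 3) / Y.
Proof.
move=> la0 T0 Y1 TY tY xb; have xb0 := normr_ge0 (x - b).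
have e : expR ((x - b) ^+ 2 / 2 + la * `|x - b|) <= expR (9 / 2 + la * 3).
  rewrite ler_expR; apply: lerD; last exact: ler_wpM2l.
  have : (x - b) ^+ 2 <= 3 ^+ 2 by rewrite le_sqr_norm.
  lra.
have g1 : (1 + Y) * ga (t - T) <= 8 * cG / Y.
  have -> : ga (t - T) = ga `|t - T| by rewrite /ga real_normK ?num_real.
  by apply: ga_far => //; have := ler_normD (t - T) T; rewrite subrK tY (ger0_norm T0); lra.
have g2 : (1 + Y) * ga (t + T) <= 8 * cG / Y.
  have -> : ga (t + T) = ga `|t + T| by rewrite /ga real_normK ?num_real.
  by apply: ga_far => //; have := ler_normB (t + T) T; rewrite addrK tY (ger0_norm T0); ulra TY.
have Y0 : 0 <= 1 + Y by lra.
apply: le_trans (ler_wpM2l Y0 (Nc_gkT b T x t la0)) _; rewrite mulrCA mulrDr.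
apply: le_trans (ler_pM (expR_ge0 _) _ e (lerD g1 g2)) _.
  by rewrite -mulrDr mulr_ge0 // addr_ge0 ?ga_ge0.
by rewrite le_eqVlt; apply/orP; left; apply/eqP; ring.
Qed.

Lemma rect_sides f a c Y (K : R) : a <= c -> 0 <= Y -> (forall z, a <= Re z <= c -> holo f z) ->
  (forall x t, a <= x <= c -> `|t| = Y -> Nc (f (x +i* t)) <= K) ->
  Nc (cint (fun t => f (a +i* t)) (- Y) Y - cint (fun t => f (c +i* t)) (- Y) Y) <= 2 * (c - a) * K.
Proof.
move=> ac Y0 hf HK; have YY : - Y <= Y by move: Y0; lra.
have := goursat ac YY (fun z (h : inrect a c (- Y) Y z) => hf z (proj1 (andP h))).
rewrite /rect => E.
have sc t : segcont (fun x => f (x +i* t)) a c.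
  by apply: (@segcont_x _ f) => // x hx; apply/holo_ccont/hf.
have B t : `|t| = Y -> Nc (cint (fun x => f (x +i* t)) a c) <= K * (c - a).
  move=> tY; rewrite -[c - a]ger0_norm ?subr_ge0 //; apply: cint_bound => // x; rewrite inseg_le // => hx.
  exact: HK.
have B1 := B (- Y); have B2 := B Y; rewrite normrN (ger0_norm Y0) in B1 B2.
move/addr0_eq: E => E.
have := congr1 (fun z : C => Nc z) E; rewrite [X in _ -> X <= _]NcBC NcN NcM Nc_i mul1r => <-.
apply: le_trans (NcB _ _) _; have := B1 erefl; have := B2 erefl; lra.
Qed.

(** The horizontal sides are [O(1 / Y)] with a constant depending on everything else, which is
    enough because [Y] alone tends to infinity. *)
Lemma line_shift f a c la b T V : 0 <= la -> 0 <= T -> 0 <= V -> a <= c -> (forall x, a <= x <= c -> `|x - b| <= 3) ->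
  (forall z, a <= Re z <= c -> holo f z) ->
  (forall z, a <= Re z <= c -> Nc (f z) <= V * (1 + `|Im z|)) ->
  forall Y, 1 <= Y -> 2 * T <= Y ->
  Nc (cint (fun t => f (a +i* t) * gkT la b T (a +i* t)) (- Y) Y - cint (fun t => f (c +i* t) * gkT la b T (c +i* t)) (- Y) Y)
    <= 2 * (c - a) * (V * (16 * cG * expR (9 / 2 + la * 3))) / Y.
Proof.
move=> la0 T0 V0 ac xb hf fV Y Y1 TY; rewrite -[leRHS]mulrA.
apply: (@rect_sides (fun z => f z * gkT la b T z)) => //; first lra.
  by move=> z hz; apply: holoM; [exact: hf|exact: holo_gkT].
move=> x t hx tY; rewrite NcM; have := fV (x +i* t) hx; rewrite ImI tY => h.
apply: le_trans (ler_wpM2r (Nc_ge0 _) h) _; rewrite -!mulrA; apply: ler_wpM2l => //.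
rewrite mulrA [in leRHS]mulrA; exact: gkT_far (xb _ hx).
Qed.

Definition gc x v : C := cexp ((2^-1)%:C * ((x +i* v) * (x +i* v))).

Lemma holo_gc z : holo (fun z => cexp ((2^-1)%:C * (z * z))) z.
Proof. by apply: holo_exp; apply: holoM; [exact: holo_cst|apply: holoM; exact: holo_id]. Qed.

Lemma segcont_gc x a b : segcont (gc x) a b.
Proof. by move=> t _; apply: (@cont_y R (fun z => cexp ((2^-1)%:C * (z * z)))); apply: holo_ccont; exact: holo_gc. Qed.

Lemma Nc_gc x v : Nc (gc x v) = expR (x ^+ 2 / 2) * ga v.
Proof. by rewrite /gc Nc_cexp -expRD; congr expR; rewrite !ReImE; field. Qed.

Lemma gc0 v : gc 0 v = (ga v)%:C.
Proof.
rewrite /gc (_ : _ * _ = (- (v ^+ 2 / 2))%:C); first exact: cexp_real.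
by apply: Ceq; rewrite !ReImE; field.
Qed.

Lemma rsegcont_ga a b : rsegcont ga a b.
Proof. by move=> t _; exact: rder_cont (rder_ga t). Qed.

(** Goursat's theorem for [e^(z^2 / 2)] between the lines [Re z = 0] and [Re z = x]; the horizontal
    ends carry the error. *)
Lemma gauss_shift x A B : A <= B -> Nc (cint (gc x) A B - (rint ga A B)%:C) <= `|x| * expR (x ^+ 2 / 2) * (ga A + ga B).
Proof.
move=> AB; pose f z : C := cexp ((2^-1)%:C * (z * z)).
have E : rect f 0 x A B = 0 by apply: goursat_or => z _ _; exact: holo_gc.
have B1 t : Nc (cint (fun u => f (u +i* t)) 0 x) <= expR (x ^+ 2 / 2) * ga t * `|x|.
  rewrite -[X in `|X|]subr0; apply: cint_bound => u; first by move=> _; apply: cont_x; apply: holo_ccont; exact: holo_gc.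
  move=> hu; rewrite -/(gc u t) Nc_gc; apply: ler_wpM2r; first exact: ga_ge0.
  rewrite ler_expR; have : u ^+ 2 <= `|x| ^+ 2.
    rewrite le_sqr_norm // ler_norml; have := ler_norm x; have := ler_norm (- x); rewrite normrN.
    by case/orP: hu => /andP[? ?] ? ?; apply/andP; split; rlra 4.
  by rewrite real_normK ?num_real //; lra.
move: E; rewrite /rect => /addr0_eq E.
have R0 : cint (fun y => f (0 +i* y)) A B = (rint ga A B)%:C.
  have [P HP] := rprim_ex (rsegcont_ga (a := A) (b := B)).
  rewrite (rintE HP) (cintE (F := fun t => (P t)%:C)) ?realC_B // => t ht.
  by apply: rcder_eq (rcder_real (HP t ht)); rewrite -gc0.
rewrite R0 in E; have := congr1 (fun z : C => Nc z) E; rewrite NcN NcM Nc_i mul1r => <-.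
apply: le_trans (NcB _ _) _; have := B1 A; have := B1 B; lra.
Qed.

(** On [[-1, 1]] the Gaussian is at least [1/2]. *)
Lemma rint_ga_ge A B : A <= -1 -> 1 <= B -> 1 <= rint ga A B.
Proof.
move=> A1 B1; have AB : A <= B by lra.
have [P HP] := rprim_ex (rsegcont_ga (a := A) (b := B)); rewrite (rintE HP).
have D t : A <= t <= B -> rder P t (ga t) by move=> h; apply: HP; rewrite inseg_le.
have m a b : a <= b -> A <= a -> b <= B -> P a <= P b.
  move=> ab Aa bB; have := @rder_mono R (fun=> 0) (fun=> 0) P ga a b ab.
  rewrite subrr subr_ge0; apply => t /andP[? ?]; [exact: rder_cst|apply: D; apply/andP; split; lra|exact: ga_ge0].
have h1 := m A (-1) A1 (lexx _) (ltac:(lra)); have h2 := m 1 B B1 (ltac:(lra)) (lexx _).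
have := @rder_mono R (fun t => 0 + 2^-1 * t) (fun=> 2^-1) P ga (-1) 1 (ltac:(lra)).
move=> h; have {h} : (0 + 2^-1 * 1) - (0 + 2^-1 * -1) <= P 1 - P (-1).
  apply: h => t /andP[t1 t2]; [exact: rder_aff|apply: D; apply/andP; split; lra|].
  have t3 : t ^+ 2 <= 1 by rewrite !expr2; nra.
  have := expR_ge1Dx (- (t ^+ 2 / 2)); rewrite -/(ga t); lra.
lra.
Qed.

End GaussKernel.

Section PrimeSums.
Variable V : nmodType.
Implicit Types (F : nat -> V) (P : nat).

Lemma sum_prime0 F : \sum_(p < 1 | prime p) F p = 0.
Proof. by rewrite big1 // => i; case: i => -[]. Qed.

Lemma sum_primeS F P : \sum_(p < P.+2 | prime p) F p = \sum_(p < P.+1 | prime p) F p + (if prime P.+1 then F P.+1 else 0).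
Proof. by rewrite [in LHS]big_mkcond big_ord_recr /= -big_mkcond. Qed.

End PrimeSums.

(** * The integral against the test function as a sum over primes *)

Section LowerIntegral.
Variable R : realType.
Local Notation C := R[i].
Implicit Types (z w s : C) (a b c d x y t v e r la T Y l tau : R) (P n p : nat).

(** For the inverse square roots [a], [c] of consecutive integers, [a^2 - c^2 = a^2 c^2]; this
    bounds [c^3] by a difference that telescopes. *)
Lemma rpow32 n : expR (- (3 / 2 * ln n.+2%:R)) <= 2 * (expR (- (ln n.+1%:R / 2)) - expR (- (ln n.+2%:R / 2))) :> R.
Proof.
set a := expR (- (ln n.+1%:R / 2)); set c := expR (- (ln n.+2%:R / 2)).
have m0 := nat1_gt0 R n; have m1 := nat1_gt0 R n.+1.
have a0 : 0 < a := expR_gt0 _; have c0 : 0 < c := expR_gt0 _.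
have sq (m : R) : 0 < m -> expR (- (ln m / 2)) ^+ 2 = m^-1.
  by move=> p0; rewrite -expRM_natl (_ : 2 * - (ln m / 2) = - ln m); [rewrite expRN lnK ?posrE|field].
have ea : a ^+ 2 = n.+1%:R^-1 := sq _ m0; have ec : c ^+ 2 = n.+2%:R^-1 := sq _ m1.
have ac : c <= a by rewrite ler_expR lerN2 ler_pM2r ?invr_gt0 // ler_ln ?posrE // ler_nat.
have -> : expR (- (3 / 2 * ln n.+2%:R)) = c ^+ 3 by rewrite -expRM_natl; congr expR; field.
have E : (a - c) * (a + c) = a ^+ 2 * c ^+ 2.
  rewrite -subr_sqr ea ec -[n.+2%:R]natr1; move: m0; move: (n.+1%:R : R) => m m0; field.
  by do ?(apply/andP; split); apply: lt0r_neq0; lra.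
clearbody a c; have h1 : a ^+ 2 * c ^+ 2 <= (a - c) * (2 * a).
  by rewrite -E; apply: ler_wpM2l; lra.
have h2 : a * c ^+ 2 <= 2 * (a - c).
  rewrite -(ler_pM2l a0) mulrA -expr2; apply: le_trans h1 _; rewrite le_eqVlt; apply/orP; left; apply/eqP; ring.
apply: le_trans h2; rewrite exprS; apply: ler_wpM2r => //; exact: sqr_ge0.
Qed.

Lemma sum_rpow32 P : \sum_(p < P.+1 | prime p) expR (- (3 / 2 * ln p%:R)) <= 2 :> R.
Proof.
pose F (p : nat) : R := expR (- (3 / 2 * ln p%:R)).
case: P => [|P]; first by rewrite (sum_prime0 F).
apply: (@le_trans _ _ (2 - 2 * expR (- (ln P.+1%:R / 2)))); last by have := expR_ge0 (- (ln P.+1%:R / 2) : R); lra.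
elim: P => [|n IH]; first by rewrite (sum_primeS F) (sum_prime0 F) ln1 mul0r oppr0 expR0 /=; lra.
rewrite -/F in IH *; rewrite (sum_primeS F (n.+1)); have h := rpow32 n; have f0 : 0 <= F n.+2 := expR_ge0 _.
have m : expR (- (ln n.+2%:R / 2)) <= expR (- (ln n.+1%:R / 2)) :> R.
  by rewrite ler_expR lerN2 ler_pM2r ?invr_gt0 // ler_ln ?posrE ?ltr0n // ler_nat.
by move: IH h m f0; rewrite -/(F n.+2); move: (\sum_(_ < _ | _) _) => sm; case: (prime n.+2); lra.
Qed.

Lemma Nc_npow_prime (p : nat) s : prime p -> 3 / 4 <= Re s ->
  Nc (npow p%:R s) <= 4 / 5 /\ Nc (npow p%:R s) ^+ 2 <= expR (- (3 / 2 * ln p%:R)).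
Proof.
move=> pp hs; have p2 : 2 <= p%:R :> R by rewrite ler_nat prime_gt1.
have l2 := ln2_ge R; have lp : ln 2 <= ln p%:R :> R by rewrite ler_ln ?posrE //; lra.
rewrite Nc_npow; split.
  apply: (@le_trans _ _ (expR (- (3 / 8)))).
    by rewrite ler_expR mulNr lerN2; apply: (@le_trans _ _ (3 / 4 * 2^-1)); [rlra 0|apply: ler_pM; ulra hs lp l2].
  rewrite expRN -[leRHS]invrK lef_pV2 ?posrE ?expR_gt0 ?invr_gt0 ?divr_gt0 //.
  by have := expR_ge1Dx (3 / 8 : R); lra.
rewrite -expRM_natl ler_expR mulNr mulrN lerN2 mulrA.
by apply: ler_wpM2r; lra.
Qed.

Variable L : C -> C.
Hypothesis HL : is_Ln L.

(** The prime powers with exponent at least 2. They are integrated on [Re s = 3/4], where their sum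
    is bounded and the test function is at most a constant times [e^(la / 4)]. *)
Definition lrem P s : C := \sum_(p < P.+1 | prime p) (lam L (npow p%:R s) - npow p%:R s).
Definition psumC P s : C := \sum_(p < P.+1 | prime p) npow p%:R s.

Lemma Nc_lrem P s : 3 / 4 <= Re s -> Nc (lrem P s) <= 10.
Proof.
move=> hs; pose F (p : nat) := lam L (npow p%:R s) - npow p%:R s.
pose F2 (p : nat) : R := expR (- (3 / 2 * ln p%:R)).
suff : Nc (lrem P s) <= 5 * \sum_(p < P.+1 | prime p) F2 p by have := sum_rpow32 P; rewrite -/F2; lra.
elim: P => [|P IH]; first by rewrite /lrem (sum_prime0 F) (sum_prime0 F2) Nc_real normr0 mulr0.
rewrite /lrem (sum_primeS F) (sum_primeS F2) mulrDr; apply: le_trans (NcD _ _) _; apply: lerD; first exact: IH.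
case: ifP => pp; last by rewrite Nc_real normr0 mulr0.
have [h1 h2] := Nc_npow_prime pp hs.
apply: le_trans (lam_bound2 HL h1 (ltac:(rlra 0))) _.
have -> : (1 - 4 / 5)^-1 = 5 :> R by field.
by rewrite mulrC ler_pM2l.
Qed.

Lemma holo_lrem P s : 2^-1 < Re s -> holo (lrem P) s.
Proof.
move=> hs; elim: P => [|P IH].
  apply: (@holo_loc _ (fun=> 0) _ _ 1) => //; last exact: holo_cst.
  by move=> w _; rewrite /lrem (sum_prime0 (fun p => lam L (npow p%:R w) - npow p%:R w)).
apply: (@holo_loc _ (fun u => lrem P u + (if prime P.+1 then lam L (npow P.+1%:R u) - npow P.+1%:R u else 0)) _ _ 1) => //.
  by move=> w _; rewrite /lrem (sum_primeS (fun p => lam L (npow p%:R w) - npow p%:R w)).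
apply: holoD => //; case pp: (prime P.+1); last exact: holo_cst.
apply: holoB; last exact: holo_npow.
have h : Nc (npow P.+1%:R s) < 1.
  rewrite Nc_npow -[ltRHS]expR0 ltr_expR mulNr oppr_lt0 mulr_gt0 //; first lra.
  by rewrite ln_gt0 // ltr1n prime_gt1.
by apply: (@holo_comp _ (lam L) (npow P.+1%:R)); [exact: holo_npow|eexists; exact: cder_lam h].
Qed.

Lemma holo_psumC P s : holo (psumC P) s.
Proof.
elim: P => [|P IH].
  apply: (@holo_loc _ (fun=> 0) _ _ 1) => //; last exact: holo_cst.
  by move=> w _; rewrite /psumC (sum_prime0 (fun p => npow p%:R w)).
apply: (@holo_loc _ (fun u => psumC P u + (if prime P.+1 then npow P.+1%:R u else 0)) _ _ 1) => //.
  by move=> w _; rewrite /psumC (sum_primeS (fun p => npow p%:R w)).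
by apply: holoD => //; case: (prime P.+1); [exact: holo_npow|exact: holo_cst].
Qed.

Lemma esum_split P s : esum_lam L P s = lrem P s + psumC P s.
Proof. by rewrite /lrem /psumC -big_split; apply: eq_bigr => p _; rewrite /= subrK. Qed.

Definition wgt la l : R := (ga (la - l) + ga (la + l)) / 2.
Definition psum b la T P : R := \sum_(p < P.+1 | prime p) expR (- (b * ln p%:R)) * cos (T * ln p%:R) * wgt la (ln p%:R).

(** Completing the square: the factor [e^(-s l)] turns each half of the hyperbolic cosine into a
    Gaussian on a shifted line, with weights [ga (la - l) / 2] and [ga (la + l) / 2]. *)
Lemma kernel_term la b l tau x t : cexp (- (x +i* t) * l%:C) * gk la (x +i* t - (b +i* tau)) =
  cexp (- (b +i* tau) * l%:C) * ((ga (la - l) / 2)%:C * gc (x - b + (la - l)) (t - tau) +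
    (ga (la + l) / 2)%:C * gc (x - b - (la + l)) (t - tau)).
Proof.
rewrite /gk subI; set q := (x - b) +i* (t - tau).
have -> : x +i* t = q + (b +i* tau) by rewrite /q -subI subrK.
have key (c : R) : cexp (- (q + (b +i* tau)) * l%:C) * (cexp ((2^-1)%:C * (q * q)) * cexp (c%:C * q)) =
   cexp (- (b +i* tau) * l%:C) * ((ga (c - l))%:C * gc (x - b + (c - l)) (t - tau)).
  rewrite /gc /ga -cexp_real -!cexpD; congr cexp.
  by apply: Ceq; rewrite /q !ReImE; field.
rewrite mulrA mulrCA mulrA mulrDr mulrDr.
have k1 := key la; have k2 := key (- la).
have E2 : ga (- la - l) = ga (la + l) by rewrite /ga -opprD sqrrN.
rewrite E2 (_ : x - b + (- la - l) = x - b - (la + l)) in k2; last ring.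
rewrite realC_N [(- la%:C) * q]mulNr in k2; rewrite -!mulrA k1 k2 !realC_M; ring.
Qed.

Lemma cint_gc_shift (x tau Y : R) : cint (fun t => gc x (t - tau)) (- Y) Y = cint (gc x) (- Y - tau) (Y - tau).
Proof.
have := @cint_aff R (gc x) (- Y) Y (- tau) 1 (@segcont_gc R x _ _); rewrite !mul1r ![- tau + _]addrC => <-.
by apply: cint_ext => t _; rewrite mulr1 mul1r addrC.
Qed.

Lemma rcder_gcs x tau t : exists d : C, rcder (fun t => gc x (t - tau)) t d.
Proof.
have [d hd] := holo_gc (x +i* (t - tau)); exists (d * iC * (1 - 0)%:C).
exact: (@rcder_comp R (gc x) (fun t => t - tau) t _ _ (cder_y hd) (rderB (rder_id t) (rder_cst tau t))).
Qed.

Lemma segcont_gcs x tau a b : segcont (fun t => gc x (t - tau)) a b.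
Proof. by move=> t _; have [d hd] := rcder_gcs x tau t; exact: rcder_cont hd. Qed.

Lemma cint_lin2 (f g : R -> C) (k k1 k2 : C) a c : segcont f a c -> segcont g a c ->
  cint (fun t => k * (k1 * f t + k2 * g t)) a c = k * (k1 * cint f a c + k2 * cint g a c).
Proof.
move=> /prim_ex[F hF] /prim_ex[H hH]; rewrite (cintE hF) (cintE hH).
rewrite (cintE (F := fun t => k * (k1 * F t + k2 * H t))); first ring.
by move=> t ht; apply: rcderZ; apply: rcderD; apply: rcderZ; [exact: hF|exact: hH].
Qed.

Lemma kernel_int la b l tau x : exists2 D : R, 0 <= D & forall Y, 1 <= Y -> 2 * `|tau| <= Y ->
  Nc (cint (fun t => cexp (- (x +i* t) * l%:C) * gk la (x +i* t - (b +i* tau))) (- Y) Y -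
    cexp (- (b +i* tau) * l%:C) * (wgt la l * rint (@ga R) (- Y - tau) (Y - tau))%:C) <= D / Y.
Proof.
set k := cexp (- (b +i* tau) * l%:C).
pose x1 := x - b + (la - l); pose x2 := x - b - (la + l).
pose e1 := `|x1| * expR (x1 ^+ 2 / 2); pose e2 := `|x2| * expR (x2 ^+ 2 / 2).
have e10 : 0 <= e1 by rewrite mulr_ge0 ?expR_ge0. have e20 : 0 <= e2 by rewrite mulr_ge0 ?expR_ge0.
pose a1 := ga (la - l) / 2; pose a2 := ga (la + l) / 2.
have a10 : 0 <= a1 by rewrite divr_ge0 ?ga_ge0. have a20 : 0 <= a2 by rewrite divr_ge0 ?ga_ge0.
exists (Nc k * (a1 * e1 + a2 * e2) * (16 * cG R)).
  by rewrite !mulr_ge0 ?Nc_ge0 ?(ltW (cG_gt0 R)) // addr_ge0 // mulr_ge0.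
move=> Y Y1 TY; have tn := normr_ge0 tau; have AB : - Y - tau <= Y - tau by lra.
have [t1 t2] : - tau <= `|tau| /\ tau <= `|tau| by split; rewrite ?ler_norm // -normrN ler_norm.
have far v : Y / 2 <= v -> ga v <= 8 * cG R / Y.
  move=> hv; apply: le_trans (ga_far Y1 hv); rewrite mulrDl mul1r lerDl mulr_ge0 ?ga_ge0 //; ulra AB.
have g1 : ga (- Y - tau) + ga (Y - tau) <= 16 * cG R / Y.
  have -> : ga (- Y - tau) = ga (Y + tau) by rewrite /ga -opprD sqrrN.
  have := far (Y + tau) (ltac:(ulra t1 TY)); have := far (Y - tau) (ltac:(ulra t2 TY)).
  by rewrite (_ : 16 * cG R / Y = 8 * cG R / Y + 8 * cG R / Y); [rlra 0|field; apply: lt0r_neq0; ulra Y1].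
rewrite (cint_ext (g := fun t => k * (a1%:C * gc x1 (t - tau) + a2%:C * gc x2 (t - tau)))); last first.
  by move=> t _; exact: kernel_term.
have -> : cint (fun t => k * (a1%:C * gc x1 (t - tau) + a2%:C * gc x2 (t - tau))) (- Y) Y =
    k * (a1%:C * cint (gc x1) (- Y - tau) (Y - tau) + a2%:C * cint (gc x2) (- Y - tau) (Y - tau)).
  rewrite (@cint_lin2 (fun t => gc x1 (t - tau)) (fun t => gc x2 (t - tau))); [|exact: segcont_gcs|exact: segcont_gcs].
  by rewrite (cint_gc_shift x1 tau Y) (cint_gc_shift x2 tau Y).
rewrite -mulrBr NcM -[Nc k * _ * _ / Y]mulrA -[Nc k * _ * _]mulrA; apply: ler_wpM2l; first exact: Nc_ge0.
set r := rint _ _ _.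
have -> : (wgt la l * r)%:C = a1%:C * r%:C + a2%:C * r%:C :> C.
  by rewrite -!realC_M -realC_D /wgt /a1 /a2; congr (_%:C); ring.
set A := cint _ _ _; set B := cint _ _ _.
have -> : a1%:C * A + a2%:C * B - (a1%:C * r%:C + a2%:C * r%:C) = a1%:C * (A - r%:C) + a2%:C * (B - r%:C) by ring.
apply: le_trans (NcD _ _) _; rewrite !NcM !Nc_real !ger0_norm // mulrDl.
have s1 := gauss_shift x1 AB; have s2 := gauss_shift x2 AB; rewrite -/r -/A -/B -/e1 -/e2 in s1 s2.
apply: lerD; rewrite -[leRHS]mulrA; apply: ler_wpM2l => //.
- by apply: le_trans s1 _; apply: ler_wpM2l.
- by apply: le_trans s2 _; apply: ler_wpM2l.
Qed.

Lemma segcont_line (f : C -> C) x a c : (forall t, holo f (x +i* t)) -> segcont (fun t => f (x +i* t)) a c.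
Proof. by move=> h t _; apply: cont_y; exact: holo_ccont. Qed.

(** The mass in [[-Y, Y]] of the Gaussians centred at [T] and [-T], common to all primes. *)
Definition kap T Y : R := rint (@ga R) (- Y - T) (Y - T) + rint (@ga R) (- Y - - T) (Y - - T).

Lemma prime_int la b T x p : 0 <= T -> exists2 D : R, 0 <= D & forall Y, 1 <= Y -> 2 * T <= Y ->
  `|Re (cint (fun t => npow p%:R (x +i* t) * gkT la b T (x +i* t)) (- Y) Y) -
    kap T Y * (expR (- (b * ln p%:R)) * cos (T * ln p%:R) * wgt la (ln p%:R))| <= D / Y.
Proof.
move=> T0; set l := ln p%:R.
have [D1 D10 H1] := kernel_int la b l T x; have [D2 D20 H2] := kernel_int la b l (- T) x.
exists (D1 + D2); first exact: addr_ge0.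
move=> Y Y1 TY; have := H1 Y Y1 (ltac:(rewrite ger0_norm //)); have := H2 Y Y1 (ltac:(rewrite normrN ger0_norm //)).
rewrite {H1 H2} /kap.
have E1 tau : segcont (fun t => cexp (- (x +i* t) * l%:C) * gk la (x +i* t - (b +i* tau))) (- Y) Y.
  apply: (@segcont_line (fun z => npow p%:R z * gk la (z - (b +i* tau)))) => t; apply: holoM; first exact: holo_npow.
  by apply: (@holo_comp _ (gk la)) (holo_gk _ _); apply: holoB; [exact: holo_id|exact: holo_cst].
have -> : cint (fun t => npow p%:R (x +i* t) * gkT la b T (x +i* t)) (- Y) Y =
   cint (fun t => cexp (- (x +i* t) * l%:C) * gk la (x +i* t - (b +i* T))) (- Y) Y +
   cint (fun t => cexp (- (x +i* t) * l%:C) * gk la (x +i* t - (b +i* (- T)))) (- Y) Y.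
  by rewrite -cintD //; apply: cint_ext => t _; rewrite /gkT mulrDr.
set I1 := cint _ _ _; set I2 := cint _ _ _; set r1 := rint _ _ _; set r2 := rint _ _ _.
have rk tau r : Re (cexp (- (b +i* tau) * l%:C) * (wgt la l * r)%:C) = expR (- (b * l)) * cos (tau * l) * (wgt la l * r).
  rewrite ReM ImC mulr0 subr0 ReC; congr (_ * _).
  have -> : - (b +i* tau) * l%:C = (- (b * l)) +i* (- (tau * l)) by apply: Ceq; rewrite !ReImE; ring.
  by rewrite /= cosN.
move=> h2 h1; have := le_trans (Re_Nc _) h1; have := le_trans (Re_Nc _) h2.
rewrite ![Re (_ - _)]ReD !ReN !rk mulNr cosN ReD => k2 k1.
set w := wgt la l in k1 k2 *; set g := expR _ * cos _ in k1 k2 *.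
have -> : Re I2 + Re I1 - (r2 + r1) * (g * w) = (Re I2 - g * (w * r2)) + (Re I1 - g * (w * r1)) by ring.
by rewrite [leRHS]mulrDl; apply: le_trans (ler_normD _ _) (lerD k1 k2).
Qed.

Lemma kap_ge T Y : 1 <= T -> 2 * T <= Y -> 2 <= kap T Y.
Proof.
move=> T1 TY; have := @rint_ga_ge R (- Y - T) (Y - T) (ltac:(lra)) (ltac:(lra)).
have := @rint_ga_ge R (- Y - - T) (Y - - T) (ltac:(lra)) (ltac:(lra)); rewrite /kap; lra.
Qed.

Lemma psum_int la b T x P : 0 <= T -> exists2 D : R, 0 <= D & forall Y, 1 <= Y -> 2 * T <= Y ->
  `|Re (cint (fun t => psumC P (x +i* t) * gkT la b T (x +i* t)) (- Y) Y) - kap T Y * psum b la T P| <= D / Y.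
Proof.
move=> T0; pose g (p : nat) := expR (- (b * ln p%:R)) * cos (T * ln p%:R) * wgt la (ln p%:R).
elim: P => [|P [D D0 IH]].
  exists 0 => // Y Y1 TY; rewrite /psum (sum_prime0 g) mulr0 mul0r subr0.
  rewrite (cint_ext (g := fun=> 0)); last by move=> t _; rewrite /psumC (sum_prime0 (fun p => npow p%:R (x +i* t))) mul0r.
  by rewrite (cintE (F := fun=> 0)) ?subrr ?normr0 // => t _; exact: rcder_cst.
have E t : psumC P.+1 (x +i* t) * gkT la b T (x +i* t) =
    psumC P (x +i* t) * gkT la b T (x +i* t) + (if prime P.+1 then npow P.+1%:R (x +i* t) else 0) * gkT la b T (x +i* t).
  by rewrite /psumC (sum_primeS (fun p => npow p%:R (x +i* t))) mulrDl.
have s1 Y : segcont (fun t => psumC P (x +i* t) * gkT la b T (x +i* t)) (- Y) Y.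
  by apply: (@segcont_line (fun z => psumC P z * gkT la b T z)) => t; apply: holoM; [exact: holo_psumC|exact: holo_gkT].
have s2 p Y : segcont (fun t => npow p%:R (x +i* t) * gkT la b T (x +i* t)) (- Y) Y.
  by apply: (@segcont_line (fun z => npow p%:R z * gkT la b T z)) => t; apply: holoM; [exact: holo_npow|exact: holo_gkT].
have PS : psum b la T P.+1 = psum b la T P + (if prime P.+1 then g P.+1 else 0) by rewrite /psum (sum_primeS g).
rewrite PS; case: (prime P.+1) E => E; last first.
  exists D => // Y Y1 TY; rewrite addr0 (cint_ext (fun t _ => E t)).
  by rewrite (cint_ext (g := fun t => psumC P (x +i* t) * gkT la b T (x +i* t))); [exact: IH|move=> t _; rewrite mul0r addr0].
have [D2 D20 H2] := prime_int la b x P.+1 T0.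
exists (D + D2); first exact: addr_ge0.
move=> Y Y1 TY; rewrite (cint_ext (fun t _ => E t)) cintD // ReD mulrDr [leRHS]mulrDl.
have := IH Y Y1 TY; have := H2 Y Y1 TY; rewrite -/(g P.+1).
set r1 := Re _; set r2 := Re _; set k := kap T Y => h2 h1.
have -> : r2 + r1 - (k * psum b la T P + k * g P.+1) = (r2 - k * psum b la T P) + (r1 - k * g P.+1) by ring.
exact: le_trans (ler_normD _ _) (lerD h1 h2).
Qed.

Variables (zeta G : C -> C).
Hypothesis hzeta : is_riemann_zeta zeta.
Hypothesis HG : is_logzeta zeta G.

Lemma rest_arith (T n u w : R) : 0 < T -> 0 < n -> 0 <= u -> 0 <= w -> T <= 3 + u + w -> 3 + u <= 2 * n ->
  2 * n^-1 <= 8 / T * (1 + w ^+ 2).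
Proof.
move=> T0 n0 u0 w0 Tb ns; have -> : 8 / T * (1 + w ^+ 2) = 8 * (1 + w ^+ 2) / T by ring.
rewrite ler_pdivlMr // mulrAC ler_pdivrMr //.
have w2 := sqr_ge0 (w - 1); rewrite expr2 in w2; have := mulr_ge0 (ltW n0) (sqr_ge0 w); rewrite expr2 => nw.
have : n * (2 * w) <= n * (1 + w * w) by rewrite ler_pM2l //; lra.
have : (3 + u) * w <= 2 * n * w by apply: ler_wpM2r.
nra.
Qed.

(** Both terms are [O(1 / T)] near height [tau]: [log (1 - 1/s)] because [|s|] is of the order of
    [T] there, [gdiff] because the primes up to [P >= T - 1] are removed. The quadratic factor
    covers the other heights. *)
Lemma rest_bound P T tau t : (0 < P)%N -> 0 < T -> `|tau| = T -> T <= P.+1%:R ->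
  Nc (L (1 - (3 +i* t)^-1) + gdiff G L P (3 +i* t)) <= 16 / T * (1 + (t - tau) ^+ 2).
Proof.
move=> P0 T0 tT TP; set s := 3 +i* t; have Rs : Re s = 3 by [].
have Is : Im s = t by [].
have s2 : 2 < Re s by rewrite Rs; lra.
have tn := normr_ge0 t; set v := t - tau; have v2 := sqr_ge0 v.
have h1 : Nc (gdiff G L P s) <= 8 / T.
  apply: le_trans (gdiff_small hzeta HG HL P0 s2) _.
  by apply: ler_wpM2l => //; rewrite lef_pV2 ?posrE // ltr0n.
have i1 := inv_lt s2.
have h2 : Nc (L (1 - s^-1)) <= 2 * Nc s^-1.
  have := lam_bound HL i1 (ltac:(lra)); rewrite /lam NcN.
  have -> : (1 - 2^-1)^-1 = 2 :> R by field.
  by rewrite mulrC.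
have ns : 3 + `|t| <= 2 * Nc s.
  by have := Re_le_Nc s; have := Im_Nc s; rewrite Rs Is; rlra 0.
have Tb : T <= 3 + `|t| + `|v| by have := ler_normB t v; rewrite /v subKr tT; rlra 0.
have v1 : `|v| ^+ 2 = v ^+ 2 by rewrite real_normK ?num_real.
have s0 : 0 < Nc s by ulra ns tn.
have h3 := rest_arith T0 s0 tn (normr_ge0 v) Tb ns; rewrite v1 -NcV in h3.
have h4 : 8 / T <= 8 / T * (1 + v ^+ 2) by rewrite ler_peMr ?divr_ge0 ?(ltW T0) //; lra.
apply: le_trans (NcD _ _) _.
have -> : 16 / T * (1 + v ^+ 2) = 8 / T * (1 + v ^+ 2) + 8 / T * (1 + v ^+ 2) by rewrite -mulrDl; congr (_ * _); field; exact: lt0r_neq0.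
exact: lerD (le_trans h2 h3) (le_trans h1 h4).
Qed.

Lemma segcont_gkT (f : C -> C) la b T x a c : (forall t, holo f (x +i* t)) ->
  segcont (fun t => f (x +i* t) * gkT la b T (x +i* t)) a c.
Proof.
by move=> hf; apply: (@segcont_line (fun z => f z * gkT la b T z)) => t; apply: holoM; [exact: hf|exact: holo_gkT].
Qed.

Definition rest P s : C := L (1 - s^-1) + gdiff G L P s.

Lemma holo_rest P t : holo (rest P) (3 +i* t).
Proof.
have s2 : 2 < Re (3 +i* t) by rewrite ReI; lra.
apply: holoD; last exact: (holo_gdiff HG HL).
case: HL => _ _ LD; apply: (@holo_comp _ L (fun s => 1 - s^-1)).
  by apply: holoB; [exact: holo_cst|apply: holoV; [apply: Re_neq0; lra|exact: holo_id]].
by eexists; apply: LD; apply: Re1B; have := inv_lt s2; lra.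
Qed.

(** On [Re s = 3] the test function may reach the order of [e^(3 la)]; the hypothesis
    [expR (3 * la) <= T] lets the bound [O(1 / T)] of [rest] compensate this. *)
Lemma rest_int b la T P Y : 2^-1 <= b <= 6 / 10 -> 0 <= la -> 1 <= T -> (0 < P)%N -> expR (3 * la) <= T ->
  T <= P.+1%:R -> 0 <= Y ->
  Nc (cint (fun t => rest P (3 +i* t) * gkT la b T (3 +i* t)) (- Y) Y) <= 128 * cG R * expR 4.
Proof.
move=> /andP[b2 b3] la0 T1 P0 yT TP Y0; have T0 : 0 <= T by lra.
have h := @line_bound R (rest P) la b T 3 (16 / T) Y la0 (divr_ge0 (ler0n _ _) T0) Y0 (fun t => holo_ccont (holo_rest P t)).
apply: le_trans (h _ _) _.
- by move=> t; apply: rest_bound => //; [ulra T1|rewrite ger0_norm].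
- move=> t; have := @rest_bound P T (- T) t P0 (ltac:(ulra T1)); rewrite opprK; apply => //.
  by rewrite normrN ger0_norm.
have hx : expR ((3 - b) ^+ 2 / 2 + la * `|3 - b|) <= expR 4 * T.
  apply: (@le_trans _ _ (expR 4 * expR (3 * la))); last by apply: ler_wpM2l => //; exact: expR_ge0.
  rewrite -expRD ler_expR ger0_norm; last ulra la0 b3.
  have q : (3 - b) ^+ 2 <= 8 by rewrite expr2; nra.
  have q2 : la * (3 - b) <= 3 * la by rewrite mulrC; apply: ler_wpM2r => //; ulra b2.
  by apply: lerD => //; ulra q.
have -> : 128 * cG R * expR 4 = 8 * (16 / T * (cG R * (expR 4 * T))) by field; apply: lt0r_neq0; ulra T1.
apply: ler_wpM2l => //; apply: ler_wpM2l; first by rewrite divr_ge0.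
by apply: ler_wpM2l; [exact: ltW (cG_gt0 R)|].
Qed.

Lemma lrem_int b la T P Y : 2^-1 <= b <= 6 / 10 -> 0 <= la -> 0 <= Y ->
  Nc (cint (fun t => lrem P (3 / 4 +i* t) * gkT la b T (3 / 4 +i* t)) (- Y) Y) <= 80 * cG R * (expR 1 * expR (la / 4)).
Proof.
move=> /andP[b2 b3] la0 Y0.
have nb t u : Nc (lrem P (3 / 4 +i* t)) <= 10 * (1 + u ^+ 2).
  by apply: le_trans (Nc_lrem P (lexx _ : 3 / 4 <= Re (3 / 4 +i* t))) _; have := sqr_ge0 u; lra.
have hl t : holo (lrem P) (3 / 4 +i* t) by apply: holo_lrem; rewrite ReI; lra.
have h := @line_bound R (lrem P) la b T (3 / 4) 10 Y la0 (ler0n _ _) Y0 (fun t => holo_ccont (hl t)).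
apply: le_trans (h (fun t => nb t _) (fun t => nb t _)) _.
rewrite -expRD -mulrA; have -> : 80 * (cG R * expR (1 + la / 4)) = 8 * (10 * (cG R * expR (1 + la / 4))) by ring.
do 2!(apply: ler_wpM2l => //); apply: ler_wpM2l; first exact: ltW (cG_gt0 R).
rewrite ler_expR; have nx : `|3 / 4 - b| <= 4^-1 by rewrite ler_norml; apply/andP; split; ulra b3 b2.
have q : (3 / 4 - b) ^+ 2 <= 4^-1 ^+ 2 by rewrite le_sqr_norm.
have q2 : la * `|3 / 4 - b| <= la * 4^-1 by apply: ler_wpM2l.
by apply: lerD => //; move: q; rewrite [4^-1 ^+ 2]expr2; rlra 0.
Qed.

Lemma cint_split3 b la T P Y : cint (fun t => G (3 +i* t) * gkT la b T (3 +i* t)) (- Y) Y =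
    cint (fun t => lrem P (3 +i* t) * gkT la b T (3 +i* t)) (- Y) Y +
    cint (fun t => psumC P (3 +i* t) * gkT la b T (3 +i* t)) (- Y) Y +
    cint (fun t => rest P (3 +i* t) * gkT la b T (3 +i* t)) (- Y) Y.
Proof.
have hl t : holo (lrem P) (3 +i* t) by apply: holo_lrem; rewrite ReI; lra.
have s1 := @segcont_gkT (lrem P) la b T 3 (- Y) Y hl.
have s2 := @segcont_gkT (psumC P) la b T 3 (- Y) Y (fun t => holo_psumC P _).
have s3 := @segcont_gkT (rest P) la b T 3 (- Y) Y (holo_rest P).
have [F1 hF1] := prim_ex s1; have [F2 hF2] := prim_ex s2; have [F3 hF3] := prim_ex s3.
rewrite (cintE hF1) (cintE hF2) (cintE hF3) (cintE (F := fun t => F1 t + F2 t + F3 t)); first ring.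
move=> t ht; apply: rcder_eq (rcderD (rcderD (hF1 t ht) (hF2 t ht)) (hF3 t ht)).
by rewrite -!mulrDl; congr (_ * _); rewrite /rest /gdiff esum_split; ring.
Qed.

Lemma lower_arith (x1 x2 x3 x4 x5 e1 e2 d p k m1 m2 m3 M1 M2 : R) : - e1 <= x1 - (x2 + x3 + x4) -> x5 - x2 <= e2 ->
  - m1 <= x5 -> - m2 <= x4 -> - d <= x3 - k * p -> 2 * p <= k * p -> m2 <= m3 -> e1 <= M1 -> e2 <= M2 ->
  2 * p - (m1 + m3) - (d + M1 + M2) <= x1.
Proof. lra. Qed.

(** On [Re s = 3] the function [G] splits into primes, higher prime powers and [rest]; the higher
    powers are then moved back to [Re s = 3/4]. [D] collects the errors that vanish as [Y] grows. *)
Lemma lower_int : exists2 CI : R, 0 < CI & forall e la T P, 0 < e <= 10^-1 -> 0 <= la -> 1 <= T -> (0 < P)%N ->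
  expR (3 * la) <= T -> T <= P.+1%:R -> 0 <= psum (2^-1 + e) la T P ->
  exists2 D : R, 0 <= D & forall Y, 1 <= Y -> 2 * T <= Y ->
    2 * psum (2^-1 + e) la T P - CI * expR (la / 4) - D / Y <=
    Re (cint (fun t => G ((2^-1 + e) +i* t) * gkT la (2^-1 + e) T ((2^-1 + e) +i* t)) (- Y) Y).
Proof.
have cg := cG_gt0 R.
exists (80 * cG R * expR 1 + 128 * cG R * expR 4); first by rewrite addr_gt0 // mulr_gt0 ?expR_gt0 // mulr_gt0.
move=> e la T P /andP[e0 e1] la0 T1 P0 yT TP ps0; have T0 : 0 <= T by lra.
set b := 2^-1 + e; have b2 : 2^-1 < b by rewrite /b; lra.
have b3 : b <= 6 / 10 by rewrite /b; lra.
have hb : 2^-1 <= b <= 6 / 10 by rewrite (ltW b2).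
have [K K0 HK] := G_poly hzeta HG HL (ltac:(by apply/andP; split; ulra e0 e1) : 0 < e <= 1).
have [D1 D10 H1] := psum_int la b 3 P T0.
have hG s : b <= Re s <= 3 -> holo G s by move=> /andP[h _]; apply: (holo_G HG); apply: lt_le_trans h.
have xb x : b <= x <= 3 -> `|x - b| <= 3 by move=> /andP[? ?]; rewrite ler_norml; apply/andP; split; rlra 5.
have xb2 x : 3 / 4 <= x <= 3 -> `|x - b| <= 3 by move=> /andP[? ?]; rewrite ler_norml; apply/andP; split; rlra 5.
have S1 := line_shift (f := G) (a := b) (c := 3) (b := b) la0 T0 (ltW K0) (ltac:(ulra hb)) xb hG HK.
have hl s : 3 / 4 <= Re s <= 3 -> holo (lrem P) s by move=> /andP[h _]; apply: holo_lrem; ulra h.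
have vl s : 3 / 4 <= Re s <= 3 -> Nc (lrem P s) <= 10 * (1 + `|Im s|).
  by move=> /andP[h _]; apply: le_trans (Nc_lrem P h) _; have := normr_ge0 (Im s); rlra 0.
have S2 := line_shift (f := lrem P) (a := 3 / 4) (c := 3) (b := b) la0 T0 (ltac:(rlra 0) : (0 : R) <= 10) (ltac:(rlra 0)) xb2 hl vl.
set E1 := _ * (3 - b) * _ in S1; set E2 := _ * (3 - 3 / 4) * _ in S2.
exists (D1 + `|E1| + `|E2|); first by rewrite !addr_ge0.
move=> Y Y1 TY; have Y0 : 0 <= Y by ulra Y1.
have {}S1 := S1 Y Y1 TY; have {}S2 := S2 Y Y1 TY; have {}H1 := H1 Y Y1 TY.
have k2 := kap_ge T1 TY.
have B3 := rest_int hb la0 T1 P0 yT TP Y0; have B1 := lrem_int T P hb la0 Y0.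
rewrite (cint_split3 b la T P Y) in S1; clearbody E1 E2.
move: S1 S2 H1 B1 B3.
set I1 := cint (fun t => G _ * _) _ _; set I2 := cint (fun t => lrem P (3 +i* t) * _) _ _.
set I3 := cint (fun t => psumC _ _ * _) _ _; set I4 := cint (fun t => rest _ _ * _) _ _; set I5 := cint _ _ _.
move=> S1 S2 H1 B1 B3.
have n1 : E1 / Y <= `|E1| / Y by apply: ler_wpM2r; rewrite ?invr_ge0 // ler_norm.
have n2 : E2 / Y <= `|E2| / Y by apply: ler_wpM2r; rewrite ?invr_ge0 // ler_norm.
have r1 := le_trans (Re_Nc _) S1; have r2 := le_trans (Re_Nc _) S2; have r3 := le_trans (Re_Nc _) B1; have r4 := le_trans (Re_Nc _) B3.
move: r1 r2 r3 r4 H1; rewrite !ler_norml !(ReD, ReN) => /andP[r1 _] /andP[_ r2] /andP[r3 _] /andP[r4 _] /andP[r5 _].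
have kp : 2 * psum b la T P <= kap T Y * psum b la T P by apply: ler_wpM2r.
have ex2 : 128 * cG R * expR 4 <= 128 * cG R * expR 4 * expR (la / 4).
  by rewrite ler_peMr ?mulr_ge0 ?expR_ge0 ?(ltW cg) // -expR0 ler_expR divr_ge0.
have -> : (80 * cG R * expR 1 + 128 * cG R * expR 4) * expR (la / 4) =
  80 * cG R * (expR 1 * expR (la / 4)) + 128 * cG R * expR 4 * expR (la / 4) by rewrite mulrDl !mulrA.
have -> : (D1 + `|E1| + `|E2|) / Y = D1 / Y + `|E1| / Y + `|E2| / Y by rewrite !mulrDl.
exact: lower_arith r1 r2 r3 r4 r5 kp ex2 n1 n2.
Qed.

End LowerIntegral.

(** * Lower bound of the prime sum at y = 2^J, and the choice of T *)

Section PrimeSumLower.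
Variable R : realType.
Local Notation C := R[i].
Implicit Types (b x y e la T l c : R) (J M k p m n : nat).

Lemma sum_primes_ge (F : nat -> R) m n c : (forall p, prime p -> (m < p <= n)%N -> c <= F p) ->
  c * (primes_in m n)%:R <= \sum_(m.+1 <= p < n.+1 | prime p) F p.
Proof.
move=> H; rewrite /primes_in natr_sum mulr_sumr big_seq_cond [leRHS]big_seq_cond; apply: ler_sum => p.
by rewrite mem_index_iota mulr1 ltnS => /andP[h1 h2]; exact: H.
Qed.

Lemma ln2_lt1 : ln 2 <= 1 :> R.
Proof. by have := @ln_le_sub1 R 2 (ltr0n _ _); lra. Qed.

Lemma ln_pow2 k : ln ((2 ^ k)%N%:R : R) = k%:R * ln 2.
Proof. by rewrite natrX lnXn // mulr_natl. Qed.

Lemma expR_pow2 k : expR (k%:R * ln 2) = (2 ^ k)%N%:R :> R.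
Proof. by rewrite -ln_pow2 lnK // posrE ltr0n expn_gt0. Qed.

Lemma ln_prime_bounds k m p : (2 ^ k < p <= 2 ^ m)%N -> k%:R * ln 2 <= ln (p%:R : R) <= m%:R * ln 2.
Proof.
move=> /andP[h1 h2]; have p0 : (0 < p)%N by apply: leq_trans h1.
rewrite -!ln_pow2 !ler_ln ?posrE ?ltr0n ?expn_gt0 // !ler_nat h2 andbT; exact: ltnW.
Qed.

Definition pterm b la T p : R := expR (- (b * ln p%:R)) * cos (T * ln p%:R) * wgt la (ln p%:R).

Lemma wgt_ge0 la l : 0 <= wgt la l.
Proof. by rewrite /wgt divr_ge0 // addr_ge0 ?ga_ge0. Qed.

Lemma wgt_le la l : 0 <= la -> 0 <= l -> wgt la l <= ga (la - l).
Proof.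
move=> la0 l0; rewrite /wgt; suff : ga (la + l) <= ga (la - l) by lra.
rewrite ler_expR lerN2 ler_pM2r ?invr_gt0 //; have : 0 <= la * l by exact: mulr_ge0.
rewrite !expr2; lra.
Qed.

Section Fixed.
Variables (J : nat) (e T : R).
Hypothesis J12 : (12 <= J)%N.
Hypothesis e0 : 0 < e.
Hypothesis eJ : e * J%:R <= 1.
Local Notation la := ((J%:R : R) * ln (2 : R)).
Local Notation b := (2^-1 + e).
Hypothesis Tcos : forall p, prime p -> (p <= 2 ^ (J + 20))%N -> 2^-1 <= cos (T * ln p%:R).
Ltac section_fact H ::= first [constr_eq H e0 | constr_eq H eJ].

Lemma fx_l2 : (2^-1 <= ln (2 : R)) && (ln (2 : R) <= 1). Proof. by rewrite ln2_ge ln2_lt1. Qed.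
Lemma fx_J : 12 <= J%:R :> R. Proof. by rewrite ler_nat. Qed.

Lemma pterm_pos p : prime p -> (p <= 2 ^ (J + 20))%N -> 0 <= pterm b la T p.
Proof.
move=> pp hp; rewrite /pterm; apply: mulr_ge0; last exact: wgt_ge0.
by apply: mulr_ge0; [exact: expR_ge0|have := Tcos pp hp; lra].
Qed.

(** Within six dyadic scales of [2^J] the Gaussian is at least [e^(- 6^2 / 2)], and [e * J <= 1]
    lets the shift of the abscissa cost at most a factor [expR 1]. *)
Lemma pterm_main p : prime p -> (2 ^ (J - 6) < p <= 2 ^ J)%N -> expR (- (19 + la / 2)) / 4 <= pterm b la T p.
Proof.
move=> pp hp; have /andP[l1 l2] := ln_prime_bounds hp; have /andP[a1 a2] := fx_l2; have J0 := fx_J.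
have J6 : (J - 6)%:R = J%:R - 6 :> R by rewrite natrB //; apply: leq_trans J12.
rewrite J6 mulrBl in l1; set l := ln p%:R in l1 l2 *.
have hp2 : (p <= 2 ^ (J + 20))%N by case/andP: hp => _ h; apply: leq_trans h _; rewrite leq_exp2l // leq_addr.
have c1 := Tcos pp hp2.
have g1 : expR (- 18) <= ga (la - l).
  rewrite ler_expR lerN2; have : (la - l) ^+ 2 <= 6 ^+ 2.
    by apply: lerXn2r; rewrite ?nnegrE; ulra l2 l1 a2.
  lra.
have w1 : expR (- 18) / 2 <= wgt la l by have := ga_ge0 (la + l); rewrite /wgt; ulra g1.
have g2 : expR (- (1 + la / 2)) <= expR (- (b * l)).
  rewrite ler_expR lerN2; have h1 : b * l <= b * la by apply: ler_wpM2l => //; move: e0; rlra 0.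
  have h2 : e * la <= 1.
    rewrite mulrA -[leRHS]mulr1; apply: ler_pM => //; last ulra l2 l1.
    by apply: mulr_ge0 => //; exact: ltW.
  by move: h1; rewrite [b * la]mulrDl; ulra h2.
rewrite /pterm -/l.
have -> : expR (- (19 + la / 2)) / 4 = expR (- (1 + la / 2)) * 2^-1 * (expR (- 18) / 2).
  have -> : - (19 + la / 2) = - (1 + la / 2) + - 18 by ring.
  by rewrite expRD; field.
by apply: ler_pM => //; apply: ler_pM => //; exact: expR_ge0.
Qed.

(** The cosine is uncontrolled here. For [l - la >= 10] the Gaussian is at most [e^(-5 (l - la))],
    which outweighs the number of primes in the dyadic block and leaves [e^(-2 (k - J))]. *)
Lemma pterm_tail k p : prime p -> (J + 20 <= k)%N -> (2 ^ k < p <= 2 ^ k.+1)%N ->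
  - (expR (- (k%:R * ln 2)) * (expR (la / 2) * expR (- (2 * (k - J)%:R)))) <= pterm b la T p.
Proof.
move=> pp kJ hp; have /andP[l1 _] := ln_prime_bounds hp; have /andP[a1 a2] := fx_l2; have J0 := fx_J.
set l := ln p%:R in l1 *; set j := (k - J)%N.
have Ek : k%:R = J%:R + j%:R :> R by rewrite -natrD subnKC // (leq_trans _ kJ) // leq_addr.
have j20 : 20 <= j%:R :> R by rewrite ler_nat leq_subRL ?(leq_trans _ kJ) // leq_addr.
have l0 : 0 <= l by apply: le_trans l1; rewrite mulr_ge0; ulra j20 Ek J0 a1.
have la0 : 0 <= la by rewrite mulr_ge0; ulra l0 J0 a1.
have hb : expR (- (b * l)) <= expR (- (l / 2)).
  by rewrite ler_expR lerN2 mulrDl mulrC lerDl mulr_ge0 // ltW.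
have hw := wgt_le la0 l0.
have B : expR (- (b * l)) * wgt la l <= expR (- (k%:R * ln 2)) * (expR (la / 2) * expR (- (2 * j%:R))).
  apply: le_trans (ler_pM (expR_ge0 _) (wgt_ge0 _ _) hb hw) _.
  rewrite /ga -!expRD ler_expR.
  have x10 : 10 <= j%:R * ln (2 : R) by apply: (@le_trans _ _ (20 * 2^-1)); [rlra 0|apply: ler_pM; ulra j20 a1].
  have lx : la + j%:R * ln 2 <= l by move: l1; rewrite Ek mulrDl.
  have jx : j%:R / 2 <= j%:R * ln (2 : R) by apply: ler_wpM2l.
  rewrite Ek mulrDl; move: x10 lx jx; set x := j%:R * ln 2; move: la => A x10 lx jx.
  have q1 : (A - l) ^+ 2 = (l - A) ^+ 2 by rewrite -sqrrN opprB.
  rewrite q1; have : 10 * (l - A) <= (l - A) ^+ 2 by rewrite expr2; apply: ler_wpM2r; ulra lx x10.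
  ulra jx lx x10.
have hc := cos_geN1 (T * l); rewrite /pterm -/l.
have -> : expR (- (b * l)) * cos (T * l) * wgt la l = expR (- (b * l)) * wgt la l * cos (T * l) by ring.
have p0 : 0 <= expR (- (b * l)) * wgt la l by rewrite mulr_ge0 ?expR_ge0 ?wgt_ge0.
move: B p0 hc; set q := _ * wgt _ _; set B := _ * (_ * _); move: (cos _) => c; nra.
Qed.

Lemma psumE b' la' P : psum b' la' T P = \sum_(0 <= p < P.+1 | prime p) pterm b' la' T p.
Proof. by rewrite big_mkord. Qed.

(** Block [k] contains at most [2^(k + 1) / J] primes; the bound telescopes because
    [e^-2 <= 1/2]. *)
Lemma tail_sum n : - (4 / J%:R * expR (la / 2) * (expR (- 40) - expR (- (2 * (n + 20)%:R)))) <=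
  \sum_((2 ^ (J + 20)).+1 <= p < (2 ^ (J + 20 + n)).+1 | prime p) pterm b la T p.
Proof.
have J0 := fx_J; have E0 := expR_gt0 (la / 2).
elim: n => [|n IH].
  rewrite addn0 add0n big_geq // (_ : 2 * 20%:R = 40 :> R); last by ring.
  by rewrite subrr mulr0 oppr0.
rewrite (@big_cat_nat _ _ _ (2 ^ (J + 20 + n)).+1) //=; [|by rewrite ltnS leq_exp2l // leq_addr|by rewrite ltnS leq_exp2l // leq_add2l].
set k := (J + 20 + n)%N; have kE : (J + 20 + n.+1 = k.+1)%N by rewrite addnS.
have kJ : (k - J = n + 20)%N by rewrite /k -addnA addKn addnC.
have := @sum_primes_ge (pterm b la T) (2 ^ k) (2 ^ k.+1) _ (fun p pp hp => pterm_tail pp (leq_addr n (J + 20)) hp).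
rewrite -/k kJ => h; rewrite kE.
have cnt : (primes_in (2 ^ k) (2 ^ k.+1))%:R <= 2 / J%:R * expR (k%:R * ln 2) :> R.
  rewrite expR_pow2 mulrAC ler_pdivlMr; last lra.
  rewrite -natrM -natrM ler_nat -expnS; apply: leq_trans (dyadic_primes k).
  by rewrite mulnC leq_mul2r /k -addnA leq_addr orbT.
set r := expR (- (2 * (n + 20)%:R)) in h IH *.
have r0 : 0 < r := expR_gt0 _.
have rS : expR (- (2 * (n.+1 + 20)%:R)) <= r / 2.
  have -> : - (2 * (n.+1 + 20)%:R) = - (2 * (n + 20)%:R) - 2 :> R by rewrite addSn -natr1; ring.
  rewrite expRD; apply: ler_wpM2l; first exact: ltW.
  rewrite expRN lef_pV2 ?posrE ?expR_gt0 //; have := expR_ge1Dx (2 : R); rlra 0.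
have blk : - (2 / J%:R * expR (la / 2) * r) <= \sum_((2 ^ k).+1 <= p < (2 ^ k.+1).+1 | prime p) pterm b la T p.
  apply: le_trans h; rewrite mulNr lerN2.
  have -> : 2 / J%:R * expR (la / 2) * r = expR (- (k%:R * ln 2)) * (expR (la / 2) * r) * (2 / J%:R * expR (k%:R * ln 2)).
    have : expR (- (k%:R * ln 2)) * expR (k%:R * ln 2) = 1 :> R by rewrite -expRD addNr expR0.
    move=> E; rewrite [RHS](_ : _ = 2 / J%:R * expR (la / 2) * r * (expR (- (k%:R * ln 2)) * expR (k%:R * ln 2))); last by ring.
    by rewrite E mulr1.
  by apply: ler_wpM2l => //; rewrite !mulr_ge0 ?expR_ge0 ?(ltW r0).
apply: le_trans (lerD IH blk); rewrite -opprD lerN2.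
have -> : 2 / J%:R * expR (la / 2) * r = 4 / J%:R * expR (la / 2) * (r / 2) by field; apply: lt0r_neq0; ulra J0.
rewrite -mulrDr; apply: ler_wpM2l; last by ulra rS.
by rewrite mulr_ge0 ?expR_ge0 // divr_ge0.
Qed.

(** The block from [2^(J - 6)] to [2^J] yields the constant [e^-19 / 16]. Other primes up to
    [2^(J + 20)] contribute nonnegative terms, and the tail at most half of the main term, since
    [4 e^-40 <= e^-19 / 32]. *)
Lemma psum_lower M : (J + 20 <= M)%N -> expR (- 19) / 32 * (expR (la / 2) / J%:R) <= psum b la T (2 ^ M).
Proof.
move=> JM; have J0 := fx_J; have Ji : 0 < (J%:R : R)^-1 by rewrite invr_gt0; lra.
have E0 := expR_gt0 (la / 2).
rewrite psumE (@big_cat_nat _ _ _ (2 ^ (J - 6)).+1) //=; last by rewrite ltnS leq_exp2l // (leq_trans (leq_subr _ _)) // (leq_trans _ JM) // leq_addr.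
rewrite [X in _ + X](@big_cat_nat _ _ _ (2 ^ J).+1) //=; [|by rewrite ltnS leq_exp2l // leq_subr|by rewrite ltnS leq_exp2l // (leq_trans _ JM) // leq_addr].
rewrite [X in _ + (_ + X)](@big_cat_nat _ _ _ (2 ^ (J + 20)).+1) //=; [|by rewrite ltnS leq_exp2l // leq_addr|by rewrite ltnS leq_exp2l].
have pos m n : (n <= J + 20)%N -> 0 <= \sum_(m <= p < (2 ^ n).+1 | prime p) pterm b la T p.
  move=> nJ; rewrite big_seq_cond; apply: sumr_ge0 => p; rewrite mem_index_iota => /andP[/andP[_ h] pp].
  by apply: pterm_pos => //; apply: (@leq_trans (2 ^ n)); [rewrite -ltnS|rewrite leq_exp2l].
have p1 := pos 0%N (J - 6)%N (ltac:(by rewrite (leq_trans (leq_subr _ _)) // leq_addr)).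
have p2 := pos (2 ^ J).+1 (J + 20)%N (leqnn _).
have p3 := tail_sum (M - (J + 20)); rewrite subnKC // in p3.
have p4 := sum_primes_ge pterm_main.
have cnt : expR la / (4 * J%:R) <= (primes_in (2 ^ (J - 6)) (2 ^ J))%:R :> R.
  rewrite expR_pow2 ler_pdivrMr; last ulra J0.
  have h := primes_in_lower J12; rewrite -(ler_nat R) !natrM in h; apply: le_trans h _.
  by rewrite le_eqVlt; apply/orP; left; apply/eqP; ring.
have c4 : 0 <= expR (- (19 + la / 2)) / 4 by rewrite divr_ge0 ?expR_ge0.
have p5 := le_trans (ler_wpM2l c4 cnt) p4.
have E1 : expR (- (19 + la / 2)) / 4 * (expR la / (4 * J%:R)) = expR (- 19) / 16 * (expR (la / 2) / J%:R).
  have -> : - (19 + la / 2) = - 19 + - (la / 2) by ring.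
  have -> : expR la = expR (la / 2) * expR (la / 2) :> R by rewrite -expRD; congr expR; field.
  rewrite expRD expRN; field; do ?(apply/andP; split); apply: lt0r_neq0; ulra J0 E0.
rewrite E1 in p5.
have p6 : 4 / J%:R * expR (la / 2) * (expR (- 40) - expR (- (2 * (M - (J + 20) + 20)%:R))) <= expR (- 19) / 32 * (expR (la / 2) / J%:R).
  apply: (@le_trans _ _ (4 * expR (- 40) * (expR (la / 2) / J%:R))).
    have -> : 4 / J%:R * expR (la / 2) * (expR (- 40) - expR (- (2 * (M - (J + 20) + 20)%:R))) =
      (4 * (expR (- 40) - expR (- (2 * (M - (J + 20) + 20)%:R)))) * (expR (la / 2) / J%:R) by ring.
    apply: ler_wpM2r; first by rewrite divr_ge0 // ltW.
    by apply: ler_wpM2l => //; rewrite gerBl expR_ge0.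
  apply: ler_wpM2r; first by rewrite divr_ge0 // ltW.
  have -> : - 40 = - 19 + - (7%:R * 3) :> R by ring.
  rewrite expRD [expR (- (7%:R * 3))]expRN expRM_natl mulrCA; apply: ler_wpM2l; first exact: expR_ge0.
  rewrite ler_pdivrMr ?exprn_gt0 ?expR_gt0 // mulrC ler_pdivlMr //.
  have : (2 : R) ^+ 7 <= expR 3 ^+ 7 by apply: lerXn2r; rewrite ?nnegrE ?expR_ge0 //; have := expR_ge1Dx (3 : R); rlra 0.
  by apply: le_trans; rewrite !exprS expr0; rlra 0.
move: p1 p2 p3 p5 p6; move: (\sum_(_ <= _ < _ | _) _) (\sum_(_ <= _ < _ | _) _) (\sum_(_ <= _ < _ | _) _) (\sum_(_ <= _ < _ | _) _) => s1 s2 s3 s4.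
rlra 0.
Qed.

End Fixed.

(** [18 * 2^20] is [ln 8 <= 3] times the constant 6 of [primepi_pow_upper] at [2^(J + 20)]; 12
    covers the term [3 la]. *)
Definition C3 : R := 18 * 2 ^+ 20 + 12.

Lemma sqr_le_pow2 J : (4 <= J)%N -> (J * J <= 2 ^ J)%N.
Proof.
elim: J => // J IH; rewrite leq_eqVlt => /predU1P[<- //|h]; have {}IH := IH h.
rewrite expnS mul2n -addnn; apply: leq_trans (leq_add IH IH); rewrite ltnS in h.
nia.
Qed.

Lemma T_arith (p Jr l2 lj E W : R) : 0 < Jr -> lj <= p * 3 -> p * Jr <= 6 * (W * E) -> Jr * Jr <= E ->
  l2 <= 1 -> 0 <= E -> lj + 3 * (Jr * l2) <= (18 * W + 12) * (E / Jr).
Proof.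
move=> J0 h1 h2 h3 h4 E0; rewrite [leRHS]mulrA ler_pdivlMr //.
have h5 : lj * Jr <= p * 3 * Jr by rewrite ler_pM2r.
have h6 : Jr * l2 * Jr <= Jr * Jr by rewrite ler_pM2r // ler_piMr // ltW.
move: h2 h3 h5 h6 E0; clear; lra.
Qed.

(** Dirichlet's theorem is applied to multiples of [e^(3 la)], which secures the size required by
    [rest_int]; the exponent in [j <= 8^(size s)] is a number of primes and bounds [ln T]. *)
Lemma T_exists J : (12 <= J)%N -> exists T : R, [/\ expR (3 * (J%:R * ln 2)) <= T,
  ln T <= C3 * (expR (J%:R * ln 2) / J%:R) & forall p, prime p -> (p <= 2 ^ (J + 20))%N -> 2^-1 <= cos (T * ln p%:R)].
Proof.
move=> J12; have J0 := fx_J J12; have /andP[a1 a2] := fx_l2.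
set la := J%:R * ln 2; set X := (2 ^ (J + 20))%N.
pose s := [seq ln (p%:R : R) | p <- index_iota 0 X.+1 & prime p].
have [j /andP[j1 j2] hj] := dirichlet s (expR (3 * la)).
have sz : size s = primepi X by rewrite size_map size_filter /primepi sum1_count.
have jr : 1 <= j%:R :> R by rewrite ler1n.
exists (j%:R * expR (3 * la)); split.
- by rewrite ler_peMl // expR_ge0.
- rewrite lnM ?posrE ?expR_gt0 //; last lra.
  rewrite expRK addrC; have l1 : ln j%:R <= (primepi X)%:R * 3 :> R.
    apply: (@le_trans _ _ (ln ((8 ^ primepi X)%N%:R))); first by rewrite ler_ln ?posrE ?ltr0n ?expn_gt0 // ler_nat -sz.
    rewrite natrX lnXn // -[ln 8 *+ _]mulr_natl; apply: ler_wpM2l => //.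
    have -> : ln 8 = 3%:R * ln 2 :> R by rewrite mulr_natl -lnXn //; congr ln; ring.
    lra.
  have l2 : (primepi X)%:R * J%:R <= 6 * (2 ^+ 20 * expR la).
    rewrite expR_pow2 -natrM -!natrX -!natrM ler_nat mulnC.
    apply: (@leq_trans ((J + 20) * primepi X)); first by rewrite leq_mul2r leq_addr orbT.
    by apply: leq_trans (primepi_pow_upper _) _; rewrite expnD [(2 ^ J * _)%N]mulnC.
  have l3 : J%:R * J%:R <= expR la :> R.
    by rewrite expR_pow2 -natrM ler_nat; apply: sqr_le_pow2; apply: leq_trans J12.
  by rewrite addrC; apply: (T_arith _ l1 l2 l3); rewrite ?expR_ge0 //; lra.
- by move=> p pp hp; apply: hj; apply/mapP; exists p => //; rewrite mem_filter pp mem_index_iota ltnS.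
Qed.

Variable zeta : C -> C.
Hypothesis hzeta : is_riemann_zeta zeta.
Variables (G L : C -> C).
Hypothesis HG : is_logzeta zeta G.
Hypothesis HL : is_Ln L.

Lemma lower_main : exists2 CI : R, 0 < CI & forall J, (12 <= J)%N -> exists T : R,
  [/\ expR (3 * (J%:R * ln 2)) <= T, ln T <= C3 * (expR (J%:R * ln 2) / J%:R) &
  forall e, 0 < e <= 10^-1 -> e * J%:R <= 1 -> exists2 D : R, 0 <= D & forall Y, 1 <= Y -> 2 * T <= Y ->
    expR (- 19) / 16 * (expR (J%:R * ln 2 / 2) / J%:R) - CI * expR (J%:R * ln 2 / 4) - D / Y <=
    Re (cint (fun t => G ((2^-1 + e) +i* t) * gkT (J%:R * ln 2) (2^-1 + e) T ((2^-1 + e) +i* t)) (- Y) Y)].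
Proof.
have [CI CI0 H] := lower_int HL hzeta HG; exists CI => // J J12.
have [T [h1 h2 h3]] := T_exists J12; exists T; split => // e he eJ.
have /andP[e0 _] := he; have J0 := fx_J J12; have /andP[a1 a2] := fx_l2.
set la := J%:R * ln 2 in h1 *; have la0 : 0 <= la by rewrite mulr_ge0; ulra h1 J0 a1.
have T1 : 1 <= T by apply: le_trans h1; rewrite -[leLHS]expR0 ler_expR mulr_ge0.
(* The cut-off [P = 2^N] has to reach [T], for [rest], and [2^(J + 20)], for the prime sum. *)
have [M hM] := exp2_big T; pose N := maxn M (J + 20).
have ps := psum_lower J12 e0 eJ h3 (leq_maxr M (J + 20)).
have c0 : 0 <= expR (- 19) / 32 * (expR (la / 2) / J%:R) by rewrite mulr_ge0 // divr_ge0 ?expR_ge0 // ler0n.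
have [||D D0 HD] := H e la T (2 ^ N)%N he la0 T1 _ h1 _ (le_trans c0 ps).
- by rewrite expn_gt0.
- apply: (@le_trans _ _ (2 ^+ M)); first exact: ltW.
  by rewrite -natrX ler_nat ltnW // ltnS leq_exp2l // leq_maxl.
exists D => // Y Y1 TY; apply: le_trans (HD Y Y1 TY); move: ps; rewrite -/N; rlra 0.
Qed.

End PrimeSumLower.

(** * Integration by parts against [Jint] *)

Section TestSide.
Variable R : realType.
Local Notation C := R[i].
Implicit Types (a b c d x y t u v w e la T Y A : R).

Definition kc la v : R := ga v * cos (la * v).
Definition kc' la v : R := - v * ga v * cos (la * v) - ga v * (la * sin (la * v)).

Lemma rder_kc la v : rder (kc la) v (kc' la v).
Proof.
have dl : rder (fun v => la * v) v la by apply: rder_eq (rderZ la (rder_id v)); rewrite mulr1.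
have dc : rder (fun v => cos (la * v)) v (- sin (la * v) * la) by exact: (@rder_comp _ (@cos R) _ _ _ _ (is_derive_cos _) dl).
by apply: rder_eq (rderM (rder_ga v) dc); rewrite /kc'; ring.
Qed.

Lemma kcN la v : kc la (- v) = kc la v.
Proof. by rewrite /kc /ga sqrrN mulrN cosN. Qed.

Definition ph la T t : R := kc la (t - T) + kc la (t + T).
Definition ph' la T t : R := kc' la (t - T) + kc' la (t + T).

Lemma rder_ph la T t : rder (ph la T) t (ph' la T t).
Proof.
have d1 : rder (fun t => t - T) t 1 by apply: rder_eq (rderB (rder_id t) (rder_cst T t)); rewrite subr0.
have d2 : rder (fun t => t + T) t 1 by apply: rder_eq (rderD (rder_id t) (rder_cst T t)); rewrite addr0.
apply: rder_eq (rderD (@rder_comp _ (kc la) (fun t => t - T) t _ _ (rder_kc la (t - T)) d1)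
  (@rder_comp _ (kc la) (fun t => t + T) t _ _ (rder_kc la (t + T)) d2)).
by rewrite !mulr1.
Qed.

Lemma phN la T t : ph la T (- t) = ph la T t.
Proof. by rewrite /ph -opprD kcN (_ : - t + T = - (t - T)) ?kcN; [rewrite addrC|ring]. Qed.

(** The square root of [ga]: one copy absorbs polynomial factors, the other keeps the decay. *)
Definition g4 v : R := expR (- (v ^+ 2 / 4)).

Lemma g4_ge0 v : 0 <= g4 v. Proof. exact: expR_ge0. Qed.

Lemma norm_mul_g4 v : `|v| * g4 v <= 1.
Proof.
rewrite /g4 expRN ler_pdivrMr ?expR_gt0 // mul1r; apply: le_trans (expR_ge1Dx _).
have := sqr_ge0 (`|v| - 2); rewrite sqrrB real_normK ?num_real // -[`|v| * 2 *+ 2]mulr_natr.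
by move: (normr_ge0 v); move: (v ^+ 2) `|v| => q n; rewrite expr2; lra.
Qed.

Lemma ga_g4 v : ga v = g4 v * g4 v.
Proof. by rewrite /ga /g4 -expRD; congr expR; field. Qed.

Lemma g4_le1 v : g4 v <= 1.
Proof. by rewrite /g4 -expR0 ler_expR oppr_le0 divr_ge0 ?sqr_ge0. Qed.

Lemma kc_le la v : `|kc la v| <= g4 v.
Proof.
rewrite /kc normrM ger0_norm ?ga_ge0 // ga_g4 -mulrA -[leRHS]mulr1; apply: ler_wpM2l; first exact: g4_ge0.
rewrite -[leRHS]mulr1; apply: ler_pM; rewrite ?g4_ge0 ?g4_le1 //.
by rewrite ler_norml cos_geN1 cos_le1.
Qed.

Lemma kc'_le la v : 1 <= la -> `|kc' la v| <= 2 * la * g4 v.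
Proof.
move=> la1; have c1 : `|cos (la * v)| <= 1 by rewrite ler_norml cos_geN1 cos_le1.
have s1 : `|sin (la * v)| <= 1 by rewrite ler_norml sin_geN1 sin_le1.
have g0 := g4_ge0 v; have g1 := g4_le1 v; have h := norm_mul_g4 v.
apply: le_trans (ler_normB _ _) _.
have h1 : `|- v * ga v * cos (la * v)| <= g4 v.
  rewrite !normrM normrN (ger0_norm (ga_ge0 v)) ga_g4.
  have -> : `|v| * (g4 v * g4 v) * `|cos (la * v)| = g4 v * (`|v| * g4 v * `|cos (la * v)|) by ring.
  rewrite -[leRHS]mulr1; apply: ler_wpM2l => //; rewrite -[leRHS]mulr1.
  by apply: ler_pM => //; rewrite mulr_ge0.
have h2 : `|ga v * (la * sin (la * v))| <= la * g4 v.
  rewrite !normrM (ger0_norm (ga_ge0 v)) (@ger0_norm _ la) ?ga_g4; last lra.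
  have -> : g4 v * g4 v * (la * `|sin (la * v)|) = la * g4 v * (g4 v * `|sin (la * v)|) by ring.
  rewrite -[leRHS]mulr1; apply: ler_wpM2l; first by rewrite mulr_ge0 //; lra.
  by rewrite -[leRHS]mulr1; apply: ler_pM.
have h3 : g4 v <= la * g4 v by rewrite ler_peMl.
move: h1 h2 h3; lra.
Qed.

Lemma g4_plus t T : 0 <= t -> 0 <= T -> g4 (t + T) <= g4 (t - T).
Proof.
move=> t0 T0; rewrite /g4 ler_expR lerN2 ler_pM2r ?invr_gt0 //.
have := mulr_ge0 t0 T0; rewrite !expr2; lra.
Qed.

(** The factor [1/4 + t^2] undoes the weight in the integrand of [Jint]. *)
Definition mm la T t : R := ph la T t * (4^-1 + t ^+ 2).
Definition mm' la T t : R := ph' la T t * (4^-1 + t ^+ 2) + ph la T t * (2 * t).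

Lemma rder_mm la T t : rder (mm la T) t (mm' la T t).
Proof.
have d : rder (fun t => 4^-1 + t ^+ 2) t (2 * t).
  by apply: rder_eq (rderD (rder_cst 4^-1 t) (rderX 2 (rder_id t))); rewrite add0r mulr1 expr1.
exact: rderM (rder_ph la T t) d.
Qed.

(** [t^2 <= 2 T^2 + 2 (t - T)^2] shows that the inverse weight costs [T^2]; differentiating the
    oscillating factor costs [la]. For [t >= 0] the hump at [-T] is dominated by the one at [T]. *)
Lemma mm_bounds la T t : 1 <= la -> 1 <= T -> 0 <= t ->
  `|mm la T t| <= 6 * T ^+ 2 * ((1 + (t - T) ^+ 2) * g4 (t - T)) /\
  `|mm' la T t| <= 18 * la * T ^+ 2 * ((1 + (t - T) ^+ 2) * g4 (t - T)).
Proof.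
move=> la1 T1 t0; have T0 : 0 <= T by lra.
have gp := g4_plus t0 T0; have g0 := g4_ge0 (t - T).
have p1 : `|ph la T t| <= 2 * g4 (t - T).
  by apply: le_trans (ler_normD _ _) _; have := kc_le la (t - T); have := kc_le la (t + T); lra.
have p2 : `|ph' la T t| <= 4 * la * g4 (t - T).
  apply: le_trans (ler_normD _ _) _; have := kc'_le (t - T) la1; have := kc'_le (t + T) la1.
  have : 2 * la * g4 (t + T) <= 2 * la * g4 (t - T) by apply: ler_wpM2l => //; lra.
  lra.
have v0 := sqr_ge0 (t - T); have T2 : 1 <= T ^+ 2 by rewrite exprn_ege1.
set v2 := (t - T) ^+ 2 in v0 *.
have w1 : 1 + t ^+ 2 <= 3 * T ^+ 2 * (1 + v2).
  have a : t ^+ 2 <= 2 * T ^+ 2 + 2 * v2.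
    by have := sqr_ge0 (t - 2 * T); rewrite /v2 !expr2; rlra 0.
  have b : v2 <= T ^+ 2 * v2 by rewrite ler_peMl.
  by move: a b T2 v0; clear; lra.
have w2 : 2 * t <= 3 * T ^+ 2 * (1 + v2) by have := sqr_ge0 (t - 1); move: w1; rewrite sqrrB expr1n mulr1 -mulr_natr; rlra 0.
have w3 : 4^-1 + t ^+ 2 <= 3 * T ^+ 2 * (1 + v2) by ulra w1.
have w0 : 0 <= 4^-1 + t ^+ 2 by have := sqr_ge0 t; rlra 0.
have B0 : 0 <= 3 * T ^+ 2 * (1 + v2) by ulra w0 w3.
have m1 : `|ph la T t| * (4^-1 + t ^+ 2) <= 2 * g4 (t - T) * (3 * T ^+ 2 * (1 + v2)) by apply: ler_pM.
have m2 : `|ph' la T t| * (4^-1 + t ^+ 2) <= 4 * la * g4 (t - T) * (3 * T ^+ 2 * (1 + v2)) by apply: ler_pM.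
have m3 : `|ph la T t| * (2 * t) <= 2 * g4 (t - T) * (3 * T ^+ 2 * (1 + v2)) by apply: ler_pM => //; ulra t0.
split; first by rewrite /mm normrM (ger0_norm w0); move: m1; clear; lra.
rewrite /mm'; apply: le_trans (ler_normD _ _) _; rewrite !normrM (ger0_norm w0) (@ger0_norm _ 2) // (ger0_norm t0).
apply: le_trans (lerD m2 m3) _.
have q : 0 <= T ^+ 2 * ((1 + v2) * g4 (t - T)) by rewrite !mulr_ge0 //; lra.
have := mulr_ge0 (ltac:(ulra la1) : 0 <= la - 1) q; clear; rlra 0.
Qed.

(** As [m] is even, the integral of [g m] over [[-Y, Y]] is [j Y m Y] minus the integral of [j m']
    over [[0, Y]], where [j t] is the integral of [g] over [[-t, t]]. The Gaussian absorbs the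
    growth allowed to [j]. *)
Lemma parts_bound (g m m' : R -> R) A B T Y : 0 <= A -> 0 <= B -> 0 <= Y ->
  (forall t, {for t, continuous g}) -> (forall t, rder m t (m' t)) -> (forall t, m (- t) = m t) ->
  (forall t, 0 <= t -> `|rint g (- t) t| <= A * (1 + (t - T) ^+ 2) ^+ 2) ->
  (forall t, 0 <= t -> `|m t| <= B * ((1 + (t - T) ^+ 2) * g4 (t - T))) ->
  (forall t, 0 <= t -> `|m' t| <= B * ((1 + (t - T) ^+ 2) * g4 (t - T))) ->
  `|rint (fun t => g t * m t) (- Y) Y| <= 5 * (cG R * (A * B)).
Proof.
move=> A0 B0 Y0 cg dm me HA Hm Hm'; have YY : - Y <= Y by lra.
have [F hF] : exists F : R -> R, forall t, inseg (- Y) Y t -> rder F t (g t) by apply: rprim_ex => t _.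
have [P hP] : exists P : R -> R, forall t, inseg (- Y) Y t -> rder P t (g t * m t).
  by apply: rprim_ex => t _; apply: (@cvgM _ _ _ _ g m); [exact: cg|exact: rder_cont (dm t)].
pose j t := F t - F (- t).
have sub t : 0 <= t <= Y -> inseg (- Y) Y t /\ inseg (- Y) Y (- t).
  by move=> /andP[? ?]; rewrite !inseg_le //; split; apply/andP; split; rlra 2.
have jE t : 0 <= t <= Y -> j t = rint g (- t) t.
  move=> ht; rewrite (rintE (G := F)) // => u; have /andP[t0 tY] := ht.
  by rewrite inseg_le; [move=> /andP[? ?]; apply: hF; rewrite inseg_le //; apply/andP; split; rlra 3|ulra t0].
have dN t : rder (fun t : R => - t) t (-1) by exact: rderN (rder_id t).
have dj t : 0 <= t <= Y -> rder j t (g t + g (- t)).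
  move=> ht; have [h1 h2] := sub t ht.
  by apply: rder_eq (rderB (hF t h1) (@rder_comp _ F (fun t => - t) t _ _ (hF _ h2) (dN t))); ring.
have dP t : 0 <= t <= Y -> rder (fun t => P t - P (- t)) t (g t * m t + g (- t) * m t).
  move=> ht; have [h1 h2] := sub t ht.
  by apply: rder_eq (rderB (hP t h1) (@rder_comp _ P (fun t => - t) t _ _ (hP _ h2) (dN t))); rewrite me; ring.
pose N t := P t - P (- t) - j t * m t.
have dNt t : 0 <= t <= Y -> rder N t (- (j t * m' t)).
  by move=> ht; apply: rder_eq (rderB (dP t ht) (rderM (dj t ht) (dm t))); ring.
have N0 : N 0 = 0 by rewrite /N /j oppr0 !subrr mul0r subr0.
pose K := cG R * (A * B); have K0 : 0 <= K by rewrite !mulr_ge0 // ltW // cG_gt0.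
have core t (x : R) : 0 <= t <= Y -> `|x| <= B * ((1 + (t - T) ^+ 2) * g4 (t - T)) -> `|j t * x| <= K * (1 + (t - T) ^+ 2)^-1.
  move=> ht hx; have /andP[t0 _] := ht; have q0 := sqr_ge0 (t - T).
  rewrite normrM jE //; apply: le_trans (ler_pM (normr_ge0 _) (normr_ge0 _) (HA t t0) hx) _.
  rewrite ler_pdivlMr; last ulra q0.
  have := ler_wpM2l (mulr_ge0 A0 B0) (gauss_decay (t - T)); rewrite -/(g4 _) /K.
  by rewrite [cG R * _]mulrC; apply: le_trans; rewrite le_eqVlt; apply/orP; left; apply/eqP; ring.
pose Q t := K * (1^-1 * atan (1 * (t - T))).
have dQ t : rder Q t (K * (1 + (t - T) ^+ 2)^-1).
  by apply: rder_eq (rderZ K (rder_atan1 T t ltr01)); rewrite mul1r.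
have d4 := @atan1_diff R 1 T 0 Y K ltr01 K0; rewrite divr1 -/(Q _) -/(Q _) in d4.
have up : N Y - N 0 <= Q Y - Q 0.
  apply: (rder_mono Y0 dNt (fun t _ => dQ t)) => t ht; have /andP[t0 _] := ht.
  by have := core t (m' t) ht (Hm' t t0); rewrite ler_norml => /andP[h _]; ulra h.
have lo : - N Y - - N 0 <= Q Y - Q 0.
  apply: (rder_mono Y0 (fun t ht => rderN (dNt t ht)) (fun t _ => dQ t)) => t ht; have /andP[t0 _] := ht.
  by rewrite opprK; have := core t (m' t) ht (Hm' t t0); rewrite ler_norml => /andP[_ h].
have YYY : 0 <= Y <= Y by rewrite Y0 lexx.
have bd : `|j Y * m Y| <= K.
  apply: le_trans (core Y (m Y) YYY (Hm Y Y0)) _; rewrite -[leRHS]mulr1; apply: ler_wpM2l => //.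
  by rewrite invf_le1 ?lerDl ?sqr_ge0 //; have := sqr_ge0 (Y - T); rlra 0.
rewrite (rintE hP); have -> : P Y - P (- Y) = N Y + j Y * m Y by rewrite /N subrK.
rewrite N0 in up lo; move: bd up lo d4; rewrite /K ler_norml => /andP[? ?] ? ? ?.
by rewrite ler_norml; apply/andP; split; rlra 5.
Qed.

Lemma phi_upper (G : C -> C) e la T A Y : (forall s, 2^-1 < Re s -> holo G s) -> 0 < e -> 1 <= la -> 1 <= T -> 0 <= A -> 0 <= Y ->
  (forall t, 0 <= t -> `|Jint G e t| <= A * (1 + (t - T) ^+ 2) ^+ 2) ->
  `|Re (cint (fun t => G ((2^-1 + e) +i* t) * gkT la (2^-1 + e) T ((2^-1 + e) +i* t)) (- Y) Y)| <=
  90 * cG R * (la * T ^+ 2 * A).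
Proof.
move=> hG e0 la1 T1 A0 Y0 HJ; set b := 2^-1 + e.
have hb t : holo G (b +i* t) by apply: hG; rewrite ReI /b; lra.
have sc : segcont (fun t => G (b +i* t) * gkT la b T (b +i* t)) (- Y) Y by exact: segcont_gkT.
rewrite Re_cint //; pose g t := Re (G (b +i* t)) / (4^-1 + t ^+ 2).
have -> : (fun t => Re (G (b +i* t) * gkT la b T (b +i* t))) = (fun t => g t * mm la T t).
  apply: funext => t; rewrite gkT_im ReM ImC mulr0 subr0 ReC /g /mm /ph /kc.
  have := sqr_ge0 t => t2; field; apply: lt0r_neq0; lra.
have cg t : {for t, continuous g} by have [d hd] := hb t; apply: continuousM; [exact: (rder_cont (cder_y hd).1)|exact: cont_w].
have T2 : 0 <= T ^+ 2 by exact: sqr_ge0.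
have B0 : 0 <= 18 * la * T ^+ 2 by rewrite !mulr_ge0 //; ulra la1 T1.
have := @parts_bound g (mm la T) (mm' la T) A (18 * la * T ^+ 2) T Y A0 B0 Y0 cg (rder_mm la T).
move=> h; apply: le_trans (h _ _ _ _) _.
- by move=> t; rewrite /mm phN sqrrN.
- by move=> t t0; exact: HJ.
- move=> t t0; have [h1 _] := mm_bounds la1 T1 t0; apply: le_trans h1 _; apply: ler_wpM2r.
    by rewrite mulr_ge0 ?g4_ge0 //; have := sqr_ge0 (t - T); rlra 0.
  by apply: ler_wpM2r => //; ulra la1.
- by move=> t t0; have [_ h1] := mm_bounds la1 T1 t0.
by rewrite le_eqVlt; apply/orP; left; apply/eqP; ring.
Qed.

End TestSide.

(** * The upper bound for [Jint], uniform in the shift *)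

Section UniformUpper.
Variable R : realType.
Local Notation C := R[i].
Implicit Types (e t T gam : R).
Variable zeta : C -> C.
Hypothesis hzeta : is_riemann_zeta zeta.
Variables (G L : C -> C).
Hypothesis HG : is_logzeta zeta G.
Hypothesis HL : is_Ln L.

(** [gam] bounds the correction [G (1 + e)], which tends to [G 1 = 0]. It is left free, and [e0]
    depends on it but not on [T]: one application takes [gam = 1] for all heights, the other lets
    [gam] depend on [T]. *)
Lemma upper_unif : exists2 K : R, 0 < K & forall gam, 0 < gam <= 1 -> exists2 e0 : R, 0 < e0 &
  forall e T, 0 < e < e0 -> 80 <= ln (ln T) ->
  `|Jint G e T| <= K * (1 / T ^+ 2 * (ln T / ln (ln T) ^+ 2)) + K * gam * expR (ln (ln T) / 4).
Proof.
have [C0 C00 tb] := tauber_abs R; have m0 := M0_ge R.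
pose m := 2 * M0 R + 1; have mp : 0 < m by rewrite /m; lra.
pose K := 2 * C0 * (8 * 80 * m + 88).
have Kp : 0 < K by rewrite /K mulr_gt0 ?mulr_gt0 // addr_gt0 // !mulr_gt0.
exists (K + 4 * C0 + 10); first lra.
move=> gam /andP[gam0 gam1].
have cG : ccont G 1 by apply: holo_ccont; apply: (holo_G HG); rewrite /=; rlra 0.
have [d d0 hd] := cG _ gam0; case: (HG) => G1 _ _.
exists (Num.min d 10^-1); first by rewrite lt_min d0 invr_gt0 ltr0n.
move=> e T; rewrite lt_min => /andP[e0 /andP[ed e10]] h80.
have [l1 T1 _] := lnln_gt (ltac:(rlra 0) : 0 < 80 :> R) h80.
set ll := ln (ln T) in h80 *; set l := ln T in l1 *.
pose E := expR (20 * (ll / 80)); have E0 : 0 < E := expR_gt0 _.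
have E1 : 1 <= E by have : expR 0 <= E by [rewrite ler_expR; ulra h80]; rewrite expR0.
have EE : expR (ll / 4) = E by rewrite /E; congr expR; field.
pose den := 4 * (C0 * E) + 10; have CE : 0 < C0 * E by exact: mulr_gt0.
have e01 : 0 < e <= 10^-1 by rewrite e0 ltW.
pose g1 := G (1 + e%:C).
have g1g : Nc g1 <= gam.
  have := hd (1 + e%:C); rewrite addrAC subrr add0r Nc_real (ger0_norm (ltW e0)) G1 subr0 => /(_ ed).
  exact: ltW.
have g11 x : 1 <= x -> Nc g1 <= x by move=> h; apply: le_trans g1g (le_trans gam1 h).
have [H [W0 [dW0 HE]]] := us_exists HG e01 (erefl g1).
have [w hw] := us_center hzeta HG HL e01 dW0 HE g11 tb C00 h80 gam0.
have T0 : 0 <= T by ulra T1.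
have h := us_J e01 dW0 HE T0 hw.
set Z := 1 / T ^+ 2 * (l / ll ^+ 2).
have Z0 : 0 <= Z by rewrite mulr_ge0 // ?divr_ge0 ?sqr_ge0 //; ulra l1.
apply: (@le_trans _ _ (K * Z + gam * den)).
  apply: le_trans h _; apply: upper_arith => //.
  - rewrite /Z -/ll -/l -/m; field.
    by do ?(apply/andP; split); apply: lt0r_neq0; ulra h80 T1.
  - have T2 : 0 < T ^+ 2 by rewrite exprn_gt0 //; ulra T1.
    have q := exp_quarter (ltac:(rewrite -/l -/ll; ulra h80) : 1 < ln (ln T)); rewrite -/l -/ll in q.
    have -> : 20 * (ll / 80) = ll / 4 by field.
    have -> : 88 * Z = 8 * (l / ll ^+ 2) * (11 / T ^+ 2) by rewrite /Z; ring.
    apply: ler_pM => //.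
      by apply: divr_ge0 => //; ulra T2.
    by apply: ler_wpM2l => //; rewrite lef_pV2 ?posrE //; ulra T2.
rewrite EE; apply: lerD.
  by apply: ler_wpM2r => //; ulra C00.
rewrite [_ * gam]mulrC -mulrA; apply: ler_wpM2l; first exact: ltW.
rewrite /den; have : 10 <= 10 * E by ulra E1.
have : 0 < K * E by exact: mulr_gt0.
rlra 0.
Qed.

End UniformUpper.

(** * The comparison function of the lower bound *)

Section Scale.
Variable R : realType.
Implicit Types (a b c x y t v T dl : R).

Definition q32 x : R := x `^ (3 / 2).
Definition hh T : R := Num.sqrt (ln T) / q32 (ln (ln T)).

Lemma q32_ge0 x : 0 <= q32 x. Proof. exact: powR_ge0. Qed.

Lemma q32_sqr x : 0 <= x -> q32 x ^+ 2 = x ^+ 3.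
Proof.
move=> x0; rewrite -powR_mulrn ?powR_ge0 // -powRrM -powR_mulrn //; congr (_ `^ _).
by field.
Qed.

Lemma q32_gt0 x : 0 < x -> 0 < q32 x. Proof. exact: powR_gt0. Qed.

Lemma le_of_sqr x y : 0 <= y -> x ^+ 2 <= y ^+ 2 -> x <= y.
Proof. by move=> y0; rewrite le_sqr_norm // => h; apply: le_trans h; exact: ler_norm. Qed.

Lemma hh_ge1 T : 256 <= ln (ln T) -> 1 <= hh T.
Proof.
move=> h; have [l1 T1 E] := lnln_gt (ltac:(lra) : 0 < 256 :> R) h.
have ll0 : 0 < ln (ln T) by lra.
rewrite /hh ler_pdivlMr ?q32_gt0 // mul1r; apply: le_of_sqr; first exact: sqrtr_ge0.
rewrite q32_sqr ?(ltW ll0) // sqr_sqrtr; last lra.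
have lE : ln T = expR (ln (ln T)) by rewrite lnK // posrE; lra.
rewrite [leRHS]lE; have h2 := @sqr_le_exp R (ln (ln T) / 2) (ltac:(lra)).
have -> : expR (ln (ln T)) = expR (ln (ln T) / 2) ^+ 2 by rewrite -expRM_natl; congr expR; field.
have h3 : ln (ln T) ^+ 2 <= 16 * expR (ln (ln T) / 2) by move: h2; rewrite expr_div_n; lra.
move: h h3 (expR_gt0 (ln (ln T) / 2)); move: (ln (ln T)) (expR _) => x y x256 h3 y0.
have x2 : 256 * x <= x ^+ 2 by rewrite expr2; apply: ler_wpM2r; ulra x256.
have : x ^+ 2 * x <= 16 * y * x by apply: ler_wpM2r; ulra x256 h3.
have : y * (16 * x) <= y * y by apply: ler_wpM2l; ulra y0 x2 h3.
rewrite exprSr [y ^+ 2]expr2; rlra 0.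
Qed.

Lemma hh_le_sqrt T : 256 <= ln (ln T) -> hh T <= Num.sqrt (ln T).
Proof.
move=> h; rewrite /hh ler_pdivrMr; last by apply: q32_gt0; lra.
rewrite ler_peMr ?sqrtr_ge0 //; apply: le_of_sqr; first exact: q32_ge0.
by rewrite q32_sqr ?expr1n ?exprn_ege1 //; lra.
Qed.

Lemma sqrt_le_id x : 1 <= x -> Num.sqrt x <= x.
Proof.
move=> x1; apply: le_of_sqr; first lra.
by rewrite sqr_sqrtr ?expr2; [rewrite ler_peMr //; lra|lra].
Qed.

Lemma hh_le_id T : 256 <= ln (ln T) -> hh T <= T.
Proof.
move=> h; have [l1 T1 _] := lnln_gt (ltac:(lra) : 0 < 256 :> R) h.
apply: le_trans (hh_le_sqrt h) _; apply: le_trans (sqrt_le_id (ltW l1)) _.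
by have := @ln_le_sub1 R T (ltac:(lra)); lra.
Qed.

Lemma frac_le (s1 s2 q1 q2 k : R) : 0 < q1 -> 0 < q2 -> 0 <= s1 -> 0 <= k -> s1 * q2 <= k * (s2 * q1) -> s1 / q1 <= k * (s2 / q2).
Proof. by move=> p1 p2 s0 k0 h; rewrite ler_pdivrMr // -mulrA [_ / q2 * q1]mulrAC mulrA ler_pdivlMr // -mulrA. Qed.

(** For such [t] one has [log log T <= 2 log log t], so the denominators differ by a factor of at
    most [2^(3/2) <= 4], and the numerator increases. *)
Lemma hh_half t T : 256 <= ln (ln t) -> T / 2 <= t -> t <= T -> hh t <= 4 * hh T.
Proof.
move=> h tT Tt; have [l1 t1 _] := lnln_gt (ltac:(lra) : 0 < 256 :> R) h.
have l2 : ln T <= ln t + 1.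
  have : ln T <= ln (2 * t) by rewrite ler_ln ?posrE; ulra tT t1 Tt.
  by rewrite lnM ?posrE; [have := ln2_lt1 R; rlra 0|rlra 0|ulra t1].
have lt : ln t <= ln T by rewrite ler_ln ?posrE; ulra Tt t1.
have ll : ln (ln t) <= ln (ln T) by rewrite ler_ln ?posrE; ulra lt l1.
have ll2 : ln (ln T) <= 2 * ln (ln t).
  have -> : 2 * ln (ln t) = ln (ln t ^+ 2) by rewrite lnXn ?mulr_natl //; lra.
  rewrite ler_ln ?posrE ?exprn_gt0; try lra.
  apply: le_trans l2 _; have [_ _ e] := lnln_gt (ltac:(lra) : 0 < 256 :> R) h.
  by have := expR_ge1Dx (256 : R); move: e; rewrite expr2; nra.
have qT : q32 (ln (ln T)) <= 4 * q32 (ln (ln t)).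
  apply: le_of_sqr; first by rewrite mulr_ge0 ?q32_ge0.
  rewrite exprMn !q32_sqr; try lra.
  have : ln (ln T) ^+ 3 <= (2 * ln (ln t)) ^+ 3 by apply: lerXn2r; rewrite ?nnegrE; ulra ll2 ll.
  have : 0 <= ln (ln t) ^+ 3 by rewrite exprn_ge0; ulra ll2 ll.
  by rewrite exprMn; lra.
have sT : Num.sqrt (ln t) <= Num.sqrt (ln T) by apply: ler_wsqrtr.
have p1 : 0 < q32 (ln (ln t)) by apply: q32_gt0; ulra h.
have p2 : 0 < q32 (ln (ln T)) by apply: q32_gt0; ulra ll h.
apply: frac_le => //.
by rewrite mulrCA; apply: ler_pM; rewrite ?sqrtr_ge0 ?q32_ge0.
Qed.

(** [log t <= log T + (t - T)], so the numerator grows at most by the stated factor, while the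
    larger denominator only helps. *)
Lemma hh_up t T : 256 <= ln (ln T) -> T <= t -> hh t <= 2 * (1 + (t - T) ^+ 2) * hh T.
Proof.
move=> h Tt; have [l1 T1 e] := lnln_gt (ltac:(lra) : 0 < 256 :> R) h.
have lt : ln T <= ln t by rewrite ler_ln ?posrE; ulra Tt T1.
have ll : ln (ln T) <= ln (ln t) by rewrite ler_ln ?posrE; ulra lt l1.
set X := 2 * (1 + (t - T) ^+ 2); have v0 := sqr_ge0 (t - T); have X1 : 1 <= X by rewrite /X; lra.
have lX : ln t <= X * ln T.
  have : ln t <= ln T + (t - T).
    have -> : t = T * (t / T) by field; apply: lt0r_neq0; ulra T1.
    rewrite lnM ?posrE ?divr_gt0; try lra.
    have := @ln_le_sub1 R (t / T) (ltac:(apply: divr_gt0; ulra T1 Tt)).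
    have -> : T * (t / T) = t by field; apply: lt0r_neq0; ulra T1.
    have : t / T - 1 <= t - T.
      have -> : t / T - 1 = (t - T) / T by field; apply: lt0r_neq0; ulra T1.
      by rewrite ler_pdivrMr ?ler_peMr; ulra X1 Tt T1.
    rlra 0.
  have h1 : t - T <= 1 + (t - T) ^+ 2 by have := sqr_ge0 (t - T - 1); rewrite sqrrB expr1n mulr1 -mulr_natr; ulra v0.
  have h2 : 1 + (t - T) ^+ 2 <= (1 + (t - T) ^+ 2) * ln T by rewrite ler_peMr; ulra h1 v0 l1.
  have h3 : ln T <= (1 + (t - T) ^+ 2) * ln T by rewrite ler_peMl; ulra h2 l1 v0.
  rewrite /X; ulra h3 h2 h1.
have sX : Num.sqrt (ln t) <= X * Num.sqrt (ln T).
  apply: le_of_sqr; first by rewrite mulr_ge0 ?sqrtr_ge0; ulra lX X1.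
  rewrite exprMn !sqr_sqrtr; try lra.
  apply: le_trans lX _; rewrite expr2 -mulrA ler_peMl //; apply: mulr_ge0; ulra X1 l1.
have qT : q32 (ln (ln T)) <= q32 (ln (ln t)).
  apply: le_of_sqr; first exact: q32_ge0.
  by rewrite !q32_sqr; [apply: lerXn2r; rewrite ?nnegrE; ulra h ll|ulra ll h|ulra h].
have p1 : 0 < q32 (ln (ln t)) by apply: q32_gt0; ulra ll h.
have p2 : 0 < q32 (ln (ln T)) by apply: q32_gt0; ulra h.
apply: frac_le => //; first by ulra p1 qT sX lX X1.
by rewrite mulrA; apply: ler_pM; rewrite ?sqrtr_ge0 ?q32_ge0.
Qed.

Lemma lnln_large T m : 0 <= m -> expR (expR m) <= T -> m <= ln (ln T).
Proof.
move=> m0 h; have T0 : 0 < T by apply: lt_le_trans h; exact: expR_gt0.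
have h1 : expR m <= ln T by rewrite -[leLHS]expRK ler_ln ?posrE ?expR_gt0.
rewrite -[leLHS]expRK ler_ln ?posrE ?expR_gt0 //; apply: lt_le_trans h1; exact: expR_gt0.
Qed.

Lemma far_quad x v : 0 <= x -> x / 2 <= `|v| -> x ^+ 4 / 16 <= (1 + v ^+ 2) ^+ 2.
Proof.
move=> x0 h; have h1 : (x / 2) ^+ 2 <= v ^+ 2.
  by rewrite -[leRHS]real_normK ?num_real //; apply: lerXn2r; rewrite ?nnegrE //; lra.
have -> : x ^+ 4 / 16 = ((x / 2) ^+ 2) ^+ 2 by field.
by apply: lerXn2r; rewrite ?nnegrE ?sqr_ge0 //; have := sqr_ge0 v; lra.
Qed.

Lemma sqr_le_quarter (J : nat) : (12 <= J)%N -> J%:R ^+ 2 <= 256 * expR (J%:R * ln 2 / 4) :> R.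
Proof.
move=> J12; have J0 := fx_J R J12; have /andP[l2 _] := fx_l2 R.
have := @sqr_le_exp R (J%:R / 8) (ltac:(lra)).
have : expR (J%:R / 8) <= expR (J%:R * ln 2 / 4) :> R.
  by rewrite ler_expR; have : J%:R * 2^-1 <= J%:R * ln 2 :> R by [apply: ler_wpM2l]; lra.
rewrite expr_div_n; lra.
Qed.

Definition C4 : R := 64 * C3 R + 256.

Lemma C3_ge : 12 <= C3 R.
Proof. by rewrite /C3 lerDr mulr_ge0 ?exprn_ge0. Qed.

(** Only an upper bound relates [ln T] to [y = 2^J], so [ln (ln T)] need not be of the order of [J].
    If [ln T >= y^(1/2)], then [ln (ln T) >= J / 4] and the denominator supplies [J^(3/2)].
    Otherwise [hh T <= y^(1/4)], and [J^2 = O(y^(1/4))] suffices. *)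
Lemma hh_bound (J : nat) T : (12 <= J)%N -> 256 <= ln (ln T) -> ln T <= C3 R * (expR (J%:R * ln 2) / J%:R) ->
  J%:R * ln 2 * hh T <= C4 * (expR (J%:R * ln 2 / 2) / J%:R).
Proof.
move=> J12 h hT; have J0 := fx_J R J12; have /andP[l2 l2'] := fx_l2 R; have c3 := C3_ge.
have [l1 T1 e] := lnln_gt (ltac:(lra) : 0 < 256 :> R) h.
set la := J%:R * ln 2 in hT *; have laJ : J%:R / 2 <= la by apply: ler_wpM2l; ulra J0 l2.
have laJ' : la <= J%:R by rewrite /la ler_piMr; ulra laJ J0 l2'.
set S := expR (la / 2); have S0 : 0 < S := expR_gt0 _.
have SS : expR la = S ^+ 2 by rewrite -expRM_natl; congr expR; field.
have h0 : 0 <= hh T by have := hh_ge1 h; rlra 0.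
apply: (@le_trans _ _ (J%:R * hh T)); first exact: ler_wpM2r.
rewrite mulrA ler_pdivlMr; last ulra J0.
have [c1|c1] := lerP S (ln T).
- have lll : J%:R / 4 <= ln (ln T).
    apply: (@le_trans _ _ (la / 2)); first ulra laJ.
    by rewrite -[leLHS]expRK ler_ln ?posrE //; ulra c1 S0.
  have ll0 : 0 < ln (ln T) by ulra h.
  have q0 := q32_gt0 ll0.
  rewrite /hh mulrAC mulrA ler_pdivrMr //; apply: le_of_sqr.
    by rewrite !mulr_ge0 ?(ltW S0) ?(ltW q0) // /C4; ulra c3.
  rewrite !exprMn q32_sqr ?(ltW ll0) // sqr_sqrtr; last ulra c1 S0.
  have a1 : ln T * J%:R <= C3 R * S ^+ 2 by rewrite -SS -ler_pdivlMr -?mulrA //; ulra J0.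
  have a2 : (J%:R / 4) ^+ 3 <= ln (ln T) ^+ 3 by apply: lerXn2r; rewrite ?nnegrE; ulra laJ' laJ ll0 lll.
  have a3 : 64 * C3 R <= C4 ^+ 2.
    rewrite /C4 expr2; have : 64 * C3 R * 1 <= (64 * C3 R + 256) * (64 * C3 R + 256) by apply: ler_pM; ulra c3.
    by rewrite mulr1.
  have S2 : 0 <= S ^+ 2 := sqr_ge0 _.
  apply: (@le_trans _ _ (64 * C3 R * S ^+ 2 * (J%:R / 4) ^+ 3)).
    have -> : J%:R ^+ 2 * J%:R ^+ 2 * ln T = (ln T * J%:R) * J%:R ^+ 3 by ring.
    have -> : 64 * C3 R * S ^+ 2 * (J%:R / 4) ^+ 3 = C3 R * S ^+ 2 * J%:R ^+ 3 by field.
    by apply: ler_wpM2r => //; rewrite exprn_ge0; lra.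
  have b0 : 0 <= 64 * C3 R * S ^+ 2 by apply: mulr_ge0 => //; ulra c3.
  have b1 : 0 <= (J%:R / 4) ^+ 3 :> R by apply: exprn_ge0; ulra laJ' laJ.
  exact: ler_pM b0 b1 (ler_wpM2r S2 a3) a2.
- have sS : Num.sqrt (ln T) <= expR (la / 4).
    apply: le_of_sqr; first exact: expR_ge0.
    rewrite sqr_sqrtr ?(ltW (lt_trans ltr01 l1)) //; apply: ltW; apply: lt_le_trans c1 _.
    by rewrite -expRM_natl /S ler_expR; rlra 0.
  have hs := le_trans (hh_le_sqrt h) sS.
  have := sqr_le_quarter J12; rewrite -/la => b1.
  have SQ : S = expR (la / 4) * expR (la / 4) by rewrite -expRD /S; congr expR; field.
  set E := expR (la / 4) in hs b1 SQ; have E0 : 0 < E := expR_gt0 _.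
  have -> : J%:R * hh T * J%:R = hh T * J%:R ^+ 2 by ring.
  apply: le_trans (ler_pM h0 (sqr_ge0 _) hs b1) _.
  rewrite SQ mulrCA; apply: ler_wpM2r; first by rewrite mulr_ge0 ?ltW.
  by rewrite /C4; ulra c3.
Qed.

End Scale.

(** * The two estimates for the integral *)

Section Conclusion.
Variable R : realType.
Local Notation C := R[i].
Implicit Types (e t u v x T Y A dl K B X : R).

Lemma Jint_bounded (G : C -> C) e Y : (forall s, 2^-1 < Re s -> holo G s) -> 0 < e -> 0 <= Y ->
  exists B : R, forall t, 0 <= t <= Y -> `|Jint G e t| <= B * t.
Proof.
move=> hG e0 Y0; pose g t := Re (G ((2^-1 + e) +i* t)) / (4^-1 + t ^+ 2).
have sc a b : segcont (fun t => (g t)%:C) a b.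
  move=> t _; apply: rcont_real; have [d hd] := hG ((2^-1 + e) +i* t) (ltac:(rewrite ReI; lra)).
  by apply: continuousM; [exact: (rder_cont (cder_y hd).1)|exact: cont_w].
have [B B0 HB] := segcont_bounded (sc (- Y) Y).
exists (2 * B) => t /andP[t0 tY]; apply: le_trans (Re_Nc _) _.
apply: le_trans (cint_bound (K := B) (sc _ _) _) _.
  move=> x; rewrite inseg_le; last lra.
  by move=> /andP[? ?]; apply: HB; rewrite inseg_le; [apply/andP; split; lra|lra].
by rewrite ger0_norm; lra.
Qed.

Lemma case_start (J K1 dl h T X : R) : 0 < dl -> 1 <= h -> 1 <= T -> K1 / dl <= T -> `|J| <= K1 -> T ^+ 4 / 16 <= X ->
  `|J| <= 40 * (dl / T ^+ 2 * h) * X.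
Proof.
move=> dl0 h1 T1 hK hJ hX; have T2 : 0 < T ^+ 2 by rewrite exprn_gt0; lra.
apply: le_trans hJ _; have hK2 : K1 <= T * dl by rewrite -ler_pdivrMr.
have g0 : 0 <= 40 * (dl / T ^+ 2 * h) by rewrite !mulr_ge0 ?invr_ge0 ?ltW //; lra.
apply: le_trans (ler_wpM2l g0 hX).
have -> : 40 * (dl / T ^+ 2 * h) * (T ^+ 4 / 16) = 5 / 2 * (dl * T ^+ 2) * h by field; apply: lt0r_neq0; lra.
have a1 : T <= T ^+ 2 by rewrite expr2 ler_peMr; ulra g0 T1.
have a2 : T * dl <= dl * T ^+ 2 by rewrite mulrC ler_pM2l.
have a3 : 0 <= dl * T ^+ 2 by rewrite mulr_ge0 ?ltW.
have : 5 / 2 * (dl * T ^+ 2) <= 5 / 2 * (dl * T ^+ 2) * h by rewrite ler_peMr //; lra.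
lra.
Qed.

Lemma case_mid (I J dl ht h T X : R) (t : R) : 0 < dl -> 1 <= h -> 0 < t -> T / 2 <= t -> 0 < T -> ht <= 4 * h ->
  `|I| <= dl * (1 / t ^+ 2 * ht) -> `|I - J| <= dl / T ^+ 2 * h -> 0 <= ht -> 1 <= X -> `|J| <= 40 * (dl / T ^+ 2 * h) * X.
Proof.
move=> dl0 h1 t0 tT T0 hht hI hIJ ht0 X1; set g := dl / T ^+ 2 * h in hIJ *.
have T2 : 0 < T ^+ 2 by rewrite exprn_gt0.
have t2 : 0 < t ^+ 2 by rewrite exprn_gt0.
have g0 : 0 <= g by rewrite !mulr_ge0 ?invr_ge0 ?ltW //; ulra h1.
have ti : 1 / t ^+ 2 <= 4 / T ^+ 2.
  rewrite ler_pdivlMr // mulrAC ler_pdivrMr // mul1r.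
  have : T ^+ 2 <= (2 * t) ^+ 2 by apply: lerXn2r; rewrite ?nnegrE; ulra T0 tT.
  by rewrite exprMn; lra.
have hI2 : `|I| <= 16 * g.
  apply: le_trans hI _; have -> : 16 * g = dl * (4 / T ^+ 2 * (4 * h)) by rewrite /g; ring.
  apply: ler_wpM2l; first exact: ltW.
  by apply: ler_pM => //; rewrite divr_ge0 // ltW.
have nJ : `|J| <= `|I| + `|I - J| by have := ler_normB I (I - J); rewrite subKr.
have : 40 * g <= 40 * g * X by rewrite ler_peMr // mulr_ge0.
ulra nJ hI2 g0 hIJ.
Qed.

Lemma case_up (I J dl ht h T w X : R) (t : R) : 0 < dl -> 1 <= h -> T <= t -> 0 < T -> 1 <= w -> ht <= 2 * w * h ->
  `|I| <= dl * (1 / t ^+ 2 * ht) -> `|I - J| <= dl / T ^+ 2 * h -> 0 <= ht -> X = w ^+ 2 -> `|J| <= 40 * (dl / T ^+ 2 * h) * X.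
Proof.
move=> dl0 h1 tT T0 w1 hht hI hIJ ht0 ->; set g := dl / T ^+ 2 * h in hIJ *.
have T2 : 0 < T ^+ 2 by rewrite exprn_gt0.
have g0 : 0 <= g by rewrite !mulr_ge0 ?invr_ge0 ?ltW //; lra.
have ti : 1 / t ^+ 2 <= 1 / T ^+ 2.
  rewrite !div1r lef_pV2 ?posrE ?exprn_gt0 //; last lra.
  by apply: lerXn2r; rewrite ?nnegrE; ulra T0 tT.
have hI2 : `|I| <= 2 * w * g.
  apply: le_trans hI _; have -> : 2 * w * g = dl * (1 / T ^+ 2 * (2 * w * h)) by rewrite /g; ring.
  apply: ler_wpM2l; first exact: ltW.
  by apply: ler_pM => //; rewrite divr_ge0 // sqr_ge0.
have nJ : `|J| <= `|I| + `|I - J| by have := ler_normB I (I - J); rewrite subKr.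
have a : w <= w ^+ 2 by rewrite expr2 ler_peMr; ulra nJ w1.
have b : w * g <= w ^+ 2 * g by apply: ler_wpM2r.
have c : g <= w * g by rewrite ler_peMl.
have d : 0 <= w ^+ 2 * g by rewrite mulr_ge0 ?sqr_ge0.
rewrite -mulrA [g * _]mulrC; ulra c b nJ hI2 g0 hIJ.
Qed.

Lemma case_far (J K g X t : R) : 0 < g -> 1 <= t -> K / g <= t -> 0 <= K -> `|J| <= 2 * (K * t) -> t ^+ 4 / 16 <= X -> `|J| <= 40 * g * X.
Proof.
move=> g0 t1 hK K0 hJ hX; apply: le_trans hJ _.
have g40 : 0 <= 40 * g by rewrite mulr_ge0 // ltW.
apply: le_trans (ler_wpM2l g40 hX).
have h1 : K <= t * g by rewrite -ler_pdivrMr.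
have h2 : K * t <= t * g * t by apply: ler_wpM2r => //; lra.
have h3 : t * g * t <= t ^+ 4 * g.
  have -> : t * g * t = t ^+ 2 * g by ring.
  by apply: ler_wpM2r; [exact: ltW|apply: ler_weXn2l].
have : 0 <= t ^+ 4 * g by rewrite mulr_ge0 ?exprn_ge0 ?ltW //; lra.
lra.
Qed.

Lemma far_left t T : 0 <= t -> t <= T / 2 -> T ^+ 4 / 16 <= (1 + (t - T) ^+ 2) ^+ 2.
Proof. by move=> t0 tT; apply: far_quad; [|rewrite ler0_norm]; lra. Qed.

Lemma far_right t T : 0 <= T -> 2 * T <= t -> t ^+ 4 / 16 <= (1 + (t - T) ^+ 2) ^+ 2.
Proof. by move=> T0 tT; apply: far_quad; [|rewrite ger0_norm]; lra. Qed.

(** Below [T1] a constant bounds [Jt], up to [T / 2] the bound [dl + 1] does, around [T] the slow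
    variation of [hh] transports the hypothesis, and beyond [Y0] the crude bound takes over. Away
    from [T] the last factor is of order [T^4] or [t^4], which leaves ample room. *)
Lemma J_cases (dl T T1 K1 K g Y0 t It Jt : R) : 0 < dl -> 1 <= hh T -> 256 <= ln (ln T) -> g = dl / T ^+ 2 * hh T -> 0 < g ->
  1 <= T -> K1 / dl <= T -> (dl + 1) / dl <= T -> 0 <= t -> 0 <= K -> 2 * T <= Y0 -> K / g <= Y0 -> 1 <= T1 -> T1 <= T ->
  (t <= T1 -> `|Jt| <= K1) -> (T1 <= t -> 256 <= ln (ln t) /\ `|It| <= dl * (1 / t ^+ 2 * hh t)) ->
  (0 < t <= Y0 -> `|It - Jt| <= Num.min g 1) -> (256 <= ln (ln t) -> `|Jt| <= 2 * (K * t)) -> t <= T / 2 \/ T1 <= t ->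
  `|Jt| <= 40 * (dl / T ^+ 2 * hh T) * (1 + (t - T) ^+ 2) ^+ 2.
Proof.
move=> dl0 h1 h gE g0 T1' hK1 hK2 t0 K0 TY KY T11 TT1 HJ HI HIJ Hc tc.
have w1 : 1 <= 1 + (t - T) ^+ 2 by rewrite lerDl sqr_ge0.
have X1 : 1 <= (1 + (t - T) ^+ 2) ^+ 2 by rewrite exprn_ege1.
have Tp : 0 < T by exact: lt_le_trans T1'.
have TY0 : T <= Y0 by move: Tp TY; clear; lra.
have b2 : 0 < t <= Y0 -> `|It - Jt| <= dl / T ^+ 2 * hh T.
  by move=> tY; rewrite -gE; apply: le_trans (HIJ tY) _; rewrite ge_min lexx.
have [tT2|tT2] := lerP t (T / 2).
  have [tT1|tT1] := lerP t T1; first exact: case_start dl0 h1 T1' hK1 (HJ tT1) (far_left t0 tT2).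
  have [ht hI] := HI (ltW tT1); have tp : 1 < t by exact: le_lt_trans tT1.
  have tY : 0 < t <= Y0 by rewrite (lt_trans ltr01 tp) /=; move: tT2 TY0 Tp; clear; lra.
  have a1 : `|Jt| <= dl + 1.
    have c1 : `|It| <= dl.
      apply: le_trans hI _; rewrite -[leRHS]mulr1; apply: ler_wpM2l; first exact: ltW.
      rewrite mulrAC mul1r ler_pdivrMr ?exprn_gt0 ?(lt_trans ltr01 tp) // mul1r; apply: le_trans (hh_le_id ht) _.
      by rewrite expr2 ler_peMr ?(ltW tp) // (ltW (lt_trans ltr01 tp)).
    have m1 : Num.min g 1 <= 1 by rewrite ge_min lexx orbT.
    have b1 := HIJ tY.
    have := ler_normB It (It - Jt); rewrite subKr; move: c1 m1 b1; clear; lra.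
  exact: case_start dl0 h1 T1' hK2 a1 (far_left t0 tT2).
have tT1 : T1 <= t by case: tc => // tT2'; have := lt_le_trans tT2 tT2'; rewrite ltxx.
have [ht hI] := HI tT1; have h0 := le_trans ler01 (hh_ge1 ht).
have t1 : 1 <= t by exact: le_trans tT1.
have tp : 0 < t by exact: lt_le_trans t1.
have [tT4|tT4] := lerP t T.
  by apply: (case_mid dl0 h1 tp (ltW tT2) Tp (hh_half ht (ltW tT2) tT4) hI (b2 _) h0 X1); rewrite tp (le_trans tT4).
have [tT3|tT3] := lerP t Y0.
  by apply: (case_up dl0 h1 (ltW tT4) Tp w1 (hh_up h (ltW tT4)) hI (b2 _) h0 erefl); rewrite tp.
rewrite -gE; apply: (case_far g0 t1 (le_trans KY (ltW tT3)) K0 (Hc ht)).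
by apply: far_right (ltW Tp) _; exact: le_trans (ltW tT3).
Qed.

Lemma drop_sum1 (T1 a b x T : R) : 2 * T1 + a + b <= T -> 0 <= b -> 1 <= T1 -> x <= a -> x <= T. Proof. lra. Qed.
Lemma drop_sum2 (T1 a b x T : R) : 2 * T1 + a + b <= T -> 0 <= a -> 1 <= T1 -> x <= b -> x <= T. Proof. lra. Qed.
Lemma drop_sum3 (T1 a b t T : R) : 2 * T1 + a + b <= T -> 0 <= a -> 0 <= b -> t <= T1 -> t <= T / 2. Proof. lra. Qed.

Lemma sub_half (c x y d r : R) : r <= c / 2 * x -> c * x - y - d <= r -> c / 2 * x - y - d <= 0. Proof. lra. Qed.

Lemma double_ge1 (t y : R) : 1 <= t -> 2 * t <= y -> 1 <= y. Proof. lra. Qed.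

Lemma half_ge1 (j x : R) : 12 <= j -> j / 2 <= x -> 1 <= x. Proof. lra. Qed.

Lemma final_arith (c CI S S4 j : R) : 0 < c -> 0 < CI -> 12 <= j -> 1 <= S4 -> S = S4 * S4 -> j ^+ 2 <= 256 * S4 ->
  512 * (CI + 1) / c < j -> c / 2 * (S / j) - CI * S4 <= 1 -> False.
Proof.
move=> c0 CI0 j12 s4 SS k3; rewrite ltr_pdivrMr // => k5 key.
have j0 : 0 < j by ulra j12. have S40 : 0 < S4 by ulra s4.
have k1 : c / 2 * (S / j) <= (CI + 1) * S4 by ulra key s4.
have k2 : c * S4 <= 2 * (CI + 1) * j.
  move: k1; rewrite SS mulrA ler_pdivrMr //.
  have -> : c / 2 * (S4 * S4) = c / 2 * S4 * S4 by ring.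
  have -> : (CI + 1) * S4 * j = (CI + 1) * j * S4 by ring.
  by rewrite ler_pM2r //; rlra 0.
have k4 : c * j ^+ 2 <= c * (256 * S4) by rewrite ler_pM2l.
have k6 : (512 * (CI + 1)) * j < j * c * j by rewrite ltr_pM2r.
have k7 : j * c * j = c * j ^+ 2 by ring.
rewrite k7 in k6; move: k2 k4 k6; clear; lra.
Qed.

Variable zeta : C -> C.
Hypothesis hzeta : is_riemann_zeta zeta.
Variables (G L : C -> C).
Hypothesis HG : is_logzeta zeta G.
Hypothesis HL : is_Ln L.

Local Notation I := (log_zeta_integral zeta).

(** The case [gam = 1]. It covers all large heights with one range of [e], whereas [integral_limit]
    is uniform on bounded ranges only. *)
Lemma Jint_crude : exists2 K : R, 0 < K & exists2 e0 : R, 0 < e0 & forall e t, 0 < e < e0 -> 256 <= ln (ln t) ->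
  `|Jint G e t| <= 2 * (K * t).
Proof.
have [K K0 H] := upper_unif hzeta HG HL; exists K => //.
have [e0 e00 He] := H 1 (ltac:(by rewrite ltr01 lexx)); exists e0 => // e t he h.
have [l1 t1 ex] := lnln_gt (ltac:(lra) : 0 < 256 :> R) h.
apply: le_trans (He e t he (ltac:(ulra h))) _.
have lt : ln t <= t by have := @ln_le_sub1 R t (ltac:(ulra t1)); rlra 0.
have a1 : expR (ln (ln t) / 4) <= t.
  apply: le_trans lt; rewrite -[leRHS]lnK ?posrE ?ler_expR; ulra h l1.
have a2 : 1 / t ^+ 2 * (ln t / ln (ln t) ^+ 2) <= t.
  rewrite mulrA ler_pdivrMr ?exprn_gt0 //; last ulra h.
  rewrite mulrAC ler_pdivrMr ?exprn_gt0 ?mul1r //; last ulra t1.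
  have b1 : 1 <= ln (ln t) ^+ 2 by rewrite exprn_ege1 //; ulra h.
  have b2 : 1 <= t ^+ 2 by rewrite exprn_ege1 //; ulra t1.
  have b3 := mulr_ege1 b1 b2.
  apply: le_trans lt _; rewrite -mulrA ler_peMr //; ulra t1.
have : K * (1 / t ^+ 2 * (ln t / ln (ln t) ^+ 2)) <= K * t by rewrite ler_pM2l.
have : K * expR (ln (ln t) / 4) <= K * t by rewrite ler_pM2l.
rlra 0.
Qed.

Lemma J_all : (forall dl, 0 < dl -> exists T0 : R, forall T, T0 <= T -> `|I T| <= dl * (1 / T ^+ 2 * hh T)) ->
  forall dl, 0 < dl -> exists T0 : R, forall T, T0 <= T -> [/\ 256 <= ln (ln T), 1 <= T & exists2 e0 : R, 0 < e0 &
    forall e t, 0 < e < e0 -> 0 <= t -> `|Jint G e t| <= 40 * (dl / T ^+ 2 * hh T) * (1 + (t - T) ^+ 2) ^+ 2].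
Proof.
move=> Io dl dl0; have [Ta HTa] := Io dl dl0; have [K K0 [ec ec0 Hc]] := Jint_crude.
pose XX : R := expR (expR 256); have XX1 : 1 <= XX.
  have e1 : 1 <= expR (256 : R) by have := expR_ge1Dx (256 : R); lra.
  by rewrite /XX -[leLHS]expR0 ler_expR; lra.
pose T1 := Num.max Ta XX; have TaT1 : Ta <= T1 by rewrite le_max lexx.
have XT1 : XX <= T1 by rewrite le_max lexx orbT.
have lnl t : T1 <= t -> 256 <= ln (ln t).
  by move=> h; apply: lnln_large; [rlra 0|apply: le_trans h; exact: XT1].
clearbody XX T1; have T11 : 1 <= T1 by ulra XT1 XX1.
have [ea ea0 Ha] := integral_limit hzeta HG T11 ltr01.
have ea2 : 0 < ea / 2 < ea by apply/andP; split; ulra ea0.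
(* On [[0, T1]] all small shifts are compared with the fixed shift [ea / 2], which yields one
   constant [K1] for all of them. *)
have [B HB] := Jint_bounded (fun s => holo_G HG (s := s)) (ltac:(ulra ea2) : 0 < ea / 2) (ltac:(ulra T11) : 0 <= T1).
have [B0 HB0] := Jint_bounded (fun s => holo_G HG (s := s)) (ltac:(ulra ea2) : 0 < ea / 2) (lexx 0).
pose K1 := `|B| * T1 + 2.
have J1 e t : 0 < e < ea -> 0 <= t -> t <= T1 -> `|Jint G e t| <= K1.
  move=> he t0 tT; have := t0; rewrite le_eqVlt => /predU1P[<-|tp].
    have [e_0 _] := andP he.
    have [B' HB'] := Jint_bounded (fun s => holo_G HG (s := s)) e_0 (lexx 0).
    have := HB' 0 (ltac:(by rewrite lexx)); rewrite mulr0 => h; apply: le_trans h _.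
    have : 0 <= `|B| * T1 by apply: mulr_ge0 => //; ulra tT t0.
    by rewrite /K1; rlra 0.
  have h1 := Ha e t he (ltac:(by rewrite tp)); have h2 := Ha _ t ea2 (ltac:(by rewrite tp)).
  have h3 := HB t (ltac:(by rewrite t0)).
  have h4 : B * t <= `|B| * T1 by apply: le_trans (ler_wpM2r t0 (ler_norm B)) _; apply: ler_wpM2l.
  move: h1 h2 h3; rewrite /K1 !ler_norml => /andP[? ?] /andP[? ?] /andP[? ?]; apply/andP; split; rlra 8.
clearbody K1; exists (2 * T1 + `|K1| / dl + `|dl + 1| / dl) => T hT.
have p1 : 0 <= `|K1| / dl by rewrite divr_ge0 // ltW.
have p2 : 0 <= `|dl + 1| / dl by rewrite divr_ge0 // ltW.
have TT1 : T1 <= T by ulra p2 p1 hT T11.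
have h := lnl T TT1; have [l1 T1' _] := lnln_gt (ltac:(rlra 0) : 0 < 256 :> R) h.
have h1 := hh_ge1 h; split => //; first ulra T1'.
have T20 : 0 < T ^+ 2 by rewrite exprn_gt0 //; ulra T1'.
have hp : 0 < hh T by ulra h1.
pose g := dl / T ^+ 2 * hh T; have g0 : 0 < g by apply: mulr_gt0 => //; exact: divr_gt0.
(* Beyond [Y0] the crude bound [2 K t] stays below [40 g t^4 / 16]. Up to [Y0] the shift is taken so
   small that [Jint] is within [g] of the true integral. *)
pose Y0 := Num.max (2 * T) (K / g); have TY : 2 * T <= Y0 by rewrite le_max lexx.
have KY : K / g <= Y0 by rewrite le_max lexx orbT.
clearbody Y0; have [eb eb0 Hb] := integral_limit hzeta HG (ltac:(ulra TY T1') : 1 <= Y0) (ltac:(rewrite lt_min g0 ltr01 //) : 0 < Num.min g 1).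
exists (Num.min ea (Num.min eb ec)); first by rewrite !lt_min ea0 eb0.
move=> e t; rewrite !lt_min => /andP[e0 /andP[e1 /andP[e2 e3]]] t0.
have hK1 : K1 / dl <= T.
  have : K1 / dl <= `|K1| / dl by rewrite ler_pM2r ?invr_gt0 // ler_norm.
  by move: hT p2 T11; exact: drop_sum1.
have hK2 : (dl + 1) / dl <= T.
  have : (dl + 1) / dl <= `|dl + 1| / dl by rewrite ler_pM2r ?invr_gt0 // ler_norm.
  by move: hT p1 T11; exact: drop_sum2.
apply: (@J_cases dl T T1 K1 K g Y0 t (I t) (Jint G e t)) => //; rewrite ?(ltW K0) ?(ltW T1') //.
- by move=> tT; apply: J1 => //; rewrite e0.
- by move=> tT; split; [exact: lnl|apply: HTa; exact: le_trans tT].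
- by move=> ht; apply: Hb => //; rewrite e0.
- by move=> ht; apply: Hc => //; rewrite e0.
- by have [tT|tT] := lerP T1 t; [right|left; move: hT p1 p2 (ltW tT); exact: drop_sum3].
Qed.

Lemma lim_D (a D : R) : 0 <= D -> (forall Y0 : R, exists2 Y, Y0 <= Y & a - D / Y <= 0) -> a <= 1.
Proof.
move=> D0 H; have [Y hY h] := H (D + 1); have Y0 : 0 < Y by lra.
have : D / Y <= 1 by rewrite ler_pdivrMr // mul1r; lra.
lra.
Qed.

(** [dl] makes the bound by parts at most half of the main term [c S / J]. What remains bounds
    [S / J] by a multiple of [S4], where [S = S4^2] and [S4] exceeds a multiple of [J^2], which is
    impossible for large [J]. *)
Lemma omega_contra : (forall dl, 0 < dl -> exists T0 : R, forall T, T0 <= T -> `|I T| <= dl * (1 / T ^+ 2 * hh T)) -> False.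
Proof.
move=> Io; have [CI CI0 HM] := lower_main hzeta HG HL.
pose c : R := expR (- 19) / 16; have c0 : 0 < c by rewrite divr_gt0 ?expR_gt0.
have cg := cG_gt0 R; have c4 : 0 < C4 R by rewrite /C4; have := C3_ge R; lra.
pose M := 90 * cG R * (40 * C4 R); have M0 : 0 < M by rewrite !mulr_gt0.
pose dl := c / (2 * M); have dl0 : 0 < dl by rewrite divr_gt0 // mulr_gt0.
have [T0 HT0] := J_all Io dl0.
(* [J] exceeds [T0], hence so does [T >= e^(3 la)], and it exceeds the constant required by
   [final_arith]. *)
pose J := (12 + (Num.truncn `|T0|).+1 + (Num.truncn (512 * (CI + 1) / c)).+1)%N.
have J12 : (12 <= J)%N by rewrite /J -addnA leq_addr.
have JT0 : T0 <= J%:R.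
  apply: le_trans (ler_norm _) _; apply: ltW; apply: lt_le_trans (_ : (Num.truncn `|T0|).+1%:R <= _).
    by have /andP[] := truncn_itv (normr_ge0 T0).
  by rewrite ler_nat /J addnAC addnC leq_addr.
have Jbig : 512 * (CI + 1) / c < J%:R.
  have q : 0 <= 512 * (CI + 1) / c by apply: divr_ge0; [apply: mulr_ge0; [exact: ler0n|ulra CI0]|exact: ltW].
  apply: lt_le_trans (_ : (Num.truncn (512 * (CI + 1) / c)).+1%:R <= _).
    by have /andP[] := truncn_itv q.
  by rewrite ler_nat /J leq_addl.
clearbody J; have J0 := fx_J R J12; have /andP[l2 l2'] := fx_l2 R.
have [T [hT1 hT2 HT]] := HM J J12.
set la := J%:R * ln 2 in hT1 hT2 HT; have laJ : J%:R / 2 <= la by apply: ler_wpM2l; ulra J0 l2.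
have la1 := half_ge1 J0 laJ.
have T0T : T0 <= T by apply: le_trans hT1; have := expR_ge1Dx (3 * la); ulra laJ J0 Jbig JT0.
have [h T1 [e0 e00 HJ]] := HT0 T T0T.
pose e := Num.min (e0 / 2) (Num.min 10^-1 J%:R^-1).
have e_0 : 0 < e by rewrite !lt_min !invr_gt0 divr_gt0 // ltr0n /=; lra.
have ee0 : e < e0 by apply: (@le_lt_trans _ _ (e0 / 2)); [rewrite ge_min lexx|lra].
have e1 : e <= 10^-1 by rewrite /e minA ge_min ge_min lexx orbT.
have eJ : e * J%:R <= 1.
  have : e <= J%:R^-1 by rewrite /e !ge_min lexx !orbT.
  by rewrite -ler_pdivlMr ?div1r //; ulra J0.
clearbody e; have [D D0 HD] := HT e (ltac:(by rewrite e_0)) eJ.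
set S := expR (la / 2) in HD; set S4 := expR (la / 4) in HD.
have S40 : 0 < S4 := expR_gt0 _.
have SS : S = S4 * S4 by rewrite -expRD /S; congr expR; field.
have h1 := hh_ge1 h.
have hb := hh_bound J12 h hT2; rewrite -/la -/S in hb.
have T20 : 0 < T ^+ 2 by rewrite exprn_gt0 //; ulra T1.
have hp : 0 < hh T by ulra h1.
pose A := 40 * (dl / T ^+ 2 * hh T); have A0 : 0 <= A.
  by apply: mulr_ge0 => //; apply: mulr_ge0; [exact: ltW (divr_gt0 dl0 T20)|exact: ltW].
have up Y : 0 <= Y -> `|Re (cint (fun t => G ((2^-1 + e) +i* t) * gkT la (2^-1 + e) T ((2^-1 + e) +i* t)) (- Y) Y)| <=
    c / 2 * (S / J%:R).
  move=> Y0; have He t : 0 <= t -> `|Jint G e t| <= A * (1 + (t - T) ^+ 2) ^+ 2 by apply: HJ; rewrite e_0.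
  apply: le_trans (phi_upper (@holo_G _ _ _ HG) e_0 la1 T1 A0 Y0 He) _.
  have -> : 90 * cG R * (la * T ^+ 2 * A) = 90 * cG R * 40 * dl * (la * hh T) by rewrite /A; field; apply: lt0r_neq0; ulra T1.
  have k0 : 0 <= 90 * cG R * 40 * dl by apply: mulr_ge0 (ltW dl0); apply: mulr_ge0; [apply: mulr_ge0 (ltW cg)|]; exact: ler0n.
  apply: le_trans (ler_wpM2l k0 hb) _; rewrite le_eqVlt; apply/orP; left; apply/eqP.
  rewrite /dl /M; field; do ?(apply/andP; split); apply: lt0r_neq0 => //; lra.
have key : c / 2 * (S / J%:R) - CI * S4 <= 1.
  apply: (@lim_D _ D) => // Y0; exists (Num.max Y0 (2 * T)); first by rewrite le_max lexx.
  set Y := Num.max _ _; have TY : 2 * T <= Y by rewrite le_max lexx orbT.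
  have Y1 := double_ge1 T1 TY.
  have := HD Y Y1 TY; have := up Y (le_trans ler01 Y1); rewrite ler_norml => /andP[_]; rewrite -/c.
  by set r := Re _ => r1 r2; apply: sub_half r1 r2.
have s4 : 1 <= S4 by rewrite /S4 -[leLHS]expR0 ler_expR divr_ge0 // (le_trans ler01 la1).
have k3 := sqr_le_quarter R J12; rewrite -/la -/S4 in k3.
exact: final_arith c0 CI0 J0 s4 SS k3 Jbig key.
Qed.

(** For each [T] the parameter [gam] is taken so small that its term is at most half of [g]; then
    [e] is taken so small that [Jint] is within the other half of the integral. *)
Lemma O_bound : exists2 K : R, 0 < K & forall T, 80 <= ln (ln T) ->
  `|I T| <= K * (1 / T ^+ 2 * (ln T / ln (ln T) ^+ 2)).
Proof.
have [K K0 H] := upper_unif hzeta HG HL; exists (K + 1); first lra.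
move=> T h; have [l1 T1 _] := lnln_gt (ltac:(lra) : 0 < 80 :> R) h.
set g := 1 / T ^+ 2 * _; have g0 : 0 < g by rewrite mulr_gt0 ?divr_gt0 ?exprn_gt0 //; ulra T1 l1 h.
pose E := expR (ln (ln T) / 4); have E0 : 0 < E := expR_gt0 _.
pose gam := Num.min 1 (g / (2 * (K * E))); have KE : 0 < 2 * (K * E) by rewrite !mulr_gt0.
have gam0 : 0 < gam <= 1 by rewrite lt_min ltr01 divr_gt0 // ge_min lexx.
have gamE : gam * (2 * (K * E)) <= g by rewrite -ler_pdivlMr // ge_min lexx orbT.
have [e0 e00 He] := H gam gam0.
have [e1 e10 Hi] := integral_limit hzeta HG (ltW T1) (ltac:(ulra g0) : 0 < g / 2).
pose e := Num.min e0 e1 / 2; have m0 : 0 < Num.min e0 e1 by rewrite lt_min e00.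
have ea : e < e0 by apply: (@lt_le_trans _ _ (Num.min e0 e1)); [rewrite /e; ulra m0|rewrite ge_min lexx].
have eb : e < e1 by apply: (@lt_le_trans _ _ (Num.min e0 e1)); [rewrite /e; ulra m0|rewrite ge_min lexx orbT].
have ep : 0 < e by rewrite /e; ulra m0.
have a1 := He e T (ltac:(by rewrite ep)) h; have a2 := Hi e T (ltac:(by rewrite ep)) (ltac:(by rewrite lexx andbT; ulra T1)).
have := ler_normD (I T - Jint G e T) (Jint G e T); rewrite subrK => a3.
rewrite -/g -/E in a1; have a4 : K * gam * E <= g / 2 by move: gamE; rlra 0.
move: a1 a2 a3 a4; rewrite mulrDl; rlra 0.
Qed.

End Conclusion.

Theorem theorem1 (R : realType) (zeta : R[i] -> R[i])
    (hzeta : is_riemann_zeta zeta) (RH : riemann_hypothesis zeta) :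
  bigO_pinfty (log_zeta_integral zeta)
    (fun T : R => 1 / T ^+ 2 * (ln T / ln (ln T) ^+ 2)) /\
  Omega_pinfty (log_zeta_integral zeta)
    (fun T : R => 1 / T ^+ 2 * (Num.sqrt (ln T) / ln (ln T) `^ (3 / 2))).
Proof.
have [L HL] := Ln_exists R; have [G HG] := logzeta_exists hzeta RH; split.
  have [K K0 H] := O_bound hzeta HG HL; apply/eqO_exP; exists K => //.
  exists (expR (expR 80)); split; first exact: num_real.
  move=> T /ltW hT; have h := lnln_large (ltac:(lra) : (0 : R) <= 80) hT.
  by apply: le_trans (H T h) _; apply: ler_wpM2l; [exact: ltW|exact: ler_norm].
rewrite /Omega_pinfty => /= /(iffLR (eqoP _ _ _)) Ho; apply: (omega_contra hzeta HG HL) => dl dl0.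
have [T0 [_ H]] := Ho dl dl0.
exists (Num.max (T0 + 1) (expR (expR 256))) => T; rewrite ge_max => /andP[h1 h2].
have h := lnln_large (ltac:(lra) : (0 : R) <= 256) h2.
have h3 := hh_ge1 h; apply: le_trans (H T _) _; first by apply: lt_le_trans h1; rewrite ltrDl.
rewrite ger0_norm // mulr_ge0 //; first by rewrite divr_ge0 ?sqr_ge0.
by apply: le_trans h3.
Qed.
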